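(* For a real operator system $\mathcal{S}$ the following are equivalent: (a) $\mathcal{S}$ has the real DCEP; (b) the complexification $\mathcal{S}_c$ has the complex DCEP; (c) $\mathcal{S}\otimes_{\rm el}\mathcal{T}=\mathcal{S}\otimes_{\mathfrak{c}}\mathcal{T}$ for all real operator systems $\mathcal{T}$; (d) $\mathcal{S}\otimes_{\rm el}C^*(\mathbb{F}_\infty)=\mathcal{S}\otimes_{\max}C^*(\mathbb{F}_\infty)$, where $C^*(\mathbb{F}_\infty)$ is the real full group C$^*$-algebra of the free group $\mathbb{F}_\infty$; (e) for all unital real C$^*$-algebras $A$ and $B$ with $\mathcal{S}$ a subsystem of $A$, the canonical map $\mathcal{S}\otimes_{\max}B\to A\otimes_{\max}B$ is a unital complete order embedding.
   Context: A real (resp. complex) operator system is a unital selfadjoint real (resp. complex) subspace of $B(H)$, $H$ a real (resp. complex) Hilbert space, with matrix cones $M_n(V)^+$; a subsystem is a selfadjoint subspace containing the unit. A real C$^*$-algebra is a norm closed real $*$-subalgebra of $B(H)$, $H$ a real Hilbert space. The complexification of a real operator system $V$ is the complex operator system $V_c=V+iV$ with $(x+iy)^*=x^*-iy^*$, the same unit, and $M_n(V_c)^+=\{x+iy:x=x^*,\,y=-y^*\in M_n(V),\ \begin{bmatrix} x & -y \\ y & x \end{bmatrix}\in M_{2n}(V)^+\}$. A ucp map is a linear unital completely positive map. $I(V)$ denotes the (real or complex) injective envelope of $V$: an injective operator system containing $V$ as a subsystem such that the only ucp map $I(V)\to I(V)$ which is the identity on $V$ is the identity. An operator system $\mathcal{S}$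 has the (real or complex) DCEP (double commutant expectation property) if every unital complete order embedding $\varphi:\mathcal{S}\to B(H)$ ($H$ a Hilbert space over the respective field) extends to a ucp map $I(\mathcal{S})\to\varphi(\mathcal{S})''$, the double commutant in $B(H)$. For real operator systems $V,W$ with units $e,f$: a selfadjoint $x$ is in $M_n(V\otimes_{\max}W)^+$ iff for every $\epsilon>0$ there are finitely many $A_i\in M_{n_i}(V)^+$, $B_i\in M_{m_i}(W)^+$ and a real scalar matrix $\alpha$ with $x+\epsilon I_n\otimes e\otimes f=\alpha^T{\rm diag}(A_1\otimes B_1,\dots,A_k\otimes B_k)\alpha$; $V\otimes_{\rm el}W$ is $V\otimes W$ with the structure inherited from $I(V)\otimes_{\max}W$; and $z\in M_n(V\otimes_{\mathfrak{c}}W)^+$ iff $(\Phi\cdot\Psi)^{(n)}(z)\ge0$ for all real Hilbert spaces $H$ and all completely positive maps $\Phi:V\to B(H)$, $\Psi:W\to B(H)$ with commuting ranges, where $(\Phi\cdot\Psi)(v\otimes w)=\Phi(v)\Psi(w)$. Equality of tensor products means equality of all the matrix cones. *)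

(* Defs.v *)
From HB Require Import structures.
From mathcomp Require Import all_boot all_order all_algebra.
From mathcomp Require Import generic_quotient sesquilinear.
From mathcomp Require Import complex mxtens.
From mathcomp Require Import all_classical all_reals all_analysis.

Set Implicit Arguments.
Unset Strict Implicit.
Unset Printing Implicit Defensive.

Import Order.TTheory GRing.Theory Num.Theory.
Import numFieldNormedType.Exports.

Local Open Scope classical_set_scope.
Local Open Scope ring_scope.

(* Real and complex objects are treated together: K is the scalar field and   *)
(* theta its conjugation, i.e. (R, idfun) or (R[i], conjc) with R : realType. *)
(* A {dot H for theta} form is linear in its first argument.                  *)
Record hilbertType (K : numFieldType) (theta : K -> K) := Hilbert {
  hilbert_sort :> completeNormedModType K;
  inner : {dot hilbert_sort for theta};
  inner_norm : forall x : hilbert_sort, `|x| ^+ 2 = inner x x }.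

Section BoundedOperators.
Context {K : numFieldType} {theta : K -> K} (H : hilbertType theta).

Definition bounded_op : {pred (H -> H)} := fun T =>
  `[< linear T /\ exists M : K, forall x, `|T x| <= M * `|x| >].

Lemma bounded_op_submod : submod_closed bounded_op.
Proof.
split=> [|a S T /asboolP[linS [M SM]] /asboolP[linT [N TN]]]; apply/asboolP.
  split=> [b x y|]; first by rewrite /= scaler0 addr0.
  by exists 0 => x; rewrite normr0 mul0r.
split=> [b x y|].
  rewrite !fctE linS linT !scalerDr !scalerA [a * b]mulrC.
  by rewrite addrACA.
exists (`|a| * M + N) => x.
rewrite fctE mulrDl (le_trans (ler_normD _ _))// lerD//.
by rewrite normrZ -mulrA ler_wpM2l.
Qed.

HB.instance Definition _ :=
  GRing.isSubmodClosed.Build K (H -> H) bounded_op bounded_op_submod.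

Record BH := MkBH { bop :> H -> H; bopP : bop \in bounded_op }.

HB.instance Definition _ := [isSub for bop].
HB.instance Definition _ := [Choice of BH by <:].
HB.instance Definition _ := [SubChoice_isSubLmodule of BH by <:].

Lemma bop_id_subproof : idfun \in bounded_op.
Proof.
by apply/asboolP; split=> [a x y //|]; exists 1 => x; rewrite mul1r.
Qed.

Definition bop1 : BH := MkBH bop_id_subproof.

Lemma bop_comp_subproof (S T : BH) : S \o T \in bounded_op.
Proof.
case: S T => [S /asboolP[linS [M SM]]] [T /asboolP[linT [N TN]]] /=.
apply/asboolP; split=> [a x y|]; first by rewrite /= linT linS.
exists (`|M| * N) => x /=; rewrite -mulrA.
have M0 : M * `|T x| <= `|M| * `|T x|.
  have [->|Tx0] := eqVneq (T x) 0; first by rewrite normr0 !mulr0.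
  have Tx_gt0 : 0 < `|T x| by rewrite normr_gt0.
  rewrite ler_wpM2r//; apply/real_ler_norm/ger0_real.
  by rewrite -(pmulr_lge0 _ Tx_gt0) (le_trans _ (SM _)).
by rewrite (le_trans (SM _))// (le_trans M0)// ler_wpM2l.
Qed.

Definition bopM (S T : BH) : BH := MkBH (bop_comp_subproof S T).

(* The adjoint exists by the Riesz representation theorem; 0 is only the      *)
(* default value of the choice operator xget.                                 *)
Definition adjoint (T : BH) : BH :=
  xget 0 [set S : BH | forall x y, inner H (T x) y = inner H x (S y)].

Definition opnorm_le (T : BH) (M : K) :=
  0 <= M /\ forall x, `|T x| <= M * `|x|.

Definition commutant (A : set BH) : set BH :=
  [set T | forall S, A S -> bopM T S = bopM S T].

End BoundedOperators.

(* The data carried by an operator system: a vector space with an involution, *)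
(* a unit and matrix cones; is_opsys below says that these data come from a   *)
(* unital selfadjoint subspace of some B(H).                                  *)
Record mosys (K : numFieldType) := MOSys {
  mosys_sort :> lmodType K;
  ostar : mosys_sort -> mosys_sort;
  ounit : mosys_sort;
  cone : forall n, set 'M[mosys_sort]_n }.

Definition mxstar (V : Type) (st : V -> V) n (x : 'M[V]_n) : 'M[V]_n :=
  \matrix_(i, j) st (x j i).

(* M_n(B(H)) is B(H^n); over the reals selfadjointness does not follow from   *)
(* nonnegativity of the quadratic form.                                       *)
Definition BHsys (K : numFieldType) (theta : K -> K) (H : hilbertType theta) :
    mosys K :=
  @MOSys K (BH H) (@adjoint K theta H) (bop1 H)
    (fun n => [set X | mxstar (@adjoint K theta H) X = X /\
       forall xi : 'I_n -> H,
         0 <= \sum_i \sum_j inner H (X i j (xi j)) (xi i)]).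

Section Maps.
Context {K : numFieldType}.
Implicit Types V W : mosys K.

Definition cp V W (f : V -> W) :=
  linear f /\ forall n (x : 'M[V]_n), cone x -> cone (map_mx f x).

Definition ucp V W (f : V -> W) := cp f /\ f (ounit V) = ounit W.

Definition co_embedding V W (f : V -> W) :=
  [/\ linear f, injective f, forall x, f (ostar x) = ostar (f x) &
      forall n (x : 'M[V]_n), cone x <-> cone (map_mx f x)].

Definition uco_embedding V W (f : V -> W) :=
  co_embedding f /\ f (ounit V) = ounit W.

End Maps.

Section OperatorSystems.
Context {K : numFieldType} (theta : K -> K).
Implicit Types V I : mosys K.

Definition is_opsys V :=
  exists (H : hilbertType theta) (f : V -> BHsys H), uco_embedding f.

(* A (not necessarily nondegenerate) norm closed *-subalgebra of B(H) that    *)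
(* has a unit, considered up to isomorphism.                                  *)
Definition cstar_embedding V (H : hilbertType theta) (f : V -> BHsys H) :=
  [/\ co_embedding f,
      forall a b, exists c, f c = bopM (f a) (f b),
      forall a, bopM (f (ounit V)) (f a) = f a /\
                bopM (f a) (f (ounit V)) = f a &
      forall T : BH H,
        (forall eps : K, 0 < eps -> exists a, opnorm_le (T - f a) eps) ->
        exists a, f a = T].

Definition is_unital_cstar V :=
  exists (H : hilbertType theta) (f : V -> BHsys H), cstar_embedding f.

Definition is_injective I :=
  forall (E F : mosys K) (j : E -> F) (f : E -> I),
    is_opsys E -> is_opsys F -> uco_embedding j -> ucp f ->
    exists2 g : F -> I, ucp g & forall x, g (j x) = f x.

Definition is_injenv V I (j : V -> I) :=
  [/\ is_opsys I, is_injective I, uco_embedding j &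
      forall f : I -> I, ucp f -> (forall x, f (j x) = j x) -> f =1 id].

(* I(V) is determined up to an isomorphism fixing V, hence the quantification *)
(* over all pairs (I, j) that are an injective envelope of V.                 *)
Definition DCEP V :=
  forall I (j : V -> I), is_injenv j ->
  forall (H : hilbertType theta) (f : V -> BHsys H), uco_embedding f ->
  exists2 g : I -> BHsys H, ucp g &
    (forall x, g (j x) = f x) /\
    (forall y, commutant (commutant (range f)) (g y)).

End OperatorSystems.

Section Complexification.
Context {R : realType}.

Definition cplx (V : lmodType R) : Type := (V * V)%type.

Section Lmodule.
Variable V : lmodType R.

HB.instance Definition _ := GRing.Zmodule.copy (cplx V) (V * V)%type.

Definition cplx_scale (a : R[i]) (z : cplx V) : cplx V :=
  (complex.Re a *: z.1 - complex.Im a *: z.2,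
   complex.Re a *: z.2 + complex.Im a *: z.1).

Lemma cplx_scaleA a b z :
  cplx_scale a (cplx_scale b z) = cplx_scale (a * b) z.
Proof.
case: a b z => [a1 a2] [b1 b2] [x y]; rewrite /cplx_scale /=.
rewrite !scalerDr !scalerN !scalerA !scalerDl !scaleNr !opprD.
by congr pair; rewrite [RHS]addrACA; congr (_ + _); rewrite addrC.
Qed.

Lemma cplx_scale1 : left_id 1 cplx_scale.
Proof.
by case=> x y; rewrite /cplx_scale /= !scale1r !scale0r subr0 addr0.
Qed.

Lemma cplx_scaleDr : right_distributive cplx_scale +%R.
Proof.
by move=> a [x y] [x' y']; rewrite /cplx_scale /=; congr pair;
   rewrite /= !scalerDr ?opprD addrACA.
Qed.

Lemma cplx_scaleDl z : {morph cplx_scale^~ z : a b / a + b}.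
Proof.
case: z => x y [a1 a2] [b1 b2]; rewrite /cplx_scale /=; congr pair;
  by rewrite /= !scalerDl ?opprD addrACA.
Qed.

HB.instance Definition _ := GRing.Zmodule_isLmodule.Build R[i] (cplx V)
  cplx_scaleA cplx_scale1 cplx_scaleDr cplx_scaleDl.

End Lmodule.

(* (x, y) : cplx V stands for x + iy. *)
Definition complexification (V : mosys R) : mosys R[i] :=
  @MOSys R[i] (cplx V)
    (fun z => (ostar z.1, - ostar z.2)) (ounit V, 0)
    (fun n => [set z : 'M[cplx V]_n |
       let x := \matrix_(i, j) (z i j).1 in
       let y := \matrix_(i, j) (z i j).2 in
       [/\ mxstar (@ostar R V) x = x, mxstar (@ostar R V) y = - y &
           cone (block_mx x (- y) y x)]]).

End Complexification.

Section TensorProduct.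
Context {K : fieldType} {V W : lmodType K}.
Local Open Scope quotient_scope.

Definition tsum (U : lmodType K) (b : V -> W -> U) (s : seq (V * W)) : U :=
  \sum_(p <- s) b p.1 p.2.

(* The algebraic tensor product: finite formal sums of pairs, two of them     *)
(* being identified when no bilinear map tells them apart.                    *)
Definition tens_rel (s t : seq (V * W)) : bool :=
  `[< forall (U : lmodType K) (b : {bilinear V -> W -> U}),
        tsum b s = tsum b t >].

Lemma tens_rel_refl : reflexive tens_rel.
Proof. by move=> s; apply/asboolP. Qed.

Lemma tens_rel_sym : symmetric tens_rel.
Proof. by move=> s t; apply/asboolP/asboolP => st U b; rewrite st. Qed.

Lemma tens_rel_trans : transitive tens_rel.
Proof.
by move=> t s u /asboolP st /asboolP tu; apply/asboolP => U b; rewrite st tu.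
Qed.

Canonical tens_equiv := EquivRel tens_rel tens_rel_refl tens_rel_sym
  tens_rel_trans.

Definition tensor := {eq_quot tens_rel}.

HB.instance Definition _ := Choice.on tensor.
HB.instance Definition _ := EqQuotient.on tensor.

(* The linear map with v (x) w |-> b v w, when b is bilinear. *)
Definition tlift (U : lmodType K) (b : V -> W -> U) (z : tensor) : U :=
  tsum b (repr z).

Lemma tlift_pi (U : lmodType K) (b : {bilinear V -> W -> U}) s :
  tlift b (\pi_tensor s) = tsum b s.
Proof. by have /eqmodP/asboolP := reprK (\pi_tensor s); apply. Qed.

Lemma tensorP (x y : tensor) :
  (forall (U : lmodType K) (b : {bilinear V -> W -> U}),
     tlift b x = tlift b y) -> x = y.
Proof.
by move=> xy; rewrite -[x]reprK -[y]reprK; apply/eqmodP/asboolP.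
Qed.

Definition tens (v : V) (w : W) : tensor := \pi_tensor [:: (v, w)].
Definition tens_zero : tensor := \pi_tensor [::].
Definition tens_add (x y : tensor) : tensor := \pi_tensor (repr x ++ repr y).
Definition tens_scale (a : K) (x : tensor) : tensor :=
  \pi_tensor [seq (a *: p.1, p.2) | p <- repr x].
Definition tens_opp (x : tensor) : tensor := tens_scale (-1) x.

Lemma tlift0 (U : lmodType K) (b : {bilinear V -> W -> U}) : tlift b tens_zero = 0.
Proof. by rewrite tlift_pi /tsum big_nil. Qed.

Lemma tliftD (U : lmodType K) (b : {bilinear V -> W -> U}) x y :
  tlift b (tens_add x y) = tlift b x + tlift b y.
Proof. by rewrite tlift_pi /tsum big_cat. Qed.

Lemma tliftZ (U : lmodType K) (b : {bilinear V -> W -> U}) a x :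
  tlift b (tens_scale a x) = a *: tlift b x.
Proof.
rewrite tlift_pi /tlift /tsum big_map scaler_sumr.
by apply: eq_bigr => p _; rewrite linearZl_LR.
Qed.

Lemma tens_addA : associative tens_add.
Proof. by move=> x y z; apply: tensorP => U b; rewrite !tliftD addrA. Qed.

Lemma tens_addC : commutative tens_add.
Proof. by move=> x y; apply: tensorP => U b; rewrite !tliftD addrC. Qed.

Lemma tens_add0 : left_id tens_zero tens_add.
Proof. by move=> x; apply: tensorP => U b; rewrite tliftD tlift0 add0r. Qed.

Lemma tens_addN : left_inverse tens_zero tens_opp tens_add.
Proof.
move=> x; apply: tensorP => U b.
by rewrite tliftD tliftZ tlift0 scaleN1r addNr.
Qed.

HB.instance Definition _ := GRing.isZmodule.Build tensor
  tens_addA tens_addC tens_add0 tens_addN.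

Lemma tens_scaleA a b x :
  tens_scale a (tens_scale b x) = tens_scale (a * b) x.
Proof. by apply: tensorP => U f; rewrite !tliftZ scalerA. Qed.

Lemma tens_scale1 : left_id 1 tens_scale.
Proof. by move=> x; apply: tensorP => U f; rewrite tliftZ scale1r. Qed.

Lemma tens_scaleDr : right_distributive tens_scale +%R.
Proof.
by move=> a x y; apply: tensorP => U f; rewrite tliftD !tliftZ tliftD scalerDr.
Qed.

Lemma tens_scaleDl x : {morph tens_scale^~ x : a b / a + b}.
Proof.
by move=> a b; apply: tensorP => U f; rewrite tliftD !tliftZ scalerDl.
Qed.

HB.instance Definition _ := GRing.Zmodule_isLmodule.Build K tensor
  tens_scaleA tens_scale1 tens_scaleDr tens_scaleDl.

End TensorProduct.
Arguments tensor {K} V W.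

Definition tens_map (K : fieldType) (V V' W W' : lmodType K)
    (f : V -> V') (g : W -> W') : tensor V W -> tensor V' W' :=
  tlift (fun v w => tens (f v) (g w)).

Section OperatorSystemTensors.
Context {R : realType}.
Implicit Types V W : mosys R.

Definition tens_star V W : tensor V W -> tensor V W :=
  tlift (fun v w => tens (ostar v) (ostar w)).

Definition tens_unit V W : tensor V W := tens (ounit V) (ounit W).

Definition tensor_mx V W n m (A : 'M[V]_n) (B : 'M[W]_m) :
    'M[tensor V W]_(n * m) :=
  \matrix_(k, l) tens (A (mxtens_unindex k).1 (mxtens_unindex l).1)
                      (B (mxtens_unindex k).2 (mxtens_unindex l).2).

(* alpha^T X alpha *)
Definition congr_mx (U : lmodType R) p n (X : 'M[U]_p)
    (alpha : 'M[R]_(p, n)) : 'M[U]_n :=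
  \matrix_(i, j) \sum_k \sum_l (alpha k i * alpha l j) *: X k l.

Definition max_cone V W n : set 'M[tensor V W]_n :=
  [set x | mxstar (@tens_star V W) x = x /\
     forall eps : R, 0 < eps ->
       exists (k : nat) (p q : 'I_k -> nat)
              (A : forall i, 'M[V]_(p i)) (B : forall i, 'M[W]_(q i))
              (alpha : 'M[R]_(\sum_i (p i * q i)%N, n)),
         [/\ forall i, cone (A i), forall i, cone (B i) &
             x + \matrix_(i, j) ((eps *: tens_unit V W) *+ (i == j)) =
             congr_mx (\mxdiag_i tensor_mx (A i) (B i)) alpha]].

Definition max_tensor V W : mosys R :=
  @MOSys R (tensor V W) (@tens_star V W) (tens_unit V W) (@max_cone V W).

(* For an injective envelope j : V -> I of V. *)
Definition el_cone V (I : mosys R) (j : V -> I) W n : set 'M[tensor V W]_n :=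
  [set z | max_cone (map_mx (tens_map j (@id W)) z)].

Definition c_cone V W n : set 'M[tensor V W]_n :=
  [set z | forall (H : hilbertType (@idfun R))
             (Phi : V -> BHsys H) (Psi : W -> BHsys H), cp Phi -> cp Psi ->
       (forall v w, bopM (Phi v) (Psi w) = bopM (Psi w) (Phi v)) ->
       @cone R (BHsys H) n
         (map_mx (tlift (fun v w => bopM (Phi v) (Psi w) : BH H)) z)].

End OperatorSystemTensors.

Section FreeGroup.
Variable X : choiceType.

Definition flip_letter (a : X * bool) := (a.1, ~~ a.2).
(* (x, false) is the generator x and (x, true) its inverse. *)
Definition reduced : pred (seq (X * bool)) :=
  sorted (fun a b => b != flip_letter a).
Definition push (a : X * bool) (s : seq (X * bool)) :=
  if s is b :: s' then if b == flip_letter a then s' else a :: s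
  else [:: a].

Record free_group := FreeGroup { word : seq (X * bool); wordP : reduced word }.
HB.instance Definition _ := [isSub for word].
HB.instance Definition _ := [Choice of free_group by <:].

Lemma flip_letterK : involutive flip_letter.
Proof. by case=> x b; rewrite /flip_letter negbK. Qed.

Lemma reduced_push a s : reduced s -> reduced (push a s).
Proof.
case: s => [|b s] //=; case: ifPn => [_|ba] rs; last by rewrite /= ba.
by rewrite /reduced (path_sorted rs).
Qed.

Lemma reduced_cons a s : reduced (a :: s) -> reduced s.
Proof. exact: path_sorted. Qed.

Lemma push_reduced a s : reduced (a :: s) -> push a s = a :: s.
Proof. by case: s => [|b s] //= /andP[/negPf ->]. Qed.

Lemma pushK a s : reduced s -> push (flip_letter a) (push a s) = s.
Proof.
case: s => [|b s] rs /=; first by rewrite flip_letterK eqxx.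
case: ifPn => [/eqP ba|_]; last by rewrite /= flip_letterK eqxx.
by rewrite -ba push_reduced.
Qed.

Lemma pushVK a s : reduced s -> push a (push (flip_letter a) s) = s.
Proof. by move=> rs; rewrite -{1}[a]flip_letterK pushK. Qed.

Lemma reduced_foldr s t : reduced t -> reduced (foldr push t s).
Proof. by move=> rt; elim: s => //= a s; apply: reduced_push. Qed.

Lemma foldr_push a s t : reduced t ->
  foldr push t (push a s) = push a (foldr push t s).
Proof.
case: s => [|b s] rt //=; case: ifPn => [/eqP ->|_] //=.
by rewrite pushVK// reduced_foldr.
Qed.

Lemma foldr_push_nil s : reduced s -> foldr push [::] s = s.
Proof.
elim: s => //= a s IHs ras.
by rewrite IHs ?(reduced_cons ras)// push_reduced.
Qed.

Definition flip_word s := rev [seq flip_letter a | a <- s].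

Lemma reduced_flip s : reduced s -> reduced (flip_word s).
Proof.
rewrite /flip_word /reduced rev_sorted sorted_map.
by apply: sub_sorted => a b /=; rewrite flip_letterK eq_sym.
Qed.

Lemma flip_wordK : involutive flip_word.
Proof.
move=> s; rewrite /flip_word map_rev revK -map_comp.
by rewrite (eq_map flip_letterK) map_id.
Qed.

Definition fg_one : free_group := FreeGroup (isT : reduced [::]).
Definition fg_mul (s t : free_group) : free_group :=
  FreeGroup (reduced_foldr (word s) (wordP t)).
Definition fg_inv (s : free_group) : free_group :=
  FreeGroup (reduced_flip (wordP s)).

Lemma fg_mulA : associative fg_mul.
Proof.
move=> [s rs] [t rt] [u ru]; apply: val_inj => /=.
elim: s {rs} => //= a s ->.
by rewrite foldr_push.
Qed.

Lemma fg_mul1 : left_id fg_one fg_mul.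
Proof. by move=> s; apply: val_inj. Qed.

Lemma fg_mulr1 : right_id fg_one fg_mul.
Proof. by move=> [s rs]; apply: val_inj => /=; apply: foldr_push_nil. Qed.

Lemma fg_mulV : left_inverse fg_one fg_inv fg_mul.
Proof.
move=> [s rs]; apply: val_inj => /=; rewrite /flip_word.
elim: s rs => //= a s IHs ras.
rewrite rev_cons foldr_rcons -(push_reduced ras) pushK ?(reduced_cons ras)//.
by rewrite IHs ?(reduced_cons ras).
Qed.

Lemma fg_mulrV : right_inverse fg_one fg_inv fg_mul.
Proof.
move=> s; have {1}<- : fg_inv (fg_inv s) = s.
  by apply: val_inj; exact: flip_wordK.
exact: fg_mulV.
Qed.

HB.instance Definition _ := isGroup.Build free_group
  fg_mulA fg_mul1 fg_mulr1 fg_mulV fg_mulrV.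

End FreeGroup.

Section GroupCstar.
Context {K : numFieldType} (theta : K -> K) (G : groupType).

Definition unitary_rep (H : hilbertType theta) (pi : G -> BH H) :=
  [/\ pi 1%g = bop1 H,
      forall g h, pi (g * h)%g = bopM (pi g) (pi h) &
      forall g x y, inner H (pi g x) (pi g y) = inner H x y].

(* A is the completion of the group algebra of G, whose elements are written  *)
(* as lists of pairs (coefficient, group element), in the largest norm coming *)
(* from a unitary (orthogonal, over the reals) representation of G.           *)
Definition is_full_group_cstar (A : mosys K) :=
  exists (H : hilbertType theta) (f : A -> BHsys H) (u : G -> A),
    [/\ cstar_embedding f,
        [/\ u 1%g = ounit A,
            forall g h, f (u (g * h)%g) = bopM (f (u g)) (f (u h)) &
            forall g, u (g^-1)%g = ostar (u g)],
        forall (a : A) (eps : K), 0 < eps -> exists s : seq (K * G),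
          opnorm_le (f (a - \sum_(p <- s) p.1 *: u p.2)) eps &
        forall (s : seq (K * G)) (M : K),
          opnorm_le (f (\sum_(p <- s) p.1 *: u p.2)) M <->
          forall (H' : hilbertType theta) (pi : G -> BH H'), unitary_rep pi ->
            opnorm_le (\sum_(p <- s) p.1 *: pi p.2) M].

End GroupCstar.

(* Main.v *)
From HB Require Import structures.
From mathcomp Require Import all_boot all_order all_algebra.
From mathcomp Require Import generic_quotient sesquilinear.
From mathcomp Require Import complex mxtens.
From mathcomp Require Import all_classical all_reals all_analysis.
From mathcomp Require Import ring lra.
Require Import Defs.

Set Implicit Arguments.
Unset Strict Implicit.
Unset Printing Implicit Defensive.

Import Order.TTheory GRing.Theory Num.Theory.
Import numFieldNormedType.Exports.

Local Open Scope classical_set_scope.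
Local Open Scope ring_scope.

(** The implications form the circle (a), (b), (c), (d), (e), (a); the passages from (b) to (c) and
    from (d) to (e) go through (a).

    Two returns to (a) rest on one extension principle, [commuting_extension]. Let [f] on [S] and
    [pi] on [B] be ucp with commuting ranges, let [S] sit in [A], and suppose that an element of S
    (x) B which becomes positive in A (x) B is already maximally positive. Then the product of [f]
    and [pi] is positive for the order of A (x) B and extends there by [arveson]. The restriction
    [g] of the extension to A (x) 1 extends [f], and by [multiplicative_domain] it commutes with
    [pi b] whenever [b] and its adjoint lie in the multiplicative domain of [pi].

    From (e) to (a), [B] is the commutant of f(S) and [A] is some B(K) containing [S]; then [g] has
    values in f(S)'', and I(S) is mapped into B(K) by injectivity. From (d) to (a), operators of the
    commutant have to be encoded by a representation of the free group. The Hilbert space is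
    doubled: for [a] in the commutant, [0 a; -a^* 0] is skew and commutes with [S], and its Cayley
    transform is orthogonal. A sequence [a n] thus gives a representation of the full group
    C*-algebra; the extension commutes with it, and its compression to one copy of [H] commutes with
    every [a n]. An ultralimit over finite subsets of the commutant finishes ([el_max_DCEP_map]).

    From (a), commuting completely positive maps [Phi], [Psi] on [S] and [T] are dilated so that the
    first becomes a complete order embedding [f]; the DCEP extends [f] to I(S) inside f(S)'', hence
    still commuting with [T], so positivity in I(S) (x) T forces commuting positivity
    ([DCEP_el_sub_c]). The converse inclusion holds because I(S) is a ucp retract of some B(K) and
    because the commuting and maximal cones agree as soon as one factor is a unital C*-algebra
    ([c_cone_max_r], by a separating functional and a GNS construction). This agreement also gives
    (d) from (c), and (e) from (a) once the inclusion of [S] in I(S) is extended to [A]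
    ([DCEP_exact]).

    For (a) and (b), the complexification of I(S) is an injective envelope of the complexification
    of [S] ([cx_injenv]). A complex representation restricts to a real one whose commutant contains
    multiplication by i, so the real extension commutes with i and complexifies; conversely a real
    representation is complexified and the complex extension is compressed back.

    Hilbert spaces are obtained from positive kernels ([kernel_hilbert]), maps into B(H) from
    operator-system valued kernels ([kolmogorov_cp]), functionals from Hahn-Banach for cones
    ([cone_functional]), and limits from ultrafilters. *)

(** * Algebra of bounded operators *)

Section LinearBH.
Context {K : numFieldType} {theta : K -> K} (H : hilbertType theta).

Lemma bop_linear (T : BH H) : linear (bop T).
Proof. by have /asboolP[] := bopP T. Qed.

HB.instance Definition _ (T : BH H) :=
  GRing.isLinear.Build K H H *:%R (bop T) (bop_linear T).

Lemma bop_bounded (T : BH H) : exists2 M : K, 0 <= M & forall x, `|T x| <= M * `|x|.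
Proof.
have /asboolP[linT [M TM]] := bopP T; exists `|M| => // x.
have [->|x0] := eqVneq x 0; first by rewrite (le_trans (TM 0))// normr0 !mulr0.
rewrite (le_trans (TM x))// ler_wpM2r// real_ler_norm// ger0_real//.
by rewrite -(@pmulr_lge0 _ `|x|) ?normr_gt0// (le_trans _ (TM x)).
Qed.

Lemma bop_ext (S T : BH H) : (forall x, S x = T x) -> S = T.
Proof. by move=> ST; apply: val_inj; apply/funext. Qed.

Lemma bopDE (S T : BH H) x : (S + T) x = S x + T x. Proof. by []. Qed.
Lemma bopNE (S : BH H) x : (- S) x = - S x. Proof. by []. Qed.
Lemma bopZE a (S : BH H) x : (a *: S) x = a *: S x. Proof. by []. Qed.
Lemma bop0E x : (0 : BH H) x = 0. Proof. by []. Qed.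

Lemma bop_sumE I (r : seq I) P (F : I -> BH H) x :
  (\sum_(i <- r | P i) F i) x = \sum_(i <- r | P i) F i x.
Proof. by elim/big_rec2: _ => // i y T _ <-. Qed.

Lemma bopDr (T : BH H) x y : T (x + y) = T x + T y. Proof. exact: linearD. Qed.
Lemma bopZr (T : BH H) a x : T (a *: x) = a *: T x. Proof. exact: linearZ. Qed.
Lemma bopNr (T : BH H) x : T (- x) = - T x. Proof. exact: linearN. Qed.
Lemma bop0r (T : BH H) : T 0 = 0. Proof. exact: linear0. Qed.
Lemma bop_sumr (T : BH H) I (r : seq I) P (F : I -> H) :
  T (\sum_(i <- r | P i) F i) = \sum_(i <- r | P i) T (F i).
Proof. exact: linear_sum. Qed.

Lemma bopMDl (S T U : BH H) : bopM (S + T) U = bopM S U + bopM T U.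
Proof. exact: bop_ext. Qed.
Lemma bopMDr (S T U : BH H) : bopM U (S + T) = bopM U S + bopM U T.
Proof. by apply: bop_ext => x /=; rewrite linearD. Qed.
Lemma bopMZl a (S T : BH H) : bopM (a *: S) T = a *: bopM S T.
Proof. exact: bop_ext. Qed.
Lemma bopMZr a (S T : BH H) : bopM S (a *: T) = a *: bopM S T.
Proof. by apply: bop_ext => x /=; rewrite linearZ. Qed.
Lemma bopMA (S T U : BH H) : bopM S (bopM T U) = bopM (bopM S T) U.
Proof. exact: bop_ext. Qed.

Lemma mkbop_subproof (f : H -> H) (lf : linear f)
  (bf : exists M : K, forall x, `|f x| <= M * `|x|) : f \in @bounded_op K theta H.
Proof. exact/asboolP. Qed.

Definition mkbop f lf bf : BH H := MkBH (@mkbop_subproof f lf bf).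

End LinearBH.

(** * Semidefinite forms and the Cauchy-Schwarz inequality *)

Section Quadratic.
Variable R : realType.

Lemma discr_le (a b c : R) : (forall t, 0 <= a + 2 * b * t + c * t ^+ 2) ->
  b ^+ 2 <= a * c.
Proof.
move=> h; have a0 : 0 <= a by have := h 0; rewrite expr2 !mulr0 !addr0.
have [c0|c0|c0] := ltgtP c 0.
(* A negative [c] is impossible: this [t] is at least 1 and makes the polynomial negative. *)
- have [t tE] : exists t : R, t = (a + 1) * (1 + 2 * `|b|) / - c by eexists.
  have sb (s : R) : 2 * b * s <= 2 * `|b| * `|s|.
    by rewrite -mulrA -[leRHS]mulrA ler_pM2l// -normrM ler_norm.
  have t0 : 0 < t by rewrite tE divr_gt0 ?oppr_gt0// mulr_gt0// ?ltr_wpDl// mulr_ge0.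
  have := h t; have := sb t; rewrite (gtr0_norm t0) => h1 h2.
  have : 0 <= a + 2 * `|b| * t + c * t ^+ 2 by lra.
  have -> : c * t ^+ 2 = - (a + 1) * (1 + 2 * `|b|) * t.
    by rewrite tE; field; rewrite lt_eqF.
  have t1 : 0 <= `|b| * t by rewrite mulr_ge0// ltW.
  have := h 1; have := h (-1) => *.
  have cb : - c <= a + 2 * `|b| by have := sb 1; have := h 1; rewrite normr1; lra.
  have {}tE : t * - c = (a + 1) * (1 + 2 * `|b|).
    by rewrite tE mulrVK// unitfE oppr_eq0 lt_eqF.
  have nb := normr_ge0 b.
  have tge : 1 <= t.
    have : - c <= t * - c by rewrite tE; nra.
    by rewrite ler_peMl ?oppr_gt0//; nra.
  by nra.
- have := h (- b / c); have c0' : c != 0 by rewrite gt_eqF.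
  have -> : a + 2 * b * (- b / c) + c * (- b / c) ^+ 2 = (a * c - b ^+ 2) / c by field.
  by rewrite pmulr_lge0 ?invr_gt0// subr_ge0.
- rewrite c0 mulr0; have [->|b0] := eqVneq b 0; first by rewrite expr0n.
  have := h (- (a + 1) / (2 * b)); rewrite c0 mul0r addr0.
  have -> : 2 * b * (- (a + 1) / (2 * b)) = - (a + 1) by field.
  by lra.
Qed.

Lemma sqrD_le2 (a b P Q : R) : a ^+ 2 <= P -> b ^+ 2 <= Q ->
  (a + b) ^+ 2 <= 2 * P + 2 * Q.
Proof. by move=> aP bQ; have := sqr_ge0 (a - b); rewrite sqrrB sqrrD; lra. Qed.

Variables (L : lmodType R) (q : L -> L -> R).
Definition psd_form :=
  [/\ forall a x y z, q (a *: x + y) z = a * q x z + q y z,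
      forall x y, q x y = q y x & forall x, 0 <= q x x].

Hypothesis qP : psd_form.

Lemma psdDl x y z : q (x + y) z = q x z + q y z.
Proof. by have [h _ _] := qP; have := h 1 x y z; rewrite scale1r mul1r. Qed.
Lemma psd0l x : q 0 x = 0.
Proof. by have := psdDl 0 0 x; rewrite addr0; lra. Qed.
Lemma psdZl a x z : q (a *: x) z = a * q x z.
Proof. by have [h _ _] := qP; have := h a x 0 z; rewrite addr0 psd0l addr0. Qed.
Lemma psdC x y : q x y = q y x. Proof. by have [_ h _] := qP. Qed.
Lemma psd_ge0 x : 0 <= q x x. Proof. by have [_ _ h] := qP. Qed.
Lemma psdDr x y z : q z (x + y) = q z x + q z y.
Proof. by rewrite psdC psdDl !(psdC z). Qed.
Lemma psdZr a x z : q z (a *: x) = a * q z x.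
Proof. by rewrite psdC psdZl !(psdC z). Qed.
Lemma psdNl x z : q (- x) z = - q x z.
Proof. by rewrite -scaleN1r psdZl mulN1r. Qed.
Lemma psdNr x z : q z (- x) = - q z x.
Proof. by rewrite -scaleN1r psdZr mulN1r. Qed.

Lemma psd_CS x y : q x y ^+ 2 <= q x x * q y y.
Proof.
apply: discr_le => t; rewrite (_ : _ + _ = q (x + t *: y) (x + t *: y)) ?psd_ge0//.
by rewrite psdDl !psdDr psdZl !psdZr psdZl (psdC y x); ring.
Qed.

Lemma psd_CS0 x y : q x x = 0 -> q x y = 0.
Proof.
move=> x0; have := psd_CS x y; rewrite x0 mul0r => h.
by apply/eqP; rewrite -sqrf_eq0 eq_le h sqr_ge0.
Qed.

End Quadratic.

Notation realHilbert R := (hilbertType (@idfun R)).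

(** * Real Hilbert spaces: Riesz representation and adjoints *)

Section RealHilbert.
Variable (R : realType) (H : realHilbert R).
Local Notation "<< x , y >>" := (inner H x y) (at level 0, x, y at level 99).

Lemma inner_psd : psd_form (inner H).
Proof.
split=> [a x y z|x y|x].
- exact: (linearPl (inner H) z a x y).
- by rewrite (@hermitian_subproof _ _ _ _ (inner H)) /= expr0 mul1r.
- by rewrite -inner_norm exprn_ge0.
Qed.

Definition ipDl := psdDl inner_psd.
Definition ipZl := psdZl inner_psd.
Definition ipDr := psdDr inner_psd.
Definition ipZr := psdZr inner_psd.
Definition ipNl := psdNl inner_psd.
Definition ipNr := psdNr inner_psd.
Definition ip0l := psd0l inner_psd.
Lemma ipC x y : <<x, y>> = <<y, x>>. Proof. exact: psdC inner_psd x y. Qed.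
Lemma ip0r x : <<x, 0>> = 0. Proof. by rewrite ipC ip0l. Qed.
Lemma ip_ge0 x : 0 <= <<x, x>>. Proof. exact: psd_ge0 inner_psd x. Qed.
Lemma ip_CS x y : <<x, y>> ^+ 2 <= <<x, x>> * <<y, y>>.
Proof. exact: psd_CS inner_psd x y. Qed.

Lemma ip_eq0 x : <<x, x>> = 0 -> x = 0.
Proof.
by rewrite -inner_norm => /eqP; rewrite sqrf_eq0 normr_eq0 => /eqP.
Qed.

Lemma ip_sumr I (r : seq I) P (F : I -> H) x :
  <<x, \sum_(i <- r | P i) F i>> = \sum_(i <- r | P i) <<x, F i>>.
Proof. by apply: (big_morph (inner H x)) => [a b|]; rewrite ?ipDr ?ip0r. Qed.
Lemma ip_suml I (r : seq I) P (F : I -> H) x :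
  <<\sum_(i <- r | P i) F i, x>> = \sum_(i <- r | P i) <<F i, x>>.
Proof. by rewrite ipC ip_sumr; apply: eq_bigr => i _; rewrite ipC. Qed.

Lemma ip_norm_le x y : `|<<x, y>>| <= `|x| * `|y|.
Proof.
rewrite -(@ler_pXn2r _ 2)// ?nnegrE ?mulr_ge0// exprMn !inner_norm.
by rewrite real_normK ?num_real// ip_CS.
Qed.

Lemma ip_inj x y : (forall z, <<x, z>> = <<y, z>>) -> x = y.
Proof.
move=> xy; apply/eqP; rewrite -subr_eq0; apply/eqP/ip_eq0.
by rewrite ipDl ipNl xy subrr.
Qed.

Lemma ip_injr x y : (forall z, <<z, x>> = <<z, y>>) -> x = y.
Proof. by move=> xy; apply: ip_inj => z; rewrite ipC xy ipC. Qed.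

Lemma norm_le_ip x (M : R) : 0 <= M -> (`|x| <= M) = (<<x, x>> <= M ^+ 2).
Proof. by move=> M0; rewrite -inner_norm ler_pXn2r ?nnegrE. Qed.

(** The solution minimises [J x = q x x - 2 * phi x]. By the parallelogram law near-minimisers form
    a Cauchy filter, and the equation is the vanishing of the first variation of [J] at its
    limit. *)
Lemma lax_milgram (q : H -> H -> R) (C c : R) (phi : H -> R) :
  psd_form q -> (forall x, `|x| ^+ 2 <= q x x) ->
  (forall x, q x x <= C * `|x| ^+ 2) ->
  (forall a x y, phi (a *: x + y) = a * phi x + phi y) ->
  (forall x, `|phi x| <= c * `|x|) ->
  exists y, forall x, phi x = q x y.
Proof.
move=> qP qge qle plin pb.
have phiD x y : phi (x + y) = phi x + phi y by have := plin 1 x y; rewrite scale1r mul1r.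
have phi0 : phi 0 = 0 by have := phiD 0 0; rewrite addr0; lra.
have phiZ a x : phi (a *: x) = a * phi x by have := plin a x 0; rewrite !addr0 phi0 addr0.
have qE := (psdDl qP, psdDr qP, psdZl qP, psdZr qP, psdNl qP, psdNr qP).
pose J x := q x x - 2 * phi x.
have Jge x : - c ^+ 2 <= J x.
  have := qge x; have := pb x; have := ler_norm (phi x).
  have := sqr_ge0 (`|x| - c).
  rewrite /J sqrrB; set n := `|x|; nra.
have hinf : has_inf (range J).
  by split; [exists (J 0), 0|exists (- c ^+ 2) => _ [x _ <-]].
pose m := inf (range J).
have mle x : m <= J x by apply: ge_inf; [case: hinf|exists x].
pose A e := [set x | J x < m + e].
have Ane e : 0 < e -> A e !=set0.
  by move=> e0; have [_ [x _ <-] xe] := inf_adherent e0 hinf; exists x.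
have mid x y : `|x - y| ^+ 2 <= 2 * (J x + J y) - 4 * m.
  apply: (le_trans (qge _)); have := mle (2^-1 *: (x + y)).
  rewrite /J phiZ phiD !qE (psdC qP y x).
  by lra.
(* The filter generated by the sublevel sets of [J] just above its infimum. *)
pose F := filter_from [set e : R | 0 < e] A.
have FF : ProperFilter F.
  apply: filter_from_proper; last by move=> e; exact: Ane.
  apply: filter_from_filter; first by exists 1 => /=.
  move=> e1 e2 /= e10 e20; exists (Num.min e1 e2); first by rewrite lt_min e10.
  by move=> x; rewrite /A /= => xm; split; apply: (lt_le_trans xm);
    rewrite lerD2l ge_min lexx ?orbT.
have Fc : cauchy F.
  apply/cauchy_ballP => e e0; pose d := e ^+ 2 / 4.
  have d0 : 0 < d by rewrite divr_gt0// exprn_gt0.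
  exists (A d, A d); first by split; exists d.
  move=> [x y] /= [xd yd]; rewrite -ball_normE /ball_ /=.
  rewrite -(@ltr_pXn2r _ 2)// ?nnegrE ?(ltW e0)//.
  apply: (le_lt_trans (mid _ _)); rewrite /A /= in xd yd.
  have : 4 * d = e ^+ 2 by rewrite /d; field.
  by lra.
have := @cauchy_cvg H F FF Fc; set y := lim F => Fy.
exists y => h; apply/eqP; rewrite -subr_eq0 -sqrf_eq0 eq_le sqr_ge0 andbT.
apply/ler_addgt0Pl => e e0; rewrite addr0.
have C0 : 0 <= q h h by apply: psd_ge0.
(* With this [d] the two squared errors below, doubled by [sqrD_le2], sum to at most [e]. *)
pose d := e / (2 * q h h + 2 * q h h * `|C| + 1).
have d0 : 0 < d.
  by rewrite divr_gt0// ltr_wpDl// addr_ge0 ?mulr_ge0.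
have [s s0 sd] : exists2 s : R, 0 < s & s ^+ 2 <= d.
  exists (Num.sqrt d); first by rewrite sqrtr_gt0.
  by rewrite sqr_sqrtr// ltW.
have [x [xd xy]] : exists x, A d x /\ ball y s x.
  have : F (A d `&` ball y s).
    apply: filterI; first by exists d.
    by apply: Fy; exact: nbhsx_ballx.
  by case=> d' d'0 /(_ _)/= sub; have [x /sub] := Ane _ d'0; exists x.
(* First variation: [J (x - t *: h)] is at least [J x - d] for every [t], and the discriminant turns
   this into a bound. *)
have h1 : (phi h - q h x) ^+ 2 <= d * q h h.
  apply: discr_le => t; have := mle (x - t *: h); have := xd; rewrite /A /= => h2 h3.
  have : 0 <= J (x - t *: h) - J x + d by lra.
  rewrite /J phiD -scaleNr phiZ !qE (psdC qP x h).
  by rewrite -!addrA => H1; apply: (le_trans H1); rewrite le_eqVlt; apply/orP; left; apply/eqP; ring.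
have h2 : (q h x - q h y) ^+ 2 <= q h h * (`|C| * d).
  rewrite -[q h x - _](_ : q h (x - y) = _); last by rewrite !qE.
  apply: (le_trans (psd_CS qP _ _)); rewrite ler_wpM2l//.
  apply: (le_trans (qle _)); apply: (@le_trans _ _ (`|C| * `|x - y| ^+ 2)).
    by rewrite ler_wpM2r ?exprn_ge0// ler_norm.
  rewrite ler_wpM2l// (le_trans _ sd)// ler_pXn2r ?nnegrE// ?(ltW s0)//.
  by rewrite distrC ltW//; move: xy; rewrite -ball_normE.
have -> : phi h - q h y = (phi h - q h x) + (q h x - q h y) by ring.
apply: (le_trans (sqrD_le2 h1 h2)).
have dE : d * (2 * q h h + 2 * q h h * `|C| + 1) = e.
  by rewrite /d mulfVK// gt_eqF// ltr_wpDl// addr_ge0 ?mulr_ge0.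
rewrite -[leRHS]dE -subr_ge0.
by rewrite (_ : _ - _ = d) ?ltW//; ring.
Qed.

Lemma riesz (c : R) (phi : H -> R) :
  (forall a x y, phi (a *: x + y) = a * phi x + phi y) ->
  (forall x, `|phi x| <= c * `|x|) -> exists y, forall x, phi x = <<x, y>>.
Proof.
apply: (@lax_milgram _ 1); [exact: inner_psd|..] => x; rewrite inner_norm//.
by rewrite mul1r.
Qed.

Lemma form_op (b : H -> H -> R) (c : R) :
  (forall a x y z, b (a *: x + y) z = a * b x z + b y z) ->
  (forall a x y z, b z (a *: x + y) = a * b z x + b z y) ->
  (forall x y, `|b x y| <= c * `|x| * `|y|) ->
  exists T : BH H, forall x y, <<T x, y>> = b x y.
Proof.
move=> bl br bb.
have /choice[f fP] : forall x, exists y, forall z, b x z = <<z, y>>.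
  by move=> x; apply: (@riesz (c * `|x|)).
have lf : linear f.
  move=> a x y; apply: ip_injr => z.
  by rewrite -fP bl ipDr ipZr -!fP.
have bf : exists M : R, forall x, `|f x| <= M * `|x|.
  exists `|c| => x; have [->|fx0] := eqVneq (f x) 0; first by rewrite normr0 mulr_ge0.
  rewrite -(@ler_pM2r _ `|f x|) ?normr_gt0// -expr2 inner_norm -fP.
  rewrite (le_trans (ler_norm _))// (le_trans (bb _ _))//.
  by rewrite ler_wpM2r// ler_wpM2r// ler_norm.
by exists (mkbop lf bf) => x y /=; rewrite ipC -fP.
Qed.

(** Riesz representation, through [form_op], shows that the choice defining [adjoint] never falls
    back on its default value. *)
Lemma adjointP (T : BH H) x y : <<T x, y>> = <<x, adjoint T y>>.
Proof.
suff : [set S : BH H | forall x y, inner H (T x) y = inner H x (S y)] (adjoint T) by exact.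
rewrite /adjoint; apply: xgetPex.
have [M M0 TM] := bop_bounded T.
have [S SP] : exists S : BH H, forall x y, <<S x, y>> = <<x, T y>>.
  apply: (@form_op _ M) => [a x' y' z|a x' y' z|x' y'].
  - by rewrite ipDl ipZl.
  - by rewrite linearD linearZ ipDr ipZr.
  - rewrite (le_trans (ip_norm_le _ _))// mulrAC [leRHS]mulrC ler_wpM2l//.
by exists S => x' y'; rewrite ipC -SP ipC.
Qed.

Lemma adjointPr (T : BH H) x y : <<x, T y>> = <<adjoint T x, y>>.
Proof. by rewrite ipC adjointP ipC. Qed.

Lemma bop_ip_ext (S T : BH H) : (forall x y, <<S x, y>> = <<T x, y>>) -> S = T.
Proof. by move=> ST; apply: bop_ext => x; exact: ip_inj. Qed.

Lemma adjoint_uniq (S T : BH H) : (forall x y, <<T x, y>> = <<x, S y>>) -> adjoint T = S.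
Proof. by move=> h; apply: bop_ip_ext => x y; rewrite ipC -adjointP h ipC. Qed.

Lemma adjointK (T : BH H) : adjoint (adjoint T) = T.
Proof. by apply: adjoint_uniq => x y; rewrite -adjointPr. Qed.
Lemma adjointD (S T : BH H) : adjoint (S + T) = adjoint S + adjoint T.
Proof. by apply: adjoint_uniq => x y; rewrite !bopDE ipDl ipDr !adjointP. Qed.
Lemma adjointZ a (S : BH H) : adjoint (a *: S) = a *: adjoint S.
Proof. by apply: adjoint_uniq => x y; rewrite !bopZE ipZl ipZr adjointP. Qed.
Lemma adjointM (S T : BH H) : adjoint (bopM S T) = bopM (adjoint T) (adjoint S).
Proof. by apply: adjoint_uniq => x y /=; rewrite !adjointP. Qed.
Lemma adjoint1 : adjoint (bop1 H) = bop1 H.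
Proof. exact: adjoint_uniq. Qed.

End RealHilbert.

(** * From the parallelogram law to an inner product *)

Section JordanVonNeumann.
Variables (R : realType) (L : lmodType R) (N : L -> R).
Hypothesis N_ge0 : forall x, 0 <= N x.
Hypothesis NZ : forall c x, N (c *: x) = c ^+ 2 * N x.
Hypothesis Npar : forall x y, N (x + y) + N (x - y) = 2 * N x + 2 * N y.

Definition polar x y : R := (N (x + y) - N (x - y)) / 4.

Let NN x : N (- x) = N x.
Proof. by rewrite -scaleN1r NZ sqrrN expr1n mul1r. Qed.

Let polarC x y : polar x y = polar y x.
Proof. by rewrite /polar (addrC x) -(NN (x - y)) opprB. Qed.

Let N3 x y z : N (x + y + z) =
  N (x + z) + N (y + z) + N x + N y - N z - N (x - y).
Proof.
have h1 := Npar (x + z) y; have h2 := Npar (y + z) x; have h3 := Npar z (x - y).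
move: h1 h2 h3; rewrite (_ : x + z + y = x + y + z); last by rewrite addrAC.
rewrite (_ : y + z + x = x + y + z); last by rewrite addrC addrA.
rewrite (_ : z + (x - y) = x + z - y); last by rewrite addrCA addrA.
rewrite (_ : z - (x - y) = y + z - x); last by rewrite opprB addrCA addrA.
by lra.
Qed.

Let polarDl x y z : polar (x + y) z = polar x z + polar y z.
Proof.
by rewrite /polar N3 (N3 x y (- z)) NN; lra.
Qed.

Let polar_bound x y : `|polar x y| <= N x + N y.
Proof.
have := Npar x y; have := N_ge0 (x + y); have := N_ge0 (x - y).
by rewrite /polar ler_norml => *; apply/andP; split; lra.
Qed.

Let polarN x y : polar (- x) y = - polar x y.
Proof.
by rewrite /polar -(NN (- x + y)) -(NN (- x - y)) !opprD !opprK -mulNr opprB addrC.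
Qed.

Let polar0 y : polar 0 y = 0.
Proof. by have := polarDl 0 0 y; rewrite addr0; lra. Qed.

Let polarMn x y n : polar (n%:R *: x) y = n%:R * polar x y.
Proof.
elim: n => [|n IH]; first by rewrite scale0r polar0 mul0r.
by rewrite -[n.+1]addn1 natrD scalerDl polarDl IH scale1r mulrDl mul1r.
Qed.

Let polarZz x y (n : int) : polar (n%:~R *: x) y = n%:~R * polar x y.
Proof.
by case: n => n; [exact: polarMn|rewrite NegzE !mulrNz scaleNr polarN polarMn mulNr].
Qed.

(** The parallelogram law gives additivity, hence homogeneity over the integers. Real scalars are
    reached without continuity: by [polar_bound], [n.+1] times the homogeneity defect is bounded
    uniformly in [n]. *)
Lemma polar_psd : psd_form polar.
Proof.
split=> [a x y z|x y|x]; [|exact: polarC|]; last first.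
  rewrite /polar subrr (_ : N 0 = 0); last by rewrite -(scale0r 0) NZ expr0n mul0r.
  by rewrite subr0 mulr_ge0.
rewrite polarDl; congr (_ + _); apply/eqP; rewrite -subr_eq0 -normr_eq0.
pose c := N x + N z + `|polar x z|.
have c0 : 0 <= c by rewrite !addr_ge0.
suff h n : n.+1%:R * `|polar (a *: x) z - a * polar x z| <= c.
  rewrite eq_le normr_ge0 andbT; rewrite leNgt; apply/negP => d0.
  set d := `|_| in d0 h; have [n nc] : exists n, c / d < n.+1%:R.
    by exists (Num.truncn (c / d)); rewrite truncnS_gt.
  by have := h n; rewrite leNgt -ltr_pdivrMr// nc.
have n0 : (0 : R) < n.+1%:R by [].
(* Write [a] as [(j + r) / m] with [m] a square: the integer part contributes no defect, and the
   rest rescales to the scalar [r / n.+1], which lies between 0 and 1. *)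
pose m : R := n.+1%:R ^+ 2; have m0 : 0 < m by rewrite exprn_gt0.
pose j := Num.floor (a * m); pose r := a * m - j%:~R.
have r01 : 0 <= r <= 1.
  by have := floor_itv (a * m); rewrite -/j intrD /r; lra.
have e1 : n.+1%:R * (polar (a *: x) z - a * polar x z) =
    polar ((n.+1%:R^-1 * r) *: x) z - (n.+1%:R^-1 * r) * polar x z.
  have aE : a = m^-1 * r + j%:~R * m^-1.
    by rewrite /r; field; rewrite gt_eqF.
  have h : n.+1%:R * polar (a *: x) z =
      polar ((n.+1%:R^-1 * r) *: x) z + j%:~R * polar (n.+1%:R^-1 *: x) z.
    rewrite -polarMn scalerA -polarZz scalerA -polarDl -scalerDl; congr (polar (_ *: _) _).
    by rewrite {1}aE /m; field.
  rewrite mulrBr h; have := polarMn (n.+1%:R^-1 *: x) z n.+1.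
  rewrite scalerA divff ?gt_eqF// scale1r => ->.
  by rewrite aE /m; field.
rewrite -[X in X * _](gtr0_norm n0) -normrM e1.
case/andP: r01 => r0 r1.
have nr : 0 <= n.+1%:R^-1 * r <= 1.
  by rewrite mulr_ge0 ?invr_ge0//= mulr_ile1 ?invr_ge0// invf_le1// ler1n.
have n1 : n.+1%:R^-1 * r <= 1 by case/andP: nr.
rewrite (le_trans (ler_normB _ _))// /c lerD//.
  rewrite (le_trans (polar_bound _ _))// lerD2r// NZ ler_piMl//.
  by case/andP: nr => *; rewrite expr_le1.
by rewrite normrM ler_piMl// ger0_norm//; case/andP: nr.
Qed.

Lemma polar_id x : polar x x = N x.
Proof.
rewrite /polar subrr (_ : N 0 = 0); last by rewrite -(scale0r 0) NZ expr0n mul0r.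
by rewrite -mulr2n -scaler_nat NZ subr0; field.
Qed.

End JordanVonNeumann.

(** * Positive semidefinite kernels *)

Section Kernel.
Variables (R : realType) (X : Type).
Implicit Types (k : X -> X -> R) (s t u : seq (R * X)) (f g : X -> R).

(** Lists of pairs (coefficient, point) stand for finite combinations of vectors in a Hilbert space
    still to be built. *)
Definition kform k s t : R := \sum_(p <- s) \sum_(r <- t) p.1 * r.1 * k p.2 r.2.
Definition kev f s : R := \sum_(p <- s) p.1 * f p.2.
Definition kscale (c : R) s := [seq (c * p.1, p.2) | p <- s].

Lemma kevC f s t : kev f (s ++ t) = kev f s + kev f t.
Proof. by rewrite /kev big_cat. Qed.
Lemma kev_scale c f s : kev f (kscale c s) = c * kev f s.
Proof. by rewrite /kev big_map mulr_sumr; apply: eq_bigr => p _ /=; rewrite mulrA. Qed.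
Lemma kevD f g s : kev (f + g) s = kev f s + kev g s.
Proof. by rewrite /kev -big_split; apply: eq_bigr => p _; rewrite mulrDr. Qed.
Lemma kevZ c f s : kev (c *: f) s = c * kev f s.
Proof. by rewrite /kev mulr_sumr; apply: eq_bigr => p _; rewrite mulrCA. Qed.
Lemma kevN f s : kev (- f) s = - kev f s.
Proof. by rewrite -scaleN1r kevZ mulN1r. Qed.
Lemma kev0 s : kev 0 s = 0.
Proof. by rewrite /kev big1// => p _; rewrite mulr0. Qed.
Lemma kev1 f c x : kev f [:: (c, x)] = c * f x.
Proof. by rewrite /kev big_seq1. Qed.

Lemma kformE k s t : kform k s t = kev (fun y => kev (k^~ y) s) t.
Proof.
rewrite /kform exchange_big; apply: eq_bigr => r _.
by rewrite /kev mulr_sumr; apply: eq_bigr => p _; rewrite mulrCA mulrA.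
Qed.
Lemma kformEl k s t : kform k s t = kev (fun x => kev (k x) t) s.
Proof.
apply: eq_bigr => r _.
by rewrite /kev mulr_sumr; apply: eq_bigr => p _; rewrite mulrA.
Qed.
Lemma kformCl k s t u : kform k (s ++ t) u = kform k s u + kform k t u.
Proof. by rewrite !kformEl kevC. Qed.
Lemma kformCr k s t u : kform k u (s ++ t) = kform k u s + kform k u t.
Proof. by rewrite !kformE kevC. Qed.
Lemma kformZl k c s t : kform k (kscale c s) t = c * kform k s t.
Proof. by rewrite !kformEl kev_scale. Qed.
Lemma kformZr k c s t : kform k s (kscale c t) = c * kform k s t.
Proof. by rewrite !kformE kev_scale. Qed.
Lemma kform0l k s : kform k [::] s = 0. Proof. by rewrite /kform big_nil. Qed.
Lemma kform1l k c x s : kform k [:: (c, x)] s = c * kev (k x) s.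
Proof. by rewrite kformEl kev1. Qed.
Lemma kform11 k c x d y : kform k [:: (c, x)] [:: (d, y)] = c * d * k x y.
Proof. by rewrite /kform !big_seq1. Qed.

Record kernel := Kernel { kfun :> X -> X -> R;
  kfunC : forall x y, kfun x y = kfun y x;
  kfun_psd : forall s, 0 <= kform kfun s s }.

Lemma kformC (k : kernel) s t : kform k s t = kform k t s.
Proof.
rewrite kformE kformEl; congr (kev _ _); apply/funext => y.
by congr (kev _ _); apply/funext => x; exact: kfunC.
Qed.

End Kernel.

(** * The reproducing kernel Hilbert space *)

Section RKHS.
Variables (R : realType) (X : Type) (k : kernel R X).
Implicit Types (s t u : seq (R * X)).
Let q := kform k.

(** The supremum of these numbers is the squared norm of [f], as the Legendre transform of the
    quadratic form of [k]. Taking the functions for which it is finite gives a complete space at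
    once, with no quotient or completion. *)
Definition rkhs_vals (f : X -> R) : set R := [set 2 * kev f s - q s s | s in setT].
Definition rkhs_pred : {pred (X -> R)} := fun f => `[< has_ubound (rkhs_vals f) >].

Lemma rkhs_predP f : reflect (exists M, forall s, 2 * kev f s - q s s <= M) (f \in rkhs_pred).
Proof.
apply: (iffP (asboolP _)) => -[M h]; exists M.
  by move=> s; apply: h; exists s.
by move=> _ [s _ <-].
Qed.

Lemma kev_scale_le f M c s : (forall s, 2 * kev f s - q s s <= M) ->
  2 * (c * kev f s) - q s s <= c ^+ 2 * M.
Proof.
move=> h; have q0 := kfun_psd k s.
have [->|c0] := eqVneq c 0.
  by rewrite !mul0r mulr0 expr0n mul0r sub0r oppr_le0; exact: q0.
have := h (kscale c^-1 s); rewrite kev_scale /q kformZl kformZr => h1.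
have c2 : 0 < c ^+ 2 by rewrite exprn_even_gt0.
rewrite -(ler_pM2l c2) in h1; apply: le_trans h1; rewrite le_eqVlt; apply/orP; left.
by apply/eqP; rewrite /q; field.
Qed.

Lemma rkhs_submod : submod_closed rkhs_pred.
Proof.
split=> [|c f g /rkhs_predP[M fM] /rkhs_predP[M' gM]]; apply/rkhs_predP.
  by exists 0 => s; rewrite kev0 mulr0 sub0r oppr_le0 kfun_psd.
exists (2 * (c ^+ 2 * M) + 2 * M') => s.
have h1 := kev_scale_le c (kscale 2^-1 s) fM.
have h2 := kev_scale_le 1 (kscale 2^-1 s) gM.
have := kfun_psd k s; rewrite -/(q s s) => q0.
have h3 s' : kev (c *: f + g) s' = c * kev f s' + kev g s' by rewrite kevD kevZ.
move: h1 h2; rewrite h3 !kev_scale /q kformZl kformZr expr1n.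
have -> : kform k s s = q s s by [].
lra.
Qed.

HB.instance Definition _ := GRing.isSubmodClosed.Build R (X -> R) rkhs_pred rkhs_submod.
Record rkhs := MkRkhs { rkval :> X -> R; rkvalP : rkval \in rkhs_pred }.
HB.instance Definition _ := [isSub for rkval].
HB.instance Definition _ := [Choice of rkhs by <:].
HB.instance Definition _ := [SubChoice_isSubLmodule of rkhs by <:].
Implicit Types f g : rkhs.

Definition rknorm2 (f : rkhs) := sup (rkhs_vals f).

Lemma rknorm2_ub f s : 2 * kev f s - q s s <= rknorm2 f.
Proof.
apply: ub_le_sup; last by exists s.
by have /rkhs_predP[M h] := rkvalP f; exists M => _ [t _ <-].
Qed.

Lemma rknorm2_le f M : (forall s, 2 * kev f s - q s s <= M) -> rknorm2 f <= M.
Proof. by move=> h; apply: ge_sup => [|_ [s _ <-]//]; exists (2 * kev f [::] - q [::] [::]), [::]. Qed.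

Lemma rknorm2_ge0 f : 0 <= rknorm2 f.
Proof. by have := rknorm2_ub f [::]; rewrite /q kform0l /kev big_nil mulr0 subr0. Qed.

Lemma rkvalDE f g : rkval (f + g) = rkval f + rkval g. Proof. by []. Qed.
Lemma rkvalZE c f : rkval (c *: f) = c *: rkval f. Proof. by []. Qed.
Lemma rkvalNE f : rkval (- f) = - rkval f. Proof. by []. Qed.

Lemma rknorm2Z_le c f : rknorm2 (c *: f) <= c ^+ 2 * rknorm2 f.
Proof.
apply: rknorm2_le => s; rewrite rkvalZE kevZ.
exact/kev_scale_le/rknorm2_ub.
Qed.

Lemma rknorm2Z c f : rknorm2 (c *: f) = c ^+ 2 * rknorm2 f.
Proof.
apply/eqP; rewrite eq_le rknorm2Z_le/=.
have [->|c0] := eqVneq c 0; first by rewrite expr0n mul0r rknorm2_ge0.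
have := rknorm2Z_le c^-1 (c *: f); rewrite scalerA mulVf// scale1r.
rewrite exprVn -(ler_pM2l (_ : 0 < c ^+ 2)) ?exprn_even_gt0//.
by rewrite mulVKf// expf_neq0.
Qed.

Lemma rknorm2_par_le f g : rknorm2 (f + g) + rknorm2 (f - g) <= 2 * rknorm2 f + 2 * rknorm2 g.
Proof.
rewrite -lerBrDr; apply: rknorm2_le => s.
rewrite lerBrDr addrC -lerBrDr; apply: rknorm2_le => t.
have h1 := rknorm2_ub f (kscale 2^-1 (s ++ t)).
have h2 := rknorm2_ub g (kscale 2^-1 (s ++ kscale (-1) t)).
rewrite !rkvalDE rkvalNE !kevD kevN.
move: h1 h2; rewrite /q !(kev_scale, kevC, kformZl, kformZr, kformCl, kformCr).
rewrite (kformC k t s); lra.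
Qed.

Lemma rknorm2_par f g : rknorm2 (f + g) + rknorm2 (f - g) = 2 * rknorm2 f + 2 * rknorm2 g.
Proof.
apply/eqP; rewrite eq_le rknorm2_par_le/=.
have := rknorm2_par_le (f + g) (f - g).
have -> : f + g + (f - g) = 2 *: f by rewrite scaler_nat mulr2n addrACA subrr addr0.
have -> : f + g - (f - g) = 2 *: g.
  by rewrite scaler_nat mulr2n opprB [g - f]addrC addrACA subrr add0r.
rewrite !rknorm2Z; lra.
Qed.

Definition rkip := polar rknorm2.

Lemma rkip_psd : psd_form rkip.
Proof. exact: polar_psd rknorm2_ge0 rknorm2Z rknorm2_par. Qed.

Lemma rkip_id f : rkip f f = rknorm2 f.
Proof. exact: polar_id rknorm2Z f. Qed.

Lemma rkhs_val_le f x : (f x) ^+ 2 <= rknorm2 f * k x x.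
Proof.
apply: discr_le => t.
have := rknorm2_ub f [:: (- t, x)]; rewrite /q kev1 kform11; lra.
Qed.

Lemma rknorm2_eq0 f : rknorm2 f = 0 -> f = 0.
Proof.
move=> f0; apply: val_inj; apply/funext => x /=.
have := rkhs_val_le f x; rewrite f0 mul0r => h.
by apply/eqP; rewrite -sqrf_eq0 eq_le h sqr_ge0.
Qed.

Definition rknorm f := Num.sqrt (rknorm2 f).

Lemma rknormD f g : rknorm (f + g) <= rknorm f + rknorm g.
Proof.
have s0 x : 0 <= rknorm x by exact: sqrtr_ge0.
have sE x : rknorm x ^+ 2 = rknorm2 x by rewrite sqr_sqrtr// rknorm2_ge0.
rewrite -(@ler_pXn2r _ 2)// ?nnegrE ?addr_ge0// sE.
rewrite -!rkip_id (psdDl rkip_psd) !(psdDr rkip_psd) (psdC rkip_psd g f) !rkip_id.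
have : rkip f g <= rknorm f * rknorm g.
  rewrite (le_trans (ler_norm _))// -(@ler_pXn2r _ 2)// ?nnegrE ?mulr_ge0//.
  by rewrite real_normK ?num_real// [leRHS]exprMn !sE -!rkip_id (psd_CS rkip_psd).
rewrite sqrrD !sE; lra.
Qed.

Lemma rknormZ c f : rknorm (c *: f) = `|c| * rknorm f.
Proof. by rewrite /rknorm rknorm2Z sqrtrM ?sqr_ge0// sqrtr_sqr. Qed.

Lemma rknorm_eq0 f : rknorm f = 0 -> f = 0.
Proof.
move/eqP; rewrite sqrtr_eq0 => h; apply: rknorm2_eq0.
by apply/eqP; rewrite eq_le h rknorm2_ge0.
Qed.

HB.instance Definition _ := Lmodule_isNormed.Build R rkhs rknormD rknormZ rknorm_eq0.

Lemma rknormE f : `|f| = rknorm f. Proof. by []. Qed.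
Lemma rknorm_sqr f : `|f| ^+ 2 = rknorm2 f.
Proof. by rewrite rknormE sqr_sqrtr// rknorm2_ge0. Qed.

(** By [rkhs_val_le] a Cauchy filter converges pointwise. The squared norm is a supremum of
    expressions in finitely many values, so norm estimates survive in the pointwise limit. *)
Lemma rkhs_complete (F : set_system rkhs) : ProperFilter F -> cauchy F -> cvg F.
Proof.
move=> FF Fc.
have Fe (e : R) : 0 < e -> exists2 A, F A & forall f g, A f -> A g -> rknorm2 (f - g) <= e ^+ 2.
  move=> e0; have /cauchy_ballP/(_ e e0)[[A B]/= [FA FB] AB] := Fc.
  exists (A `&` B); first exact: filterI.
  move=> f g [Af _] [_ Bg]; rewrite -rknorm_sqr ler_pXn2r ?nnegrE ?(ltW e0)//.
  by apply: ltW; have := AB (f, g) (conj Af Bg); rewrite -ball_normE.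
have Fx x : cvg ((fun f : rkhs => f x) @ F).
  apply: cauchy_cvg; apply/cauchy_ballP => e e0.
  have kx : 0 <= k x x by have := kfun_psd k [:: (1, x)]; rewrite kform11 !mul1r.
  have kx1 : 0 < k x x + 1 by rewrite ltr_wpDl.
  have [d d0 dE] : exists2 d : R, 0 < d & e = d * (k x x + 1).
    by exists (e / (k x x + 1)); rewrite ?divr_gt0// mulfVK// gt_eqF.
  have [A FA AP] := Fe _ d0.
  exists ((fun f : rkhs => f x) @` A, (fun f : rkhs => f x) @` A).
    by split; apply: (@filterS _ F _ A) => // f Af /=; exists f.
  move=> [_ _] /= [[f Af <-] [g Ag <-]]; rewrite /ball /=.
  rewrite -(@ltr_pXn2r _ 2)// ?nnegrE ?(ltW e0)// real_normK ?num_real//.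
  have h := rkhs_val_le (f - g) x; have h' := AP _ _ Af Ag.
  apply: (le_lt_trans h); apply: (@le_lt_trans _ _ (d ^+ 2 * k x x)); first by rewrite ler_wpM2r.
  rewrite dE exprMn ltr_pM2l ?exprn_gt0// sqrrD mulr1 expr1n.
  by have := sqr_ge0 (k x x); lra.
pose l x := lim ((fun f : rkhs => f x) @ F).
have kevl s : (fun f : rkhs => kev f s) @ F --> kev l s.
  rewrite /kev; elim: s => [|p s IH].
    by under eq_fun do rewrite big_nil; rewrite big_nil; exact: cvg_cst.
  under eq_fun do rewrite big_cons; rewrite big_cons; apply: cvgD => //.
  by apply: cvgMr; exact: (Fx p.2).
have close A e (f : rkhs) : F A -> (forall g, A g -> rknorm2 (f - g) <= e) ->
    forall s, 2 * (kev f s - kev l s) - q s s <= e.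
  move=> FA fA s.
  have : (fun g : rkhs => 2 * (kev f s - kev g s) - q s s) @ F --> 2 * (kev f s - kev l s) - q s s.
    apply: cvgB; last exact: cvg_cst.
    by apply: cvgMr; apply: cvgB; [exact: cvg_cst|exact: kevl].
  move=> /cvg_lim <-//; apply: limr_le.
    apply/cvg_ex; eexists; apply: cvgB; last exact: cvg_cst.
    by apply: cvgMr; apply: cvgB; [exact: cvg_cst|exact: kevl].
  near=> g; apply: (le_trans _ (fA g _)); last by near: g.
  by apply: le_trans (rknorm2_ub _ s); rewrite rkvalDE rkvalNE kevD kevN lexx.
have [A1 FA1 A1P] := Fe 1 ltr01.
have [f1 Af1] := filter_ex FA1.
have lP : l \in rkhs_pred.
  suff h : (rkval f1 - l) \in rkhs_pred.
    have -> : l = rkval f1 - (rkval f1 - l) by rewrite opprB addrC subrK.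
    by apply: rpredB => //; exact: rkvalP.
  apply/rkhs_predP; exists (1 ^+ 2) => s.
  have := close A1 (1 ^+ 2) f1 FA1 (fun g Ag => A1P _ _ Af1 Ag) s.
  by rewrite kevD kevN.
apply/cvg_ex; exists (MkRkhs lP); apply/cvgrPdist_le => e e0.
have [A FA AP] := Fe e e0.
apply: (filterS _ FA) => f Af.
rewrite distrC -(@ler_pXn2r _ 2)// ?nnegrE ?(ltW e0)// rknorm_sqr.
apply: rknorm2_le => s; have := close A (e ^+ 2) f FA (fun g Ag => AP _ _ Af Ag) s.
by rewrite rkvalDE rkvalNE /= kevD kevN; exact.
Unshelve. all: by end_near. Qed.

HB.instance Definition _ := Uniform_isComplete.Build rkhs rkhs_complete.

Lemma rkip_bilinear : bilinear_for *%R (idfun \; *%R) rkip.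
Proof.
split=> x a y z; first by rewrite (psdDl rkip_psd) (psdZl rkip_psd).
by rewrite (psdDr rkip_psd) (psdZr rkip_psd).
Qed.
Lemma rkip_herm x y : rkip x y = (-1) ^+ false * idfun (rkip y x).
Proof. by rewrite expr0 mul1r (psdC rkip_psd). Qed.
Lemma rkip_dot x : x != 0 -> 0 < rkip x x.
Proof.
move=> x0; rewrite lt_neqAle (psd_ge0 rkip_psd) andbT eq_sym rkip_id.
by apply: contra x0 => /eqP/rknorm2_eq0 ->.
Qed.
HB.instance Definition _ := bilinear_isBilinear.Build R rkhs rkhs R *%R (idfun \; *%R) rkip rkip_bilinear.
HB.instance Definition _ := isHermitianSesquilinear.Build R rkhs false idfun rkip rkip_herm.
HB.instance Definition _ := isDotProduct.Build R rkhs rkip rkip_dot.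

Lemma rkip_norm f : `|f| ^+ 2 = rkip f f.
Proof. by rewrite rknorm_sqr rkip_id. Qed.

Definition rkhsH : realHilbert R := @Hilbert R idfun rkhs rkip rkip_norm.

Lemma kvec_subproof x : (k x : X -> R) \in rkhs_pred.
Proof.
apply/rkhs_predP; exists (k x x) => s.
have := kfun_psd k ((-1, x) :: s); rewrite -cat1s kformCl !kformCr -!/q.
by rewrite /q kform11 (kformC k s) !kform1l; lra.
Qed.

Definition kvec x : rkhsH := MkRkhs (kvec_subproof x).

(** The reproducing property: shifting test combinations by a multiple of [x] computes the norm of
    [f + c *: kvec x] exactly, and polarization reads off the inner product. *)
Lemma rkip_kvec (f : rkhsH) x : inner rkhsH f (kvec x) = rkval f x.
Proof.
have h (c : R) : rknorm2 (f + c *: kvec x) = rknorm2 f + 2 * c * rkval f x + c ^+ 2 * k x x.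
  apply/eqP; rewrite eq_le; apply/andP; split.
    apply: rknorm2_le => s.
    have := rknorm2_ub f ((- c, x) :: s).
    rewrite -cat1s kevC kev1 /q kformCl !kformCr kform11 (kformC k s) !kform1l.
    by rewrite rkvalDE rkvalZE kevD kevZ /=; lra.
  rewrite -!addrA -lerBrDr; apply: rknorm2_le => s.
  rewrite lerBrDr; have := rknorm2_ub (f + c *: kvec x) ((c, x) :: s).
  rewrite -cat1s kevC kev1 /q kformCl !kformCr kform11 (kformC k s) !kform1l.
  rewrite rkvalDE rkvalZE kevD kevZ fctE.
  rewrite -[(c *: rkval (kvec x)) x]/(c * k x x) -[kev (kvec x) s]/(kev (k x) s); lra.
rewrite -[inner rkhsH f (kvec x)]/(polar rknorm2 f (kvec x)) /polar.
have := h 1; have := h (-1); rewrite scale1r scaleN1r => -> ->; lra.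
Qed.

Lemma kvec_ip x y : inner rkhsH (kvec x) (kvec y) = k x y.
Proof. by rewrite rkip_kvec. Qed.

Lemma rkhs_ext (f g : rkhsH) :
  (forall x, inner rkhsH f (kvec x) = inner rkhsH g (kvec x)) -> f = g.
Proof. by move=> fg; apply: val_inj; apply/funext => x; have := fg x; rewrite !rkip_kvec. Qed.

End RKHS.

(** * Operators on the Hilbert space of a kernel *)

Section KernelHilbert.
Variables (R : realType) (X : Type) (k : kernel R X).

(** An axiomatic description of the kernel space: prescribed Gram matrix, totality of the vectors
    [v x], and representation of every functional that is bounded on their combinations. *)
Definition kernel_rep (H : realHilbert R) (v : X -> H) :=
  [/\ forall x y, inner H (v x) (v y) = k x y,
      forall f g, (forall x, inner H f (v x) = inner H g (v x)) -> f = g &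
      forall (f : X -> R) M, (forall s, 2 * kev f s - kform k s s <= M) ->
        exists2 h : H, forall x, inner H h (v x) = f x & inner H h h <= M].

Lemma kernel_hilbert : exists (H : realHilbert R) (v : X -> H), kernel_rep v.
Proof.
exists (rkhsH k), (@kvec R X k); split; first exact: kvec_ip; first exact: rkhs_ext.
move=> f M fM; have fP : f \in rkhs_pred k by apply/rkhs_predP; exists M.
exists (MkRkhs fP : rkhsH k) => [x|]; first by rewrite rkip_kvec.
by rewrite -[inner _ _ _]/(rkip _ _) rkip_id; apply: rknorm2_le.
Qed.

Variables (H : realHilbert R) (v : X -> H).
Hypothesis vP : kernel_rep v.

Definition krep_ip := let: And3 h _ _ := vP in h.
Definition krep_ext := let: And3 _ h _ := vP in h.

Lemma krep_bop_ext (S T : BH H) :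
  (forall x y, inner H (S (v x)) (v y) = inner H (T (v x)) (v y)) -> S = T.
Proof.
move=> ST; suff h : adjoint S = adjoint T by rewrite -(adjointK S) h adjointK.
apply: bop_ext => f; apply: krep_ext => x.
rewrite ipC -adjointP [RHS]ipC -adjointP.
by have -> : S (v x) = T (v x) by exact: krep_ext.
Qed.

Definition ksum (s : seq (R * X)) : H := \sum_(p <- s) p.1 *: v p.2.

Lemma ksum_ipr h s : inner H h (ksum s) = kev (fun x => inner H h (v x)) s.
Proof. by rewrite /ksum ip_sumr; apply: eq_bigr => p _; rewrite ipZr. Qed.

(** The hypothesis is positivity of the block matrix with diagonal [M * k] and corner [b]; it says
    that [b] is a form of norm at most [M]. The images of the [v y] under the adjoint are
    represented first, as [B y], and then [T] itself. *)
Lemma krep_op (b : X -> X -> R) (M : R) : 0 <= M ->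
  (forall s t, 0 <= M * kform k s s + 2 * kform b s t + M * kform k t t) ->
  exists T : BH H, forall x y, inner H (T (v x)) (v y) = b x y.
Proof.
move=> M0 bM; have [vip vext vex] := vP.
have b2 s t : kform b s t ^+ 2 <= (M * kform k s s) * (M * kform k t t).
  apply: discr_le => c; have := bM s (kscale c t).
  by rewrite !kformZr kformZl; set z := kform k t t; lra.
have z2 (z a c : R) : z ^+ 2 <= a * c -> 0 <= a -> 0 <= c -> 2 * z <= a + c.
  move=> h a0 c0; rewrite (le_trans (ler_norm _))// -(@ler_pXn2r _ 2)// ?nnegrE ?addr_ge0//.
  by rewrite real_normK ?num_real//; have := sqr_ge0 (a - c); lra.
have k0 s : 0 <= kform k s s by exact: kfun_psd.
have Bt t : exists2 h, forall x, inner H h (v x) = kev (b x) t & inner H h h <= M ^+ 2 * kform k t t.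
  apply: vex => s; rewrite -kformEl lerBlDr; apply: z2 => //; last by rewrite mulr_ge0 ?exprn_ge0.
  by apply: (le_trans (b2 _ _)); rewrite le_eqVlt; apply/orP; left; apply/eqP; ring.
have /choice[B BP] : forall y, exists h, forall x, inner H h (v x) = b x y.
  by move=> y; have [h hP _] := Bt [:: (1, y)]; exists h => x; rewrite hP kev1 mul1r.
have BtM t : inner H (\sum_(p <- t) p.1 *: B p.2) (\sum_(p <- t) p.1 *: B p.2) <= M ^+ 2 * kform k t t.
  have [h hP hM] := Bt t; suff -> : \sum_(p <- t) p.1 *: B p.2 = h by [].
  apply: vext => x; rewrite hP ip_suml; apply: eq_bigr => p _.
  by rewrite ipZl BP.
have /choice[T TP] : forall f, exists h, (forall y, inner H h (v y) = inner H f (B y)) /\ inner H h h <= M ^+ 2 * inner H f f.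
  move=> f; have [t|h h1 h2] := vex (fun y => inner H f (B y)) (M ^+ 2 * inner H f f); last by exists h.
  rewrite lerBlDr; have -> : kev (fun y => inner H f (B y)) t = inner H f (\sum_(p <- t) p.1 *: B p.2).
    by rewrite ip_sumr; apply: eq_bigr => p _; rewrite ipZr.
  apply: z2 => //; last by rewrite mulr_ge0 ?exprn_ge0 ?ip_ge0.
  apply: (le_trans (ip_CS _ _)); rewrite -mulrA [leRHS]mulrCA ler_wpM2l ?ip_ge0//.
have lT : linear T.
  move=> a f g; apply: vext => y.
  by rewrite (TP _).1 ipDl ipZl ipDl ipZl !(TP _).1.
have bT : exists M' : R, forall x, `|T x| <= M' * `|x|.
  exists M => f; rewrite norm_le_ip ?mulr_ge0// exprMn inner_norm; exact: (TP f).2.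
by exists (mkbop lT bT) => x y /=; rewrite (TP _).1 ipC BP.
Qed.

End KernelHilbert.

(** * Hahn-Banach theorems for sublinear functionals and cones *)

Section HahnBanach.
Variable R : realType.

Section RealLinear.
Variables (W : lmodType R) (F : W -> R).
Definition rlin := forall a x y, F (a *: x + y) = a * F x + F y.
Hypothesis Fl : rlin.
Lemma rlinD x y : F (x + y) = F x + F y.
Proof. by have := Fl 1 x y; rewrite scale1r mul1r. Qed.
Lemma rlin0 : F 0 = 0.
Proof. by have := rlinD 0 0; rewrite addr0; lra. Qed.
Lemma rlinZ a x : F (a *: x) = a * F x.
Proof. by have := Fl a x 0; rewrite rlin0 !addr0. Qed.
Lemma rlinN x : F (- x) = - F x.
Proof. by rewrite -scaleN1r rlinZ mulN1r. Qed.
Lemma rlin_sum I (r : seq I) P (G : I -> W) :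
  F (\sum_(i <- r | P i) G i) = \sum_(i <- r | P i) F (G i).
Proof. by apply: big_morph; [exact: rlinD|exact: rlin0]. Qed.
End RealLinear.

Variable W : lmodType R.
Implicit Types p q : W -> R.

Definition sublinear p :=
  (forall x y, p (x + y) <= p x + p y) /\ forall c x, 0 < c -> p (c *: x) = c * p x.

Lemma sublinear0 p : sublinear p -> p 0 = 0.
Proof.
move=> [_ pZ]; have := pZ 2 0; rewrite scaler0 => /(_ (ltr0Sn _ _)).
by lra.
Qed.

Lemma sublinear_ge p x : sublinear p -> - p (- x) <= p x.
Proof. by move=> sp; have := sp.1 x (- x); rewrite subrr sublinear0//; lra. Qed.

(** A sublinear minorant of [p] whose value at [- w] is at most [- p w] (take [t = 1]); a linear
    functional below it therefore attains [p w] at [w]. *)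
Definition tilt p w x := inf [set p (x + t *: w) - t * p w | t in [set t : R | 0 <= t]].

Lemma tilt_lb p w x : sublinear p ->
  has_lbound [set p (x + t *: w) - t * p w | t in [set t : R | 0 <= t]].
Proof.
move=> sp; exists (- p (- x)) => _ [t /= t0 <-].
have := sp.1 (x + t *: w) (- x); rewrite addrAC subrr add0r.
case: (ltgtP 0 t) t0 => // [t1|<-] _; first by rewrite sp.2//; lra.
by rewrite mul0r scale0r addr0 sublinear0//; lra.
Qed.

Lemma tilt_le p w x t : sublinear p -> 0 <= t -> tilt p w x <= p (x + t *: w) - t * p w.
Proof. by move=> sp t0; apply: ge_inf; [exact: tilt_lb|exists t]. Qed.

Lemma le_tilt p w x m : (forall t, 0 <= t -> m <= p (x + t *: w) - t * p w) -> m <= tilt p w x.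
Proof.
move=> h; apply: lb_le_inf; last by move=> _ [t /= t0 <-]; exact: h.
by exists (p (x + 0 *: w) - 0 * p w), 0 => /=.
Qed.

Lemma tilt_sublinear p w : sublinear p -> sublinear (tilt p w).
Proof.
move=> sp; split=> [x y|c x c0].
  rewrite -lerBlDr; apply: le_tilt => s s0; rewrite lerBlDr -lerBlDl.
  apply: le_tilt => t t0; rewrite lerBlDr.
  apply: (le_trans (@tilt_le p w _ (t + s) sp _)); first exact: addr_ge0.
  have := sp.1 (y + t *: w) (x + s *: w).
  rewrite (_ : y + _ + _ = x + y + (t + s) *: w); first by lra.
  by rewrite scalerDl [x + y]addrC addrACA.
have h d u : 0 < d -> tilt p w (d *: u) <= d * tilt p w u.
  move=> d0; rewrite -ler_pdivrMl//; apply: le_tilt => t t0; rewrite ler_pdivrMl//.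
  apply: (le_trans (@tilt_le p w _ (d * t) sp _)); first by rewrite mulr_ge0// ltW.
  by rewrite -scalerA -scalerDr sp.2// mulrBr mulrA.
apply/eqP; rewrite eq_le h//= -ler_pdivlMl//.
by rewrite -{1}[x](scalerK (lt0r_neq0 c0)) h// invr_gt0.
Qed.

Lemma tilt_le_id p w x : sublinear p -> tilt p w x <= p x.
Proof. by move=> sp; have := @tilt_le p w x 0 sp (lexx _); rewrite scale0r addr0 mul0r subr0. Qed.

(** Zorn's lemma gives a minimal sublinear functional below [p]. It equals all its tilts, which
    makes it additive and odd, hence linear. *)
Lemma hahn_banach0 p : sublinear p -> exists F, rlin F /\ forall x, F x <= p x.
Proof.
move=> sp.
pose T := {q : W -> R | sublinear q /\ forall x, q x <= p x}.
pose rel_ (q r : T) := `[< forall x, sval r x <= sval q x >].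
have [| | | |[q [sq qp]] qmin] := @Zorn T rel_.
- by move=> q; apply/asboolP.
- by move=> q r s /asboolP qr /asboolP rs; apply/asboolP => x; exact: le_trans (rs x) (qr x).
- move=> [q hq] [r hr] /asboolP /= qr /asboolP /= rq; apply: eq_exist => /=.
  by apply/funext => x; apply/eqP; rewrite eq_le qr rq.
- move=> A Atot; have [[q0 Aq0]|A0] := pselect (exists r, A r); last first.
    by exists (exist _ p (conj sp (fun x => lexx _))) => s As; case: A0; exists s.
  pose S x := [set sval r x | r in A].
  have Slb x : has_lbound (S x).
    exists (- p (- x)) => _ [r Ar <-]; case: r Ar => r [sr rp] _ /=.
    by apply: le_trans (sublinear_ge _ sr); rewrite lerN2.
  have Sne x : S x !=set0 by exists (sval q0 x), q0.
  pose m x := inf (S x).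
  have mle r x : A r -> m x <= sval r x by move=> Ar; apply: ge_inf => //; exists r.
  have mge x (c : R) : (forall r, A r -> c <= sval r x) -> c <= m x.
    by move=> h; apply: lb_le_inf => // _ [r Ar <-]; exact: h.
  have sm : sublinear m.
    split=> [x y|c x c0].
      rewrite -lerBlDr; apply: (@mge) => r Ar; rewrite lerBlDr -lerBlDl.
      apply: (@mge) => s As; rewrite lerBlDr.
      have [/asboolP h|/asboolP h] := Atot _ _ Ar As.
        apply: (le_trans (mle s _ As)); apply: le_trans ((svalP s).1.1 _ _) _.
        by rewrite addrC lerD2l h.
      apply: (le_trans (mle r _ Ar)); apply: le_trans ((svalP r).1.1 _ _) _.
      by rewrite addrC lerD2r h.
    have h d u : 0 < d -> m (d *: u) <= d * m u.
      move=> d0; rewrite -ler_pdivrMl//; apply: (@mge) => r Ar; rewrite ler_pdivrMl//.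
      by rewrite -(svalP r).1.2// mle.
    apply/eqP; rewrite eq_le h//= -ler_pdivlMl//.
    by rewrite -{1}[x](scalerK (lt0r_neq0 c0)) h// invr_gt0.
  have mp x : m x <= p x by apply: (le_trans (mle _ _ Aq0)); exact: (svalP q0).2.
  by exists (exist _ m (conj sm mp)) => s As; apply/asboolP => x /=; exact: mle.
exists q; split=> //.
have qtilt w : tilt q w = q.
  have ht : sublinear (tilt q w) /\ forall x, tilt q w x <= p x.
    split; first exact: tilt_sublinear.
    by move=> x; exact: le_trans (tilt_le_id _ _ sq) (qp x).
  have := qmin (exist _ _ ht); suff h : rel_ (exist _ q (conj sq qp)) (exist _ _ ht).
    by move=> /(_ h) /(congr1 sval).
  by apply/asboolP => x /=; exact: tilt_le_id.
have qD x y : q (x + y) = q x + q y.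
  apply/eqP; rewrite eq_le sq.1/=.
  by have := @tilt_le q y x 1 sq ler01; rewrite qtilt scale1r; lra.
have qN x : q (- x) = - q x by have := qD x (- x); rewrite subrr sublinear0//; lra.
move=> a x y; rewrite qD; congr (_ + _).
have [a0|a0|->] := ltgtP a 0; last by rewrite scale0r mul0r sublinear0.
  by have := sq.2 (- a) x; rewrite oppr_gt0 scaleNr qN => /(_ a0); lra.
exact: sq.2.
Qed.

Lemma hahn_banach p w : sublinear p ->
  exists F, [/\ rlin F, forall x, F x <= p x & F w = p w].
Proof.
move=> sp; have [F [Fl Fp]] := hahn_banach0 (tilt_sublinear w sp).
have Fp' x : F x <= p x by exact: le_trans (Fp x) (tilt_le_id _ _ sp).
exists F; split => //; apply/eqP; rewrite eq_le Fp'/=.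
have := le_trans (Fp (- w)) (@tilt_le p w _ 1 sp ler01).
by rewrite scale1r addNr sublinear0// rlinN//; lra.
Qed.

Definition convex_cone (C : set W) :=
  [/\ C 0, forall x y, C x -> C y -> C (x + y) & forall c x, 0 < c -> C x -> C (c *: x)].

(** Krein extension of a positive functional from a cofinal subspace: it is dominated by the infimum
    of [phi e] over the [e] above [x]. The last clause makes [F] as large as possible at one chosen
    [w]. *)
Lemma cone_functional (E : lmodType R) (C : set W) (i : E -> W) (phi : E -> R) w :
  convex_cone C -> linear i -> rlin phi ->
  (forall e, C (i e) -> 0 <= phi e) -> (forall x, exists e, C (i e - x)) ->
  exists F, [/\ rlin F, forall e, F (i e) = phi e, forall x, C x -> 0 <= F x &
    forall m, (forall e, C (i e - w) -> m <= phi e) -> m <= F w].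
Proof.
move=> [C0 CD CZ] li lphi phi_ge0 cof.
have iD x y : i (x + y) = i x + i y by have := li 1 x y; rewrite !scale1r.
have i0 : i 0 = 0 by apply: (addIr (i 0)); rewrite -iD !add0r.
have iZ a x : i (a *: x) = a *: i x by have := li a x 0; rewrite i0 !addr0.
pose S x := [set phi e | e in [set e | C (i e - x)]].
pose p x := inf (S x).
have Sne x : S x !=set0 by have [e Ce] := cof x; exists (phi e), e.
have Slb x : has_lbound (S x).
  have [e' Ce'] := cof (- x); exists (- phi e') => _ [e /= Ce <-].
  have := CD _ _ Ce Ce'; rewrite opprK addrACA addNr addr0 -iD => /phi_ge0.
  by rewrite rlinD//; lra.
have ple e x : C (i e - x) -> p x <= phi e by move=> Ce; apply: ge_inf => //; exists e.
have lep x m : (forall e, C (i e - x) -> m <= phi e) -> m <= p x.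
  by move=> h; apply: lb_le_inf => // _ [e /= Ce <-]; exact: h.
have sp : sublinear p.
  split=> [x y|c x c0].
    rewrite -lerBlDr; apply: (@lep) => e Ce; rewrite lerBlDr -lerBlDl.
    apply: (@lep) => e' Ce'; rewrite lerBlDr -rlinD//; apply: ple.
    by rewrite iD [x + y]addrC opprD addrACA; apply: (CD _ _).
  have h d u : 0 < d -> p (d *: u) <= d * p u.
    move=> d0; rewrite -ler_pdivrMl//; apply: (@lep) => e Ce; rewrite ler_pdivrMl//.
    by rewrite -rlinZ//; apply: ple; rewrite iZ -scalerBr; apply: CZ.
  apply/eqP; rewrite eq_le h//= -ler_pdivlMl//.
  by rewrite -{1}[x](scalerK (lt0r_neq0 c0)) h// invr_gt0.
have [F [Fl Fp Fw]] := hahn_banach w sp.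
have Fle e : F (i e) <= phi e by apply: le_trans (Fp _) _; apply: ple; rewrite subrr.
exists F; split => //.
- move=> e; apply/eqP; rewrite eq_le Fle/=.
  have := Fle (- e); rewrite (rlinN lphi) -[- e]scaleN1r iZ scaleN1r rlinN//; lra.
- move=> x Cx; have := Fp (- x); rewrite rlinN//.
  have := ple 0 (- x); rewrite i0 opprK add0r (rlin0 lphi) => /(_ Cx).
  lra.
- by move=> m h; rewrite Fw; exact: lep.
Qed.

(** Extend [r *: u |-> r] from the line of the order unit, as large as possible at [- z]. Since
    [z + e *: u] is outside [C], this value is at least [e]. *)
Lemma cone_separation (C : set W) (u z : W) (e : R) :
  convex_cone C -> C u -> (forall x, exists M, C (M *: u - x)) ->
  0 < e -> ~ C (z + e *: u) ->
  exists F, [/\ rlin F, forall x, C x -> 0 <= F x & F z < 0].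
Proof.
move=> Ccone Cu cof e0 nC; have [C0 CD CZ] := Ccone.
have CZ0 c : 0 <= c -> C (c *: u).
  by rewrite le_eqVlt => /orP[/eqP <-|c0]; [rewrite scale0r|exact: CZ].
have rge (r : R) : C (r *: u) -> 0 <= r.
  move=> Cr; rewrite leNgt; apply/negP => r0; apply: nC.
  have [M CM] := cof (- z); rewrite opprK in CM.
  pose M' := Num.max M e.
  have -> : z + e *: u = (M *: u + z) + ((M' - M) *: u + ((e - M') / r) *: (r *: u)).
    rewrite scalerA divfK ?lt_eqF// -scalerDl [M *: u + z]addrC -addrA -scalerDl.
    by congr (_ + _ *: _); ring.
  apply: (CD _ _) => //; apply: (CD _ _); first by apply: CZ0; rewrite subr_ge0 le_max lexx.
  have : 0 <= (e - M') / r.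
    by rewrite ler_ndivlMr// mul0r subr_le0 le_max lexx orbT.
  by rewrite le_eqVlt => /orP[/eqP <-|]; [rewrite scale0r|move=> h; exact: CZ].
have [||r Cr|x|F [Fl _ Fge Fz]] := @cone_functional R^o C (fun r => r *: u) id (- z) Ccone.
- by move=> a x y; rewrite scalerDl scalerA.
- by move=> a x y.
- exact: rge.
- exact: cof.
exists F; split => //; have := Fz e; rewrite rlinN// => h; suff: e <= - F z by lra.
apply: h => r; rewrite opprK => Cr; rewrite leNgt; apply/negP => re; apply: nC.
have -> : z + e *: u = (r *: u + z) + (e - r) *: u.
  by rewrite [r *: u + z]addrC -addrA -scalerDl; congr (_ + _ *: _); ring.
by apply: (CD _ _) => //; apply: CZ0; rewrite subr_ge0 ltW.
Qed.

End HahnBanach.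

(** * Matrix cones over finite index types and the working axioms of operator systems *)

Section Pcone.
Variable R : realType.
Implicit Types V W : mosys R.

Lemma cone_eq V n (x y : 'M[V]_n) : x = y -> cone x -> cone y.
Proof. by move=> ->. Qed.

(* Matrices indexed by an arbitrary finite type, so that blocks and tensor    *)
(* products need no reindexing.                                               *)
Definition pcone V (P : finType) (X : P -> P -> V) :=
  @cone R V #|P| (\matrix_(i, j) X (enum_val i) (enum_val j)).

(** The properties shared by operator systems and by algebraic tensor products before Archimedean
    closure. [ax_bound] uses a 2 x 2 matrix because a real system is not spanned by its selfadjoint
    elements, so the order of [V] alone does not bound skew elements. *)
Record osys_ax V : Prop := OsysAx {
  ax_starD : forall x y : V, ostar (x + y) = ostar x + ostar y;
  ax_starZ : forall a (x : V), ostar (a *: x) = a *: ostar x;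
  ax_starK : forall x : V, ostar (ostar x) = x;
  ax_cone_star : forall n (x : 'M[V]_n), cone x -> mxstar (@ostar R V) x = x;
  ax_coneD : forall n (x y : 'M[V]_n), cone x -> cone y -> cone (x + y);
  ax_congr : forall p n (x : 'M[V]_p) (a : 'M[R]_(p, n)), cone x -> cone (congr_mx x a);
  ax_unit : pcone (fun _ _ : unit => ounit V);
  ax_bound : forall v : V, exists2 M : R, 0 <= M &
    pcone (fun a b : bool => if a == b then M *: ounit V else if a then v else ostar v) }.

Section Theory.
Variable V : mosys R.
Hypothesis HV : osys_ax V.

Lemma pcone_congr (P Q : finType) (X : P -> P -> V) (a : P -> Q -> R) : pcone X ->
  pcone (fun i j => \sum_k \sum_l (a k i * a l j) *: X k l).
Proof.
move=> /(ax_congr HV (\matrix_(i < #|P|, j < #|Q|) a (enum_val i) (enum_val j))).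
rewrite ?/pcone; apply: cone_eq; apply/matrixP => i j; rewrite !mxE.
rewrite [RHS]big_enum_val; apply: eq_bigr => k _.
by rewrite [RHS]big_enum_val; apply: eq_bigr => l _; rewrite !mxE.
Qed.

Lemma pconeD (P : finType) (X Y : P -> P -> V) :
  pcone X -> pcone Y -> pcone (fun i j => X i j + Y i j).
Proof.
move=> hX hY; have := ax_coneD HV hX hY; rewrite ?/pcone; apply: cone_eq.
by apply/matrixP => i j; rewrite !mxE.
Qed.

Lemma eq_pcone (P : finType) (X Y : P -> P -> V) : (forall i j, X i j = Y i j) -> pcone X -> pcone Y.
Proof. by move=> XY; rewrite ?/pcone; apply: cone_eq; apply/matrixP => i j; rewrite !mxE. Qed.

Lemma sum_delta (P : finType) (U : lmodType R) (i : P) (F : P -> U) :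
  \sum_k (k == i)%:R *: F k = F i.
Proof.
by rewrite (bigD1 i)//= eqxx scale1r big1 ?addr0// => k /negPf ->; rewrite scale0r.
Qed.

Lemma pcone_sub (P Q : finType) (X : P -> P -> V) (f : Q -> P) : pcone X ->
  pcone (fun i j => X (f i) (f j)).
Proof.
move=> /(pcone_congr (fun k i => (k == f i)%:R)); apply: eq_pcone => i j.
under eq_bigr do under eq_bigr do rewrite -scalerA.
under eq_bigr do rewrite -scaler_sumr sum_delta.
exact: sum_delta.
Qed.

Lemma cone_pcone n (x : 'M[V]_n) : cone x <-> pcone (fun i j : 'I_n => x i j).
Proof.
pose f (k : 'I_#|'I_n|) : 'I_n := enum_val k.
have E p (y : 'M[V]_p) q (g : 'I_q -> 'I_p) : cone y -> cone (\matrix_(i, j) y (g i) (g j)).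
  move=> /(ax_congr HV (\matrix_(k, i) (k == g i)%:R)).
  rewrite ?/pcone; apply: cone_eq; apply/matrixP => i j; rewrite !mxE.
  under eq_bigr do under eq_bigr do rewrite !mxE -scalerA.
  under eq_bigr do rewrite -scaler_sumr sum_delta.
  exact: sum_delta.
split; first exact: E.
rewrite /pcone => /(E _ _ _ (fun i : 'I_n => enum_rank i)); rewrite ?/pcone; apply: cone_eq.
by apply/matrixP => i j; rewrite !mxE !enum_rankK.
Qed.

Lemma pcone_star (P : finType) (X : P -> P -> V) i j : pcone X -> ostar (X j i) = X i j.
Proof.
move=> /(ax_cone_star HV)/matrixP/(_ (enum_rank i) (enum_rank j)).
by rewrite !mxE !enum_rankK.
Qed.

Lemma pcone0 (P : finType) : pcone (fun _ _ : P => (0 : V)).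
Proof.
have := pcone_congr (fun (_ : unit) (_ : P) => 0) (ax_unit HV); apply: eq_pcone => i j.
by rewrite big1// => k _; rewrite big1// => l _; rewrite mul0r scale0r.
Qed.

Lemma pcone_sum (P : finType) I (r : seq I) (X : I -> P -> P -> V) :
  (forall i, pcone (X i)) -> pcone (fun a b => \sum_(i <- r) X i a b).
Proof.
move=> hX; elim: r => [|i r IH].
  by apply: eq_pcone (pcone0 P) => a b; rewrite big_nil.
by apply: eq_pcone (pconeD (hX i) IH) => a b; rewrite big_cons.
Qed.

Lemma pconeZ (P : finType) (X : P -> P -> V) c : 0 <= c -> pcone X ->
  pcone (fun i j => c *: X i j).
Proof.
move=> c0 /(pcone_congr (fun k i => Num.sqrt c * (k == i)%:R)); apply: eq_pcone => i j.
under eq_bigr do under eq_bigr do rewrite mulrACA -expr2 sqr_sqrtr// -!scalerA.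
under eq_bigr do rewrite -!scaler_sumr sum_delta.
by rewrite -scaler_sumr sum_delta.
Qed.

Lemma pcone_scale (P Q : finType) (X : P -> P -> V) (f : Q -> P) (c : Q -> R) : pcone X ->
  pcone (fun a b => (c a * c b) *: X (f a) (f b)).
Proof.
move=> /(pcone_congr (fun k a => c a * (k == f a)%:R)); apply: eq_pcone => a b.
under eq_bigr do under eq_bigr do rewrite mulrACA -!scalerA.
under eq_bigr do rewrite -!scaler_sumr sum_delta.
by rewrite -!scaler_sumr sum_delta scalerA.
Qed.

Lemma pcone_unit (P : finType) (c : P -> R) : pcone (fun i j => (c i * c j) *: ounit V).
Proof.
have := pcone_congr (fun _ => c) (ax_unit HV); apply: eq_pcone => i j.
by rewrite !(big_pred1 tt)//; case.
Qed.

Lemma pcone_id (P : finType) : pcone (fun i j : P => (i == j)%:R *: ounit V).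
Proof.
have := pcone_sum (index_enum P) (fun k => pcone_unit (fun i => (i == k)%:R)).
apply: eq_pcone => i j; under eq_bigr do rewrite -scalerA [i == _]eq_sym.
by rewrite sum_delta eq_sym.
Qed.

Lemma pcone_dsum (P Q : finType) (X : P -> P -> V) (Y : Q -> Q -> V) : pcone X -> pcone Y ->
  pcone (fun a b : P + Q => match a, b with
    | inl i, inl j => X i j | inr i, inr j => Y i j | _, _ => 0 end).
Proof.
move=> /(pcone_congr (fun k (a : P + Q) => if a is inl i then (k == i)%:R else 0)) hX.
move=> /(pcone_congr (fun k (a : P + Q) => if a is inr i then (k == i)%:R else 0)) hY.
apply: eq_pcone (pconeD hX hY).
have e1 (I : finType) (F : I -> I -> V) i j : \sum_k \sum_l ((k == i)%:R * (l == j)%:R) *: F k l = F i j.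
  under eq_bigr do under eq_bigr do rewrite -scalerA.
  under eq_bigr do rewrite -scaler_sumr sum_delta.
  exact: sum_delta.
have z1 (I J : finType) (a : I -> R) (F : I -> J -> V) : \sum_k \sum_l (a k * 0) *: F k l = 0.
  by rewrite big1// => k _; rewrite big1// => l _; rewrite mulr0 scale0r.
have z2 (I J : finType) (a : J -> R) (F : I -> J -> V) : \sum_k \sum_l (0 * a l) *: F k l = 0.
  by rewrite big1// => k _; rewrite big1// => l _; rewrite mul0r scale0r.
by move=> [i|i] [j|j]; rewrite ?e1 ?z1 ?z2 ?add0r ?addr0.
Qed.

Lemma ax_star0 : ostar (0 : V) = 0.
Proof. by rewrite -[X in ostar X](scale0r 0) (ax_starZ HV) scale0r. Qed.
Lemma ax_starN (x : V) : ostar (- x) = - ostar x.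
Proof. by rewrite -scaleN1r (ax_starZ HV) scaleN1r. Qed.
Lemma ax_star1 : ostar (ounit V) = ounit V.
Proof. exact: pcone_star tt tt (ax_unit HV). Qed.

Lemma ax_bound2 (v : V) : exists2 M : R, 0 <= M & forall N, M <= N ->
    pcone (fun a b : bool => if a == b then N *: ounit V else if a then v else ostar v).
Proof.
have [M M0 hM] := ax_bound HV v; exists M => // N MN.
have N0 : 0 <= N - M by rewrite subr_ge0.
apply: eq_pcone (pconeD hM (pconeZ N0 (pcone_id _))) => a b.
case: eqP => _; last by rewrite scale0r scaler0 addr0.
by rewrite scale1r -scalerDl addrC subrK.
Qed.

End Theory.

Section BHcone.
Variable H : realHilbert R.

Lemma BHpcone (P : finType) (X : P -> P -> BHsys H) : pcone X <->
  (forall i j, adjoint (X j i) = X i j) /\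
  (forall xi : P -> H, 0 <= \sum_i \sum_j inner H (bop (X i j) (xi j)) (xi i)).
Proof.
split=> [[/matrixP Xs Xp]|[Xs Xp]].
  split=> [i j|xi].
    by have := Xs (enum_rank i) (enum_rank j); rewrite !mxE !enum_rankK.
  have := Xp (fun k => xi (enum_val k)); congr (_ <= _).
  rewrite [RHS]big_enum_val; apply: eq_bigr => i _.
  by rewrite [RHS]big_enum_val; apply: eq_bigr => j _; rewrite mxE.
split=> [|xi]; first by apply/matrixP => i j; rewrite !mxE.
have := Xp (fun k => xi (enum_rank k)); congr (_ <= _).
rewrite big_enum_val; apply: eq_bigr => i _.
by rewrite big_enum_val; apply: eq_bigr => j _; rewrite mxE !enum_valK.
Qed.

Lemma cone_BH n (x : 'M[BHsys H]_n) : cone x <->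
  (forall i j, adjoint (x j i) = x i j) /\
  (forall xi : 'I_n -> H, 0 <= \sum_i \sum_j inner H (bop (x i j) (xi j)) (xi i)).
Proof.
split=> -[h1 h2]; split=> //; last by apply/matrixP => i j; rewrite mxE.
by move=> i j; have /matrixP/(_ i j) := h1; rewrite mxE.
Qed.

Lemma BH_ax : osys_ax (BHsys H).
Proof.
have ad0 : adjoint (0 : BH H) = 0.
  by apply: adjoint_uniq => x y; rewrite !bop0E ip0l ip0r.
split.
- exact: adjointD.
- exact: adjointZ.
- exact: adjointK.
- by move=> n x [].
- move=> n x y /cone_BH[xs xp] /cone_BH[ys yp]; apply/cone_BH; split=> [i j|xi].
    by rewrite !mxE adjointD xs ys.
  have := addr_ge0 (xp xi) (yp xi); rewrite -big_split; congr (_ <= _).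
  apply: eq_bigr => i _; rewrite -big_split; apply: eq_bigr => j _.
  by rewrite mxE bopDE ipDl.
- move=> p n x a /cone_BH[xs xp]; apply/cone_BH; split=> [i j|xi].
    rewrite !mxE exchange_big (big_morph _ (@adjointD R H) ad0); apply: eq_bigr => k _.
    rewrite (big_morph _ (@adjointD R H) ad0); apply: eq_bigr => l _.
    by rewrite adjointZ xs mulrC.
  have := xp (fun k => \sum_i a k i *: xi i); congr (_ <= _).
  under eq_bigr do under eq_bigr do rewrite bop_sumr ip_suml.
  under eq_bigr do under eq_bigr do under eq_bigr do rewrite bopZr ipZl ip_sumr.
  under [RHS]eq_bigr do under eq_bigr do rewrite mxE bop_sumE ip_suml.
  under [RHS]eq_bigr do under eq_bigr do under eq_bigr do rewrite bop_sumE ip_suml.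
  under [RHS]eq_bigr do rewrite exchange_big.
  rewrite [RHS]exchange_big; apply: eq_bigr => k _.
  under [RHS]eq_bigr do rewrite exchange_big.
  rewrite [RHS]exchange_big; apply: eq_bigr => l _.
  rewrite exchange_big; apply: eq_bigr => i _.
  by rewrite mulr_sumr; apply: eq_bigr => j _; rewrite bopZE ipZl ipZr; ring.
- apply/BHpcone; split=> [i j|xi]; first exact: adjoint1.
  by rewrite !(big_pred1 tt) ?ip_ge0//; case.
- move=> v; have [M M0 vM] := bop_bounded v; exists M => //.
  apply/BHpcone; split=> [[] []|xi] /=; rewrite ?adjointZ ?adjoint1 ?adjointK//.
  rewrite !big_bool.
  suff : 0 <= inner H (M *: xi true) (xi true) + inner H (v (xi false)) (xi true) +
    (inner H (adjoint v (xi true)) (xi false) + inner H (M *: xi false) (xi false)) by exact.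
  rewrite !ipZl -!inner_norm.
  rewrite (ipC (adjoint v _)) -adjointP.
  have := ip_norm_le (v (xi false)) (xi true); rewrite ler_norml => /andP[h _].
  have h2 : `|v (xi false)| * `|xi true| <= M * `|xi false| * `|xi true| by rewrite ler_wpM2r.
  have := mulr_ge0 M0 (sqr_ge0 (`|xi true| - `|xi false|)); rewrite sqrrB.
  lra.
Qed.

End BHcone.

(** The image of the unit may differ from the identity of B(H), because a C*-algebra is allowed to
    act degenerately. *)
Lemma embedding_ax V (H : realHilbert R) (f : V -> BHsys H) : co_embedding f ->
  pcone (fun _ _ : unit => f (ounit V)) ->
  (forall v, exists2 M : R, 0 <= M & pcone (fun a b : bool =>
     if a == b then M *: f (ounit V) else if a then f v else ostar (f v))) ->
  osys_ax V.
Proof.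
move=> [fl fi fs fc] f1 fb; have BA := BH_ax H.
have fD x y : f (x + y) = f x + f y by have := fl 1 x y; rewrite !scale1r.
have f0 : f 0 = 0 by apply: (addIr (f 0)); rewrite -fD !add0r.
have fZ a x : f (a *: x) = a *: f x by have := fl a x 0; rewrite !addr0 f0 addr0.
have pf (P : finType) (X : P -> P -> V) : pcone X <-> pcone (fun i j => f (X i j)).
  by rewrite /pcone fc (_ : map_mx _ _ = \matrix_(i, j) f (X (enum_val i) (enum_val j)))//;
     apply/matrixP => i j; rewrite !mxE.
split.
- by move=> x y; apply: fi; rewrite fs !fD !fs (ax_starD BA).
- by move=> a x; apply: fi; rewrite fs !fZ !fs (ax_starZ BA).
- by move=> x; apply: fi; rewrite !fs (ax_starK BA).
- move=> n x /fc/(ax_cone_star BA)/matrixP xs; apply/matrixP => i j.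
  by have := xs i j; rewrite !mxE -fs => /fi.
- move=> n x y /fc hx /fc hy; apply/fc; have := ax_coneD BA hx hy; apply: cone_eq.
  by apply/matrixP => i j; rewrite !mxE fD.
- move=> p n x a /fc hx; apply/fc; have := ax_congr BA a hx; apply: cone_eq.
  apply/matrixP => i j; rewrite !mxE (big_morph _ fD f0); apply: eq_bigr => k _.
  by rewrite (big_morph _ fD f0); apply: eq_bigr => l _; rewrite fZ mxE.
- exact/pf.
- move=> v; have [M M0 hM] := fb v; exists M => //; apply/pf.
  by apply: eq_pcone hM => a b; case: eqP => _; rewrite ?fZ//; case: a; rewrite ?fs.
Qed.

Lemma opsys_ax V : is_opsys idfun V -> osys_ax V.
Proof.
move=> [H [f [cf f1]]]; apply: (embedding_ax cf); rewrite f1; first exact: ax_unit (BH_ax H).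
by move=> v; have [M M0 hM] := ax_bound (BH_ax H) (f v); exists M.
Qed.

Lemma sum_prod (U : nmodType) (I J : finType) (F : I * J -> U) :
  \sum_a F a = \sum_i \sum_j F (i, j).
Proof. by rewrite pair_bigA; apply: eq_bigr => -[]. Qed.

Lemma cp_pcone V W (f : V -> W) (P : finType) (X : P -> P -> V) : cp f -> pcone X ->
  pcone (fun i j => f (X i j)).
Proof.
move=> [_ fc] /fc; rewrite ?/pcone; apply: cone_eq.
by apply/matrixP => i j; rewrite !mxE.
Qed.

Lemma pcone_cp V W (f : V -> W) : osys_ax V -> osys_ax W -> linear f ->
  (forall (P : finType) (X : P -> P -> V), pcone X -> pcone (fun i j => f (X i j))) -> cp f.
Proof.
move=> HV HW lf h; split=> // n x /(cone_pcone HV)/h hx; apply/(cone_pcone HW).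
by apply: eq_pcone hx => i j; rewrite mxE.
Qed.

Lemma cp_star V W (f : V -> W) x : osys_ax V -> osys_ax W -> cp f -> f (ostar x) = ostar (f x).
Proof.
move=> HV HW cf; have [M _ hM] := ax_bound HV x.
by have := pcone_star HW false true (cp_pcone cf hM) => /= ->.
Qed.

End Pcone.

(** * Linear algebra of the tensor product *)

Section TensorLinear.
Variables (R : realType) (V W : lmodType R).

Definition bilin (U : lmodType R) (b : V -> W -> U) :=
  (forall w, linear (b^~ w)) /\ (forall v, linear (b v)).

Lemma tlift_tens (U : lmodType R) (b : V -> W -> U) v w : bilin b -> tlift b (tens v w) = b v w.
Proof.
move=> bl; pose B : {bilinear V -> W -> U} := HB.pack b
  (bilinear_isBilinear.Build R V W U *:%R *:%R b bl).
by rewrite -[b]/(B : V -> W -> U) tlift_pi /tsum big_seq1.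
Qed.

Lemma tlift_linear (U : lmodType R) (b : V -> W -> U) : bilin b -> linear (tlift b).
Proof.
move=> bl; pose B : {bilinear V -> W -> U} := HB.pack b
  (bilinear_isBilinear.Build R V W U *:%R *:%R b bl).
by move=> a x y; rewrite -[b]/(B : V -> W -> U) tliftD tliftZ.
Qed.

Lemma bilin_tens : bilin (@tens R V W).
Proof.
split=> [w a v v'|v a w w']; apply: tensorP => U b; rewrite tliftD tliftZ !tlift_pi /tsum !big_seq1 /=.
  by rewrite linearPl.
by rewrite linearP.
Qed.

Lemma tensDl v v' w : tens (v + v') w = tens v w + tens v' w :> tensor V W.
Proof. by have := bilin_tens.1 w 1 v v'; rewrite /= !scale1r. Qed.
Lemma tensDr v w w' : tens v (w + w') = tens v w + tens v w' :> tensor V W.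
Proof. by have := bilin_tens.2 v 1 w w'; rewrite /= !scale1r. Qed.
Lemma tens0l w : tens 0 w = 0 :> tensor V W.
Proof. by apply: (addIr (tens 0 w)); rewrite -tensDl !add0r. Qed.
Lemma tens0r v : tens v 0 = 0 :> tensor V W.
Proof. by apply: (addIr (tens v 0)); rewrite -tensDr !add0r. Qed.
Lemma tensZl a v w : tens (a *: v) w = a *: tens v w :> tensor V W.
Proof. by have := bilin_tens.1 w a v 0; rewrite /= tens0l !addr0. Qed.
Lemma tensZr a v w : tens v (a *: w) = a *: tens v w :> tensor V W.
Proof. by have := bilin_tens.2 v a w 0; rewrite /= tens0r !addr0. Qed.
Lemma tens_suml I (r : seq I) (F : I -> V) w :
  tens (\sum_(i <- r) F i) w = \sum_(i <- r) tens (F i) w :> tensor V W.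
Proof. by apply: (big_morph (fun v => tens v w)) => [x y|]; [exact: tensDl|exact: tens0l]. Qed.
Lemma tens_sumr I (r : seq I) (F : I -> W) v :
  tens v (\sum_(i <- r) F i) = \sum_(i <- r) tens v (F i) :> tensor V W.
Proof. by apply: (big_morph (fun w => tens v w)) => [x y|]; [exact: tensDr|exact: tens0r]. Qed.

Lemma tensor_sum (z : tensor V W) : exists s : seq (V * W), z = \sum_(p <- s) tens p.1 p.2.
Proof.
exists (repr z); apply: tensorP => U b.
rewrite (big_morph (tlift b) (tliftD b) (tlift0 b)) {1}/tlift /tsum.
by apply: eq_bigr => p _; rewrite tlift_pi /tsum big_seq1.
Qed.

Lemma tens_ind (P : tensor V W -> Prop) :
  P 0 -> (forall x y, P x -> P y -> P (x + y)) -> (forall v w, P (tens v w)) -> forall z, P z.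
Proof.
move=> P0 PD Pt z; have [s ->] := tensor_sum z.
by elim: s => [|p s IH]; rewrite ?big_nil// big_cons; apply: (PD _ _).
Qed.

Lemma tens_ext (U : lmodType R) (F G : tensor V W -> U) : linear F -> linear G ->
  (forall v w, F (tens v w) = G (tens v w)) -> F =1 G.
Proof.
move=> lF lG FG; apply: tens_ind => //.
  by have := lF 0 0 0; have := lG 0 0 0; rewrite !scale0r !add0r => _ _;
     have := lF (-1) 0 0; have := lG (-1) 0 0; rewrite !scaleN1r !addNr => -> ->.
by move=> x y Fx Fy; have := lF 1 x y; have := lG 1 x y; rewrite !scale1r Fx Fy => -> ->.
Qed.

(** Induction on the length of a representing sum. If some [phi] does not kill the first left factor
    [v], the hypothesis expresses [w] through the other right factors and the first term is absorbed
    by the others. *)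
Lemma tensor_separate (FV : set (V -> R)) (FW : set (W -> R)) (z : tensor V W) :
  (forall phi, FV phi -> rlin phi) -> (forall psi, FW psi -> rlin psi) ->
  (forall v, (forall phi, FV phi -> phi v = 0) -> v = 0) ->
  (forall w, (forall psi, FW psi -> psi w = 0) -> w = 0) ->
  (forall phi psi, FV phi -> FW psi ->
    tlift (fun v w => phi v * psi w : R^o) z = 0) -> z = 0.
Proof.
move=> lV lW sV sW; have [s ->] := tensor_sum z.
have [n] := ubnP (size s); elim: n s => // n IH [|[v w] s] /=; first by rewrite big_nil.
rewrite ltnS => sn h.
have bl phi psi : FV phi -> FW psi -> bilin (fun v w => phi v * psi w : R^o).
  move=> /lV lp /lW lq; split=> x a y y'; first by rewrite lp mulrDl -mulrA.
  by rewrite lq mulrDr mulrCA.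
have ev phi psi (t : seq (V * W)) : FV phi -> FW psi ->
    tlift (fun v w => phi v * psi w : R^o) (\sum_(p <- t) tens p.1 p.2) = psi (\sum_(p <- t) phi p.1 *: p.2).
  move=> Fp Fq; have lt := tlift_linear (bl _ _ Fp Fq).
  rewrite (big_morph _ (rlinD lt) (rlin0 lt)) (rlin_sum (lW _ Fq)).
  by apply: eq_bigr => p _; rewrite tlift_tens ?(rlinZ (lW _ Fq))//; exact: bl.
have h' phi : FV phi -> \sum_(p <- (v, w) :: s) phi p.1 *: p.2 = 0.
  by move=> Fp; apply: sW => psi Fq; rewrite -ev// h.
have [phi0|] := pselect (forall phi, FV phi -> phi v = 0).
  rewrite big_cons /= (sV _ phi0) tens0l add0r; apply: IH => // phi psi Fp Fq.
  have := h _ _ Fp Fq; rewrite !ev// big_cons /= phi0// scale0r add0r; exact.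
move=> /existsNP[phi /not_implyP[Fp /eqP pv]].
have pw : phi v *: w = - \sum_(p <- s) phi p.1 *: p.2.
  by apply/eqP; rewrite -addr_eq0; have := h' _ Fp; rewrite big_cons => ->.
have wE : w = - \sum_(p <- s) ((phi v)^-1 * phi p.1) *: p.2.
  rewrite -[w]scale1r -(mulVf pv) -scalerA pw scalerN scaler_sumr.
  by congr (- _); apply: eq_bigr => p _; rewrite scalerA.
pose s' := [seq (p.1 - ((phi v)^-1 * phi p.1) *: v, p.2) | p <- s].
have E : \sum_(p <- (v, w) :: s) tens p.1 p.2 = \sum_(p <- s') tens p.1 p.2.
  rewrite big_cons big_map /= {1}wE -[- _]scaleN1r tensZr tens_sumr scaler_sumr -big_split.
  apply: eq_bigr => p _ /=; rewrite tensDl addrC; congr (_ + _).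
  by rewrite -[- _ in RHS]scaleN1r !tensZl tensZr.
by rewrite E; apply: IH; rewrite ?size_map// => f g Ff Fg; rewrite -E h.
Qed.

End TensorLinear.

(** * Tensor maps and the generators of the maximal cones *)

Section TensorMaps.
Variable R : realType.
Implicit Types V W : mosys R.

Lemma bilin_map (V V' W W' : lmodType R) (f : V -> V') (g : W -> W') : linear f -> linear g ->
  bilin (fun v w => tens (f v) (g w)).
Proof.
move=> lf lg; split=> x a y y'; first by rewrite lf tensDl tensZl.
by rewrite lg tensDr tensZr.
Qed.

Lemma tens_mapE (V V' W W' : lmodType R) (f : V -> V') (g : W -> W') v w : linear f -> linear g ->
  tens_map f g (tens v w) = tens (f v) (g w).
Proof. by move=> lf lg; rewrite /tens_map tlift_tens//; exact: bilin_map. Qed.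

Lemma tens_map_linear (V V' W W' : lmodType R) (f : V -> V') (g : W -> W') : linear f -> linear g ->
  linear (tens_map f g).
Proof. by move=> lf lg; apply: tlift_linear; exact: bilin_map. Qed.

Lemma linear_add (V W : lmodType R) (f : V -> W) x y : linear f -> f (x + y) = f x + f y.
Proof. by move=> lf; have := lf 1 x y; rewrite !scale1r. Qed.
Lemma linear_zero (V W : lmodType R) (f : V -> W) : linear f -> f 0 = 0.
Proof. by move=> lf; apply: (addIr (f 0)); rewrite -linear_add ?add0r. Qed.
Lemma linear_scale (V W : lmodType R) (f : V -> W) a x : linear f -> f (a *: x) = a *: f x.
Proof. by move=> lf; have := lf a x 0; rewrite (linear_zero lf) !addr0. Qed.
Lemma linear_opp (V W : lmodType R) (f : V -> W) x : linear f -> f (- x) = - f x.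
Proof. by move=> lf; rewrite -scaleN1r (linear_scale _ _ lf) scaleN1r. Qed.
Lemma linear_bigsum (V W : lmodType R) (f : V -> W) I (r : seq I) P (F : I -> V) : linear f ->
  f (\sum_(i <- r | P i) F i) = \sum_(i <- r | P i) f (F i).
Proof.
move=> lf; apply: (big_morph f); last exact: linear_zero.
by move=> x y; exact: linear_add.
Qed.

Definition pcg (U : lmodType R) (P N : finType) (X : P -> P -> U) (al : P -> N -> R) :=
  fun i j => \sum_k \sum_l (al k i * al l j) *: X k l.

Lemma pcg_linear (U U' : lmodType R) (P N : finType) (X : P -> P -> U) (al : P -> N -> R)
  (f : U -> U') i j : linear f -> f (pcg X al i j) = pcg (fun k l => f (X k l)) al i j.
Proof.
move=> lf; rewrite /pcg linear_bigsum//; apply: eq_bigr => k _.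
by rewrite linear_bigsum//; apply: eq_bigr => l _; rewrite linear_scale.
Qed.

Lemma pcg_pcg (U : lmodType R) (P N Q : finType) (X : P -> P -> U) (al : P -> N -> R)
    (be : N -> Q -> R) p q :
  pcg (pcg X al) be p q = pcg X (fun a q => \sum_i al a i * be i q) p q.
Proof.
rewrite /pcg; under eq_bigr do under eq_bigr do rewrite scaler_sumr.
under eq_bigr do under eq_bigr do under eq_bigr do rewrite scaler_sumr.
under eq_bigr do rewrite exchange_big.
rewrite exchange_big; apply: eq_bigr => a _.
under eq_bigr do rewrite exchange_big.
rewrite exchange_big; apply: eq_bigr => b _.
rewrite mulr_suml scaler_suml; apply: eq_bigr => i _.
rewrite mulr_sumr scaler_suml; apply: eq_bigr => j _.
by rewrite scalerA; congr (_ *: _); ring.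
Qed.

Lemma eq_pcg (U : lmodType R) (P N : finType) (X Y : P -> P -> U) (al be : P -> N -> R) i j :
  (forall k l, X k l = Y k l) -> (forall k i, al k i = be k i) -> pcg X al i j = pcg Y be i j.
Proof. by move=> XY ab; apply: eq_bigr => k _; apply: eq_bigr => l _; rewrite XY !ab. Qed.

Lemma pcg_sub (U : lmodType R) (P N : finType) (X : P -> P -> U) (f : N -> P) i j :
  pcg X (fun k i => (k == f i)%:R) i j = X (f i) (f j).
Proof.
rewrite /pcg; under eq_bigr do under eq_bigr do rewrite -scalerA.
under eq_bigr do rewrite -scaler_sumr sum_delta.
exact: sum_delta.
Qed.

(* The compressions alpha^T (A (x) B) alpha: the generators of the maximal    *)
(* cones before the Archimedean closure.                                      *)
Definition pD V W (N : finType) (x : N -> N -> tensor V W) :=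
  exists (P Q : finType) (A : P -> P -> V) (B : Q -> Q -> W) (al : P * Q -> N -> R),
    [/\ pcone A, pcone B &
        forall i j, x i j = pcg (fun a b => tens (A a.1 b.1) (B a.2 b.2)) al i j].

Lemma eq_pD V W (N : finType) (x y : N -> N -> tensor V W) : (forall i j, x i j = y i j) -> pD x -> pD y.
Proof.
by move=> xy [P [Q [A [B [al [hA hB h]]]]]]; exists P, Q, A, B, al; split=> // i j; rewrite -xy.
Qed.

Lemma pD_congr V W (N Q : finType) (x : N -> N -> tensor V W) (be : N -> Q -> R) :
  pD x -> pD (pcg x be).
Proof.
move=> [P [P' [A [B [al [hA hB h]]]]]]; exists P, P', A, B, (fun a q => \sum_i al a i * be i q).
by split=> // i j; rewrite -pcg_pcg; apply: eq_pcg.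
Qed.

Lemma pD_sub V W (N Q : finType) (x : N -> N -> tensor V W) (f : Q -> N) :
  pD x -> pD (fun i j => x (f i) (f j)).
Proof. by move=> /(pD_congr (fun k i => (k == f i)%:R)); apply: eq_pD => i j; rewrite pcg_sub. Qed.

Lemma pD_tens V W (P Q : finType) (A : P -> P -> V) (B : Q -> Q -> W) : pcone A -> pcone B ->
  pD (fun a b : P * Q => tens (A a.1 b.1) (B a.2 b.2)).
Proof.
move=> hA hB; exists P, Q, A, B, (fun k i => (k == i)%:R); split=> // i j.
by rewrite (pcg_sub _ id).
Qed.

Lemma tens_star_bilin V W : osys_ax V -> osys_ax W ->
  bilin (fun (v : V) (w : W) => tens (ostar v) (ostar w)).
Proof.
by move=> HV HW; apply: bilin_map => a x y; rewrite ?(ax_starD HV) ?(ax_starZ HV) ?(ax_starD HW) ?(ax_starZ HW).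
Qed.

Lemma tens_starE V W v w : osys_ax V -> osys_ax W ->
  tens_star (tens v w : tensor V W) = tens (ostar v) (ostar w).
Proof. by move=> HV HW; rewrite /tens_star tlift_tens//; exact: tens_star_bilin. Qed.

Lemma tens_star_linear V W : osys_ax V -> osys_ax W -> linear (@tens_star R V W).
Proof. by move=> HV HW; apply: tlift_linear; exact: tens_star_bilin. Qed.

Section Dtheory.
Variables V W : mosys R.
Hypotheses (HV : osys_ax V) (HW : osys_ax W).

Lemma pD_star (N : finType) (x : N -> N -> tensor V W) i j : pD x -> tens_star (x j i) = x i j.
Proof.
move=> [P [Q [A [B [al [hA hB h]]]]]]; rewrite !h (pcg_linear _ _ _ _ (tens_star_linear HV HW)).
rewrite /pcg exchange_big; apply: eq_bigr => k _; apply: eq_bigr => l _.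
by rewrite tens_starE// (pcone_star HV _ _ hA) (pcone_star HW _ _ hB) mulrC.
Qed.

Lemma pD_add (N : finType) (x y : N -> N -> tensor V W) : pD x -> pD y -> pD (fun i j => x i j + y i j).
Proof.
move=> [P [Q [A [B [al [hA hB h]]]]]] [P' [Q' [A' [B' [al' [hA' hB' h']]]]]].
(* The two tensors become the pure blocks of the tensor product of the direct sums; the mixed blocks
   get coefficient 0. *)
pose al2 (k : (P + P') * (Q + Q')) i := match k with
  | (inl a, inl b) => al (a, b) i | (inr a, inr b) => al' (a, b) i | _ => 0 end.
have hA2 := pcone_dsum HV hA hA'; have hB2 := pcone_dsum HW hB hB'.
eexists _, _, _, _, al2; split; [exact: hA2|exact: hB2|].
have split4 (F : (P + P') * (Q + Q') -> tensor V W) : \sum_k F k =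
   \sum_(k : P * Q) F (inl k.1, inl k.2) + \sum_(k : P * Q') F (inl k.1, inr k.2) +
   (\sum_(k : P' * Q) F (inr k.1, inl k.2) + \sum_(k : P' * Q') F (inr k.1, inr k.2)).
  have -> : \sum_k F k = \sum_a \sum_b F (a, b).
    by rewrite pair_bigA; apply: eq_bigr => -[].
  rewrite big_sumType /=; congr (_ + _).
    under eq_bigr do rewrite big_sumType /=.
    by rewrite big_split !pair_bigA.
  under eq_bigr do rewrite big_sumType /=.
  by rewrite big_split !pair_bigA.
have z (I : finType) (F : I -> tensor V W) : (forall k, F k = 0) -> \sum_k F k = 0.
  by move=> F0; apply: big1 => k _.
have z0 := (mul0r, mulr0, scale0r, tens0l, scaler0).
move=> i j; rewrite h h' /pcg split4 /=.
rewrite [X in _ = _ + X + _]z; last by move=> k; apply: z => l; rewrite !z0.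
rewrite [X in _ = _ + (X + _)]z; last by move=> k; apply: z => l; rewrite !z0.
rewrite addr0 add0r; congr (_ + _); apply: eq_bigr => -[a b] _; rewrite split4 /=.
  rewrite [X in _ = _ + X + _]z; last by move=> k; rewrite !z0.
  rewrite [X in _ = _ + (X + _)]z; last by move=> k; rewrite !z0.
  rewrite [X in _ = _ + (_ + X)]z; last by move=> k; rewrite !z0.
  by rewrite !addr0; apply: eq_bigr => -[].
rewrite [X in _ = X + _ + _]z; last by move=> k; rewrite !z0.
rewrite [X in _ = _ + X + _]z; last by move=> k; rewrite !z0.
rewrite [X in _ = _ + (X + _)]z; last by move=> k; rewrite !z0.
by rewrite !add0r; apply: eq_bigr => -[].
Qed.

Lemma pD_unit (N : finType) (c : N -> R) : pD (fun i j => (c i * c j) *: tens_unit V W).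
Proof.
have := pD_congr (fun _ => c) (pD_tens (ax_unit HV) (ax_unit HW)); apply: eq_pD => i j.
by rewrite /pcg !(big_pred1 (tt, tt))// => -[[] []].
Qed.

Lemma pD0 (N : finType) : pD (fun _ _ : N => (0 : tensor V W)).
Proof. by apply: eq_pD (pD_unit (fun _ : N => 0)) => i j; rewrite mul0r scale0r. Qed.

Lemma pD_sum (N : finType) I (r : seq I) (x : I -> N -> N -> tensor V W) :
  (forall i, pD (x i)) -> pD (fun a b => \sum_(i <- r) x i a b).
Proof.
move=> hx; elim: r => [|i r IH].
  by apply: eq_pD (pD0 N) => a b; rewrite big_nil.
by apply: eq_pD (pD_add (hx i) IH) => a b; rewrite big_cons.
Qed.

Lemma pDZ (N : finType) (x : N -> N -> tensor V W) c : 0 <= c -> pD x -> pD (fun i j => c *: x i j).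
Proof.
move=> c0 /(pD_congr (fun k i => Num.sqrt c * (k == i)%:R)); apply: eq_pD => i j; rewrite /pcg.
under eq_bigr do under eq_bigr do rewrite mulrACA -expr2 sqr_sqrtr// -!scalerA.
under eq_bigr do rewrite -!scaler_sumr sum_delta.
by rewrite -scaler_sumr sum_delta.
Qed.

Lemma pD_id (N : finType) : pD (fun i j : N => (i == j)%:R *: tens_unit V W).
Proof.
have := pD_sum (index_enum N) (fun k => pD_unit (fun i => (i == k)%:R)).
apply: eq_pD => i j; under eq_bigr do rewrite -scalerA [i == _]eq_sym.
by rewrite sum_delta eq_sym.
Qed.

End Dtheory.
End TensorMaps.

(** * The maximal tensor product *)

Section MaxCone.
Variable R : realType.
Implicit Types V W : mosys R.

Lemma big_tagnat (U : nmodType) k (p : 'I_k -> nat) (F : 'I_(\sum_i p i) -> U) :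
  \sum_K F K = \sum_i \sum_(s < p i) F (tagnat.Rank i s).
Proof.
rewrite sig_big_dep/= (reindex _ tagnat.rank_bij_on)/=.
by apply: eq_bigr => -[i s] _.
Qed.

Lemma congr_mxdiag (U : lmodType R) k (p : 'I_k -> nat) (X : forall i, 'M[U]_(p i)) n
    (al : 'M[R]_(\sum_i p i, n)) a b :
  congr_mx (\mxdiag_i X i) al a b =
  \sum_i \sum_(s < p i) \sum_(t < p i) (al (tagnat.Rank i s) a * al (tagnat.Rank i t) b) *: X i s t.
Proof.
rewrite mxE big_tagnat; apply: eq_bigr => i _; apply: eq_bigr => s _.
rewrite big_tagnat (bigD1 i)//= [X in _ + X]big1 ?addr0.
  apply: eq_bigr => t _; congr (_ *: _).
  by have /matrixP/(_ s t) := submxblock_diag X i; rewrite mxE.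
move=> i' ii'; apply: big1 => t _.
have /matrixP/(_ s t) : submxblock (\mxdiag_i X i) i i' = 0.
  by rewrite mxblockK eq_sym (negPf ii').
by rewrite !mxE => ->; rewrite scaler0.
Qed.

Lemma big_mxtens (U : nmodType) p q (F : 'I_(p * q) -> U) :
  \sum_k F k = \sum_(a : 'I_p * 'I_q) F (mxtens_index a).
Proof.
rewrite (reindex (@mxtens_index p q))//.
by exists (@mxtens_unindex p q) => x _; [exact: mxtens_indexK|exact: mxtens_unindexK].
Qed.

Section Theory.
Variables V W : mosys R.
Hypotheses (HV : osys_ax V) (HW : osys_ax W).

(** A block diagonal sum of tensors reduces to a single tensor because [pD] is stable under sums. *)
Lemma max_coneP n (x : 'M[tensor V W]_n) : max_cone x <->
  (forall i j, tens_star (x j i) = x i j) /\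
  (forall eps : R, 0 < eps -> pD (fun i j : 'I_n => x i j + (i == j)%:R *: (eps *: tens_unit V W))).
Proof.
split=> -[xs xe]; split.
- by move=> i j; have /matrixP/(_ i j) := xs; rewrite mxE.
- move=> e /xe[k [p [q [A [B [al [hA hB /matrixP h]]]]]]].
  have hi i : pD (fun a b : 'I_n => \sum_(s < p i * q i) \sum_(t < p i * q i)
      (al (tagnat.Rank i s) a * al (tagnat.Rank i t) b) *: tensor_mx (A i) (B i) s t).
    have /(cone_pcone HV) hA' := hA i; have /(cone_pcone HW) hB' := hB i.
    have := pD_congr (fun (c : 'I_(p i) * 'I_(q i)) (j : 'I_n) => al (tagnat.Rank i (mxtens_index c)) j) (pD_tens hA' hB').
    apply: eq_pD => a b; rewrite /pcg big_mxtens; apply: eq_bigr => c _.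
    rewrite big_mxtens; apply: eq_bigr => d _; congr (_ *: _).
    by rewrite mxE !mxtens_indexK.
  have := pD_sum HV HW (index_enum _) hi; apply: eq_pD => a b.
  by have := h a b; rewrite congr_mxdiag => <-; rewrite !mxE scaler_nat.
- by apply/matrixP => i j; rewrite mxE.
move=> e /xe[P [Q [A [B [al [hA hB h]]]]]].
exists 1%N, (fun=> #|P|), (fun=> #|Q|), (fun=> \matrix_(i, j) A (enum_val i) (enum_val j)),
  (fun=> \matrix_(i, j) B (enum_val i) (enum_val j)).
pose be (k : 'I_(#|P| * #|Q|)) i := al (enum_val (mxtens_unindex k).1, enum_val (mxtens_unindex k).2) i.
exists (\matrix_(K, i) be (tagnat.sig2 K) i); split=> //.
apply/matrixP => i j; rewrite congr_mxdiag big_ord1 !mxE.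
have := h i j; rewrite scaler_nat => ->.
have E (F : P * Q -> tensor V W) : \sum_a F a =
    \sum_(s < #|P| * #|Q|) F (enum_val (mxtens_unindex s).1, enum_val (mxtens_unindex s).2).
  rewrite big_mxtens; under [RHS]eq_bigr do rewrite mxtens_indexK.
  have -> : \sum_a F a = \sum_a \sum_b F (a, b) by rewrite pair_bigA; apply: eq_bigr => -[].
  have e1 (T : finType) (G : T -> tensor V W) : \sum_a G a = \sum_(i < #|T|) G (enum_val i).
    exact: big_enum_val.
  rewrite -(pair_bigA _ (fun i j => F (enum_val i, enum_val j))) e1.
  by apply: eq_bigr => a _; exact: (e1 _ (fun b => F (enum_val a, b))).
have rk (s : 'I_(#|P| * #|Q|)) : tagnat.sig2 (@tagnat.Rank 1 (fun=> #|P| * #|Q|)%N ord0 s) = s.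
  by apply: val_inj; rewrite tagnat.Rank2K.
rewrite /pcg E; apply: eq_bigr => s _; rewrite E; apply: eq_bigr => t _.
by rewrite !mxE !rk.
Qed.

Lemma pD_max n (x : 'M[tensor V W]_n) : pD (fun i j : 'I_n => x i j) -> max_cone x.
Proof.
move=> hx; apply/max_coneP; split=> [i j|e e0]; first exact: (pD_star HV HW _ _ hx).
apply: eq_pD (pD_add HV HW hx (pDZ (ltW e0) (pD_id HV HW _))) => i j.
by rewrite !scalerA mulrC.
Qed.

(** The tensor product with its cones before Archimedean closure; its axioms suffice for it to be
    the domain of an Arveson extension. *)
Definition dten : mosys R :=
  @MOSys R (tensor V W) (@tens_star R V W) (tens_unit V W) (fun n => [set x | pD (fun i j : 'I_n => x i j)]).

Lemma dten_pcone (N : finType) (x : N -> N -> dten) : pcone x <-> pD x.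
Proof.
split=> [|h].
  move=> /(pD_sub (fun i => enum_rank i)); apply: eq_pD => i j.
  by rewrite mxE !enum_rankK.
by apply: eq_pD (pD_sub (fun i => enum_val i) h) => i j; rewrite mxE.
Qed.

Lemma dten_ax : osys_ax dten.
Proof.
have sl := tens_star_linear HV HW.
have star1 : tens_star (tens_unit V W) = tens_unit V W.
  by rewrite tens_starE// (ax_star1 HV) (ax_star1 HW).
split.
- by move=> x y; exact: linear_add.
- by move=> a x; exact: linear_scale.
- apply: (@tens_ext _ _ _ _ (fun z => tens_star (tens_star z)) id) => [a x y|//|v w].
    by rewrite !sl.
  by rewrite !tens_starE// (ax_starK HV) (ax_starK HW).
- by move=> n x hx; apply/matrixP => i j; rewrite mxE; exact: (pD_star HV HW _ _ hx).
- by move=> n x y hx hy; apply: eq_pD (pD_add HV HW hx hy) => i j; rewrite mxE.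
- by move=> p n x a hx; apply: eq_pD (pD_congr (fun k i => a k i) hx) => i j; rewrite mxE.
- apply/dten_pcone; apply: eq_pD (pD_unit HV HW (fun _ : unit => 1)) => i j.
  by rewrite mulr1 scale1r.
pose Bd (z : tensor V W) M := pD (fun a b : bool =>
  if a == b then M *: tens_unit V W else if a then z else tens_star z).
suff h (z : tensor V W) : exists2 M, 0 <= M & Bd z M.
  by move=> z; have [M M0 hM] := h z; exists M => //; apply/dten_pcone.
elim/tens_ind : z => [|x y [M M0 hx] [N N0 hy]|v w].
- exists 0 => //; apply: eq_pD (pD0 HV HW _) => a b.
  by rewrite scale0r (linear_zero sl) !if_same.
- exists (M + N); first exact: addr_ge0.
  apply: eq_pD (pD_add HV HW hx hy) => a b; case: eqP => _; first by rewrite scalerDl.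
  by case: a => //; rewrite -(linear_add _ _ sl).
have [M M0 hv] := ax_bound HV v; have [N N0 hw] := ax_bound HW w.
exists (M * N); first exact: mulr_ge0.
apply: eq_pD (pD_sub (fun a : bool => (a, a)) (pD_tens hv hw)) => a b /=.
case: eqP => _; first by rewrite tensZl tensZr scalerA.
by case: a => //; rewrite tens_starE.
Qed.

End Theory.

Lemma pD_map V V' W W' (f : V -> V') (g : W -> W') (N : finType) (x : N -> N -> tensor V W) :
  cp f -> cp g -> pD x -> pD (fun i j => tens_map f g (x i j)).
Proof.
move=> cf cg [P [Q [A [B [al [hA hB h]]]]]].
exists P, Q, (fun i j => f (A i j)), (fun i j => g (B i j)), al.
split; [exact: cp_pcone|exact: cp_pcone|move=> i j].
have lf := cf.1; have lg := cg.1.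
rewrite h (pcg_linear _ _ _ _ (tens_map_linear lf lg)).
by apply: eq_pcg => // k l; rewrite tens_mapE.
Qed.

Lemma max_map V V' W W' (f : V -> V') (g : W -> W') n (x : 'M[tensor V W]_n) :
  osys_ax V -> osys_ax V' -> osys_ax W -> osys_ax W' ->
  ucp f -> ucp g -> max_cone x -> max_cone (map_mx (tens_map f g) x).
Proof.
move=> HV HV' HW HW' [cf f1] [cg g1] /(max_coneP HV HW)[xs xp].
have lf := cf.1; have lg := cg.1; have lfg := tens_map_linear lf lg.
apply/(max_coneP HV' HW'); split=> [i j|e /xp].
  rewrite !mxE -[x i j]xs; have sl := tens_star_linear HV HW; have sl' := tens_star_linear HV' HW'.
  apply: (@tens_ext _ _ _ _ (fun z => tens_star (tens_map f g z)) (fun z => tens_map f g (tens_star z))).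
  - by move=> a y z; rewrite lfg sl'.
  - by move=> a y z; rewrite sl lfg.
  - move=> v w; rewrite tens_starE// !tens_mapE// tens_starE//.
    by rewrite (cp_star _ HV HV' cf) (cp_star _ HW HW' cg).
move=> /(pD_map cf cg); apply: eq_pD => i j.
rewrite mxE (linear_add _ _ lfg) !(linear_scale _ _ lfg); congr (_ + _ *: (_ *: _)).
by rewrite /tens_unit tens_mapE// f1 g1.
Qed.

End MaxCone.

(** * Products of commuting positive operators *)

Section CommutingPositive.
Variable R : realType.

(* F. Riesz: with X_0 = X/M and X_(k+1) = X_k - X_k^2 one has                 *)
(* X_0 = sum_k X_k^2, so that <XYu, u> is a sum of terms <Y X_k u, X_k u>.    *)
Lemma comm_pos (L : lmodType R) (q : L -> L -> R) (X Y : L -> L) (M : R) :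
  psd_form q -> linear X -> linear Y ->
  (forall u v, q (X u) v = q u (X v)) -> (forall u v, q (Y u) v = q u (Y v)) ->
  (forall u, 0 <= q (X u) u <= M * q u u) -> (forall u, 0 <= q (Y u) u) ->
  (forall u, X (Y u) = Y (X u)) -> forall u, 0 <= q (X (Y u)) u.
Proof.
move=> qP lX lY sX sY Xb Yp XY.
have qE := (psdDl qP, psdDr qP, psdZl qP, psdZr qP, psdNl qP, psdNr qP).
wlog M1 : X M lX sX Xb XY / M = 1.
  move=> wl u; pose M' := Num.max M 1.
  have M'0 : 0 < M' by rewrite lt_max ltr01 orbT.
  suff h : 0 <= q (M'^-1 *: X (Y u)) u by move: h; rewrite qE pmulr_rge0 ?invr_gt0.
  apply: (wl (fun u => M'^-1 *: X u) 1) => //.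
  - by move=> a x y; rewrite lX scalerDr !scalerA mulrC.
  - by move=> x y; rewrite !qE sX.
  - move=> x; rewrite qE; have /andP[h1 h2] := Xb x; rewrite mulr_ge0 ?invr_ge0 ?(ltW M'0)//=.
    rewrite mul1r ler_pdivrMl//; apply: (le_trans h2); rewrite ler_wpM2r ?(psd_ge0 qP)//.
    by rewrite le_max lexx.
  - by move=> x; rewrite XY (linear_scale _ _ lY).
move: M1 Xb => -> Xb u; rewrite leNgt; apply/negP => neg.
pose good Z := [/\ linear Z, forall u v, q (Z u) v = q u (Z v),
  forall u, 0 <= q (Z u) u <= q u u & forall u, Z (Y u) = Y (Z u)].
pose step (Z : L -> L) u := Z u - Z (Z u).
have goodS Z : good Z -> good (step Z).
  move=> [lZ sZ bZ cZ]; rewrite /step; split.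
  - by move=> a x y; rewrite !lZ scalerBr opprD addrACA.
  - by move=> x y; rewrite !qE !sZ.
  - move=> x; have /andP[h1 h2] := bZ (x - Z x); have /andP[h3 h4] := bZ (Z x).
    have /andP[h5 h6] := bZ x; have h7 := psd_ge0 qP (x - Z x).
    move: h1 h2 h3 h4 h5 h6 h7; rewrite (linear_add _ _ lZ) (linear_opp _ lZ) !qE !sZ => *.
    by apply/andP; split; lra.
  - by move=> x; rewrite !cZ (linear_add _ _ lY) (linear_opp _ lY).
pose Xn n := iter n step X.
have gn n : good (Xn n).
  by elim: n => [|n IH] /=; [split=> // v; have := Xb v; rewrite mul1r|exact: goodS].
have sum1 n : \sum_(i < n) q (Xn i u) (Xn i u) = q (X u) u - q (Xn n u) u.
  elim: n => [|n IH]; first by rewrite big_ord0 subrr.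
  by rewrite big_ord_recr /= IH /step !qE; have [_ s _ _] := gn n; rewrite (s (Xn n u)); lra.
have sum2 n : q (X (Y u)) u = \sum_(i < n) q (Y (Xn i u)) (Xn i u) + q (Xn n (Y u)) u.
  elim: n => [|n IH]; first by rewrite big_ord0 add0r.
  rewrite big_ord_recr /= IH /step !qE; have [_ s _ c] := gn n.
  by rewrite (s (Xn n (Y u))) c; lra.
have cs n : q (X (Y u)) u ^+ 2 <= q (Y u) (Y u) * q (Xn n u) (Xn n u).
  have [_ s _ c] := gn n.
  apply: le_trans (psd_CS qP (Y u) (Xn n u)); rewrite -s.
  rewrite -[leLHS]sqrrN -[leRHS]sqrrN ler_pXn2r ?nnegrE ?oppr_ge0 ?(ltW neg)//.
    rewrite lerN2 (sum2 n) lerDr; apply: sumr_ge0 => i _; exact: Yp.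
  by apply: le_trans (ltW neg); rewrite (sum2 n) lerDr; apply: sumr_ge0 => i _; exact: Yp.
set d := q (X (Y u)) u ^+ 2; have d0 : 0 < d by rewrite exprn_even_gt0//= lt_eqF.
set y := q (Y u) (Y u) in cs; have y0 : 0 <= y := psd_ge0 qP _.
have h n : n%:R * d <= y * q (X u) u.
  apply: (@le_trans _ _ (\sum_(i < n) y * q (Xn i u) (Xn i u))).
    by rewrite mulr_natl -[n in leLHS]card_ord -sumr_const; apply: ler_sum => i _; exact: cs.
  rewrite -mulr_sumr sum1 ler_wpM2l// gerBl.
  by have [_ _ b _] := gn n; have /andP[] := b u.
have := h (Num.truncn (y * q (X u) u / d)).+1; rewrite leNgt -ltr_pdivrMr//.
by rewrite truncnS_gt.
Qed.

(** On functions from [P * Q] to [H] the two matrices act on separate indices, as commuting positive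
    operators, so that [comm_pos] applies. *)
Lemma block_pos (H : realHilbert R) (P Q : finType) (X : P -> P -> BH H) (Y : Q -> Q -> BH H) :
  (forall i j, adjoint (X j i) = X i j) -> (forall i j, adjoint (Y j i) = Y i j) ->
  (forall xi : P -> H, 0 <= \sum_i \sum_j inner H (X i j (xi j)) (xi i)) ->
  (forall xi : Q -> H, 0 <= \sum_i \sum_j inner H (Y i j (xi j)) (xi i)) ->
  (forall i j k l, bopM (X i j) (Y k l) = bopM (Y k l) (X i j)) ->
  forall z : P * Q -> H,
    0 <= \sum_a \sum_b inner H (X a.1 b.1 (Y a.2 b.2 (z b))) (z a).
Proof.
move=> Xs Ys Xp Yp XY z.
pose q (f g : P * Q -> H) := \sum_a inner H (f a) (g a).
have qP : psd_form q.
  split=> [a x y w|x y|x]; rewrite /q.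
  - by rewrite mulr_sumr -big_split; apply: eq_bigr => i _; rewrite ipDl ipZl.
  - by apply: eq_bigr => i _; rewrite ipC.
  - by apply: sumr_ge0 => i _; exact: ip_ge0.
pose X' (f : P * Q -> H) : P * Q -> H := fun a => \sum_k X a.1 k (f (k, a.2)).
pose Y' (f : P * Q -> H) : P * Q -> H := fun a => \sum_k Y a.2 k (f (a.1, k)).
have sp (A B : finType) (F : A * B -> R) : \sum_a F a = \sum_i \sum_j F (i, j).
  by rewrite pair_bigA; apply: eq_bigr => -[].
have qX f g : q (X' f) g = \sum_c \sum_i \sum_k inner H (X i k (f (k, c))) (g (i, c)).
  rewrite /q sp exchange_big; apply: eq_bigr => c _; apply: eq_bigr => i _.
  by rewrite ip_suml.
have qY f g : q (Y' f) g = \sum_c \sum_i \sum_k inner H (Y i k (f (c, k))) (g (c, i)).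
  by rewrite /q sp; apply: eq_bigr => c _; apply: eq_bigr => i _; rewrite ip_suml.
have /choice[M MP] : forall a : P * P, exists M : R, 0 <= M /\ forall x, `|X a.1 a.2 x| <= M * `|x|.
  by move=> a; have [M M0 h] := bop_bounded (X a.1 a.2); exists M.
have -> : \sum_a \sum_b inner H (X a.1 b.1 (Y a.2 b.2 (z b))) (z a) = q (X' (Y' z)) z.
  rewrite qX [LHS]sp exchange_big; apply: eq_bigr => c _; apply: eq_bigr => i _.
  rewrite sp; apply: eq_bigr => k _ /=.
  by rewrite /Y' bop_sumr ip_suml.
(* The sum of the norm bounds of all entries is an upper bound for [X']. *)
apply: (@comm_pos _ _ _ _ (\sum_a M a) qP).
- move=> a f g; apply/funext => b; rewrite /X' !fctE scaler_sumr -big_split.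
  by apply: eq_bigr => k _; rewrite bopDr bopZr.
- move=> a f g; apply/funext => b; rewrite /Y' !fctE scaler_sumr -big_split.
  by apply: eq_bigr => k _; rewrite bopDr bopZr.
- move=> f g; rewrite qX (psdC qP) qX; apply: eq_bigr => c _.
  rewrite exchange_big; apply: eq_bigr => i _; apply: eq_bigr => k _.
  by rewrite adjointP Xs ipC.
- move=> f g; rewrite qY (psdC qP) qY; apply: eq_bigr => c _.
  rewrite exchange_big; apply: eq_bigr => i _; apply: eq_bigr => k _.
  by rewrite adjointP Ys ipC.
- move=> f; rewrite qX sumr_ge0/=; last by move=> c _; exact: Xp.
  have -> : q f f = \sum_c \sum_i inner H (f (i, c)) (f (i, c)) by rewrite /q sp exchange_big.
  rewrite mulr_sumr; apply: ler_sum => c _; rewrite [X in _ <= X * _]sp mulr_suml.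
  apply: ler_sum => i _; rewrite mulr_suml; apply: ler_sum => k _.
  have [M0 hM] := MP (i, k).
  have n_le (j : P) : `|f (j, c)| ^+ 2 <= \sum_i inner H (f (i, c)) (f (i, c)).
    by rewrite inner_norm (bigD1 j)//= lerDl; apply: sumr_ge0 => *; exact: ip_ge0.
  apply: (le_trans (ler_norm _)); apply: (le_trans (ip_norm_le _ _)).
  apply: (@le_trans _ _ (M (i, k) * `|f (k, c)| * `|f (i, c)|)).
    by rewrite ler_wpM2r//; exact: hM.
  rewrite -mulrA ler_wpM2l//.
  have := n_le i; have := n_le k; have := sqr_ge0 (`|f (k, c)| - `|f (i, c)|); rewrite sqrrB; lra.
- by move=> f; rewrite qY sumr_ge0// => c _; exact: Yp.
move=> f; apply/funext => a; rewrite /X' /Y'.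
under eq_bigr do rewrite bop_sumr.
under [RHS]eq_bigr do rewrite bop_sumr.
rewrite [RHS]exchange_big; apply: eq_bigr => k _; apply: eq_bigr => l _.
by have := XY a.1 k a.2 l => /(congr1 (fun T : BH H => T (f (k, l)))).
Qed.

End CommutingPositive.

(** * The product of two maps with commuting ranges *)

Section ProductMap.
Variables (R : realType) (V W : mosys R) (H : realHilbert R).
Variables (Phi : V -> BHsys H) (Psi : W -> BHsys H).
Hypotheses (HV : osys_ax V) (HW : osys_ax W) (cPhi : cp Phi) (cPsi : cp Psi).
Hypothesis PhiPsi : forall v w, bopM (Phi v) (Psi w) = bopM (Psi w) (Phi v).

Definition prodmap : tensor V W -> BH H := tlift (fun v w => bopM (Phi v) (Psi w) : BH H).

Lemma prodmap_bilin : bilin (fun v w => bopM (Phi v) (Psi w) : BH H).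
Proof.
have lP := cPhi.1; have lQ := cPsi.1.
split=> [w a v v'|v a w w']; first by rewrite lP bopMDl bopMZl.
by rewrite lQ bopMDr bopMZr.
Qed.

Lemma prodmap_linear : linear prodmap.
Proof. exact: tlift_linear prodmap_bilin. Qed.
Lemma prodmapE v w : prodmap (tens v w) = bopM (Phi v) (Psi w).
Proof. exact: tlift_tens prodmap_bilin. Qed.

Lemma prodmap_star z : prodmap (tens_star z) = adjoint (prodmap z).
Proof.
have lp := prodmap_linear; have sl := tens_star_linear HV HW.
apply: (@tens_ext _ _ _ _ (fun z => prodmap (tens_star z)) (fun z => adjoint (prodmap z))).
- by move=> a x y; rewrite sl lp.
- by move=> a x y; rewrite lp adjointD adjointZ.
- move=> v w; rewrite tens_starE// !prodmapE adjointM PhiPsi.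
  by rewrite (cp_star v HV (BH_ax H) cPhi) (cp_star w HW (BH_ax H) cPsi).
Qed.

Lemma prodmap_pD (N : finType) (x : N -> N -> tensor V W) (xi : N -> H) : pD x ->
  0 <= \sum_i \sum_j inner H (prodmap (x i j) (xi j)) (xi i).
Proof.
move=> [P [Q [A [B [al [hA hB h]]]]]].
have /BHpcone[As Ap] := cp_pcone cPhi hA; have /BHpcone[Bs Bp] := cp_pcone cPsi hB.
have := block_pos As Bs Ap Bp (fun _ _ _ _ => PhiPsi _ _) (fun a => \sum_i al a i *: xi i).
congr (_ <= _).
under eq_bigr do under eq_bigr do rewrite !bop_sumr ip_suml.
under [RHS]eq_bigr do under eq_bigr do
  rewrite h (pcg_linear _ _ _ _ prodmap_linear) /pcg bop_sumE ip_suml.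
under [RHS]eq_bigr do rewrite exchange_big.
rewrite [RHS]exchange_big; apply: eq_bigr => a _.
under [RHS]eq_bigr do under eq_bigr do rewrite bop_sumE ip_suml.
under [RHS]eq_bigr do rewrite exchange_big.
rewrite [RHS]exchange_big; apply: eq_bigr => b _.
under [RHS]eq_bigr do under eq_bigr do rewrite prodmapE bopZE ipZl.
rewrite [RHS]exchange_big; apply: eq_bigr => j _.
rewrite ip_sumr; apply: eq_bigr => i _.
by rewrite !bopZr ipZl ipZr /=; ring.
Qed.

Lemma prodmap_max n (x : 'M[tensor V W]_n) : max_cone x -> @cone R (BHsys H) n (map_mx prodmap x).
Proof.
move=> /(max_coneP HV HW)[xs xp]; apply/cone_BH; split=> [i j|xi].
  by rewrite !mxE -prodmap_star xs.
apply/ler_addgt0Pl => e e0.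
pose T := prodmap (tens_unit V W); pose c := \sum_i inner H (T (xi i)) (xi i).
have c1 : 0 < `|c| + 1 by rewrite ltr_wpDl.
(* The perturbation of size [e / (|c| + 1)] changes the form by at most [e]. *)
have d0 : 0 < e / (`|c| + 1) by rewrite divr_gt0.
have := prodmap_pD xi (xp _ d0); set d := e / _.
have -> : \sum_i \sum_j inner H (prodmap (x i j + (i == j)%:R *: (d *: tens_unit V W)) (xi j)) (xi i)
    = \sum_i \sum_j inner H (prodmap (x i j) (xi j)) (xi i) + d * c.
  rewrite mulr_sumr -big_split; apply: eq_bigr => i _.
  have E j : inner H (prodmap (x i j + (i == j)%:R *: (d *: tens_unit V W)) (xi j)) (xi i) =
     inner H (prodmap (x i j) (xi j)) (xi i) + (j == i)%:R *: (d * inner H (T (xi j)) (xi i) : R^o).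
    rewrite (linear_add _ _ prodmap_linear) !(linear_scale _ _ prodmap_linear).
    by rewrite bopDE ipDl !bopZE !ipZl eq_sym.
  by rewrite (eq_bigr _ (fun j _ => E j)) big_split /= sum_delta.
under [X in _ -> _ <= _ + X]eq_bigr do under eq_bigr do rewrite mxE.
move=> h; apply: (le_trans h); rewrite addrC lerD2r.
rewrite /d -mulrA ger_pMr// ler_pdivrMl// mulr1.
by rewrite (le_trans (ler_norm _))// lerDl.
Qed.

End ProductMap.

(** * Limits along ultrafilters *)

Section Ultralimit.
Variables (R : realType) (T : Type) (F : set_system T).

Definition fbounded (u : T -> R) := exists M : R, F [set t | `|u t| <= M].

(** The limit along an ultrafilter refining [F]; it exists on bounded functions because segments are
    compact. *)
Lemma ultralimit : ProperFilter F -> exists L : (T -> R) -> R,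
  [/\ forall a u v, fbounded u -> fbounded v -> L (fun t => a * u t + v t) = a * L u + L v,
      forall u, fbounded u -> F [set t | 0 <= u t] -> 0 <= L u &
      forall c, L (fun=> c) = c].
Proof.
move=> FF; have [G [GU FG]] := ultraFilterLemma FF; have GP := @ultra_proper _ _ GU.
have cv u : fbounded u -> cvg (u @ G).
  move=> [M /FG GM].
  have [|l [_ cl]] := @segment_compact R (- M) M (u @ G) (fmap_proper_filter u GP).
    by apply: (@filterS _ G _ _ _ _ GM) => t /=; rewrite ler_norml in_itv.
  apply/cvg_ex; exists l => A Al.
  have [//|nA] := in_ultra_setVsetC (u @^-1` A) GU.
  by have [z [/=]] := cl (~` A) A nA Al.
exists (fun u => lim (u @ G)); split.
- move=> a u v /cv cu /cv cw; apply: cvg_lim => //; apply: cvgD => //.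
  exact: cvgMr.
- by move=> u /cv cu /FG u0; apply: limr_ge.
- by move=> c; apply: cvg_lim => //; exact: cvg_cst.
Qed.

End Ultralimit.

(** Limits along this filter turn statements about each finite set of vectors or operators into
    statements about all of them. *)
Lemma finite_sets_filter (X : eqType) :
  ProperFilter [set A : set (seq X) | exists s0 : seq X, forall s, {subset s0 <= s} -> A s].
Proof.
split; first by move=> [s0 /(_ s0)]; exact.
split=> [|A B [s hA] [t hB]|A B AB [s hA]].
- by exists [::].
- exists (s ++ t) => u su; split; [apply: hA|apply: hB] => x xs; apply: su; rewrite mem_cat xs ?orbT//.
- by exists s => t /hA; exact: AB.
Qed.

(** * Positive kernels with values in functionals on an operator system *)

Section PositiveKernels.
Variables (R : realType) (V : mosys R) (HV : osys_ax V).

Lemma pcone_block (P : finType) (v : V) (N : R) (a b : P -> R) :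
  pcone (fun i j : bool => if i == j then N *: ounit V else if i then v else ostar v) ->
  pcone (fun i j => (a i * a j * N + b i * b j * N) *: ounit V
    + (a i * b j) *: v + (b i * a j) *: ostar v).
Proof.
move=> /(pcone_congr HV (fun (k : bool) i => if k then a i else b i)); apply: eq_pcone => i j.
rewrite !big_bool /= !scalerA scalerDl -!addrA; congr (_ + _).
by rewrite [RHS]addrC -addrA.
Qed.

Lemma pcone_diag (P : finType) (c : P -> R) : (forall i, 0 <= c i) ->
  pcone (fun i j => (i == j)%:R *: (c i *: ounit V)).
Proof.
move=> c0; have := pcone_sum HV (index_enum P) (fun k => pconeZ HV (c0 k) (pcone_unit HV (fun i => (i == k)%:R))).
apply: eq_pcone => i j.
under eq_bigr do rewrite scalerA mulrCA -scalerA [i == _]eq_sym.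
by rewrite sum_delta [j == i]eq_sym scalerA mulrC -scalerA.
Qed.

(** The unit is a matrix order unit: add up one 2 x 2 bound from [ax_bound] for every entry of [x],
    then level the diagonal. *)
Lemma pcone_bound (P : finType) (x : P -> P -> V) : exists2 M : R, 0 <= M &
  pcone (fun i j => (i == j)%:R *: (M *: ounit V) + (x i j + ostar (x j i))).
Proof.
have /choice[N NP] : forall c : P * P, exists N : R, 0 <= N /\
    pcone (fun i j : bool => if i == j then N *: ounit V else if i then x c.1 c.2 else ostar (x c.1 c.2)).
  by move=> c; have [N N0 h] := ax_bound HV (x c.1 c.2); exists N.
have hs := pcone_sum HV (index_enum _) (fun c => pcone_block
  (fun i => (i == c.1)%:R) (fun i => (i == c.2)%:R) (NP c).2).
(* The multiple of the unit that the 2 x 2 blocks leave at the diagonal place [i]. *)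
pose d i := \sum_c ((i == c.1)%:R + (i == c.2)%:R) * N c.
have d0 i : d i <= \sum_c 2 * N c.
  apply: ler_sum => c _; apply: ler_wpM2r; first exact: (NP c).1.
  by case: (i == _); case: (i == _) => /=; lra.
exists (\sum_c 2 * N c); first by apply: sumr_ge0 => c _; rewrite mulr_ge0 ?(NP c).1.
have hd : pcone (fun i j => (i == j)%:R *: ((\sum_c 2 * N c - d i) *: ounit V)).
  by apply: pcone_diag => i; rewrite subr_ge0.
apply: eq_pcone (pconeD HV hs hd) => i j.
rewrite !big_split /= -[LHS]addrA [X in _ + X = _]addrC addrACA; congr (_ + (_ + _)).
- rewrite -scaler_suml !scalerA -scalerDl; congr (_ *: _).
  have -> : \sum_c ((i == c.1)%:R * (j == c.1)%:R * N c + (i == c.2)%:R * (j == c.2)%:R * N c) =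
      (i == j)%:R * d i.
    rewrite mulr_sumr; apply: eq_bigr => c _.
    case: (eqVneq i j) => [->|ij].
      by rewrite mul1r mulrDl; case: (j == _); case: (j == _); rewrite !(mul0r, mul1r).
    have h (e : P) : (i == e)%:R * (j == e)%:R = 0 :> R.
      by case: eqP => [<-|]; rewrite ?mul0r// eq_sym (negPf ij) mulr0.
    by rewrite !h !mul0r addr0.
  by rewrite mulrBr; lra.
- rewrite (bigD1 (i, j))//= !eqxx mulr1 scale1r big1 ?addr0// => -[a b] /=.
  by rewrite xpair_eqE negb_and [i == a]eq_sym [j == b]eq_sym => /orP[] /negPf ->; rewrite ?mul0r ?mulr0 scale0r.
- rewrite (bigD1 (j, i))//= !eqxx mulr1 scale1r big1 ?addr0// => -[a b] /=.
  by rewrite xpair_eqE negb_and [i == b]eq_sym [j == a]eq_sym => /orP[] /negPf ->; rewrite ?mul0r ?mulr0 scale0r.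
Qed.


Variables (X : Type) (G : V -> X -> X -> R).

(* G v x y stands for <g v k_y, k_x>. *)
Record pos_kernel : Prop := PosKernel {
  pk_lin : forall x y, rlin (fun v => G v x y);
  pk_pos : forall (P : finType) (A : P -> P -> V) (xi : P -> X), pcone A ->
    0 <= \sum_i \sum_j G (A i j) (xi i) (xi j);
  pk_star : forall v x y, G (ostar v) y x = G v x y }.

Hypothesis GP : pos_kernel.

Let Glin x y := pk_lin GP x y.

(** Positivity passes from points to combinations: a congruence moves the coefficients into [A],
    after padding all lists with zero terms to a common length. *)
Lemma pk_kform_pos (P : finType) (A : P -> P -> V) (s : P -> seq (R * X)) : pcone A ->
  0 <= \sum_i \sum_j kform (fun x y => G (A i j) x y) (s i) (s j).
Proof.
move=> hA; pose m := \max_i size (s i); pose Q := (P * 'I_m)%type.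
(* Padding needs a point; without one all the lists are empty. *)
have [x0|nX] := pselect (exists x0 : X, True); last first.
  suff s0 i : s i = [::] by rewrite sumr_ge0// => i _; rewrite sumr_ge0// => j _; rewrite s0 kform0l.
  by case: (s i) => // -[c x]; case: nX; exists x.
have {}x0 : X by have [x _] := cid x0.
pose c (a : P * 'I_m) := (nth (0, x0) (s a.1) a.2).1.
pose xi (a : P * 'I_m) := (nth (0, x0) (s a.1) a.2).2.
have hA' : pcone (fun a b : P * 'I_m => (c a * c b) *: A a.1 b.1).
  exact: (pcone_scale HV (fun a => a.1) c hA).
have := pk_pos GP xi hA'; congr (_ <= _).
have sum_nth (U : nmodType) (F : R * X -> U) i : F (0, x0) = 0 ->
    \sum_(p <- s i) F p = \sum_(k < m) F (nth (0, x0) (s i) k).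
  move=> F0; rewrite (big_nth (0, x0)) big_mkord (big_ord_widen m (fun k => F (nth (0, x0) (s i) k))); last first.
    by rewrite /m (bigD1 i)//= leq_max leqnn.
  rewrite big_mkcond; apply: eq_bigr => k _; case: ltnP => // h.
  by rewrite nth_default.
have sp (F : P * 'I_m -> R) : \sum_a F a = \sum_i \sum_j F (i, j).
  by rewrite pair_bigA; apply: eq_bigr => -[].
rewrite sp; apply: eq_bigr => i _; under eq_bigr do rewrite sp.
rewrite exchange_big; apply: eq_bigr => j _.
rewrite /kform sum_nth; last by rewrite big1// => p _; rewrite !mul0r.
apply: eq_bigr => k _; rewrite sum_nth ?mulr0 ?mul0r//.
by apply: eq_bigr => l _; rewrite (rlinZ (Glin _ _)).
Qed.

Lemma pk_bound v : exists2 M : R, 0 <= M & forall s t,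
  0 <= M * kform (fun x y => G (ounit V) x y) s s + 2 * kform (fun x y => G v x y) s t +
       M * kform (fun x y => G (ounit V) x y) t t.
Proof.
have [M M0 hM] := ax_bound HV v; exists M => // s t.
have := pk_kform_pos (fun b : bool => if b then s else t) hM; rewrite !big_bool /=.
have kZ u : kform (fun x y => G (M *: ounit V) x y) u u = M * kform (fun x y => G (ounit V) x y) u u.
  rewrite mulr_sumr; apply: eq_bigr => p _; rewrite mulr_sumr; apply: eq_bigr => r _.
  by rewrite (rlinZ (Glin _ _)) mulrCA.
have kS : kform (fun x y => G (ostar v) x y) t s = kform (fun x y => G v x y) s t.
  rewrite /kform exchange_big; apply: eq_bigr => p _; apply: eq_bigr => r _.
  by rewrite (pk_star GP) [r.1 * _]mulrC.
by rewrite !kZ kS; lra.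
Qed.

Lemma pk_unit_sym x y : G (ounit V) x y = G (ounit V) y x.
Proof. by rewrite -(pk_star GP) (ax_star1 HV). Qed.

Lemma pk_unit_psd s : 0 <= kform (fun x y => G (ounit V) x y) s s.
Proof.
have := pk_kform_pos (fun _ : unit => s) (ax_unit HV).
by rewrite !(big_pred1 tt)//; case.
Qed.

Definition unit_kernel : kernel R X :=
  @Kernel R X (fun x y => G (ounit V) x y) pk_unit_sym pk_unit_psd.

End PositiveKernels.

(** If every combination stayed farther away, the functional defined by [h] would be represented by
    a vector of squared norm at most that of [h] minus [e]; by totality this vector is [h]. *)
Lemma krep_dense (R : realType) (X : Type) (K : kernel R X) (H : realHilbert R) (k : X -> H) h (e : R) :
  kernel_rep K k -> 0 < e ->
  exists s, inner H (h - ksum k s) (h - ksum k s) <= e.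
Proof.
move=> kP e0; apply: contrapT => nex; have [kip kext kex] := kP.
have ks s : inner H (ksum k s) (ksum k s) = kform K s s.
  rewrite ksum_ipr kformEl; congr (kev _ s); apply/funext => x.
  by rewrite ipC ksum_ipr; congr (kev _ s); apply/funext => y; rewrite kip.
have [s|h' h'h] := kex (fun x => inner H h (k x)) (inner H h h - e).
  rewrite -ksum_ipr -ks.
  have : e < inner H (h - ksum k s) (h - ksum k s).
    by rewrite ltNge; apply/negP => le; apply: nex; exists s.
  by rewrite ipDl !ipDr !ipNl !ipNr (ipC (ksum k s) h); lra.
by have -> : h' = h by [exact: kext]; lra.
Qed.

Lemma dense_pos (R : realType) (H : realHilbert R) (P : finType) (T : P -> P -> BH H) (D : set H) :
  (forall h (e : R), 0 < e -> exists2 d, D d & inner H (h - d) (h - d) <= e) ->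
  (forall xi : P -> H, (forall i, D (xi i)) -> 0 <= \sum_i \sum_j inner H (T i j (xi j)) (xi i)) ->
  forall xi : P -> H, 0 <= \sum_i \sum_j inner H (T i j (xi j)) (xi i).
Proof.
move=> dense pos xi.
have /choice[M MP] : forall c : P * P, exists M : R, 0 <= M /\ forall x, `|T c.1 c.2 x| <= M * `|x|.
  by move=> c; have [M M0 h] := bop_bounded (T c.1 c.2); exists M.
pose C := \sum_i \sum_j M (i, j) * (`|xi i| + `|xi j| + 1).
have C0 : 0 <= C.
  by apply: sumr_ge0 => i _; apply: sumr_ge0 => j _; rewrite mulr_ge0 ?(MP _).1// !addr_ge0.
apply/ler_addgt0Pl => e e0.
(* Moving all vectors by at most [d], which is at most 1, changes the form by at most [d * C], hence
   by at most [e]. *)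
pose d := Num.min 1 (e / (C + 1)).
have C1 : 0 < C + 1 by rewrite ltr_wpDl.
have d0 : 0 < d by rewrite lt_min ltr01 divr_gt0.
have d1 : d <= 1 by rewrite ge_min lexx.
have dC : d * C <= e.
  have : d * (C + 1) <= e by rewrite -ler_pdivlMr// ge_min lexx orbT.
  by apply: le_trans; rewrite ler_pM2l// lerDl.
have /choice[eta etaP] : forall i, exists h, D h /\ `|xi i - h| <= d.
  move=> i; have [h Dh hd] := dense (xi i) (d ^+ 2) (exprn_gt0 _ d0).
  by exists h; rewrite norm_le_ip ?(ltW d0).
apply: (le_trans (pos eta (fun i => (etaP i).1))); rewrite -lerBlDr; apply: le_trans dC.
rewrite -sumrB /C mulr_sumr; apply: ler_sum => i _.
rewrite -sumrB mulr_sumr; apply: ler_sum => j _.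
have [M0 hM] := MP (i, j); set m := M (i, j) in M0 hM *.
pose u := xi j - eta j; pose v := xi i - eta i.
have [_ hu] := etaP j; have [_ hv] := etaP i; rewrite -/u in hu; rewrite -/v in hv.
have ej : eta j = xi j - u by rewrite /u opprB addrC subrK.
have ei : eta i = xi i - v by rewrite /v opprB addrC subrK.
clearbody u v.
have -> : inner H (T i j (eta j)) (eta i) - inner H (T i j (xi j)) (xi i) =
    inner H (T i j u) v - inner H (T i j u) (xi i) - inner H (T i j (xi j)) v.
  by rewrite ej ei bopDr bopNr !ipDl !ipDr !ipNl !ipNr; ring.
have b x y : `|inner H (T i j x) y| <= m * (`|x| * `|y|).
  by rewrite (le_trans (ip_norm_le _ _))// mulrA ler_wpM2r//; exact: hM.
have b1 := le_trans (ler_norm _) (b u v).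
have b2 : - inner H (T i j u) (xi i) <= m * (`|u| * `|xi i|).
  by apply: le_trans (b _ _); rewrite -normrN ler_norm.
have b3 : - inner H (T i j (xi j)) v <= m * (`|xi j| * `|v|).
  by apply: le_trans (b _ _); rewrite -normrN ler_norm.
apply: (le_trans (lerD (lerD b1 b2) b3)); rewrite -!mulrDr mulrCA ler_wpM2l//.
have u1 : `|u| * `|v| <= d * 1 by rewrite ler_pM// (le_trans hv).
have u2 : `|u| * `|xi i| <= d * `|xi i| by rewrite ler_wpM2r.
have u3 : `|xi j| * `|v| <= d * `|xi j| by rewrite mulrC ler_wpM2r.
lra.
Qed.

Lemma kernel_eq (R : realType) (X : Type) (k k' : kernel R X) : (forall x y, k x y = k' x y) -> k = k'.
Proof.
case: k k' => [k kC kP] [k' kC' kP'] /= E.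
have {}E : k = k' by apply/funext => x; apply/funext => y; exact: E.
by case: _ / E in kC' kP' *; congr Kernel; exact: Prop_irrelevance.
Qed.

(* Kolmogorov-Stinespring decomposition of a positive operator-system valued  *)
(* kernel.                                                                    *)
Lemma kolmogorov_cp (R : realType) (V : mosys R) (X : Type) (G : V -> X -> X -> R) (K : kernel R X)
  (M0 : R) (H : realHilbert R) (k : X -> H) : osys_ax V -> pos_kernel G -> kernel_rep K k -> 0 <= M0 ->
  (forall s, kform (fun x y => G (ounit V) x y) s s <= M0 * kform K s s) ->
  exists g : V -> BHsys H, cp g /\ forall v x y, inner H (bop (g v) (k y)) (k x) = G v x y.
Proof.
move=> HV GP kP M00 GK; have [kip kext kex] := kP.
have /choice[g gP] : forall v, exists T : BH H, forall x y, inner H (T (k x)) (k y) = G v y x.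
  move=> v; have [M M1 hM] := pk_bound HV GP v; apply: (krep_op kP (mulr_ge0 M1 M00)) => s t.
  have := hM t s; rewrite -!mulrA.
  have : kform (fun x y => G v y x) s t = kform (fun x y => G v x y) t s.
    by rewrite /kform exchange_big; apply: eq_bigr => p _; apply: eq_bigr => r _; rewrite [r.1 * _]mulrC.
  by have := ler_wpM2l M1 (GK s); have := ler_wpM2l M1 (GK t); lra.
exists g; split => //.
apply: (pcone_cp HV (BH_ax H)) => [a v w|P A hA].
  apply: (krep_bop_ext kP) => x y; rewrite bopDE ipDl bopZE ipZl !gP.
  by rewrite (pk_lin GP).
apply/BHpcone; split=> [i j|].
  apply: (krep_bop_ext kP) => x y.
  by rewrite ipC -adjointP !gP -(pcone_star HV i j hA) (pk_star GP).
apply: (@dense_pos _ _ _ _ (range (ksum k))).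
  by move=> h e e0; have [s hs] := krep_dense h kP e0; exists (ksum k s) => //; exists s.
move=> xi xiD; have /choice[s sP] : forall i, exists s, ksum k s = xi i.
  by move=> i; have [s _ <-] := xiD i; exists s.
have := pk_kform_pos HV GP s hA; congr (_ <= _).
apply: eq_bigr => i _; apply: eq_bigr => j _.
rewrite -(sP i) -(sP j).
rewrite ksum_ipr kformEl; congr (kev _ (s i)); apply/funext => x.
rewrite {1}/ksum bop_sumr ip_suml; apply: eq_bigr => p _.
by rewrite bopZr ipZl gP.
Qed.

Lemma kolmogorov_on (R : realType) (V : mosys R) (X : Type) (G : V -> X -> X -> R)
  (HV : osys_ax V) (GP : pos_kernel G) (H : realHilbert R) (k : X -> H) :
  kernel_rep (unit_kernel HV GP) k ->
  exists g : V -> BHsys H, ucp g /\ forall v x y, inner H (bop (g v) (k y)) (k x) = G v x y.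
Proof.
move=> kP; have [|g [cg gP]] := kolmogorov_cp HV GP kP ler01; first by move=> s; rewrite mul1r.
exists g; split=> //; split=> //; have [kip _ _] := kP.
by apply: (krep_bop_ext kP) => x y; rewrite gP /= kip /= (pk_unit_sym HV GP).
Qed.

Theorem kolmogorov (R : realType) (V : mosys R) (X : Type) (G : V -> X -> X -> R)
  (HV : osys_ax V) (GP : pos_kernel G) :
  exists (H : realHilbert R) (k : X -> H) (g : V -> BHsys H),
  [/\ ucp g, kernel_rep (unit_kernel HV GP) k &
      forall v x y, inner H (bop (g v) (k y)) (k x) = G v x y].
Proof.
have [H [k kP]] := kernel_hilbert (unit_kernel HV GP).
by have [g [gu gP]] := kolmogorov_on kP; exists H, k, g.
Qed.

(** * Finite sums and comparison of ultralimits *)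

Section UltralimitSum.
Variables (R : realType) (T : Type) (F : set_system T).
Hypothesis FF : ProperFilter F.

Lemma fboundedD a (u v : T -> R) : fbounded F u -> fbounded F v -> fbounded F (fun t => a * u t + v t).
Proof.
move=> [M hM] [N hN]; exists (`|a| * M + N); apply: filterS2 hM hN => t /= h1 h2.
by rewrite (le_trans (ler_normD _ _))// lerD// normrM ler_wpM2l.
Qed.

Lemma fbounded_cst (c : R) : fbounded F (fun=> c).
Proof. by exists `|c|; apply: filterS filterT => t /= _. Qed.

Variable L : (T -> R) -> R.
Hypothesis LD : forall a u v, fbounded F u -> fbounded F v -> L (fun t => a * u t + v t) = a * L u + L v.
Hypothesis Lpos : forall u, fbounded F u -> F [set t | 0 <= u t] -> 0 <= L u.
Hypothesis L1 : forall c, L (fun=> c) = c.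

Lemma fbounded_sum I (r : seq I) (u : I -> T -> R) : (forall i, fbounded F (u i)) ->
  fbounded F (fun t => \sum_(i <- r) u i t) /\
  L (fun t => \sum_(i <- r) u i t) = \sum_(i <- r) L (u i).
Proof.
move=> hu; elim: r => [|i r [IH1 IH2]].
  under eq_fun do rewrite big_nil; rewrite big_nil; split; [exact: fbounded_cst|exact: L1].
have -> : (fun t => \sum_(j <- i :: r) u j t) = (fun t => 1 * u i t + \sum_(j <- r) u j t).
  by apply/funext => t; rewrite big_cons mul1r.
by split; [exact: fboundedD|rewrite LD// IH2 big_cons mul1r].
Qed.

Lemma ulim_le (u : T -> R) c : fbounded F u -> F [set t | u t <= c] -> L u <= c.
Proof.
move=> hu uc; have := Lpos (fboundedD (-1) hu (fbounded_cst c)).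
rewrite LD ?L1//; last exact: fbounded_cst.
suff h : F [set t | 0 <= -1 * u t + c] by move=> /(_ h); lra.
by apply: filterS uc => t /=; lra.
Qed.

Lemma ulim_eq (u v : T -> R) : fbounded F u -> fbounded F v -> F [set t | u t = v t] -> L u = L v.
Proof.
move=> hu hv uv; have := ulim_le (fboundedD (-1) hu hv); have := Lpos (fboundedD (-1) hu hv).
rewrite LD// => h1 /(_ 0) h2.
have h3 : F [set t | 0 <= -1 * u t + v t] by apply: filterS uv => t /= ->; lra.
have h4 : F [set t | -1 * u t + v t <= 0] by apply: filterS uv => t /= ->; lra.
by have := h1 h3; have := h2 h4; lra.
Qed.

End UltralimitSum.

(** * Ucp maps as kernels, their limits and the Arveson extension theorem *)

Section UcpForms.
Variables (R : realType) (V : mosys R) (HV : osys_ax V) (H : realHilbert R).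

Lemma form_ucp (G : V -> H -> H -> R) : pos_kernel G ->
  (forall v y, rlin (fun x => G v x y)) -> (forall v x, rlin (G v x)) ->
  (forall x y, G (ounit V) x y = inner H x y) ->
  exists g : V -> BHsys H, ucp g /\ forall v x y, inner H (bop (g v) y) x = G v x y.
Proof.
move=> GP Gl Gr G1.
have /choice[g gP] : forall v, exists T : BH H, forall y x, inner H (T y) x = G v x y.
  move=> v; have [M M0 hM] := pk_bound HV GP v.
  apply: (@form_op _ _ _ M) => [a x y z|a x y z|x y]; [exact: Gr|exact: Gl|].
  rewrite -(@ler_pXn2r _ 2)// ?nnegrE ?mulr_ge0// real_normK ?num_real//.
  have -> : (M * `|x| * `|y|) ^+ 2 = (M * `|y| ^+ 2) * (M * `|x| ^+ 2) by ring.
  apply: discr_le => t.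
  have := hM [:: (1, y)] [:: (t, x)]; rewrite !kform11 !G1 !inner_norm; lra.
exists g; split=> //; split.
  apply: (pcone_cp HV (BH_ax H)) => [a v w|P A hA].
    by apply: bop_ip_ext => x y; rewrite bopDE ipDl bopZE ipZl !gP (pk_lin GP).
  apply/BHpcone; split=> [i j|xi].
    apply: bop_ip_ext => x y.
    by rewrite ipC -adjointP !gP -(pcone_star HV i j hA) (pk_star GP).
  have := pk_pos GP xi hA; congr (_ <= _).
  by apply: eq_bigr => i _; apply: eq_bigr => j _; rewrite gP.
by apply: bop_ip_ext => x y; rewrite gP G1 ipC.
Qed.

Lemma ucp_form (g : V -> BHsys H) : ucp g -> pos_kernel (fun v x y => inner H (bop (g v) y) x).
Proof.
move=> [cg g1]; split.
- by move=> x y a v w; rewrite cg.1 bopDE ipDl bopZE ipZl.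
- by move=> P A xi /(cp_pcone cg)/BHpcone[_].
- by move=> v x y; rewrite (cp_star v HV (BH_ax H) cg) ipC -adjointP.
Qed.

Lemma ucp_bound v : exists2 M : R, 0 <= M & forall g : V -> BHsys H, ucp g ->
  forall x y, `|inner H (bop (g v) y) x| <= M * (`|x| ^+ 2 + `|y| ^+ 2).
Proof.
have [M M0 hM] := ax_bound HV v; exists M => // g [cg g1] x y.
have /BHpcone[_ h] := cp_pcone cg hM.
have h' c : 0 <= M * `|x| ^+ 2 + 2 * c * inner H (bop (g v) y) x + M * (c ^+ 2 * `|y| ^+ 2).
  have := h (fun b => if b then x else c *: y); rewrite !big_bool /=.
  rewrite (linear_scale _ _ cg.1) g1 (cp_star v HV (BH_ax H) cg).
  rewrite -[bop (M *: ounit (BHsys H)) x]/(M *: x) -[bop (M *: ounit (BHsys H)) (c *: y)]/(M *: (c *: y)).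
  rewrite bopZr !ipZl (ipC (bop (adjoint _) x)) -adjointP bopZr !ipZr !ipZl -!inner_norm.
  by congr (_ <= _); ring.
have := h' 1; have := h' (-1); have := sqr_ge0 `|x|; have := sqr_ge0 `|y|.
rewrite ler_norml; set p := `|x| ^+ 2; set q := `|y| ^+ 2 => *.
have : 0 <= M * p by rewrite mulr_ge0.
have : 0 <= M * q by rewrite mulr_ge0.
by move=> *; apply/andP; split; lra.
Qed.

(** Pointwise weak limits: [ucp_bound] bounds every matrix coefficient uniformly in [t]. *)
Lemma ulim_ucp (T : Type) (F : set_system T) (gs : T -> V -> BHsys H) : ProperFilter F ->
  (forall t, ucp (gs t)) -> exists g : V -> BHsys H, [/\ ucp g,
    forall v x y v' x' y', F [set t | inner H (bop (gs t v) x) y = inner H (bop (gs t v') x') y'] ->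
      inner H (bop (g v) x) y = inner H (bop (g v') x') y' &
    forall v x y c, F [set t | inner H (bop (gs t v) x) y <= c] -> inner H (bop (g v) x) y <= c].
Proof.
move=> FF gsP; have [L [LD Lp L1]] := ultralimit R FF.
pose u v x y t := inner H (bop (gs t v) y) x.
have ub v x y : fbounded F (u v x y).
  have [M _ h] := ucp_bound v; exists (M * (`|x| ^+ 2 + `|y| ^+ 2)).
  by apply: filterS filterT => t _ /=; exact: h.
pose G v x y := L (u v x y).
have lin_of (w : T -> R) a (w1 w2 : T -> R) : fbounded F w1 -> fbounded F w2 ->
    (forall t, w t = a * w1 t + w2 t) -> L w = a * L w1 + L w2.
  by move=> h1 h2 h; rewrite -LD//; congr L; apply/funext.
have GP : pos_kernel G.
  split.
  - move=> x y a v w; apply: lin_of => // t.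
    by rewrite /u (gsP t).1.1 bopDE ipDl bopZE ipZl.
  - move=> P A xi hA; rewrite /G.
    have h1 i := fbounded_sum FF LD L1 (index_enum P) (fun j => ub (A i j) (xi i) (xi j)).
    under eq_bigr do rewrite -(h1 _).2.
    have h2 := fbounded_sum FF LD L1 (index_enum P) (fun i => (h1 i).1).
    rewrite -h2.2; apply: Lp; first exact: h2.1.
    by apply: filterS filterT => t _ /=; exact: (pk_pos (ucp_form (gsP t))).
  - by move=> v x y; congr L; apply/funext => t; exact: (pk_star (ucp_form (gsP t))).
have [|||g [gu gP]] := form_ucp GP.
- by move=> v y a x x'; apply: lin_of => // t; rewrite /u ipDr ipZr.
- by move=> v x a y y'; apply: lin_of => // t; rewrite /u bopDr bopZr ipDl ipZl.
- move=> x y; rewrite /G -[RHS]L1; congr L; apply/funext => t.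
  by rewrite /u (gsP t).2 ipC.
exists g; split=> //.
- by move=> v x y v' x' y' h; rewrite !gP; apply: (ulim_eq FF LD Lp L1).
- by move=> v x y c h; rewrite gP; apply: (ulim_le FF LD Lp L1).
Qed.

(** For each finite set of vectors the functional [phi] on matrices over [U] is extended by
    [cone_functional] to matrices over [V]; an ultralimit over finite sets assembles the map. The
    linear map [j] need only reflect positivity through [f], which allows tensor products of
    inclusions. *)
Lemma arveson (U : lmodType R) (j : U -> V) (us : U -> U) (u1 : U) (f : U -> BH H) :
  linear j -> (forall u, j (us u) = ostar (j u)) -> j u1 = ounit V ->
  linear f -> (forall u, f (us u) = adjoint (f u)) -> f u1 = bop1 H ->
  (forall (P : finType) (A : P -> P -> U) (xi : P -> H), pcone (fun a b => j (A a b)) ->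
     0 <= \sum_a \sum_b inner H (f (A a b) (xi b)) (xi a)) ->
  exists g : V -> BHsys H, ucp g /\ forall u, g (j u) = f u.
Proof.
move=> lj js j1 lf fs f1 fpos.
have starD := ax_starD HV; have starZ := ax_starZ HV.
have stage (s : seq H) : exists G : V -> H -> H -> R, pos_kernel G /\
    forall u a b, a \in s -> b \in s -> G (j u) a b = inner H (f u b) a.
  pose P := seq_sub s.
  (* Testing the sum with the adjoint lets functionals live on all matrices and forces them to
     vanish on skew ones. *)
  pose C (x : P -> P -> V) := pcone (fun a b => x a b + ostar (x b a)).
  pose phi (e : P -> P -> U) := \sum_a \sum_b inner H (f (e a b) (val b)) (val a).
  have [||||w|F [Fl Fj Fp _]] := @cone_functional R (P -> P -> V) (P -> P -> U)
      C (fun e a b => j (e a b)) phi 0.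
  - split.
    + apply: eq_pcone (pcone0 HV P) => a b; have z c d : (0 : P -> P -> V) c d = 0 by [].
      by rewrite !z (ax_star0 HV) addr0.
    + move=> x y hx hy; apply: eq_pcone (pconeD HV hx hy) => a b.
      by rewrite starD addrACA.
    + move=> c x c0 hx; apply: eq_pcone (pconeZ HV (ltW c0) hx) => a b.
      by rewrite !fctE starZ scalerDr.
  - by move=> c x y; apply/funext => a; apply/funext => b; rewrite !fctE lj.
  - move=> c x y; rewrite /phi mulr_sumr -big_split; apply: eq_bigr => a _.
    rewrite mulr_sumr -big_split; apply: eq_bigr => b _.
    by rewrite !fctE lf bopDE bopZE ipDl ipZl.
  - move=> e he.
    have := fpos P (fun a b => e a b + us (e b a)) val _.
    have h : pcone (fun a b => j (e a b + us (e b a))).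
      by apply: eq_pcone he => a b; rewrite (linear_add _ _ lj) js.
    move=> /(_ h); suff -> : \sum_a \sum_b inner H (f (e a b + us (e b a)) (val b)) (val a) = 2 * phi e by lra.
    have phiT : phi e = \sum_a \sum_b inner H (f (e b a) (val a)) (val b).
      by rewrite /phi exchange_big.
    rewrite mulr_natl mulr2n {2}phiT -big_split; apply: eq_bigr => a _.
    rewrite -big_split; apply: eq_bigr => b _.
    by rewrite (linear_add _ _ lf) bopDE ipDl fs (ipC (bop (adjoint _) _)) -adjointP.
  - have [M M0 hM] := pcone_bound HV (fun a b : P => - w a b).
    (* Half of the bound is enough because [C] adds the adjoint. *)
    exists (fun a b => (a == b)%:R *: ((M / 2) *: u1)).
    apply: eq_pcone hM => a b.
    rewrite !fctE !(linear_scale _ _ lj) j1 !starD !starZ (ax_star1 HV) (ax_starN HV) eq_sym.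
    rewrite addrACA; congr (_ + _); rewrite -scalerDr -scalerDl; congr (_ *: (_ *: _)).
    by field.
  pose E (v : V) (x y : H) : P -> P -> V := fun a b => ((val a == x)%:R * (val b == y)%:R) *: v.
  have FC (x : P -> P -> V) : pcone x -> 0 <= F x.
    move=> hx; apply: Fp; apply: eq_pcone (pconeD HV hx hx) => a b.
    by rewrite (pcone_star HV a b hx).
  exists (fun v x y => F (E v x y)); split.
  - split.
    + move=> x y c v w; rewrite -Fl; congr F.
      apply/funext => a; apply/funext => b; rewrite /E !fctE scalerDr scalerA.
      by rewrite scalerA [c * _]mulrC.
    + move=> Q A xi hA.
      have -> : \sum_p \sum_q F (E (A p q) (xi p) (xi q)) =
          F (fun a b => \sum_p \sum_q ((val a == xi p)%:R * (val b == xi q)%:R) *: A p q).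
        have -> : (fun a b => \sum_p \sum_q ((val a == xi p)%:R * (val b == xi q)%:R) *: A p q) =
            \sum_p \sum_q E (A p q) (xi p) (xi q).
          apply/funext => a; apply/funext => b; rewrite !fct_sumE; apply: eq_bigr => p _.
          by rewrite !fct_sumE.
        by rewrite (rlin_sum Fl); apply: eq_bigr => p _; rewrite (rlin_sum Fl).
      by apply: FC; exact: (pcone_congr HV (fun p (a : P) => (val a == xi p)%:R) hA).
    + move=> v x y; apply/eqP; rewrite -subr_eq0; apply/eqP.
      have h (z : P -> P -> V) : (forall a b, z a b + ostar (z b a) = 0) -> F z = 0.
        move=> hz; have C1 : C z by apply: eq_pcone (pcone0 HV P) => a b; rewrite hz.
        have C2 : C (- z).
          apply: eq_pcone (pcone0 HV P) => a b; rewrite !fctE (ax_starN HV) -opprD hz oppr0//.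
        have := Fp _ C1; have := Fp _ C2; rewrite (rlinN Fl); lra.
      rewrite -(rlinN Fl) -(rlinD Fl); apply: h => a b.
      rewrite /E !fctE !starD !(ax_starN HV) !starZ (ax_starK HV).
      rewrite [(val b == y)%:R * _]mulrC [(val b == x)%:R * _]mulrC.
      by rewrite addrA subrK subrr.
  - move=> u x y xs ys.
    have -> : E (j u) x y = (fun a b => j (((val a == x)%:R * (val b == y)%:R) *: u)).
      by apply/funext => a; apply/funext => b; rewrite (linear_scale _ _ lj).
    rewrite Fj /phi (bigD1 (SeqSub xs))//= [X in _ + X]big1 ?addr0; last first.
      move=> a ax; apply: big1 => b _; rewrite (_ : (ssval a == x) = false); last first.
        by apply: contraNF ax => /eqP h; apply/eqP/val_inj.
      by rewrite mul0r scale0r (linear_zero lf) bop0E ip0l.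
    rewrite (bigD1 (SeqSub ys))//= [X in _ + X]big1 ?addr0; last first.
      move=> b bx; rewrite (_ : (ssval b == y) = false); last first.
        by apply: contraNF bx => /eqP h; apply/eqP/val_inj.
      by rewrite mulr0 scale0r (linear_zero lf) bop0E ip0l.
    by rewrite !eqxx mulr1 scale1r.
have /choice[Gs GsP] := stage.
have FF := finite_sets_filter H; set F := [set A | _] in FF.
have [L [LD Lp L1]] := ultralimit R FF.
have F2 (a b : H) : F [set s : seq H | a \in s /\ b \in s].
  by exists [:: a; b] => s hs; split; apply: hs; rewrite !inE eqxx ?orbT.
pose u v x y s := Gs s v x y.
have ub v x y : fbounded F (u v x y).
  have [M M0 hM] := ax_bound HV v; exists (M * (`|x| ^+ 2 + `|y| ^+ 2)).
  apply: filterS (F2 x y) => s [xs ys] /=.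
  have [GP Gj] := GsP s.
  have G1 z : z \in s -> Gs s (ounit V) z z = `|z| ^+ 2 by move=> zs; rewrite -j1 Gj// f1 inner_norm.
  have h c : 0 <= M * `|x| ^+ 2 + 2 * c * Gs s v x y + M * (c ^+ 2 * `|y| ^+ 2).
    have := pk_kform_pos HV GP (fun b : bool => if b then [:: (1, x)] else [:: (c, y)]) hM.
    rewrite !big_bool /= !kform11 (pk_star GP) !(rlinZ (pk_lin GP _ _)) !G1//.
    by congr (_ <= _); ring.
  have := h 1; have := h (-1); have := sqr_ge0 `|x|; have := sqr_ge0 `|y|.
  rewrite /u ler_norml; set p := `|x| ^+ 2; set q := `|y| ^+ 2 => *.
  have : 0 <= M * p by rewrite mulr_ge0.
  have : 0 <= M * q by rewrite mulr_ge0.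
  by move=> *; apply/andP; split; lra.
pose G v x y := L (u v x y).
have GP : pos_kernel G.
  split.
  - move=> x y a v w; rewrite /G -LD//; congr L; apply/funext => s.
    by have [GP _] := GsP s; exact: (pk_lin GP).
  - move=> P A xi hA; rewrite /G.
    have h1 i := fbounded_sum FF LD L1 (index_enum P) (fun j => ub (A i j) (xi i) (xi j)).
    under eq_bigr do rewrite -(h1 _).2.
    have h2 := fbounded_sum FF LD L1 (index_enum P) (fun i => (h1 i).1).
    rewrite -h2.2; apply: Lp; first exact: h2.1.
    by apply: filterS filterT => s _ /=; have [GP _] := GsP s; exact: (pk_pos GP).
  - move=> v x y; congr L; apply/funext => s.
    by have [GP _] := GsP s; exact: (pk_star GP).
have Gj w x y : G (j w) x y = inner H (f w y) x.
  rewrite /G -[RHS]L1; apply: (ulim_eq FF LD Lp L1) => //; first exact: fbounded_cst.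
  by apply: filterS (F2 x y) => s [xs ys] /=; have [_ h] := GsP s; exact: h.
(* The stages see finitely many vectors and are not bilinear in them. Bilinearity of the limit comes
   from its Kolmogorov decomposition: [k] preserves inner products, hence is linear. *)
have [H' [k [g' [[cg' g'1] kP gP']]]] := kolmogorov HV GP.
have [kip kext _] := kP.
have kE x y : inner H' (k x) (k y) = inner H x y.
  by rewrite kip /= -j1 Gj f1 ipC.
have lk : linear k.
  by move=> a x y; apply: kext => z; rewrite ipDl ipZl !kE ipDl ipZl.
have [|||g [gu gP]] := form_ucp GP.
- by move=> v y a x x'; rewrite -!gP' lk ipDr ipZr.
- by move=> v x a y y'; rewrite -!gP' lk bopDr bopZr ipDl ipZl.
- by move=> x y; rewrite -kE kip.
exists g; split=> // w; apply: bop_ip_ext => x y.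
by rewrite gP Gj.
Qed.

End UcpForms.

(** * Ucp maps, embeddings and injectivity of B(H) *)

Section UcpBasics.
Variable R : realType.
Implicit Types V W Z : mosys R.

Lemma ucp_comp V W Z (f : V -> W) (g : W -> Z) : ucp f -> ucp g -> ucp (g \o f).
Proof.
move=> [[lf cf] f1] [[lg cg] g1]; split; last by rewrite /= f1 g1.
split=> [a x y|n x /cf/cg]; first by rewrite /= lf lg.
by apply: cone_eq; apply/matrixP => i j; rewrite !mxE.
Qed.

Lemma ucp_id V : ucp (@id V).
Proof.
split=> //; split=> // n x; apply: cone_eq.
by apply/matrixP => i j; rewrite mxE.
Qed.

Lemma uco_ucp V W (f : V -> W) : uco_embedding f -> ucp f.
Proof. by move=> [[lf _ _ cf] f1]; split=> //; split=> // n x /cf. Qed.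

Lemma co_pcone V W (f : V -> W) (P : finType) (X : P -> P -> V) : co_embedding f ->
  pcone X <-> pcone (fun i j => f (X i j)).
Proof.
move=> [_ _ _ fc]; rewrite /pcone fc.
suff -> : map_mx f (\matrix_(i < #|P|, j < #|P|) X (enum_val i) (enum_val j)) =
  \matrix_(i, j) f (X (enum_val i) (enum_val j)) by [].
by apply/matrixP => i j; rewrite !mxE.
Qed.

Lemma uco_comp V W Z (f : V -> W) (g : W -> Z) : uco_embedding f -> uco_embedding g -> uco_embedding (g \o f).
Proof.
move=> [[lf fi fs fc] f1] [[lg gi gs gc] g1]; split; last by rewrite /= f1 g1.
split=> [a x y|x y /gi/fi//|x|n x]; [by rewrite /= lf lg|by rewrite /= fs gs|].
by rewrite fc gc; suff -> : map_mx g (map_mx f x) = map_mx (g \o f) x by []; apply/matrixP => i j; rewrite !mxE.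
Qed.

Lemma BH_opsys (H : realHilbert R) : is_opsys (@idfun R) (BHsys H).
Proof.
exists H, id; split=> //; split=> // n x.
by suff -> : map_mx id x = x by []; apply/matrixP => i j; rewrite mxE.
Qed.

Lemma BH_cstar (H : realHilbert R) : is_unital_cstar (@idfun R) (BHsys H).
Proof.
exists H, id; split=> [|a b|a|T _].
- split=> // n x.
  by suff -> : map_mx id x = x by []; apply/matrixP => i j; rewrite mxE.
- by exists (bopM a b).
- by split; apply: bop_ext.
- by exists T.
Qed.

Lemma BH_injective (H : realHilbert R) : is_injective (@idfun R) (BHsys H).
Proof.
move=> E F j f /opsys_ax HE /opsys_ax HF [cj j1] [cf f1].
have [lj _ js _] := cj.
have [||g [gu gj]] := @arveson R F HF H E j (@ostar R E) (ounit E) f lj js j1 cf.1 _ f1.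
- by move=> u; exact: cp_star HE (BH_ax H) cf.
- by move=> P A xi /(co_pcone _ cj)/(cp_pcone cf)/BHpcone[_].
by exists g.
Qed.

End UcpBasics.

(** * Concrete operator systems inside B(H) *)

Section Subsystem.
Variables (R : realType) (H : realHilbert R).

Record bhsub := BHSub { bhset : set (BH H);
  bhset_lin : forall a S T, bhset S -> bhset T -> bhset (a *: S + T);
  bhset_star : forall S, bhset S -> bhset (adjoint S);
  bhset_unit : bhset (bop1 H) }.

Variable A : bhsub.
Definition bhsub_pred : {pred (BH H)} := fun T => `[< bhset A T >].

Lemma bhset0 : bhset A 0.
Proof.
have := bhset_lin (-1) (bhset_unit A) (bhset_unit A).
by rewrite scaleN1r addNr.
Qed.

Lemma bhsub_submod : submod_closed bhsub_pred.
Proof.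
split=> [|a S T /asboolP hS /asboolP hT]; apply/asboolP; first exact: bhset0.
exact: bhset_lin.
Qed.

HB.instance Definition _ := GRing.isSubmodClosed.Build R (BH H) bhsub_pred bhsub_submod.
Record bhsubT := MkBhsub { bhval :> BH H; bhvalP : bhval \in bhsub_pred }.
HB.instance Definition _ := [isSub for bhval].
HB.instance Definition _ := [Choice of bhsubT by <:].
HB.instance Definition _ := [SubChoice_isSubLmodule of bhsubT by <:].

Lemma bhsubP (T : bhsubT) : bhset A (bhval T).
Proof. exact/asboolP/bhvalP. Qed.

Lemma mkbhsub_subproof T : bhset A T -> T \in bhsub_pred. Proof. by move=> h; exact/asboolP. Qed.
Definition mkbhsub T (hT : bhset A T) : bhsubT := MkBhsub (mkbhsub_subproof hT).

Definition subsys : mosys R :=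
  @MOSys R bhsubT (fun T => mkbhsub (bhset_star (bhsubP T))) (mkbhsub (bhset_unit A))
    (fun n => [set x | @cone R (BHsys H) n (map_mx bhval x)]).

Lemma subsys_uco : uco_embedding (bhval : subsys -> BHsys H).
Proof. by split=> //; split=> // x y; exact: val_inj. Qed.

Lemma subsys_opsys : is_opsys (@idfun R) subsys.
Proof. by exists H, bhval; exact: subsys_uco. Qed.

Lemma subsys_cstar : (forall S T, bhset A S -> bhset A T -> bhset A (bopM S T)) ->
  (forall T, (forall e : R, 0 < e -> exists2 S, bhset A S & opnorm_le (T - S) e) -> bhset A T) ->
  cstar_embedding (bhval : subsys -> BHsys H).
Proof.
move=> AM Acl; split=> [|a b|a|T hT].
- by case: subsys_uco.
- by exists (mkbhsub (AM _ _ (bhsubP a) (bhsubP b))).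
- by split; apply: bop_ext.
- suff AT : bhset A T by exists (mkbhsub AT).
  by apply: Acl => e /hT[a ha]; exists (bhval a) => //; exact: bhsubP.
Qed.

End Subsystem.

(** * Multiplicative domains *)

Section MultiplicativeDomain.
Variables (R : realType) (A B : mosys R) (HA : osys_ax A) (HB : osys_ax B) (H : realHilbert R).
Variable Om : dten A B -> BHsys H.
Hypothesis uOm : ucp Om.
Let HD := dten_ax HA HB.

Definition block (b b2 : B) (i j : bool) : B :=
  if i then (if j then ounit B else b) else (if j then ostar b else b2).

Let Ot (x : A) (b : B) : BH H := Om (tens x b).

Let OtD x b b' : Ot x (b + b') = Ot x b + Ot x b'.
Proof. by rewrite /Ot tensDr (linear_add _ _ uOm.1.1). Qed.
Let OtZl a x b : Ot (a *: x) b = a *: Ot x b.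
Proof. by rewrite /Ot tensZl (linear_scale _ _ uOm.1.1). Qed.

Lemma Ot_star x b : Om (tens (ostar x) (ostar b)) = adjoint (Om (tens x b)).
Proof. by have := cp_star (tens x b : dten A B) HD (BH_ax H) uOm.1; rewrite /= tens_starE. Qed.

(** Tensor the positive matrix [M x; x^* M] with [1 b; b^* b2] and apply [Om]. On suitable vectors
    the quadratic term cancels because [b2] goes to [rho^* rho], so the linear term, which is the
    defect, must vanish. *)
Lemma multiplicative_domain b b2 (rho : BH H) : pcone (block b b2) ->
  Om (tens (ounit A) b) = rho -> Om (tens (ounit A) b2) = bopM (adjoint rho) rho ->
  forall x, Om (tens x (ostar b)) = bopM (adjoint rho) (Om (tens x (ounit B))).
Proof.
move=> hb hrho hb2 x.
have [M M0 hM] := ax_bound HA x.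
have h1 : pcone (fun a c : bool * bool => tens ((if a.1 == c.1 then M *: ounit A else if a.1 then x else ostar x)) (block b b2 a.2 c.2) : dten A B).
  by apply/dten_pcone; exact: pD_tens hM hb.
have /BHpcone[_ h2] := cp_pcone uOm.1 h1.
apply: bop_ip_ext => eta xi.
set c := inner H (Om (tens x (ostar b)) eta) xi - inner H (bopM (adjoint rho) (Om (tens x (ounit B))) eta) xi.
suff h : c ^+ 2 <= 0 by apply/eqP; rewrite -subr_eq0 -/c -sqrf_eq0 eq_le h sqr_ge0.
rewrite -[leRHS](mulr0 (M * inner H eta eta)); apply: discr_le => t; rewrite mul0r addr0.
(* The pair [(- rho (t *: xi), t *: xi)] is null for the image of [1 b; b^* b2], so the [t ^+ 2]
   term disappears. *)
have := h2 (fun a => match a with (true, true) => - rho (t *: xi) | (true, false) => t *: xi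
  | (false, true) => eta | (false, false) => 0 end).
have sp (F : bool * bool -> R) : \sum_a F a = F (true, true) + F (true, false) + (F (false, true) + F (false, false)).
  have -> : \sum_a F a = \sum_i \sum_j F (i, j) by rewrite pair_bigA; apply: eq_bigr => -[].
  by rewrite !big_bool.
rewrite !sp /=. rewrite !bop0r !ip0l !ip0r. rewrite ?addr0 ?add0r.
have O1 : Om (tens (ounit A) (ounit B)) = bop1 H by exact: uOm.2.
have Os : Om (tens (ounit A) (ostar b)) = adjoint rho.
  by rewrite -hrho -Ot_star (ax_star1 HA).
have Oxs : Om (tens (ostar x) (ounit B)) = adjoint (Om (tens x (ounit B))).
  by rewrite -Ot_star (ax_star1 HB).
have Oxb : Om (tens (ostar x) b) = adjoint (Om (tens x (ostar b))).
  by rewrite -Ot_star (ax_starK HB).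
have OZ y d : Om (tens (M *: y) d) = M *: Om (tens y d) by exact: OtZl.
rewrite !OZ O1 Os hrho hb2 Oxs Oxb.
have MZ (T : BHsys H) y : bop (M *: T) y = M *: bop T y by [].
rewrite !MZ !bopNr !bopZr /= !(ipZl, ipZr, ipNl, ipNr) !(ipC (bop (adjoint _) _)) -!adjointP.
have -> : c = inner H (Om (tens x (ostar b)) eta) xi - inner H (Om (tens x (ounit B)) eta) (rho xi).
  by rewrite /c /= (ipC (adjoint rho _)) -adjointP (ipC (rho xi)).
by congr (_ <= _); ring.
Qed.

End MultiplicativeDomain.

(** * Extension of a map together with its commutation relations *)

Section CommutingExtension.
Variables (R : realType) (S A B : mosys R) (H : realHilbert R).
Hypotheses (HS : osys_ax S) (HA : osys_ax A) (HB : osys_ax B).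
Variables (j : S -> A) (f : S -> BHsys H) (pi : B -> BHsys H).
Hypotheses (jP : uco_embedding j) (fP : ucp f) (piP : ucp pi).
Hypothesis fpi : forall s b, bopM (f s) (pi b) = bopM (pi b) (f s).
Hypothesis ext : forall n (x : 'M[tensor S B]_n),
  pD (fun i k : 'I_n => tens_map j id (x i k)) -> max_cone x.

(** [b2] stands in for the product of the adjoint of [b] with [b], so that membership in the
    multiplicative domain of [pi] is expressed without a product on [B]. *)
Definition isometric (b : B) := exists2 b2, pcone (block b b2) & pi b2 = bopM (adjoint (pi b)) (pi b).

(** The product of [f] and [pi] is positive on maximal cones; by [ext] it is positive for the order
    of A (x) B, and extends to [Om]. Multiplicative domains from both sides identify [Om (tens x b)]
    with either product of [g x = Om (tens x (ounit B))] and [pi b]. *)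
Lemma commuting_extension : exists g : A -> BHsys H, [/\ ucp g, forall s, g (j s) = f s &
  forall b, isometric b -> isometric (ostar b) -> forall x, bopM (g x) (pi b) = bopM (pi b) (g x)].
Proof.
have [cj j1] := jP; have [lj _ js _] := cj; have [cf f1] := fP; have [cp1 pi1] := piP.
have lid : linear (@id B) by [].
have lT := tens_map_linear lj lid.
have ltf := prodmap_linear cf cp1.
have [|||||||Om [uOm OmE]] := @arveson R (dten A B) (dten_ax HA HB) H (tensor S B) (tens_map j (@id B))
   (@tens_star R S B) (tens_unit S B) (prodmap f pi).
- exact: lT.
- have sl := tens_star_linear HS HB; have sl' := tens_star_linear HA HB.
  apply: (@tens_ext _ _ _ _ (fun z => tens_map j id (tens_star z)) (fun z => tens_star (tens_map j id z))).
  + by move=> a x y; rewrite sl lT.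
  + by move=> a x y; rewrite lT sl'.
  + by move=> s b; rewrite tens_starE// !tens_mapE// tens_starE// js.
- by rewrite /tens_unit tens_mapE// j1.
- exact: ltf.
- by move=> z; exact: (prodmap_star HS HB cf cp1 fpi).
- by rewrite /tens_unit (prodmapE cf cp1) f1 pi1; apply: bop_ext.
- move=> P X xi /dten_pcone/(pD_sub (fun i : 'I_#|P| => enum_val i)) hX.
  have : max_cone (\matrix_(i < #|P|, k < #|P|) X (enum_val i) (enum_val k)).
    by apply: ext; apply: eq_pD hX => i k; rewrite mxE.
  move=> /(prodmap_max HS HB cf cp1 fpi)/cone_BH[_ /(_ (fun i => xi (enum_val i)))]; congr (_ <= _).
  rewrite [RHS]big_enum_val; apply: eq_bigr => i _.
  by rewrite [RHS]big_enum_val; apply: eq_bigr => k _; rewrite !mxE.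
have Om1 b : Om (tens (ounit A) b) = pi b.
  by rewrite -j1 -[b in LHS]/(id b) -tens_mapE// OmE (prodmapE cf cp1) f1; apply: bop_ext.
exists (fun x => Om (tens x (ounit B))); split.
- split; last exact: uOm.2.
  apply: (pcone_cp HA (BH_ax H)) => [a x y|P X hX].
    by rewrite tensDl tensZl (linear_add _ _ uOm.1.1) (linear_scale _ _ uOm.1.1).
  apply: (cp_pcone uOm.1); apply/dten_pcone.
  exact: pD_sub (fun p => (p, tt)) (pD_tens hX (ax_unit HB)).
- by move=> s; rewrite -[ounit B]/(id (ounit B)) -tens_mapE// OmE (prodmapE cf cp1) pi1; apply: bop_ext.
move=> b [b2 hb pb2] [b3 hb' pb3] x.
have ps : pi (ostar b) = adjoint (pi b) by exact: cp_star HB (BH_ax H) cp1.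
have h1 y := multiplicative_domain HA HB uOm hb (Om1 b) (etrans (Om1 _) pb2) y.
have h2 y : Om (tens y b) = bopM (pi b) (Om (tens y (ounit B))).
  have := multiplicative_domain HA HB uOm hb' (Om1 _) (etrans (Om1 _) pb3) y.
  by rewrite (ax_starK HB) ps adjointK.
rewrite -h2 -[b in RHS](ax_starK HB) -[x in RHS](ax_starK HA) Ot_star// h1 adjointM adjointK.
by rewrite -Ot_star// (ax_starK HA) (ax_star1 HB).
Qed.

End CommutingExtension.

(** * Unital C*-algebras as operator systems *)

Section CstarSystems.
Variable R : realType.
Implicit Types A V W : mosys R.

(** The product pulled back from a C*-embedding. [cm_cone] is positivity of compressions, the source
    of the positive kernels in the GNS construction. *)
Record cstar_mul A (mul : A -> A -> A) : Prop := CstarMul {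
  cm_linl : forall z, linear (mul^~ z);
  cm_linr : forall z, linear (mul z);
  cm_assoc : forall x y z, mul x (mul y z) = mul (mul x y) z;
  cm_1l : forall x, mul (ounit A) x = x;
  cm_1r : forall x, mul x (ounit A) = x;
  cm_star : forall x y, ostar (mul x y) = mul (ostar y) (ostar x);
  cm_cone : forall (P Q : finType) (Y : P -> P -> A) (p : Q -> P) (b : Q -> A), pcone Y ->
    pcone (fun q q' => mul (mul (ostar (b q)) (Y (p q) (p q'))) (b q')) }.

Section CstarEmbedding.
Variables (A : mosys R) (H : realHilbert R) (f : A -> BHsys H).
Hypothesis fP : cstar_embedding f.

Let cf : co_embedding f. Proof. by case: fP. Qed.
Let fl : linear f. Proof. by case: cf. Qed.
Let fi : injective f. Proof. by case: cf. Qed.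
Let fs x : f (ostar x) = adjoint (f x). Proof. by case: cf. Qed.
Let f1l a : bopM (f (ounit A)) (f a) = f a. Proof. by case: fP => _ _ /(_ a)[]. Qed.
Let f1r a : bopM (f a) (f (ounit A)) = f a. Proof. by case: fP => _ _ /(_ a)[]. Qed.

Let f1s : adjoint (f (ounit A)) = f (ounit A).
Proof.
have h := f1l (ostar (ounit A)); rewrite fs in h.
by have := congr1 (@adjoint _ _ H) h; rewrite adjointM adjointK h.
Qed.

Lemma cstar_ax : osys_ax A.
Proof.
apply: (embedding_ax cf).
  apply/BHpcone; split=> // xi; rewrite !(big_pred1 tt); try by case.
  by rewrite -[f (ounit A)]f1l /= -{1}f1s -adjointPr ip_ge0.
move=> v; have [M M0 hM] := ax_bound (BH_ax H) (f v); exists M => //.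
have f1Z : adjoint (M *: f (ounit A)) = M *: f (ounit A) by rewrite adjointZ f1s.
apply/BHpcone; have /BHpcone[hs hp] := hM; split=> [[] []|xi] //=; first exact: adjointK.
(* [f (ounit A)] is a projection; testing on its range replaces the identity of B(H) by it. *)
have := hp (fun i => f (ounit A) (xi i)); congr (_ <= _).
apply: eq_bigr => i _; apply: eq_bigr => j _.
rewrite adjointPr f1s; congr (inner H _ _).
have E (T : BH H) : bopM (f (ounit A)) T = T -> bopM T (f (ounit A)) = T ->
    forall x, f (ounit A) (T (f (ounit A) x)) = T x.
  move=> h1 h2 x; have /= -> := congr1 (fun S : BH H => S (f (ounit A) x)) h1.
  exact: (congr1 (fun S : BH H => S x) h2).
case: eqP => _.
  have -> : bop (M *: ounit (BHsys H)) (f (ounit A) (xi j)) = M *: f (ounit A) (xi j) by [].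
  rewrite bopZr; congr (_ *: _).
  exact: (congr1 (fun S : BH H => S (xi j)) (f1l (ounit A))).
case: i => /=; apply: E; rewrite ?f1l ?f1r//.
  by rewrite -[adjoint (f v)]fs f1l.
by rewrite -[adjoint (f v)]fs f1r.
Qed.

Lemma cstar_mul_exists : exists mul, @cstar_mul A mul.
Proof.
have /choice[mul mulP] : forall x : A * A, exists c, f c = bopM (f x.1) (f x.2).
  by move=> x; case: fP => _ /(_ x.1 x.2).
have {}mulP x y : f (mul (x, y)) = bopM (f x) (f y) by rewrite mulP.
exists (fun x y => mul (x, y)); split.
- by move=> z a x y; apply: fi; rewrite mulP !fl bopMDl bopMZl !mulP.
- by move=> z a x y; apply: fi; rewrite mulP !fl bopMDr bopMZr !mulP.
- by move=> x y z; apply: fi; rewrite !mulP bopMA.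
- by move=> x; apply: fi; rewrite mulP f1l.
- by move=> x; apply: fi; rewrite mulP f1r.
- by move=> x y; apply: fi; rewrite fs !mulP !fs adjointM.
move=> P Q Y p b /(co_pcone _ cf)/BHpcone[Ys Yp].
apply/(co_pcone _ cf)/BHpcone; split=> [i j|xi].
  by rewrite !mulP !adjointM !fs adjointK Ys bopMA.
have hY : pcone (fun q q' : Q => f (Y (p q) (p q'))).
  have hY0 : pcone (fun i j => f (Y i j)) by apply/BHpcone.
  exact: (pcone_sub (BH_ax H) p hY0).
have /BHpcone[_ h] := hY; have := h (fun q => f (b q) (xi q)); congr (_ <= _).
apply: eq_bigr => i _; apply: eq_bigr => j _.
by rewrite !mulP fs /= -adjointPr.
Qed.

(** A nonunital embedding becomes unital on the Hilbert space of the form given by [g (ounit V)]. *)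
Lemma embedding_opsys V (g : V -> BHsys H) : osys_ax V -> co_embedding g -> is_opsys (@idfun R) V.
Proof.
move=> HV cg; have [lg gi gs gc] := cg.
pose G v x y := inner H (bop (g v) y) x.
have GP : pos_kernel G.
  split=> [x y a v w|P X xi hX|v x y]; rewrite /G.
  - by rewrite lg bopDE bopZE ipDl ipZl.
  - by have /(co_pcone _ cg)/BHpcone[_] := hX; apply.
  - by rewrite gs ipC -adjointP.
have [H' [k [h [[ch h1] kP hP]]]] := kolmogorov HV GP.
exists H', h; split=> //; split; first exact: ch.1.
- move=> v w hvw; apply: gi; apply: bop_ip_ext => x y.
  by have := hP v y x; have := hP w y x; rewrite hvw /G => -> ->.
- by move=> v; exact: cp_star HV (BH_ax H') ch.
move=> n x; split; first exact: ch.2.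
move=> /cone_BH[hs hp]; apply/gc/cone_BH; split=> [i j|xi].
  have := hs i j; rewrite !mxE => hij; apply: bop_ip_ext => y z.
  rewrite (ipC (bop (adjoint _) y)) -adjointP -[LHS]/(G (x j i) y z) -[RHS]/(G (x i j) z y).
  by rewrite -!hP -hij (ipC (bop (adjoint _) _)) -adjointP.
have := hp (fun i => k (xi i)); congr (_ <= _).
by apply: eq_bigr => i _; apply: eq_bigr => j _; rewrite !mxE hP.
Qed.

Lemma cstar_opsys : is_opsys (@idfun R) A.
Proof. exact: embedding_opsys cstar_ax cf. Qed.

End CstarEmbedding.
End CstarSystems.

(** * Schur products of positive matrices *)

Section Schur.
Variable R : realType.

(** This is [block_pos] for scalar operators on a one-dimensional space, tested on the diagonal of
    [I * I]. *)
Lemma schur_product (I : finType) (P Q : I -> I -> R) :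
  (forall i j, P i j = P j i) -> (forall i j, Q i j = Q j i) ->
  (forall c : I -> R, 0 <= \sum_i \sum_j c i * c j * P i j) ->
  (forall c : I -> R, 0 <= \sum_i \sum_j c i * c j * Q i j) ->
  0 <= \sum_i \sum_j P i j * Q i j.
Proof.
move=> Ps Qs Pp Qp.
have k1p (s : seq (R * unit)) : 0 <= kform (fun _ _ => 1) s s.
  rewrite (_ : kform _ s s = (\sum_(p <- s) p.1) ^+ 2) ?sqr_ge0//.
  rewrite expr2 mulr_suml; apply: eq_bigr => p _.
  by rewrite mulr_sumr; apply: eq_bigr => r _; rewrite mulr1.
(* The constant kernel on one point yields a one-dimensional Hilbert space. *)
have [H [k [kip kext _]]] := kernel_hilbert (@Kernel R unit (fun _ _ => 1) (fun _ _ => erefl) k1p).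
pose e := k tt; have ee : inner H e e = 1 by rewrite kip.
have eE (x : H) : x = inner H x e *: e.
  by apply: kext => -[]; rewrite ipZl ee mulr1.
have pos (T : I -> I -> R) : (forall c : I -> R, 0 <= \sum_i \sum_j c i * c j * T i j) ->
    forall xi : I -> H, 0 <= \sum_i \sum_j inner H ((T i j *: bop1 H) (xi j)) (xi i).
  move=> Tp xi; have := Tp (fun i => inner H (xi i) e); congr (_ <= _).
  apply: eq_bigr => i _; apply: eq_bigr => j _.
  have h : inner H (xi j) (xi i) = inner H (xi j) e * inner H (xi i) e.
    by rewrite {1}(eE (xi j)) ipZl [inner H e _]ipC.
  by rewrite bopZE ipZl /= h; ring.
have adj (T : I -> I -> R) : (forall i j, T i j = T j i) ->
    forall i j, adjoint (T j i *: bop1 H) = T i j *: bop1 H.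
  by move=> Ts i j; rewrite adjointZ adjoint1 Ts.
have cm i j k' l : bopM (P i j *: bop1 H) (Q k' l *: bop1 H) = bopM (Q k' l *: bop1 H) (P i j *: bop1 H).
  by rewrite !bopMZl !bopMZr !scalerA mulrC.
have := block_pos (adj P Ps) (adj Q Qs) (pos P Pp) (pos Q Qp) cm (fun a => (a.1 == a.2)%:R *: e).
congr (_ <= _).
have E (F : I * I -> R) : \sum_a (a.1 == a.2)%:R * F a = \sum_i F (i, i).
  rewrite sum_prod; apply: eq_bigr => i _ /=.
  rewrite (bigD1 i)//= eqxx mul1r big1 ?addr0// => j /negPf ji.
  by rewrite eq_sym ji mul0r.
have -> : \sum_(a : I * I) \sum_(b : I * I) inner H ((P a.1 b.1 *: bop1 H) ((Q a.2 b.2 *: bop1 H) ((b.1 == b.2)%:R *: e))) ((a.1 == a.2)%:R *: e)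
    = \sum_(a : I * I) (a.1 == a.2)%:R * (\sum_(b : I * I) (b.1 == b.2)%:R * (P a.1 b.1 * Q a.2 b.2)).
  apply: eq_bigr => a _; rewrite mulr_sumr; apply: eq_bigr => b _.
  by rewrite !bopZE /= !ipZl ipZr ee; ring.
by rewrite E; apply: eq_bigr => i _; rewrite E.
Qed.

End Schur.

(** * Selfadjointness in the commuting tensor product *)

Section TensorStar.
Variables (R : realType) (V W : mosys R).

Lemma tens_star_K (HV : osys_ax V) (HW : osys_ax W) : involutive (@tens_star R V W).
Proof. exact: ax_starK (dten_ax HV HW). Qed.

Lemma prod_kernel (H1 H2 : realHilbert R) (f1 : V -> BHsys H1) : osys_ax V -> ucp f1 ->
  pos_kernel (fun v (x y : H1 * H2) => inner H1 (bop (f1 v) y.1) x.1 * inner H2 y.2 x.2).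
Proof.
move=> HV [c1 u1]; split=> [x y a v w|P X xi hX|v x y].
- by rewrite c1.1 bopDE bopZE ipDl ipZl mulrDl mulrA.
- have /BHpcone[hs hp] := cp_pcone c1 hX.
  apply: (schur_product (P := fun i j => inner H1 (bop (f1 (X i j)) (xi j).1) (xi i).1)).
  + by move=> i j; rewrite -hs ipC -adjointP.
  + by move=> i j; rewrite ipC.
  + move=> c; have := hp (fun i => c i *: (xi i).1); congr (_ <= _).
    apply: eq_bigr => i _; apply: eq_bigr => j _.
    by rewrite bopZr ipZl ipZr mulrCA mulrA.
  + move=> c; have := ip_ge0 (\sum_i c i *: (xi i).2); congr (_ <= _).
    rewrite ip_suml; apply: eq_bigr => i _; rewrite ip_sumr; apply: eq_bigr => j _.
    by rewrite ipZl ipZr mulrA ipC.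
- by rewrite (cp_star v HV (BH_ax H1) c1) ipC -adjointP (ipC x.2).
Qed.

(** One commuting pair separates the tensor product: [f1] and [f2] acting on the two legs of the
    Hilbert tensor product, built as the space of a product kernel on [H1 * H2]. Selfadjointness is
    pulled back by [tensor_separate]. *)
Lemma c_cone_star n (x : 'M[tensor V W]_n) : is_opsys (@idfun R) V -> is_opsys (@idfun R) W ->
  c_cone x -> forall i j, tens_star (x j i) = x i j.
Proof.
move=> oV oW cx i j; have HV := opsys_ax oV; have HW := opsys_ax oW.
have [H1 [f1 uf1]] := oV; have [H2 [f2 uf2]] := oW.
have [[_ i1 _ _] _] := uf1; have [[_ i2 _ _] _] := uf2.
move: uf1 uf2 => /uco_ucp uf1 /uco_ucp uf2.
have [c1 u1] := uf1; have [c2 u2] := uf2.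
have GP := @prod_kernel H1 H2 f1 HV uf1.
pose K (w : W) (x y : H1 * H2) := inner H1 y.1 x.1 * inner H2 (bop (f2 w) y.2) x.2.
have KP : pos_kernel K.
  split=> [z y a v w|P X xi hX|v z y]; rewrite /K.
  - by rewrite c2.1 bopDE bopZE ipDl ipZl mulrDr mulrCA.
  - have /BHpcone[hs hp] := cp_pcone c2 hX.
    apply: (schur_product (Q := fun i j => inner H2 (bop (f2 (X i j)) (xi j).2) (xi i).2)).
    + by move=> k l; rewrite ipC.
    + by move=> k l; rewrite -hs ipC -adjointP.
    + move=> c; have := ip_ge0 (\sum_i c i *: (xi i).1); congr (_ <= _).
      rewrite ip_suml; apply: eq_bigr => k _; rewrite ip_sumr; apply: eq_bigr => l _.
      by rewrite ipZl ipZr mulrA ipC.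
    + move=> c; have := hp (fun i => c i *: (xi i).2); congr (_ <= _).
      apply: eq_bigr => k _; apply: eq_bigr => l _.
      by rewrite bopZr ipZl ipZr mulrCA mulrA.
  - by rewrite (cp_star v HW (BH_ax H2) c2) (ipC z.1) [inner H2 _ _]ipC -adjointP.
have [H [k [g [ug kP gE]]]] := kolmogorov HV GP.
(* Both kernels agree at the unit, so the two maps act on the same space. *)
have kP' : kernel_rep (unit_kernel HW KP) k.
  by rewrite (kernel_eq (k := unit_kernel HW KP) (k' := unit_kernel HV GP))// => y z; rewrite /= /K u1 u2.
have [h [uh hE]] := kolmogorov_on kP'.
have kip y z : inner H (k y) (k z) = inner H1 y.1 z.1 * inner H2 y.2 z.2.
  by have [-> _ _] := kP; rewrite /= u1 (ipC z.1) (ipC z.2).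
have gk v (y : H1 * H2) : g v (k y) = k (bop (f1 v) y.1, y.2).
  by apply: (krep_ext kP) => z; rewrite gE kip.
have hk w (y : H1 * H2) : h w (k y) = k (y.1, bop (f2 w) y.2).
  by apply: (krep_ext kP) => z; rewrite hE kip.
have gh v w : bopM (g v) (h w) = bopM (h w) (g v).
  by apply: (krep_bop_ext kP) => y z; rewrite /= gk hk gk hk.
have /cone_BH[hs _] := cx _ g h ug.1 uh.1 gh.
set t := tens_star (x j i) - x i j.
suff t0 : t = 0 by apply/eqP; rewrite -subr_eq0 -/t t0.
have pt : prodmap g h t = 0.
  have pl := prodmap_linear ug.1 uh.1.
  rewrite (linear_add _ _ pl) (linear_opp _ pl) (prodmap_star HV HW ug.1 uh.1 gh).
  by have := hs i j; rewrite !mxE => ->; rewrite subrr.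
apply: (@tensor_separate R V W [set phi | exists a b, phi = fun v => inner H1 (bop (f1 v) a) b]
   [set psi | exists a b, psi = fun w => inner H2 (bop (f2 w) a) b]).
- by move=> _ [a [b ->]] c v w; rewrite c1.1 bopDE bopZE ipDl ipZl.
- by move=> _ [a [b ->]] c v w; rewrite c2.1 bopDE bopZE ipDl ipZl.
- move=> v hv; apply: i1; apply: bop_ip_ext => a b.
  by rewrite (linear_zero c1.1) bop0E ip0l; apply: (hv (fun v => inner H1 (bop (f1 v) a) b)); exists a, b.
- move=> v hv; apply: i2; apply: bop_ip_ext => a b.
  by rewrite (linear_zero c2.1) bop0E ip0l; apply: (hv (fun v => inner H2 (bop (f2 v) a) b)); exists a, b.
move=> _ _ [a [b ->]] [a' [b' ->]].
suff E : tlift (fun v w => inner H1 (bop (f1 v) a) b * inner H2 (bop (f2 w) a') b' : R^o) =1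
    (fun z => inner H (prodmap g h z (k (a, a'))) (k (b, b')) : R^o).
  by rewrite E pt bop0E ip0l.
have bl : bilin (fun v w => inner H1 (bop (f1 v) a) b * inner H2 (bop (f2 w) a') b' : R^o).
  split=> [w c v v'|v c w w'].
    by rewrite c1.1 bopDE bopZE ipDl ipZl mulrDl -mulrA.
  by rewrite c2.1 bopDE bopZE ipDl ipZl mulrDr mulrCA.
apply: tens_ext.
- exact: tlift_linear.
- by move=> c y z; rewrite (prodmap_linear ug.1 uh.1) bopDE bopZE ipDl ipZl.
- by move=> v w; rewrite tlift_tens// (prodmapE ug.1 uh.1) /= hk gk kip.
Qed.

End TensorStar.

(** * Commuting and maximal cones agree when a factor is a C*-algebra *)

Section CommutingIsMaximal.
Variable R : realType.
Implicit Types V W A : mosys R.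

(** If the perturbed [x] is not a generator, a functional [F] separates it. A GNS construction over
    [A] turns [F] into a commuting pair [g], [h] and vectors [k (ounit A, i)] at which the product
    map applied to [x] has the negative value of [F]. *)
Lemma c_cone_max_r V A n (x : 'M[tensor V A]_n) :
  is_opsys (@idfun R) V -> is_unital_cstar (@idfun R) A -> c_cone x -> max_cone x.
Proof.
move=> oV [HA0 [fA fAP]] cx.
have HV := opsys_ax oV; have HA := cstar_ax fAP.
have [mul mulP] := cstar_mul_exists fAP.
have xs := c_cone_star oV (cstar_opsys fAP) cx.
apply/(max_coneP HV HA); split=> // eps eps0; apply: contrapT => nD.
have HD := dten_ax HV HA.
have sl := tens_star_linear HV HA; have sK := tens_star_K HV HA.
have star1 : tens_star (tens_unit V A) = tens_unit V A := ax_star1 HD.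
pose N := 'I_n; pose W := N -> N -> tensor V A.
(* As in [arveson], the cone is defined through the sum with the adjoint, so that [F] vanishes on
   skew matrices. *)
pose C (y : W) := pD (fun i j => y i j + tens_star (y j i)).
pose u : W := fun i j => (i == j)%:R *: tens_unit V A.
pose z : W := fun i j => x i j.
have Cof (y : W) : pD y -> C y.
  move=> hy; apply: eq_pD (pD_add HV HA hy hy) => i j.
  by rewrite (pD_star HV HA i j hy).
have Ccone : convex_cone C.
  split=> [|y w hy hw|c y c0 hy].
  - by apply: Cof; exact: pD0.
  - by apply: eq_pD (pD_add HV HA hy hw) => i j; rewrite !fctE (linear_add _ _ sl) addrACA.
  - by apply: eq_pD (pDZ (ltW c0) hy) => i j; rewrite !fctE (linear_scale _ _ sl) scalerDr.
have [||||F [Fl Fp Fx]] := @cone_separation R W C u z eps Ccone.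
- by apply: Cof; exact: pD_id.
- move=> y; have [M M0 hM] := pcone_bound HD (fun i j : N => - y i j : dten V A).
  exists (M / 2); move/dten_pcone: hM; apply: eq_pD => i j.
  rewrite !fctE (linear_add _ _ sl) (linear_opp _ sl) /u !(linear_scale _ _ sl) star1 eq_sym.
  rewrite (ax_starN HD) [RHS]addrACA; congr (_ + _).
  by rewrite !scalerA -scalerDl; congr (_ *: _); field.
- exact: eps0.
- move=> hC; apply: nD; have h2 : (0 : R) <= 2^-1 by rewrite invr_ge0.
  apply: eq_pD (pDZ h2 hC) => i j.
  rewrite !fctE /u /z (linear_add _ _ sl) !(linear_scale _ _ sl) star1 xs eq_sym -mulr2n -[(_ + _) *+ 2]scaler_nat.
  by rewrite scalerK ?pnatr_eq0// !scalerA [_ * eps]mulrC.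
have Fskew (y : W) : (forall i j, tens_star (y j i) = - y i j) -> F y = 0.
  move=> hy; have C1 : C y by apply: eq_pD (pD0 HV HA N) => i j; rewrite hy subrr.
  have C2 : C (- y) by apply: eq_pD (pD0 HV HA N) => i j; rewrite !fctE (linear_opp _ sl) hy opprK addNr.
  by have := Fp _ C1; have := Fp _ C2; rewrite (rlinN Fl); lra.
pose E (t : tensor V A) (i j : N) : W := fun p q => ((p == i)%:R * (q == j)%:R) *: t.
have El i j : linear (fun t => E t i j : W).
  move=> a s t; apply/funext => p; apply/funext => q.
  by rewrite /E !fctE scalerDr !scalerA [_ * a]mulrC.
pose FE t i j := F (E t i j).
have FEl i j : rlin (fun t => FE t i j).
  by move=> a s t; rewrite /FE El Fl.
have FEs t i j : FE (tens_star t) j i = FE t i j.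
  apply/eqP; rewrite -subr_eq0 -(rlinN Fl) -(rlinD Fl); apply/eqP/Fskew => p q.
  rewrite /E !fctE (linear_add _ _ sl) (linear_opp _ sl) !(linear_scale _ _ sl) sK opprB.
  by rewrite [(q == i)%:R * _]mulrC [(q == j)%:R * _]mulrC.
pose X := (A * N)%type.
have FEpos (P : finType) (T : P -> P -> tensor V A) (i : P -> N) : pD T ->
    0 <= \sum_p \sum_q FE (T p q) (i p) (i q).
  move=> hT; have -> : \sum_p \sum_q FE (T p q) (i p) (i q) =
      F (fun a b => \sum_p \sum_q ((a == i p)%:R * (b == i q)%:R) *: T p q).
    have -> : (fun a b => \sum_p \sum_q ((a == i p)%:R * (b == i q)%:R) *: T p q) =
        \sum_p \sum_q E (T p q) (i p) (i q).
      apply/funext => a; apply/funext => b; rewrite !fct_sumE; apply: eq_bigr => p _.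
      by rewrite !fct_sumE.
    by rewrite (rlin_sum Fl); apply: eq_bigr => p _; rewrite (rlin_sum Fl).
  by apply: Fp; apply: Cof; exact: (pD_congr (fun p (a : N) => (a == i p)%:R) hT).
(* GNS kernels on [A * N]: [v] is inserted in the left leg here, and in [K] an element of [A] is
   inserted between the two vectors, so that [h] becomes left multiplication. *)
pose G v (y w : X) := FE (tens v (mul (ostar y.1) w.1)) y.2 w.2.
have GP : pos_kernel G.
  split=> [y w a v v'|P T xi hT|v y w]; rewrite /G.
  - by rewrite tensDl tensZl FEl.
  - apply: (FEpos _ (fun p q => tens (T p q) (mul (ostar (xi p).1) (xi q).1))).
    have hb := cm_cone mulP (fun _ => tt) (fun p => (xi p).1) (ax_unit HA).
    apply: eq_pD (pD_sub (fun p => (p, p)) (pD_tens hT hb)) => p q /=.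
    by rewrite (cm_1r mulP).
  - by rewrite -FEs tens_starE// (ax_starK HV) (cm_star mulP) (ax_starK HA).
pose K a (y w : X) := FE (tens (ounit V) (mul (mul (ostar y.1) a) w.1)) y.2 w.2.
have KP : pos_kernel K.
  split=> [y w c a b|P T xi hT|a y w]; rewrite /K.
  - by rewrite (cm_linr mulP) (cm_linl mulP) tensDr tensZr FEl.
  - apply: (FEpos _ (fun p q => tens (ounit V) (mul (mul (ostar (xi p).1) (T p q)) (xi q).1))).
    have hb := cm_cone mulP id (fun p => (xi p).1) hT.
    exact: pD_sub (fun p => (tt, p)) (pD_tens (ax_unit HV) hb).
  - rewrite -FEs tens_starE// (ax_star1 HV) !(cm_star mulP) !(ax_starK HA) (cm_assoc mulP) //.
have [H [k [g [ug kP gE]]]] := kolmogorov HV GP.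
have kP' : kernel_rep (unit_kernel HA KP) k.
  by rewrite (kernel_eq (k := unit_kernel HA KP) (k' := unit_kernel HV GP))// => y w;
     rewrite /= /K /G (cm_1r mulP).
have [h [uh hE]] := kolmogorov_on kP'.
have kip y w : inner H (k y) (k w) = G (ounit V) w y by have [-> _ _] := kP; rewrite /= pk_unit_sym.
have hk a b i : h a (k (b, i)) = k (mul a b, i).
  by apply: (krep_ext kP) => y; rewrite hE kip /K /G (cm_assoc mulP).
have hs a : adjoint (h a) = h (ostar a) by have := cp_star a HA (BH_ax H) uh.1.
have gh v a : bopM (g v) (h a) = bopM (h a) (g v).
  apply: (krep_bop_ext kP) => -[b i] [b' j] /=.
  rewrite hk gE adjointP hs hk gE /G /=.
  by rewrite (cm_star mulP) (ax_starK HA) (cm_assoc mulP).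
have /cone_BH[_ /(_ (fun i => k (ounit A, i)))] := cx _ g h ug.1 uh.1 gh.
have E1 t i j : inner H (prodmap g h t (k (ounit A, j))) (k (ounit A, i)) = FE t i j.
  apply: (@tens_ext _ _ _ R^o (fun t => inner H (prodmap g h t (k (ounit A, j))) (k (ounit A, i))) (fun t => FE t i j)).
  - by move=> c y w; rewrite (prodmap_linear ug.1 uh.1) bopDE bopZE ipDl ipZl.
  - exact: FEl.
  - move=> v a; rewrite (prodmapE ug.1 uh.1) /= hk gE /G /= (cm_1r mulP).
    by rewrite (ax_star1 HA) (cm_1l mulP).
have -> : \sum_i \sum_j inner H (bop (map_mx (tlift (fun v w => bopM (g v) (h w) : BH H)) x i j)
    (k (ounit A, j))) (k (ounit A, i)) = F z.
  have -> : z = \sum_i \sum_j E (x i j) i j.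
    apply/funext => p; apply/funext => q; transitivity (\sum_i \sum_j E (x i j) i j p q).
      rewrite (bigD1 p)//= (bigD1 q)//= /E !eqxx mulr1 scale1r.
      rewrite [X in _ + X + _]big1 => [|j /negPf jq]; last first.
        by rewrite eq_sym jq mulr0 scale0r.
      rewrite [X in _ + X]big1 ?addr0// => i /negPf ip; rewrite big1// => j _.
      by rewrite eq_sym ip mul0r scale0r.
    rewrite !fct_sumE; apply: eq_bigr => i _.
    by rewrite !fct_sumE.
  rewrite (rlin_sum Fl); apply: eq_bigr => i _; rewrite (rlin_sum Fl); apply: eq_bigr => j _.
  by rewrite mxE -[LHS]/(inner H (prodmap g h (x i j) (k (ounit A, j))) (k (ounit A, i))) E1.
by rewrite leNgt Fx.
Qed.

Definition tens_flip V W : tensor V W -> tensor W V := tlift (fun v w => tens w v).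

Lemma tens_flip_bilin V W : bilin (fun (v : V) (w : W) => tens w v).
Proof. by split=> x a y z; rewrite ?tensDl ?tensZl ?tensDr ?tensZr. Qed.
Lemma tens_flip_linear V W : linear (@tens_flip V W).
Proof. exact: tlift_linear (@tens_flip_bilin V W). Qed.
Lemma tens_flipE V W v w : tens_flip (tens v w : tensor V W) = tens w v.
Proof. exact: tlift_tens (@tens_flip_bilin V W). Qed.
Lemma tens_flipK V W (z : tensor V W) : tens_flip (tens_flip z) = z.
Proof.
have l1 := @tens_flip_linear V W; have l2 := @tens_flip_linear W V.
apply: (@tens_ext _ _ _ _ (fun z => tens_flip (tens_flip z)) id) => // [a x y|v w].
  by rewrite l1 l2.
by rewrite !tens_flipE.
Qed.

Lemma pD_flip V W (N : finType) (x : N -> N -> tensor V W) : pD x -> pD (fun i j => tens_flip (x i j)).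
Proof.
move=> [P [Q [A [B [al [hA hB h]]]]]]; exists Q, P, B, A, (fun a i => al (a.2, a.1) i).
split=> // i j; rewrite h (pcg_linear _ _ _ _ (@tens_flip_linear V W)) /pcg.
pose sw (a : Q * P) := (a.2, a.1); pose sw' (a : P * Q) := (a.2, a.1).
have E (F : P * Q -> tensor W V) : \sum_a F a = \sum_(a : Q * P) F (a.2, a.1).
  by rewrite (reindex sw)//; exists sw' => -[a b].
rewrite E; apply: eq_bigr => a _; rewrite E; apply: eq_bigr => b _.
by rewrite tens_flipE.
Qed.

Lemma max_flip V W n (x : 'M[tensor V W]_n) : osys_ax V -> osys_ax W ->
  max_cone x -> max_cone (map_mx (@tens_flip V W) x).
Proof.
move=> HV HW /(max_coneP HV HW)[xs xp]; have lf := @tens_flip_linear V W.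
apply/(max_coneP HW HV); split=> [i j|e /xp/pD_flip].
  rewrite !mxE -[x i j]xs; have sl := tens_star_linear HV HW; have sl' := tens_star_linear HW HV.
  apply: (@tens_ext _ _ _ _ (fun z => tens_star (tens_flip z)) (fun z => tens_flip (tens_star z))).
  - by move=> a y z; rewrite lf sl'.
  - by move=> a y z; rewrite sl lf.
  - by move=> v w; rewrite tens_starE// !tens_flipE tens_starE.
apply: eq_pD => i j.
by rewrite mxE (linear_add _ _ lf) !(linear_scale _ _ lf) /tens_unit tens_flipE.
Qed.

Lemma c_flip V W n (x : 'M[tensor V W]_n) : c_cone x -> c_cone (map_mx (@tens_flip V W) x).
Proof.
move=> cx H Phi Psi cP cQ PQ.
have := cx H Psi Phi cQ cP (fun v w => esym (PQ w v)); apply: cone_eq.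
apply/matrixP => i j; rewrite !mxE.
apply: (@tens_ext _ _ _ _ (prodmap Psi Phi) (fun z => prodmap Phi Psi (tens_flip z))).
- exact: prodmap_linear.
- by move=> a y z; rewrite tens_flip_linear (prodmap_linear cP cQ).
- by move=> v w; rewrite tens_flipE !prodmapE.
Qed.

Lemma c_cone_max_l A W n (x : 'M[tensor A W]_n) :
  is_unital_cstar (@idfun R) A -> is_opsys (@idfun R) W -> c_cone x -> max_cone x.
Proof.
move=> cA oW /c_flip/(c_cone_max_r oW cA) h.
have [H [f fP]] := cA; have HA := cstar_ax fP; have HW := opsys_ax oW.
have := max_flip HW HA h; apply: (@cone_eq R (max_tensor A W)).
by apply/matrixP => i j; rewrite !mxE tens_flipK.
Qed.

Lemma c_map V V' W W' (f : V -> V') (g : W -> W') n (x : 'M[tensor V W]_n) :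
  cp f -> cp g -> c_cone x -> c_cone (map_mx (tens_map f g) x).
Proof.
move=> cf cg cx H Phi Psi cP cQ PQ.
have comp_cp (U U' U'' : mosys R) (a : U -> U') (b : U' -> U'') : cp a -> cp b -> cp (b \o a).
  move=> [la ca] [lb cb]; split=> [c y z|m y /ca/cb]; first by rewrite /= la lb.
  by apply: cone_eq; apply/matrixP => i j; rewrite !mxE.
have := cx H (Phi \o f) (Psi \o g) (comp_cp _ _ _ _ _ cf cP) (comp_cp _ _ _ _ _ cg cQ) (fun _ _ => PQ _ _).
apply: cone_eq; apply/matrixP => i j; rewrite !mxE.
apply: (@tens_ext _ _ _ _ (prodmap (Phi \o f) (Psi \o g)) (fun z => prodmap Phi Psi (tens_map f g z))).
- by apply: prodmap_linear; exact: comp_cp.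
- by move=> a y z; rewrite (tens_map_linear cf.1 cg.1) (prodmap_linear cP cQ).
- move=> v w; rewrite (tens_mapE _ _ cf.1 cg.1) prodmapE; try exact: comp_cp.
  by rewrite prodmapE.
Qed.

Lemma max_c V W n (x : 'M[tensor V W]_n) : osys_ax V -> osys_ax W -> max_cone x -> c_cone x.
Proof. by move=> HV HW mx H Phi Psi cP cQ PQ; exact: (prodmap_max HV HW cP cQ PQ mx). Qed.

End CommutingIsMaximal.

(** * Comparison of the el and commuting cones *)

Section RealImplications.
Variable R : realType.
Implicit Types S T A B I C : mosys R.
Local Notation opsys := (is_opsys (@idfun R)).
Local Notation injenv := (@is_injenv R (@idfun R) _ _).

Lemma el_map S T I (j : S -> I) n (x : 'M[tensor S T]_n) : opsys S -> opsys T -> opsys I ->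
  ucp j -> max_cone x -> el_cone j x.
Proof.
by move=> /opsys_ax HS /opsys_ax HT /opsys_ax HI uj; apply: max_map => //; exact: ucp_id.
Qed.

Lemma tens_map_comp (V V' V'' W : lmodType R) (f : V -> V') (g : V' -> V'') (z : tensor V W) :
  linear f -> linear g -> tens_map (g \o f) id z = tens_map g id (tens_map f id z).
Proof.
move=> lf lg; have lid : linear (@id W) by [].
have lgf : linear (g \o f) by move=> a x y; rewrite /= lf lg.
apply: (@tens_ext _ _ _ _ (tens_map (g \o f) id) (fun z => tens_map g id (tens_map f id z))).
- exact: tens_map_linear.
- by move=> a x y; rewrite (tens_map_linear lf lid) (tens_map_linear lg lid).
- by move=> v w; rewrite !tens_mapE.
Qed.

(** Injectivity makes [I] a ucp retract of some B(K), and over the C*-algebra B(K) commuting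
    positivity is maximal positivity. *)
Lemma c_sub_el S T I (j : S -> I) n (x : 'M[tensor S T]_n) : opsys T -> injenv j ->
  c_cone x -> el_cone j x.
Proof.
move=> oT [oI iI uj _] cx; have [K [f uf]] := oI.
have [P uP Pf] := iI _ _ f id oI (BH_opsys K) uf (ucp_id I).
have uj' := uco_ucp uj; have uf' := uco_ucp uf.
have lj := uj'.1.1; have lf := uf'.1.1; have lP := uP.1.1.
have cid : cp (@id T) := (ucp_id T).1.
have := c_map (ucp_comp uj' uf').1 cid cx.
move=> /(c_cone_max_l (BH_cstar K) oT) h.
have := max_map (BH_ax K) (opsys_ax oI) (opsys_ax oT) (opsys_ax oT) uP (ucp_id T) h.
apply: (@cone_eq R (max_tensor I T)); apply/matrixP => a b; rewrite !mxE.
have lfj : linear (f \o j) by move=> c y z; rewrite /= lj lf.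
rewrite -(tens_map_comp _ lfj lP); congr (tens_map _ _ _).
by apply/funext => s; rewrite /= Pf.
Qed.

Lemma commutant_star (H : realHilbert R) (D : set (BH H)) (T : BH H) : (forall Z, D Z -> D (adjoint Z)) ->
  commutant D T -> commutant D (adjoint T).
Proof.
move=> Ds hT Z /Ds/hT h; have := congr1 (@adjoint _ _ H) h.
by rewrite !adjointM !adjointK.
Qed.

(** The commuting pair is moved to a space where the map on [S] is a unital complete order embedding
    [f]. The DCEP extends [f] to [g] on [I] inside the double commutant, so [g] still commutes with
    [Psi'], and [prodmap_max] applies on [I]. *)
Lemma DCEP_el_sub_c S T I (j : S -> I) n (x : 'M[tensor S T]_n) : DCEP (@idfun R) S ->
  opsys S -> opsys T -> injenv j -> el_cone j x -> c_cone x.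
Proof.
move=> dS oS oT ij elx H Phi Psi cPhi cPsi PP.
have HS := opsys_ax oS; have HT := opsys_ax oT; have [oI _ uj _] := ij; have HI := opsys_ax oI.
have [H0 [f0 uf0]] := oS; have [[l0 i0 s0 c0] u0] := uf0; have [[cp0 _] cc0] := uco_ucp uf0.
have cpf0 := (uco_ucp uf0).1.
(* The summand [H0] with [f0] makes the new map an embedding. As [Phi] need not be unital, [H]
   enters with the form defined by [Phi (ounit S)]. *)
pose X := (H * H0)%type.
pose G s (x y : X) := inner H (bop (Phi s) y.1) x.1 + inner H0 (bop (f0 s) y.2) x.2.
have PhiS v : Phi (ostar v) = adjoint (Phi v) := cp_star v HS (BH_ax H) cPhi.
have PsiS v : Psi (ostar v) = adjoint (Psi v) := cp_star v HT (BH_ax H) cPsi.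
have s0' v : f0 (ostar v) = adjoint (f0 v) := s0 v.
have GP : pos_kernel G.
  split=> [y z a v w|P A xi hA|v y z]; rewrite /G.
  - by rewrite cPhi.1 l0 !bopDE !bopZE !ipDl !ipZl; ring.
  - under eq_bigr do rewrite big_split; rewrite big_split addr_ge0//.
      by have /BHpcone[_] := cp_pcone cPhi hA; apply.
    by have /BHpcone[_] := cp_pcone cpf0 hA; apply.
  - rewrite PhiS s0'; congr (_ + _); first by rewrite ipC -adjointP.
    by rewrite ipC -adjointP.
have [L [k [f [uf kP fE]]]] := kolmogorov HS GP.
have kip y z : inner L (k y) (k z) = G (ounit S) z y by have [-> _ _] := kP; rewrite /= pk_unit_sym.
have uff : uco_embedding f.
  split; last exact: uf.2; split; first exact: uf.1.1.
  - move=> v w vw; apply: i0; apply: bop_ip_ext => y z.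
    have E u : inner H0 (bop (f0 u) y) z = G u (0, z) (0, y) by rewrite /G /= bop0r ip0l add0r.
    by rewrite !E -!fE vw.
  - by move=> v; exact: cp_star HS (BH_ax L) uf.1.
  move=> m A; split=> [hA|/cone_BH[hs hp]].
    by apply/(cone_pcone (BH_ax L)); apply: eq_pcone (cp_pcone uf.1 ((cone_pcone HS A).1 hA)) => a b; rewrite mxE.
  have E u y z : inner H0 (bop (f0 u) y) z = G u (0, z) (0, y) by rewrite /G /= bop0r ip0l add0r.
  apply/c0/cone_BH; split=> [a b|xi].
    apply: bop_ip_ext => y z; rewrite !mxE (ipC (bop (adjoint _) y)) -adjointP !E -!fE.
    by have := hs a b; rewrite !mxE => <-; rewrite (ipC (bop (adjoint _) _)) -adjointP.
  have := hp (fun a => k (0, xi a)); congr (_ <= _).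
  by apply: eq_bigr => a _; apply: eq_bigr => b _; rewrite !mxE E fE.
(* [Psi] acts on the first summand, completed for [Phi (ounit S)], and by zero on [H0]. *)
pose K t (x y : X) := inner H (bop (Phi (ounit S)) (bop (Psi t) y.1)) x.1.
have /BHpcone[P1s P1p] := cp_pcone cPhi (ax_unit HS).
have Pc t : bopM (Phi (ounit S)) (Psi t) = bopM (Psi t) (Phi (ounit S)) by exact: PP.
have KP : pos_kernel K.
  split=> [y z a v w|P A xi hA|v y z]; rewrite /K.
  - by rewrite cPsi.1 bopDE bopZE bopDr bopZr ipDl ipZl.
  - have /BHpcone[hs hp] := cp_pcone cPsi hA.
    have := block_pos P1s hs P1p hp (fun _ _ _ _ => PP _ _) (fun a => (xi a.2).1).
    rewrite sum_prod (big_pred1 tt); last by case.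
    congr (_ <= _); apply: eq_bigr => a _; rewrite sum_prod (big_pred1 tt)//; by case.
  - have := congr1 (fun Z : BH H => inner H (Z z.1) y.1) (Pc v) => /= ->.
    by rewrite PsiS adjointP (P1s tt tt) ipC -adjointP.
have [M M0 hM] := bop_bounded (Psi (ounit T)).
have KG s : kform (fun x y => K (ounit T) x y) s s <= M * kform (unit_kernel HS GP) s s.
  pose v := \sum_(p <- s) p.1 *: p.2.1.
  have sumE (Z : BH H) : \sum_(p <- s) \sum_(r <- s) p.1 * r.1 * inner H (Z r.2.1) p.2.1 = inner H (Z v) v.
    rewrite /v ip_sumr; apply: eq_bigr => p _; rewrite bop_sumr ip_suml; apply: eq_bigr => r _.
    by rewrite bopZr ipZl ipZr; ring.
  have -> : kform (fun x y => K (ounit T) x y) s s = inner H (bopM (Phi (ounit S)) (Psi (ounit T)) v) v.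
    by rewrite -sumE.
  apply: (@le_trans _ _ (M * inner H (bop (Phi (ounit S)) v) v)); last first.
    rewrite ler_wpM2l// -sumE /kform /=; under [leRHS]eq_bigr do under eq_bigr do rewrite mulrDr.
    under [leRHS]eq_bigr do rewrite big_split; rewrite big_split lerDl /= u0.
    have := ip_ge0 (\sum_(p <- s) p.1 *: p.2.2); congr (_ <= _).
    rewrite ip_suml; apply: eq_bigr => p _; rewrite ip_sumr; apply: eq_bigr => r _.
    by rewrite ipZl ipZr mulrA ipC.
  have /BHpcone[Q1s Q1p] := cp_pcone cPsi (ax_unit HT).
  (* [M - Psi (ounit T)] is positive and commutes with [Phi (ounit S)], so their product is
     positive. *)
  pose Y (_ _ : unit) : BH H := M *: bop1 H - Psi (ounit T).
  have Ys a b : adjoint (Y b a) = Y a b.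
    by rewrite /Y adjointD adjointZ adjoint1 -scaleN1r adjointZ (Q1s tt tt) scaleN1r.
  have Yp (xi : unit -> H) : 0 <= \sum_a \sum_b inner H (Y a b (xi b)) (xi a).
    rewrite !(big_pred1 tt); [|by case|by case].
    rewrite /Y bopDE bopNE bopZE ipDl ipZl ipNl /= subr_ge0 -inner_norm.
    rewrite (le_trans (ler_norm _))// (le_trans (ip_norm_le _ _))// expr2 mulrA.
    by rewrite ler_wpM2r//; exact: hM.
  have PY (a b c d : unit) : bopM (Phi (ounit S)) (Y c d) = bopM (Y c d) (Phi (ounit S)) :> BH H.
    by rewrite /Y bopMDl bopMDr -scaleN1r bopMZl !bopMZr bopMZl Pc; congr (_ *: _ + _); apply: bop_ext.
  have := @block_pos R H unit unit (fun _ _ => Phi (ounit S)) Y P1s Ys P1p Yp PY (fun=> v).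
  rewrite !(big_pred1 (tt, tt)); try by case=> [[] []].
  have -> : bop (Y (tt, tt).2 (tt, tt).2) v = M *: v - Psi (ounit T) v by [].
  by rewrite bopDr bopNr bopZr ipDl ipNl ipZl subr_ge0.
have [Psi' [cPsi' Psi'E]] := kolmogorov_cp HT KP kP M0 KG.
have Psi'k t y : Psi' t (k y) = k (Psi t y.1, 0).
  by have [_ kext _] := kP; apply: kext => z; rewrite Psi'E kip /G /K /= bop0r ip0l addr0.
have Psi's t : adjoint (Psi' t) = Psi' (ostar t) by have := cp_star t HT (BH_ax L) cPsi'.
have fPsi s t : bopM (f s) (Psi' t) = bopM (Psi' t) (f s).
  apply: (krep_bop_ext kP) => y z /=.
  rewrite Psi'k fE adjointP Psi's Psi'k fE /G /= bop0r ip0r addr0 ip0l addr0.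
  rewrite PsiS -adjointP.
  exact: (congr1 (fun Z : BH H => inner H (Z y.1) z.1) (PP s t)).
have [g ug [gj gcc]] := dS _ _ ij _ _ uff.
have gPsi x0 t : bopM (g x0) (Psi' t) = bopM (Psi' t) (g x0).
  by apply: gcc => _ [s _ <-]; rewrite fPsi.
have /cone_BH[hs hp] := prodmap_max HI HT ug.1 cPsi' gPsi elx.
have lj : linear j by have [[]] := uj.
have lid : linear (@id T) by [].
have E z a b : inner H (prodmap Phi Psi z a) b = inner L (prodmap g Psi' (tens_map j id z) (k (a, 0))) (k (b, 0)).
  apply: (@tens_ext _ _ _ R^o (fun z => inner H (prodmap Phi Psi z a) b)
    (fun z => inner L (prodmap g Psi' (tens_map j id z) (k (a, 0))) (k (b, 0)))).
  - by move=> c y w; rewrite (prodmap_linear cPhi cPsi) bopDE bopZE ipDl ipZl.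
  - by move=> c y w; rewrite (tens_map_linear lj lid) (prodmap_linear ug.1 cPsi') bopDE bopZE ipDl ipZl.
  - move=> s t; rewrite tens_mapE// !prodmapE//; last exact: ug.1.
    by rewrite /= Psi'k gj fE /G /= bop0r ip0l addr0.
apply/cone_BH; split=> [a b|xi].
  apply: bop_ip_ext => y z; rewrite !mxE (ipC (bop (adjoint _) y)) -adjointP.
  have := hs a b; rewrite !mxE => hab.
  by rewrite -/(prodmap Phi Psi) !E -hab (ipC (bop (adjoint _) _)) -adjointP.
have := hp (fun a => k (xi a, 0)); congr (_ <= _).
by apply: eq_bigr => a _; apply: eq_bigr => b _; rewrite !mxE E.
Qed.

End RealImplications.

(** * Commutants as concrete C*-algebras *)

Section Commutant.
Variables (R : realType) (H : realHilbert R) (D : set (BH H)).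
Hypothesis Dstar : forall T, D T -> D (adjoint T).

Lemma commutant_lin a S T : commutant D S -> commutant D T -> commutant D (a *: S + T).
Proof. by move=> hS hT Z DZ; rewrite bopMDl bopMDr bopMZl bopMZr hS// hT. Qed.

Lemma commutant1 : commutant D (bop1 H).
Proof. by move=> Z _; apply: bop_ext. Qed.

Definition commutant_sub : bhsub H :=
  BHSub commutant_lin (fun T => @commutant_star R H D T Dstar) commutant1.

Lemma commutantM S T : commutant D S -> commutant D T -> commutant D (bopM S T).
Proof. by move=> hS hT Z DZ; rewrite -bopMA hT// bopMA hS// bopMA. Qed.

Lemma commutant_closed (T : BH H) :
  (forall e : R, 0 < e -> exists2 S, commutant D S & opnorm_le (T - S) e) -> commutant D T.
Proof.
move=> hT Z DZ; apply: bop_ext => x /=; apply/eqP; rewrite -subr_eq0 -normr_le0.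
apply/ler_addgt0Pl => e e0; rewrite addr0.
have [M M0 hM] := bop_bounded Z.
pose d := e / (2 * M * `|x| + 1).
have c0 : 0 < 2 * M * `|x| + 1 by rewrite ltr_wpDl// !mulr_ge0.
have d0 : 0 < d by rewrite divr_gt0.
have [S hS [_ hd]] := hT _ d0.
have hSZ : S (Z x) = Z (S x) by have := hS Z DZ => /(congr1 (fun W : BH H => W x)).
have -> : T (Z x) - Z (T x) = (T - S) (Z x) - Z ((T - S) x).
  by rewrite !(bopDE, bopNE) !(bopDr, bopNr) hSZ opprB addrA subrK.
apply: (le_trans (ler_normB _ _)).
have h1 : `|(T - S) (Z x)| <= d * (M * `|x|) by rewrite (le_trans (hd _))// ler_wpM2l ?(ltW d0).
have h2 : `|Z ((T - S) x)| <= d * (M * `|x|).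
  by rewrite (le_trans (hM _))// mulrCA ler_wpM2l.
have : d * (2 * M * `|x| + 1) = e by rewrite /d mulfVK// gt_eqF.
lra.
Qed.

End Commutant.

(** * The DCEP and embeddings of maximal tensor products *)

Section MoreImplications.
Variable R : realType.
Implicit Types S T A B I C : mosys R.
Local Notation opsys := (is_opsys (@idfun R)).
Local Notation cstar := (is_unital_cstar (@idfun R)).
Local Notation injenv := (@is_injenv R (@idfun R) _ _).

Lemma el_c_eq_max S C I (j : S -> I) n : opsys S -> cstar C -> injenv j ->
  @el_cone R S I j C n = @c_cone R S C n -> @el_cone R S I j C n = @max_cone R S C n.
Proof.
move=> oS cC [oI _ uj _] elc; have [H [f fP]] := cC; have oC := cstar_opsys fP.
apply/seteqP; split=> x.
  by rewrite elc; exact: c_cone_max_r.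
by move=> hx; apply: (el_map oS oC oI (uco_ucp uj)).
Qed.

Lemma opsys_separate S : opsys S -> exists FS : set (S -> R), (forall phi, FS phi -> rlin phi) /\
  forall s, (forall phi, FS phi -> phi s = 0) -> s = 0.
Proof.
move=> [H [f [[lf fi _ _] _]]].
exists [set phi | exists a b, phi = fun s => inner H (bop (f s) a) b]; split.
  by move=> _ [a [b ->]] c v w; rewrite lf bopDE bopZE ipDl ipZl.
move=> s hs; apply: fi; apply: bop_ip_ext => a b.
by rewrite (linear_zero lf) bop0E ip0l; apply: (hs (fun s => inner H (bop (f s) a) b)); exists a, b.
Qed.

(** Functionals on [A] restrict along [j] to a separating family on [S]. *)
Lemma tens_map_inj S A B (j : S -> A) : opsys A -> opsys B -> linear j -> injective j ->
  injective (tens_map j (@id B)).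
Proof.
move=> oA oB lj ji; have lid : linear (@id B) by [].
have lt := tens_map_linear lj lid.
suff h (z : tensor S B) : tens_map j (@id B) z = 0 -> z = 0.
  move=> x y xy; apply/eqP; rewrite -subr_eq0; apply/eqP/h.
  by rewrite (linear_add _ _ lt) (linear_opp _ lt) xy subrr.
have [FA [lA sA]] := opsys_separate oA; have [FB [lB sB]] := opsys_separate oB.
move=> z0; apply: (@tensor_separate R S B [set phi | exists2 psi, FA psi & phi = psi \o j] FB) => //.
- by move=> _ [psi Fp ->] a x y; rewrite /= lj lA.
- move=> s hs; apply: ji; rewrite (linear_zero lj); apply: sA => psi Fp.
  by apply: (hs (psi \o j)); exists psi.
move=> _ psi [phi Fphi ->] Fpsi.
have bl (V : lmodType R) (chi : V -> R) : rlin chi -> bilin (fun v w => chi v * psi w : R^o).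
  move=> lp; split=> x a y y'; first by rewrite lp mulrDl -mulrA.
  by rewrite lB// mulrDr mulrCA.
have b1 := bl _ _ (lA _ Fphi).
have b2 : bilin (fun v w => (phi \o j) v * psi w : R^o).
  by apply: bl => a x y; rewrite /= lj lA.
suff -> : tlift (fun v w => (phi \o j) v * psi w : R^o) z = tlift (fun v w => phi v * psi w : R^o) (tens_map j id z).
  by rewrite z0; exact: (linear_zero (tlift_linear b1)).
apply: (@tens_ext _ _ _ _ (tlift (fun v w => (phi \o j) v * psi w : R^o))
   (fun z => tlift (fun v w => phi v * psi w : R^o) (tens_map j id z))).
- exact: tlift_linear.
- by move=> a x y; rewrite lt tlift_linear.
- by move=> v w; rewrite tens_mapE// !tlift_tens.
Qed.

(** [j0] extends along [j] to [A], so positivity over [A] implies positivity over [I], which is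
    el-positivity. The DCEP turns it into commuting positivity, and this is maximal because [B] is a
    C*-algebra. *)
Lemma DCEP_exact S I (j0 : S -> I) A B (j : S -> A) : opsys S -> injenv j0 -> DCEP (@idfun R) S ->
  cstar A -> cstar B -> uco_embedding j ->
  uco_embedding (tens_map j (@id B) : max_tensor S B -> max_tensor A B).
Proof.
move=> oS ij0 dS cA cB uj; have [HA' [fA fAP]] := cA; have [HB' [fB fBP]] := cB.
have oA := cstar_opsys fAP; have oB := cstar_opsys fBP.
have HS := opsys_ax oS; have HA := opsys_ax oA; have HB := opsys_ax oB.
have [[lj ji js jc] j1] := uj; have lid : linear (@id B) by [].
have [oI iI uj0 _] := ij0.
split; last by rewrite /= /tens_unit tens_mapE// j1.
split; [exact: tens_map_linear|exact: tens_map_inj| |].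
  have sl := tens_star_linear HS HB; have sl' := tens_star_linear HA HB.
  have lT := tens_map_linear lj lid.
  apply: (@tens_ext _ _ _ _ (fun z => tens_map j id (tens_star z)) (fun z => tens_star (tens_map j id z))).
  - by move=> a x y; rewrite sl lT.
  - by move=> a x y; rewrite lT sl'.
  - by move=> s b; rewrite tens_starE// !tens_mapE// tens_starE// js.
move=> n x; split; first exact: max_map (uco_ucp uj) (ucp_id B).
move=> hx; apply: (c_cone_max_r oS cB); apply: (DCEP_el_sub_c dS oS oB ij0).
have [q uq qj] := iI _ _ j j0 oS oA uj (uco_ucp uj0).
have := max_map HA (opsys_ax oI) HB HB uq (ucp_id B) hx.
apply: (@cone_eq R (max_tensor I B)); apply/matrixP => a b; rewrite !mxE.
rewrite -(tens_map_comp _ lj uq.1.1); congr (tens_map _ _ _).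
by apply/funext => s; rewrite /= qj.
Qed.

(** Take for [B] the commutant of the range of [f] and for the larger algebra some B(K) containing
    [S]: commuting with [B] means lying in the double commutant. *)
Lemma exact_DCEP S : opsys S ->
  (forall A B, cstar A -> cstar B -> forall j : S -> A, uco_embedding j ->
    uco_embedding (tens_map j (@id B) : max_tensor S B -> max_tensor A B)) ->
  DCEP (@idfun R) S.
Proof.
move=> oS ex I j [oI _ uj _] H f uf; have HS := opsys_ax oS.
have fs s : f (ostar s) = adjoint (f s) by have [[]] := uf.
have Ds (T : BH H) : range f T -> range f (adjoint T) by move=> [s _ <-]; exists (ostar s).
pose B := subsys (commutant_sub Ds).
have eB := @subsys_cstar R H (commutant_sub Ds) (@commutantM R H (range f)) (@commutant_closed R H (range f)).
have cB : cstar B by exists H, (@bhval R H (commutant_sub Ds)).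
have HB := cstar_ax eB; have upi := uco_ucp (subsys_uco (commutant_sub Ds)).
have [K [f0 uf0]] := oS.
have [[_ _ _ exc] _] := ex _ B (BH_cstar K) cB f0 uf0.
have [|n x hx|g [ug gf gB]] := @commuting_extension R S (BHsys K) B H HS (BH_ax K) HB f0 f
   (@bhval R H (commutant_sub Ds)) uf0 (uco_ucp uf) upi.
- by move=> s b; have := bhsubP b => /(_ (f s)) -> //; exists s.
- by apply/exc; apply: (pD_max (BH_ax K) HB); apply: eq_pD hx => a b; rewrite mxE.
have [h uh hj] := BH_injective oS oI uj (uco_ucp uf0).
exists (g \o h); first exact: ucp_comp.
split=> [s|y T hT]; first by rewrite /= hj gf.
(* The commutant is closed under products, so [b2] is the honest product of the adjoint of [b] with
   [b]. *)
have iso (b : B) : @isometric R B H (@bhval R H (commutant_sub Ds)) b.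
  have hb2 : commutant (range f) (bopM (adjoint (bhval b)) (bhval b)).
    have hb := @bhsubP R H (commutant_sub Ds) b.
    by apply: commutantM => //; exact: commutant_star.
  exists (@mkbhsub R H (commutant_sub Ds) _ hb2) => //.
  apply/(co_pcone _ (subsys_uco (commutant_sub Ds)).1)/BHpcone; split=> [[] []|xi] //=.
  - exact: adjoint1.
  - exact: adjointK.
  - by rewrite adjointM adjointK.
  have h0 := ip_ge0 (xi true + bhval b (xi false)); rewrite !big_bool /=.
  suff : 0 <= inner H (xi true) (xi true) + inner H (bhval b (xi false)) (xi true) +
    (inner H (adjoint (bhval b) (xi true)) (xi false) +
     inner H (adjoint (bhval b) (bhval b (xi false))) (xi false)) by exact.
  rewrite !(ipC (adjoint (bhval b) _)) -!adjointP.
  by move: h0; rewrite !ipDl !ipDr (ipC (xi true) (bhval b _)); lra.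
exact: (gB (@mkbhsub R H (commutant_sub Ds) T hT) (iso _) (iso _) (h y)).
Qed.

End MoreImplications.

(** * Maps into concrete subsystems *)

Section SubsystemMaps.
Variables (R : realType) (K : realHilbert R) (A : bhsub K) (V : mosys R).

Definition bhlift (h : V -> BHsys K) (hA : forall x, bhset A (h x)) : V -> subsys A :=
  fun x => mkbhsub (hA x).

Lemma bhlift_ucp h hA : ucp h -> ucp (@bhlift h hA).
Proof.
move=> [[lh ch] h1]; split; last exact: val_inj.
split=> [a x y|n x /ch]; first by apply: val_inj => /=; rewrite lh.
by apply: cone_eq; apply/matrixP => i j; rewrite !mxE.
Qed.

Lemma bhlift_uco h hA : uco_embedding h -> uco_embedding (@bhlift h hA).
Proof.
move=> [[lh ih sh ch] h1]; split; last exact: val_inj.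
split=> [a x y|x y /(congr1 (@bhval _ _ A))/ih//|x|n x].
- by apply: val_inj => /=; rewrite lh.
- by apply: val_inj => /=; rewrite sh.
rewrite ch /=; suff -> : map_mx (bhval (A := A)) (map_mx (bhlift hA) x) = map_mx h x by [].
by apply/matrixP => i j; rewrite !mxE.
Qed.

End SubsystemMaps.

(** * Existence of injective envelopes by minimal seminorms *)

Section InjectiveEnvelope.
Variable R : realType.

(** The norm bound is positivity of [M x; x^* M], which ucp maps preserve. *)
Lemma ucp_contract (K H : realHilbert R) (g : BHsys K -> BHsys H) (x : BH K) (M : R) :
  ucp g -> opnorm_le x M -> opnorm_le (g x : BH H) M.
Proof.
move=> [cg g1] [M0 hM]; split=> // b.
have hx : pcone (fun i j : bool => if i == j then M *: ounit (BHsys K) else if i then (x : BHsys K) else ostar (x : BHsys K)).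
  apply/BHpcone; split=> [[] []|xi] /=; rewrite ?adjointZ ?adjoint1 ?adjointK//.
  rewrite !big_bool /=.
  suff : 0 <= inner K (M *: xi true) (xi true) + inner K (x (xi false)) (xi true) +
    (inner K (adjoint x (xi true)) (xi false) + inner K (M *: xi false) (xi false)) by exact.
  rewrite !ipZl -!inner_norm (ipC (adjoint x _)) -adjointP.
  have := ip_norm_le (x (xi false)) (xi true); rewrite ler_norml => /andP[h _].
  have h2 : `|x (xi false)| * `|xi true| <= M * `|xi false| * `|xi true| by rewrite ler_wpM2r.
  have := mulr_ge0 M0 (sqr_ge0 (`|xi true| - `|xi false|)); rewrite sqrrB.
  lra.
have /BHpcone[_ h] := cp_pcone cg hx.
have gs : g (ostar (x : BHsys K)) = adjoint (g x) by exact: cp_star (BH_ax K) (BH_ax H) cg.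
have h' a : inner H (g x b) a ^+ 2 <= (M * `|a| ^+ 2) * (M * `|b| ^+ 2).
  apply: discr_le => t.
  have := h (fun i => if i then a else t *: b); rewrite !big_bool /=.
  rewrite (linear_scale _ _ cg.1) g1 gs.
  rewrite -[bop (M *: ounit (BHsys H)) a]/(M *: a) -[bop (M *: ounit (BHsys H)) (t *: b)]/(M *: (t *: b)).
  rewrite bopZr !ipZl (ipC (bop (adjoint _) a)) -adjointP bopZr !ipZr !ipZl -!inner_norm.
  by congr (_ <= _); ring.
have h2 := h' (g x b); rewrite -inner_norm in h2; set n := `|g x b| in h2 *.
have [->|n0] := eqVneq n 0; first by rewrite mulr_ge0.
have np : 0 < n by rewrite lt_neqAle eq_sym n0 normr_ge0.
have Mb : 0 <= M * `|b| by rewrite mulr_ge0.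
have h3 : n ^+ 2 * n ^+ 2 <= n ^+ 2 * (M * `|b|) ^+ 2.
  by move: h2; congr (_ <= _); rewrite ?exprMn; ring.
by move: h3; rewrite ler_pM2l ?exprn_gt0// ler_pXn2r// nnegrE ltW.
Qed.

Lemma opnorm_le0 (H : realHilbert R) (x : BH H) :
  (forall e : R, 0 < e -> opnorm_le x e) -> x = 0.
Proof.
move=> hx; apply: bop_ext => v; apply/eqP; rewrite -normr_le0; apply/ler_addgt0Pl => e e0.
have c0 : 0 < `|v| + 1 by rewrite ltr_wpDl.
have [|_ h] := hx (e / (`|v| + 1)); first by rewrite divr_gt0.
rewrite addr0 (le_trans (h v))// mulrAC ler_pdivrMr// ler_pM2l// lerDl//.
Qed.

Lemma opnorm_leD (H : realHilbert R) (x y : BH H) (M N : R) :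
  opnorm_le x M -> opnorm_le y N -> opnorm_le (x + y) (M + N).
Proof.
move=> [M0 hM] [N0 hN]; split=> [|v]; first exact: addr_ge0.
by rewrite bopDE (le_trans (ler_normD _ _))// mulrDl lerD.
Qed.

Lemma opnorm_leZ (H : realHilbert R) (x : BH H) (M c : R) :
  opnorm_le x M -> opnorm_le (c *: x) (`|c| * M).
Proof.
move=> [M0 hM]; split=> [|v]; first exact: mulr_ge0.
by rewrite bopZE normrZ -mulrA ler_wpM2l.
Qed.

Variables (S : mosys R) (K : realHilbert R) (f0 : S -> BHsys K).
Hypothesis uf0 : uco_embedding f0.

Record fixing := Fixing { fixmap :> BHsys K -> BHsys K;
  fix_ucp : ucp fixmap; fixS : forall s, fixmap (f0 s) = f0 s }.
(** Larger means smaller seminorm [|phi x|]: premaximal maps are those of minimal seminorm. *)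
Definition fix_le (phi psi : fixing) : bool :=
  `[< forall x M, opnorm_le (phi x : BH K) M -> opnorm_le (psi x : BH K) M >].

Lemma fix_leP (phi psi : fixing) : reflect (forall x M, opnorm_le (phi x : BH K) M -> opnorm_le (psi x : BH K) M) (fix_le phi psi).
Proof. exact: asboolP. Qed.

Lemma fix_le_refl (phi : fixing) : fix_le phi phi. Proof. exact/fix_leP. Qed.
Lemma fix_le_trans (p1 p2 p3 : fixing) : fix_le p1 p2 -> fix_le p2 p3 -> fix_le p1 p3.
Proof. by move=> /fix_leP h1 /fix_leP h2; apply/fix_leP => x M /h1/h2. Qed.

Definition fix_id : fixing := @Fixing id (ucp_id _) (fun _ => erefl).
Lemma fix_comp_subproof (phi psi : fixing) s : (psi \o phi) (f0 s) = f0 s.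
Proof. by rewrite /= !fixS. Qed.
Definition fix_comp (phi psi : fixing) : fixing :=
  Fixing (ucp_comp (fix_ucp phi) (fix_ucp psi)) (fix_comp_subproof phi psi).

Lemma fix_comp_le (phi psi : fixing) : fix_le phi (fix_comp phi psi).
Proof. by apply/fix_leP => x M; exact: ucp_contract (fix_ucp psi). Qed.

Lemma fix_premaximal : exists phi, premaximal fix_le phi.
Proof.
apply: (ZL_preorder fix_id fix_le_refl fix_le_trans) => A Atot.
have [[c0 Ac0]|A0] := pselect (exists c, A c); last first.
  by exists fix_id => s As; case: A0; exists s.
(* The filter of tails of the chain; an ultralimit along it keeps every norm bound that holds from
   some member on. *)
pose F := [set B : set fixing | exists2 c, A c & forall d, A d -> fix_le c d -> B d].
have FF : ProperFilter F.
  split; first by move=> [c Ac /(_ c Ac (fix_le_refl c))].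
  split=> [|B B' [c Ac hc] [d Ad hd]|B B' BB' [c Ac hc]].
  - by exists c0.
  - have [cd|dc] := Atot _ _ Ac Ad.
      by exists d => // e Ae de; split; [apply: hc => //; exact: fix_le_trans cd de|exact: hd].
    by exists c => // e Ae ce; split; [exact: hc|apply: hd => //; exact: fix_le_trans dc ce].
  - by exists c => // d Ad cd; apply: BB'; exact: hc.
have [g [ug _ gle]] := ulim_ucp (BH_ax K) (gs := fixmap) FF fix_ucp.
have gS s : g (f0 s) = f0 s.
  have h x y : inner K (bop (g (f0 s)) x) y <= inner K (bop (f0 s) x) y.
    by apply: gle; exists c0 => // d _ _; rewrite /= fixS.
  apply: bop_ip_ext => x y; apply/eqP; rewrite eq_le h/=.
  by have := h x (- y); rewrite !ipNr lerN2.
exists (Fixing ug gS) => c Ac; apply/fix_leP => x M hM /=.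
have M0 := hM.1; split=> // v.
have h y : inner K (bop (g x) v) y <= M * `|v| * `|y|.
  apply: gle; exists c => // d Ad /fix_leP/(_ x M hM)[_ hd] /=.
  rewrite (le_trans (ler_norm _))// (le_trans (ip_norm_le _ _))//.
  by rewrite ler_wpM2r.
have := h (bop (g x) v); rewrite -inner_norm expr2.
have [->|n0] := eqVneq `|bop (g x) v| 0; first by rewrite mulr_ge0.
by rewrite ler_pM2r// lt_neqAle eq_sym n0 normr_ge0.
Qed.

Definition cesaro (phi : BHsys K -> BHsys K) n (x : BHsys K) : BHsys K :=
  n.+1%:R^-1 *: \sum_(k < n.+1) iter k.+1 phi x.

Lemma iter_ucp (phi : fixing) n : ucp (iter n phi).
Proof.
elim: n => [|n IH]; first exact: ucp_id.
exact: ucp_comp IH (fix_ucp phi).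
Qed.

Lemma cesaro_ucp (phi : fixing) n : ucp (cesaro phi n).
Proof.
have n0 : n.+1%:R != 0 :> R by rewrite pnatr_eq0.
split.
  apply: (pcone_cp (BH_ax K) (BH_ax K)) => [a x y|P X hX].
    rewrite /cesaro scalerA mulrC -scalerA -scalerDr; congr (_ *: _).
    rewrite scaler_sumr -big_split; apply: eq_bigr => k _.
    by rewrite (iter_ucp phi k.+1).1.1.
  apply: (pconeZ (BH_ax K)); first by rewrite invr_ge0.
  by apply: (pcone_sum (BH_ax K)) => k; exact: cp_pcone (iter_ucp phi k.+1).1 hX.
rewrite /cesaro (eq_bigr (fun=> ounit (BHsys K))); last by move=> k _; exact: (iter_ucp phi k.+1).2.
by rewrite sumr_const card_ord -[ounit _ *+ _]scaler_nat scalerA mulVf// scale1r.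
Qed.

Lemma cesaro_fix (phi : fixing) n s : cesaro phi n (f0 s) = f0 s.
Proof.
have n0 : n.+1%:R != 0 :> R by rewrite pnatr_eq0.
have h k : iter k phi (f0 s) = f0 s by elim: k => //= k ->; exact: fixS.
rewrite /cesaro (eq_bigr (fun=> f0 s)) ?sumr_const ?card_ord; last by move=> k _; exact: h.
by rewrite -[f0 s *+ _]scaler_nat scalerA mulVf// scale1r.
Qed.

(** The Cesaro means of the iterates have seminorm at most that of [phi], so by minimality they
    dominate [phi] in norm. At [x - phi x] they telescope to 0, hence [phi (x - phi x) = 0]. *)
Lemma premaximal_idem (phi : fixing) : premaximal fix_le phi -> forall x, phi (phi x) = phi x.
Proof.
move=> pm x; have lphi := (fix_ucp phi).1.1.
have h n : fix_le (Fixing (cesaro_ucp phi n) (cesaro_fix phi n)) phi.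
  apply: pm; apply/fix_leP => z M hM /=; rewrite /cesaro.
  have n0 : (0 : R) < n.+1%:R by rewrite ltr0n.
  have -> : M = `|n.+1%:R^-1| * (\sum_(k < n.+1) M).
    by rewrite sumr_const card_ord -[M *+ _]mulr_natl ger0_norm ?invr_ge0 ?ltW// mulKf// gt_eqF.
  apply: opnorm_leZ; elim/big_rec2: _ => [|k N y _ hy]; first by split=> // v; rewrite bop0E normr0 mul0r.
  apply: opnorm_leD => //; elim: (nat_of_ord k) => //= m; exact: ucp_contract (fix_ucp phi).
have [M M0 hM] := bop_bounded x.
have hx : opnorm_le x M by [].
have it k : opnorm_le (iter k phi x : BH K) M.
  by elim: k => //= k; exact: ucp_contract (fix_ucp phi).
have tele n : cesaro phi n (x - phi x) = n.+1%:R^-1 *: (phi x - iter n.+2 phi x).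
  rewrite /cesaro; congr (_ *: _).
  have E k : iter k.+1 phi (x - phi x) = iter k.+1 phi x - iter k.+2 phi x.
    have l := (iter_ucp phi k.+1).1.1.
    by rewrite (linear_add _ _ l) (linear_opp _ l) -iterSr.
  rewrite (eq_bigr (fun k : 'I_n.+1 => iter k.+1 phi x - iter k.+2 phi x)) => [|k _]; last exact: E.
  elim: n => [|n IH]; first by rewrite big_ord_recl big_ord0 addr0.
  by rewrite big_ord_recr /= IH addrA subrK.
suff : phi (x - phi x) = 0.
  by rewrite (linear_add _ _ lphi) (linear_opp _ lphi) => /eqP; rewrite subr_eq0 => /eqP.
apply: opnorm_le0 => e e0.
pose n := Num.truncn (2 * M / e).
have n0 : (0 : R) < n.+1%:R by rewrite ltr0n.
have small : n.+1%:R^-1 * (M + M) <= e.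
  rewrite ler_pdivrMl// -ler_pdivrMr//.
  by have := ltW (truncnS_gt (2 * M / e)); rewrite -/n; congr (_ <= _); congr (_ / _); ring.
have := h n => /fix_leP/(_ (x - phi x) (n.+1%:R^-1 * (M + M))).
rewrite [fixmap _ _]tele => /(_ _)[|_ h2].
  rewrite -[X in X * (M + M)]ger0_norm ?invr_ge0 ?ltW//; apply: opnorm_leZ.
  apply: opnorm_leD; first exact: (it 1%N).
  have := opnorm_leZ (-1) (it n.+2); rewrite scaleN1r normrN1 mul1r; exact.
split=> [|v]; first exact: ltW.
by rewrite (le_trans (h2 v))// ler_wpM2r.
Qed.

(** The envelope is the fixed space of a minimal [phi], injective because [phi] is an idempotent
    onto it. For rigidity, [psi] composed with [phi] is again minimal, hence idempotent, so it kills
    [y - psi y]; by minimality [phi] kills it too, while fixing it. *)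
Lemma injenv_exists_aux : exists (I : mosys R) (j : S -> I), is_injenv (@idfun R) j.
Proof.
have [phi pm] := fix_premaximal; have idem := premaximal_idem pm.
have up := fix_ucp phi; have lphi := up.1.1.
pose D : set (BH K) := [set T | phi T = T].
have D1 a Z T : D Z -> D T -> D (a *: Z + T) by rewrite /D /= => h1 h2; rewrite lphi h1 h2.
have D2 T : D T -> D (adjoint T).
  by rewrite /D /= => h; have := cp_star (T : BHsys K) (BH_ax K) (BH_ax K) up.1; rewrite h.
have D3 : D (bop1 K) by exact: up.2.
pose A := BHSub D1 D2 D3.
have jA s : bhset A (f0 s) by exact: fixS.
exists (subsys A), (bhlift jA); split.
- exact: subsys_opsys.
- move=> E F je f oE oF uje uf.
  have [g ug gj] := BH_injective oE oF uje (ucp_comp uf (uco_ucp (subsys_uco A))).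
  have gA x : bhset A ((phi \o g) x) by exact: idem.
  exists (bhlift gA); first exact/bhlift_ucp/ucp_comp.
  move=> x; apply: val_inj => /=; rewrite gj /=.
  exact: (bhsubP (f x)).
- exact: bhlift_uco.
move=> psi upsi psiS y.
have phiA x : bhset A (phi x) by exact: idem.
have uq : ucp (bhlift phiA) by exact: bhlift_ucp.
have ux : ucp (fun x => bhval (psi (bhlift phiA x)) : BHsys K).
  exact: ucp_comp uq (ucp_comp upsi (uco_ucp (subsys_uco A))).
have xS s : bhval (psi (bhlift phiA (f0 s))) = f0 s.
  have -> : bhlift phiA (f0 s) = bhlift jA s by apply: val_inj; exact: fixS.
  by rewrite psiS.
pose chi := @Fixing (fun x => bhval (psi (bhlift phiA x))) ux xS.
have phichi : fix_le phi chi.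
  apply/fix_leP => x M hM /=.
  have [q uq' qE] := BH_injective (@subsys_opsys R K A) (BH_opsys K) (subsys_uco A) (ucp_comp upsi (uco_ucp (subsys_uco A))).
  have := qE (bhlift phiA x) => /= <-.
  exact: ucp_contract uq' hM.
have chiphi := pm _ phichi.
have chipm : premaximal fix_le chi.
  move=> w chiw; apply: (fix_le_trans _ phichi); apply: pm.
  exact: fix_le_trans phichi chiw.
have chi_idem := premaximal_idem chipm.
have chiE (z : subsys A) : chi (bhval z) = bhval (psi z).
  by rewrite /= (_ : bhlift phiA (bhval z) = z)//; apply: val_inj; exact: (bhsubP z).
have psi2 : psi (psi y) = psi y by apply: val_inj; rewrite /= -!chiE; exact: chi_idem.
have lpsi := upsi.1.1.
have z0 : psi (y - psi y) = 0 by rewrite (linear_add _ _ lpsi) (linear_opp _ lpsi) psi2 subrr.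
apply/esym/eqP; rewrite -subr_eq0; apply/eqP; apply: val_inj => /=.
rewrite -[LHS]/(bhval (y - psi y : subsys A)).
have := bhsubP (y - psi y : subsys A) => /= zz; rewrite -[LHS]zz.
apply: opnorm_le0 => e e0; have /fix_leP/(_ (bhval (y - psi y : subsys A)) e) := chiphi; apply.
rewrite [X in opnorm_le X]chiE z0; clear -e0; split=> [|v]; first exact: ltW.
by rewrite bop0E normr0 mulr_ge0 ?normr_ge0 ?(ltW e0).
Qed.

End InjectiveEnvelope.

Lemma injenv_exists (R : realType) (S : mosys R) : is_opsys (@idfun R) S ->
  exists (I : mosys R) (j : S -> I), is_injenv (@idfun R) j.
Proof. by move=> [K [f0 uf0]]; exact: injenv_exists_aux uf0. Qed.

(** * Operator norm estimates *)

Section OperatorNorm.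
Variables (R : realType) (H : realHilbert R).
Implicit Types T : BH H.

Lemma opnorm_leM S T (M N : R) :
  opnorm_le S M -> opnorm_le T N -> opnorm_le (bopM S T) (M * N).
Proof.
move=> [M0 hM] [N0 hN]; split=> [|v]; first exact: mulr_ge0.
by rewrite /= (le_trans (hM _))// -mulrA ler_wpM2l.
Qed.

Lemma opnorm_le_adjoint T (M : R) : opnorm_le T M -> opnorm_le (adjoint T) M.
Proof.
move=> [M0 hM]; split=> // v; set n := `|_ v|.
have h : n ^+ 2 <= M * `|v| * n.
  rewrite /n inner_norm -adjointPr (le_trans (ler_norm _))// (le_trans (ip_norm_le _ _))//.
  by rewrite mulrC [leRHS]mulrAC ler_wpM2r.
have [->|n0] := eqVneq n 0; first by rewrite mulr_ge0.
by move: h; rewrite expr2 ler_pM2r// lt_neqAle eq_sym n0 normr_ge0.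
Qed.

Lemma opnorm_exists T : exists2 M : R, 0 < M & opnorm_le T M.
Proof.
have [M M0 hM] := bop_bounded T; exists (M + 1); first by rewrite ltr_wpDl.
split=> [|v]; first by rewrite addr_ge0.
by rewrite (le_trans (hM v))// ler_wpM2r// lerDl.
Qed.

End OperatorNorm.

(** * Orthogonal sums of kernels and isometries permuting points *)

Section DirectSumKernel.
Variables (R : realType) (X L : eqType) (l : X -> L) (k : X -> X -> R).
Hypothesis k_cross : forall x y, l x != l y -> k x y = 0.
Hypothesis k_psd : forall a (s : seq (R * X)), all (fun p => l p.2 == a) s -> 0 <= kform k s s.

Lemma direct_sum_psd s : 0 <= kform k s s.
Proof.
have [n] := ubnP (size s); elim: n s => // n IH [|p s] /=; first by rewrite kform0l.
rewrite ltnS => sn; set s' := p :: s; pose Q (q : R * X) := l q.2 == l p.2.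
pose s1 := [seq q <- s' | Q q]; pose s2 := [seq q <- s' | predC Q q].
have split_sum (F : R * X -> R) : \sum_(q <- s') F q = \sum_(q <- s1) F q + \sum_(q <- s2) F q.
  by rewrite (bigID Q) /= !big_filter.
have cross t1 t2 : all Q t1 -> all (predC Q) t2 -> kform k t1 t2 = 0 /\ kform k t2 t1 = 0.
  move=> /allP h1 /allP h2; split; rewrite /kform big_seq big1// => a at1; rewrite big_seq big1// => b bt2.
    by have := h2 _ bt2; rewrite /= /Q -(eqP (h1 _ at1)) eq_sym => /k_cross ->; rewrite mulr0.
  by have := h2 _ at1; rewrite /= /Q -(eqP (h1 _ bt2)) => /k_cross ->; rewrite mulr0.
have -> : kform k s' s' = kform k s1 s1 + kform k s2 s2.
  have a1 : all Q s1 by exact: filter_all.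
  have a2 : all (predC Q) s2 by exact: filter_all.
  have E t : kform k t s' = kform k t s1 + kform k t s2.
    by rewrite /kform -big_split; apply: eq_bigr => q _; exact: split_sum.
  have -> : kform k s' s' = kform k s1 s' + kform k s2 s' by rewrite {1}/kform split_sum.
  by rewrite !E (cross _ _ a1 a2).1 (cross _ _ a1 a2).2 addr0 add0r.
rewrite addr_ge0//; first by apply: (k_psd (a := l p.2)); exact: filter_all.
apply: IH; rewrite /s2 /s' /= /Q eqxx /= size_filter (leq_ltn_trans (count_size _ _))//.
Qed.

End DirectSumKernel.

(** The bound required by [krep_op] is semidefiniteness of [k] on the translate of one list joined
    with another. *)
Lemma kernel_action (R : realType) (X : Type) (k : kernel R X) (H : realHilbert R) (v : X -> H)
  (a : X -> X) : kernel_rep k v -> (forall x y, k (a x) (a y) = k x y) ->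
  exists U : BH H, forall x, U (v x) = v (a x).
Proof.
move=> vP ka; have [vip vext _] := vP.
have [s t|U hU] := krep_op vP (b := fun x y => k (a x) y) ler01.
  pose as_ := [seq (p.1, a p.2) | p <- s].
  have E t' : kform k as_ t' = kform (fun x y => k (a x) y) s t' by rewrite /kform big_map.
  have E2 : kform k as_ as_ = kform k s s.
    rewrite E /kform; apply: eq_bigr => p _; rewrite big_map; apply: eq_bigr => r _.
    by rewrite /= ka.
  have := kfun_psd k (as_ ++ t); rewrite kformCl !kformCr E2 (kformC k t) E.
  by congr (_ <= _); rewrite !mul1r; ring.
by exists U => x; apply: vext => y; rewrite hU vip.
Qed.

(** * The real full group C*-algebra by a universal GNS representation *)

Section FullGroupCstar.
Variables (R : realType) (G : groupType) (H2 : realHilbert R) (rho : G -> BH H2).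
Hypothesis rhoP : unitary_rep rho.

Record pdfun := PdFun { pdval :> G -> R;
  pd_psd : forall s, 0 <= kform (fun g h => pdval (h^-1 * g)%g) s s;
  pd_sym : forall g, pdval (g^-1)%g = pdval g }.
HB.instance Definition _ := gen_eqMixin pdfun.
HB.instance Definition _ := gen_choiceMixin pdfun.

(** Points of the universal representation: one GNS summand per positive definite function, which
    keeps the sum over a set, and a summand [H2] carrying the given representation. *)
Let X := (pdfun * G + H2)%type.
Definition gns_label (x : X) : option pdfun := if x is inl p then Some p.1 else None.
Definition gns_fun (x y : X) : R := match x, y with
  | inl p, inl q => if p.1 == q.1 then p.1 (q.2^-1 * p.2)%g else 0
  | inr xi, inr eta => inner H2 xi eta
  | _, _ => 0 end.
Definition gns_act (g : G) (x : X) : X := match x with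
  | inl p => inl (p.1, g * p.2)%g | inr xi => inr (rho g xi) end.

Lemma gns_funC x y : gns_fun x y = gns_fun y x.
Proof.
case: x y => [[p g]|xi] [[q h]|eta]//=; last exact: ipC.
by rewrite eq_sym; case: eqP => // ->; rewrite -pd_sym invgM invgK.
Qed.

Lemma gns_psd s : 0 <= kform gns_fun s s.
Proof.
apply: (direct_sum_psd (l := gns_label)) => [[[p g]|xi] [[q h]|eta]//= /negPf pq|[p|] {}s /allP hs].
- by have /negPf -> : p != q by apply/negP => /eqP pq'; rewrite pq' eqxx in pq.
- have := pd_psd p [seq (r.1, if r.2 is inl q then q.2 else 1%g) | r <- s].
  congr (_ <= _); rewrite /kform big_map big_seq [RHS]big_seq; apply: eq_bigr => r rs.
  rewrite big_map big_seq [RHS]big_seq; apply: eq_bigr => t ts; congr (_ * _).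
  move: (hs _ rs) (hs _ ts); case: r.2 t.2 => [[q g]|]//= [[q' h]|]//= /eqP[->] /eqP[->].
  by rewrite eqxx.
- have := ip_ge0 (\sum_(r <- s) r.1 *: (if r.2 is inr xi then xi else 0)).
  congr (_ <= _); rewrite ip_suml big_seq [RHS]big_seq; apply: eq_bigr => r rs.
  rewrite ip_sumr big_seq [RHS]big_seq; apply: eq_bigr => t ts; rewrite ipZl ipZr mulrA; congr (_ * _).
  by move: (hs _ rs) (hs _ ts); case: r.2 t.2 => [[q g]|xi]//= [[q' h]|eta].
Qed.

Definition gns_kernel : kernel R X := Kernel gns_funC gns_psd.

Lemma gns_invariant g x y : gns_kernel (gns_act g x) (gns_act g y) = gns_kernel x y.
Proof.
have [_ _ h] := rhoP; case: x y => [[p a]|xi] [[q b]|eta]//=.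
by rewrite invgM -mulgA mulKg.
Qed.

Lemma gns_actM g h x : gns_act (g * h)%g x = gns_act g (gns_act h x).
Proof. by have [_ m _] := rhoP; case: x => [[p a]|xi] /=; rewrite ?mulgA// m. Qed.

Lemma gns_act1 x : gns_act 1%g x = x.
Proof. by have [r1 _ _] := rhoP; case: x => [[p a]|xi] /=; rewrite ?mul1g// r1. Qed.

Lemma pdfun_of_rep (H : realHilbert R) (pi : G -> BH H) (xi : H) : unitary_rep pi ->
  exists p : pdfun, forall g h, p (h^-1 * g)%g = inner H (pi g xi) (pi h xi).
Proof.
move=> [pi1 piM piU]; pose f g := inner H (pi g xi) xi.
have fE g h : f (h^-1 * g)%g = inner H (pi g xi) (pi h xi).
  by rewrite /f -(piU h) -[bop (pi h) (bop _ _)]/(bopM (pi h) (pi (h^-1 * g)%g) xi) -piM mulVKg.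
have fpsd s : 0 <= kform (fun g h => f (h^-1 * g)%g) s s.
  have := ip_ge0 (\sum_(r <- s) r.1 *: pi r.2 xi); congr (_ <= _).
  rewrite ip_suml; apply: eq_bigr => r _; rewrite ip_sumr; apply: eq_bigr => t _.
  by rewrite ipZl ipZr mulrA fE.
have fsym g : f (g^-1)%g = f g.
  by have := fE 1%g g; rewrite mulg1 pi1 => ->; rewrite /f ipC.
by exists (PdFun fpsd fsym).
Qed.

Variables (H : realHilbert R) (v : X -> H) (u : G -> BH H).
Hypotheses (vP : kernel_rep gns_kernel v) (uE : forall g x, u g (v x) = v (gns_act g x)).

Lemma gns_uM g h : u (g * h)%g = bopM (u g) (u h).
Proof. by apply: (krep_bop_ext vP) => x y; rewrite /= !uE gns_actM. Qed.

Lemma gns_u1 : u 1%g = bop1 H.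
Proof. by apply: (krep_bop_ext vP) => x y; rewrite /= !uE gns_act1. Qed.

Lemma gns_uV g : adjoint (u g) = u (g^-1)%g.
Proof.
apply: (krep_bop_ext vP) => x y; rewrite -adjointPr !uE !(krep_ip vP).
by rewrite -(gns_invariant g (gns_act _ x)) -gns_actM mulgV gns_act1.
Qed.

Lemma gns_unitary : unitary_rep u.
Proof.
split; [exact: gns_u1|exact: gns_uM|move=> g x y].
by rewrite adjointP gns_uV -[bop (u _) (bop _ _)]/(bopM (u g^-1)%g (u g) y) -gns_uM mulVg gns_u1.
Qed.

Definition gcomb (s : seq (R * G)) : BH H := \sum_(p <- s) p.1 *: u p.2.
Definition gclosure : set (BH H) :=
  [set T | forall e : R, 0 < e -> exists s, opnorm_le (T - gcomb s) e].

Lemma gclosure_closed T :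
  (forall e : R, 0 < e -> exists2 S, gclosure S & opnorm_le (T - S) e) -> gclosure T.
Proof.
move=> h e e0; have e2 : 0 < e / 2 by rewrite divr_gt0.
have [S hS TS] := h _ e2; have [s Ss] := hS _ e2; exists s.
by rewrite -(subrK S T) -addrA [e]splitr; exact: opnorm_leD.
Qed.

Lemma opnorm_le_00 (e : R) : 0 < e -> opnorm_le (0 : BH H) e.
Proof. by move=> e0; split=> [|w]; rewrite ?bop0E ?normr0 ?mulr_ge0// ltW. Qed.

Lemma gcomb_closure s : gclosure (gcomb s).
Proof. by move=> e e0; exists s; rewrite subrr; exact: opnorm_le_00. Qed.

Lemma gclosure_u g : gclosure (u g).
Proof. by have := @gcomb_closure [:: (1, g)]; rewrite /gcomb big_seq1 scale1r. Qed.

Lemma gclosure_lin a S T : gclosure S -> gclosure T -> gclosure (a *: S + T).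
Proof.
move=> hS hT e e0; have c0 : 0 < `|a| + 1 by rewrite ltr_wpDl.
have [s hs] := hS (e / 2 / (`|a| + 1)) (divr_gt0 (divr_gt0 e0 (ltr0Sn _ 1)) c0).
have [t ht] := hT (e / 2) (divr_gt0 e0 (ltr0Sn _ 1)).
exists ([seq (a * p.1, p.2) | p <- s] ++ t).
have -> : gcomb ([seq (a * p.1, p.2) | p <- s] ++ t) = a *: gcomb s + gcomb t.
  rewrite /gcomb big_cat big_map scaler_sumr; congr (_ + _).
  by apply: eq_bigr => p _; rewrite scalerA.
rewrite opprD addrACA -scalerBr [e]splitr; apply: opnorm_leD => //.
have [n0 hn] := opnorm_leZ a hs.
have le : `|a| * (e / 2 / (`|a| + 1)) <= e / 2.
  by rewrite mulrCA ger_pMr ?divr_gt0// ler_pdivrMr// mul1r lerDl.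
split=> [|w]; first by rewrite ltW ?divr_gt0.
by rewrite (le_trans (hn w))// ler_wpM2r.
Qed.

Lemma gclosure_star T : gclosure T -> gclosure (adjoint T).
Proof.
move=> hT e /hT[s hs]; exists [seq (p.1, p.2^-1)%g | p <- s].
suff <- : adjoint (T - gcomb s) = adjoint T - gcomb [seq (p.1, p.2^-1)%g | p <- s].
  exact: opnorm_le_adjoint.
have -> : T - gcomb s = -1 *: gcomb s + T by rewrite scaleN1r addrC.
rewrite adjointD adjointZ scaleN1r addrC; congr (_ - _).
have A0 : adjoint (0 : BH H) = 0 by apply: adjoint_uniq => x y; rewrite !bop0E ip0l ip0r.
elim: s {hs} => [|p s IH]; first by rewrite /gcomb !big_nil.
by move: IH; rewrite /gcomb /= !big_cons adjointD adjointZ gns_uV => ->.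
Qed.

Lemma gclosure_mul S T : gclosure S -> gclosure T -> gclosure (bopM S T).
Proof.
move=> hS hT; have [M M0 hM] := opnorm_exists T.
have uT g : gclosure (bopM (u g) T).
  apply: gclosure_closed => e /hT[s hs]; exists (bopM (u g) (gcomb s)).
    suff -> : bopM (u g) (gcomb s) = gcomb [seq (p.1, g * p.2)%g | p <- s] by exact: gcomb_closure.
    elim: s {hs} => [|p s IH]; first by rewrite /gcomb !big_nil; apply: bop_ext => x /=; rewrite bop0r.
    by move: IH; rewrite /gcomb /= !big_cons bopMDr bopMZr gns_uM => ->.
  have -> : bopM (u g) T - bopM (u g) (gcomb s) = bopM (u g) (T - gcomb s).
    by apply: bop_ext => x; rewrite /= bopDr bopNr.
  rewrite -[e]mul1r; apply: opnorm_leM hs; split=> // x.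
  by rewrite mul1r norm_le_ip// inner_norm; have [_ _ ->] := gns_unitary.
have sT s : gclosure (bopM (gcomb s) T).
  elim: s => [|p s IH].
    have -> : bopM (gcomb [::]) T = gcomb [::] by rewrite /gcomb big_nil; apply: bop_ext.
    exact: gcomb_closure.
  rewrite /gcomb big_cons bopMDl bopMZl; exact: gclosure_lin.
apply: gclosure_closed => e e0; have [s hs] := hS (e / M) (divr_gt0 e0 M0).
exists (bopM (gcomb s) T) => //.
have -> : bopM S T - bopM (gcomb s) T = bopM (S - gcomb s) T by apply: bop_ext => x.
by rewrite -(divfK (lt0r_neq0 M0) e); exact: opnorm_leM.
Qed.

Lemma gclosure_unit : gclosure (bop1 H).
Proof. by rewrite -gns_u1; exact: gclosure_u. Qed.

Definition gsub : bhsub H := BHSub gclosure_lin gclosure_star gclosure_unit.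
Definition gsys : mosys R := subsys gsub.
Definition gelt (g : G) : gsys := mkbhsub (A := gsub) (gclosure_u g).

Lemma bhval_sum (s : seq (R * G)) : bhval (\sum_(p <- s) p.1 *: gelt p.2) = gcomb s.
Proof.
by elim: s => [|p s IH]; rewrite /gcomb ?big_nil// !big_cons /= IH.
Qed.

Lemma gsys_full : is_full_group_cstar (@idfun R) G gsys.
Proof.
exists H, (@bhval _ _ gsub), gelt; split.
- by apply: subsys_cstar; [exact: gclosure_mul|exact: gclosure_closed].
- split=> [|g h|g]; first exact/val_inj/gns_u1.
    exact: gns_uM.
  by apply: val_inj; rewrite /= gns_uV.
- move=> a e /(bhsubP a)[s hs]; exists s.
  suff -> : bhval (a - \sum_(p <- s) p.1 *: gelt p.2) = bhval a - gcomb s by [].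
  by rewrite -bhval_sum.
- move=> s M; rewrite bhval_sum; split=> [[M0 hM] H' pi piP|]; last by apply; exact: gns_unitary.
  (* The norm of a combination at [xi] is computed in the summand of the positive definite function
     of [xi]. *)
  split=> // xi; have [p pE] := pdfun_of_rep xi piP; have [pi1 _ _] := piP.
  have := hM (v (inl (p, 1%g))); rewrite !norm_le_ip ?mulr_ge0//.
  rewrite !exprMn !inner_norm /gcomb !bop_sumE !ip_suml (krep_ip vP) /= eqxx pE pi1.
  congr (_ <= _); apply: eq_bigr => a _; rewrite !ip_sumr; apply: eq_bigr => b _.
  rewrite -[LHS]/(inner H (a.1 *: u a.2 (v (inl (p, 1%g)))) (b.1 *: u b.2 (v (inl (p, 1%g))))).
  rewrite -[RHS]/(inner H' (a.1 *: pi a.2 xi) (b.1 *: pi b.2 xi)).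
  by rewrite !ipZl !ipZr !uE (krep_ip vP) /= eqxx !mulg1 pE.
Qed.

(** [pi] is the compression to the summand [H2], on which the group acts by [rho]. *)
Lemma gsys_rep : exists pi : gsys -> BHsys H2, [/\ ucp pi, forall g, pi (gelt g) = rho g,
  forall g, isometric pi (gelt g) /\ isometric pi (ostar (gelt g)) &
  forall Z : BH H2, (forall g, bopM Z (rho g) = bopM (rho g) Z) -> forall c, bopM Z (pi c) = bopM (pi c) Z].
Proof.
have vlin a x y : v (inr (a *: x + y)) = a *: v (inr x) + v (inr y).
  apply: (krep_ext vP) => -[z|z]; rewrite ipDl ipZl !(krep_ip vP) /= ?mulr0 ?addr0//.
  by rewrite ipDl ipZl.
have vip x y : inner H (v (inr x)) (v (inr y)) = inner H2 x y by exact: (krep_ip vP).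
pose F (c : gsys) (x y : H2) := inner H (bop (bhval c) (v (inr y))) (v (inr x)).
have Hg : osys_ax gsys := opsys_ax (subsys_opsys gsub).
have [Fl Fp Fs] := ucp_form Hg (uco_ucp (subsys_uco gsub)).
have FP : pos_kernel F.
  split=> [x y a c d|P A xi hA|c x y]; [exact: Fl|exact: Fp hA|exact: Fs].
have [|||pi [upi piE]] := form_ucp Hg FP.
- by move=> c y a x x'; rewrite /F vlin ipDr ipZr.
- by move=> c x a y y'; rewrite /F vlin bopDr bopZr ipDl ipZl.
- by move=> x y; rewrite /F /= vip ipC.
have pig g : pi (gelt g) = rho g.
  by apply: bop_ip_ext => x y; rewrite piE /F /= uE vip.
have [rho1 rhoM rhoU] := rhoP.
have rhoV g : bopM (adjoint (rho g)) (rho g) = bop1 H2.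
  by apply: bop_ip_ext => x y; rewrite /= ipC -adjointP rhoU ipC.
have gV g : ostar (gelt g) = gelt (g^-1)%g by apply: val_inj; rewrite /= gns_uV.
have iso g : isometric pi (gelt g).
  exists (ounit gsys); last by rewrite upi.2 pig rhoV.
  apply/(co_pcone _ (subsys_uco gsub).1)/BHpcone.
  split=> [[] []|xi] /=; rewrite ?adjoint1 ?adjointK//.
  have [_ _ uU] := gns_unitary; rewrite !big_bool /=.
  suff : 0 <= inner H (xi true) (xi true) + inner H (u g (xi false)) (xi true) +
    (inner H (adjoint (u g) (xi true)) (xi false) + inner H (xi false) (xi false)) by exact.
  have := ip_ge0 (xi true + u g (xi false)); congr (_ <= _).
  by rewrite !ipDl !ipDr uU (ipC (adjoint _ _)) -adjointP (ipC (xi true)); ring.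
exists pi; split=> // [g|Z hZ c]; first by split; rewrite ?gV; exact: iso.
(* The commutant of one operator is norm closed, so commutation passes from combinations of group
   elements to their limits. *)
suff : commutant [set Z] (pi c) by move=> /(_ Z erefl).
apply: commutant_closed => e /(bhsubP c)[s hs].
have picomb : pi (\sum_(p <- s) p.1 *: gelt p.2) = \sum_(p <- s) p.1 *: rho p.2.
  elim: s {hs} => [|p s IH]; first by rewrite !big_nil (linear_zero upi.1.1).
  by rewrite !big_cons upi.1.1 IH pig.
exists (\sum_(p <- s) p.1 *: rho p.2).
  move=> _ ->; elim: s {hs picomb} => [|p s IH].
    by rewrite big_nil; apply: bop_ext => x /=; rewrite bop0r.
  by rewrite big_cons bopMDl bopMDr bopMZl bopMZr IH hZ.
rewrite -picomb; set y := \sum_(p <- s) _.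
have -> : pi c - pi y = pi (c - y).
  by rewrite (linear_add _ _ upi.1.1) (linear_opp _ upi.1.1).
have ec0 : 0 <= e by case: hs.
split=> // x; rewrite norm_le_ip ?mulr_ge0//; set w := pi (c - y) x.
have -> : w = pi (c - y) x by [].
have [_ hs2] := hs.
have E (z : H2) : inner H2 (pi (c - y) x) z = inner H (bop (bhval c - gcomb s) (v (inr x))) (v (inr z)).
  by rewrite piE /F -bhval_sum.
have h1 : `|w| ^+ 2 <= e * `|x| * `|w|.
  rewrite inner_norm /w E (le_trans (ler_norm _))// (le_trans (ip_norm_le _ _))//.
  have nv z : `|v (inr z)| = `|z|.
    by apply/eqP; rewrite -(@eqrXn2 _ 2)// ?inner_norm ?vip.
  by rewrite -(nv x) -(nv w) ler_wpM2r.
rewrite -inner_norm -/w; have [->|w0] := eqVneq `|w| 0; first by rewrite expr0n sqr_ge0.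
rewrite ler_pXn2r ?nnegrE ?mulr_ge0//.
by move: h1; rewrite expr2 ler_pM2r// lt_neqAle eq_sym w0 normr_ge0.
Qed.

End FullGroupCstar.

Theorem full_group_cstar_exists (R : realType) (G : groupType) (H2 : realHilbert R) (rho : G -> BH H2) :
  unitary_rep rho ->
  exists (C : mosys R) (u : G -> C) (pi : C -> BHsys H2), is_full_group_cstar (@idfun R) G C /\
  [/\ ucp pi, forall g, pi (u g) = rho g,
    forall g, isometric pi (u g) /\ isometric pi (ostar (u g)) &
    forall Z : BH H2, (forall g, bopM Z (rho g) = bopM (rho g) Z) -> forall c, bopM Z (pi c) = bopM (pi c) Z].
Proof.
move=> rhoP; have [H [v vP]] := kernel_hilbert (gns_kernel G H2).
have /choice[u uE] : forall g, exists U : BH H, forall x, U (v x) = v (gns_act rho g x).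
  by move=> g; apply: kernel_action vP _; exact: gns_invariant.
have [pi piP] := gsys_rep rhoP vP uE.
exists (gsys rhoP vP uE), (gelt rhoP vP uE), pi; split=> //.
exact: gsys_full.
Qed.

(** * Cayley transforms of skew operators *)

Section Cayley.
Variables (R : realType) (H : realHilbert R) (k : BH H).
Hypothesis kskew : adjoint k = - k.

Let kip x y : inner H (k x) y = - inner H x (k y).
Proof. by rewrite adjointP kskew bopNE ipNr. Qed.

Let k_id x : inner H (x + k x) x = inner H x x.
Proof. by rewrite ipDl; have := kip x x; rewrite (ipC x (k x)); lra. Qed.

(** For skew [k] the form of [(1 + k) x] against [x] is the squared norm of [x], so [1 + k] is
    injective. Surjectivity is Lax-Milgram for the form [q], which pairs [(1 + k) x] with
    [(1 + k) y]. *)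
Lemma skew_inverse : exists B : BH H, forall x, B x + k (B x) = x /\ B (x + k x) = x.
Proof.
pose q x y := inner H x y + inner H (k x) (k y).
have qE x y : q x y = inner H (x + k x) (y + k y).
  by rewrite /q ipDl !ipDr (kip x y); ring.
have [M M0 hM] := bop_bounded k.
have qpsd : psd_form q.
  split=> [a x y z|x y|x]; last by rewrite /q addr_ge0 ?ip_ge0.
    by rewrite /q bopDr bopZr !ipDl !ipZl; ring.
  by rewrite /q (ipC x y) (ipC (k x)).
have ql x : `|x| ^+ 2 <= q x x by rewrite inner_norm lerDl ip_ge0.
have qu x : q x x <= (1 + M ^+ 2) * `|x| ^+ 2.
  rewrite /q -!inner_norm mulrDl mul1r lerD2l -exprMn ler_pXn2r ?nnegrE ?mulr_ge0//.
have inj x y : x + k x = y + k y -> x = y.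
  move=> xy; apply/eqP; rewrite -subr_eq0; apply/eqP/ip_eq0; rewrite -k_id.
  by rewrite bopDr bopNr addrACA -opprD xy subrr ip0l.
have /choice[B hB] : forall y, exists z, z + k z = y.
  move=> y; have [a x x'|x|z hz] := @lax_milgram R H q _ ((1 + M) * `|y|) (fun x => inner H (x + k x) y) qpsd ql qu.
  - by rewrite bopDr bopZr addrACA -scalerDr ipDl ipZl.
  - rewrite (le_trans (ip_norm_le _ _))// mulrAC ler_wpM2r// (le_trans (ler_normD _ _))//.
    by rewrite mulrDl mul1r lerD2l.
  exists z; apply/eqP; rewrite -subr_eq0 -oppr_eq0 opprB; apply/eqP/ip_eq0.
  by rewrite -k_id ipDr ipNr hz qE subrr.
have Blin : linear B.
  by move=> a x y; apply: inj; rewrite hB bopDr bopZr addrACA -scalerDr !hB.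
have Bb : exists N : R, forall x, `|B x| <= N * `|x|.
  exists 1 => x; rewrite mul1r -(@ler_pXn2r _ 2)// ?nnegrE//.
  by rewrite (le_trans (ql _))// qE hB inner_norm.
exists (mkbop Blin Bb) => x; split; first exact: hB.
by apply: inj; rewrite hB.
Qed.

End Cayley.

(** [U] is the Cayley transform [(1 - k) (1 + k)^-1], written as twice the resolvent minus 1, and
    [V] is its inverse. Recovering the resolvent from [U] shows that commuting with [U] implies
    commuting with [k]. *)
Lemma cayley (R : realType) (H : realHilbert R) (k : BH H) : adjoint k = - k ->
  exists U V : BH H, [/\ forall x y, inner H (U x) (U y) = inner H x y,
      forall x y, inner H (V x) (V y) = inner H x y, bopM U V = bop1 H /\ bopM V U = bop1 H,
      forall Z, bopM Z k = bopM k Z -> bopM Z U = bopM U Z /\ bopM Z V = bopM V Z &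
      forall Z, bopM Z U = bopM U Z -> bopM Z k = bopM k Z].
Proof.
move=> ks; have kip x y : inner H (k x) y = - inner H x (k y) by rewrite adjointP ks bopNE ipNr.
have iso z w : inner H (z - k z) (w - k w) = inner H (z + k z) (w + k w).
  by rewrite !ipDl !ipDr !ipNl !ipNr (kip z w); ring.
have ks' : adjoint (- k) = - - k by rewrite -[in LHS]scaleN1r adjointZ ks scaleN1r.
have [B hB] := skew_inverse ks; have [B' hB'] := skew_inverse ks'.
pose U := 2 *: B - bop1 H; pose V := 2 *: B' - bop1 H.
have two (x : H) : (2 : R) *: x = x + x by rewrite -[2]/(1 + 1 : R) scalerDl scale1r.
have UE z : U (z + k z) = z - k z.
  by rewrite /U bopDE bopNE bopZE (hB z).2 two opprD addrA addrK.
have VE z : V (z - k z) = z + k z.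
  by rewrite /V bopDE bopNE bopZE (hB' z).2 two /= opprB addrA addrAC addrK addrC.
have BE x : exists z, x = z + k z by exists (B x); rewrite (hB x).1.
have BE' x : exists z, x = z - k z by exists (B' x); have [/esym] := hB' x.
exists U, V; split.
- by move=> x y; have [[z ->] [w ->]] := (BE x, BE y); rewrite !UE iso.
- by move=> x y; have [[z ->] [w ->]] := (BE' x, BE' y); rewrite !VE iso.
- split; apply: bop_ext => x.
    by have [z ->] := BE' x; rewrite -[LHS]/(U (V _)) VE UE.
  by have [z ->] := BE x; rewrite -[LHS]/(V (U _)) UE VE.
- move=> Z hZ; have hk x : Z (k x) = k (Z x) by have /(congr1 (fun T : BH H => T x)) := hZ.
  have Zp z : Z (z + k z) = Z z + k (Z z) by rewrite bopDr hk.
  have Zm z : Z (z - k z) = Z z - k (Z z) by rewrite bopDr bopNr hk.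
  split; apply: bop_ext => x.
    by have [z ->] := BE x; rewrite -[LHS]/(Z (U _)) -[RHS]/(U (Z _)) UE Zm Zp UE.
  by have [z ->] := BE' x; rewrite -[LHS]/(Z (V _)) -[RHS]/(V (Z _)) VE Zm Zp VE.
- move=> Z hZ; have hU x : Z (U x) = U (Z x) by have /(congr1 (fun T : BH H => T x)) := hZ.
  have ZB x : Z (B x) = B (Z x).
    have := hU x; rewrite /U !bopDE !bopNE !bopZE bopDr bopNr bopZr => /addIr.
    by move=> /(scalerI (lt0r_neq0 (ltr0Sn _ 1))).
  apply: bop_ext => x /=; apply: (addrI (Z x)).
  by rewrite -bopDr; have [] := hB (Z (x + k x)); rewrite -ZB (hB x).2.
Qed.

(** * Representations of the free group from invertible isometries *)

Section FreeGroupRep.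
Variables (R : realType) (X : choiceType) (H : realHilbert R) (U V : X -> BH H).
Hypotheses (UI : forall n x y, inner H (U n x) (U n y) = inner H x y)
  (VI : forall n x y, inner H (V n x) (V n y) = inner H x y)
  (UV : forall n, bopM (U n) (V n) = bop1 H) (VU : forall n, bopM (V n) (U n) = bop1 H).

Definition letter_op (a : X * bool) : BH H := if a.2 then V a.1 else U a.1.
Definition word_op (s : seq (X * bool)) : BH H := foldr (fun a T => bopM (letter_op a) T) (bop1 H) s.

Lemma word_op_push a s : word_op (push a s) = bopM (letter_op a) (word_op s).
Proof.
case: s => [|b s] //=; case: eqP => [->|] //.
rewrite bopMA; suff -> : bopM (letter_op a) (letter_op (flip_letter a)) = bop1 H by apply: bop_ext.
by case: a => n [] /=; rewrite /letter_op /= ?UV ?VU.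
Qed.

Lemma free_group_rep : exists rho : free_group X -> BH H, [/\ unitary_rep rho,
  forall n, rho (FreeGroup (isT : reduced [:: (n, false)])) = U n &
  forall Z, (forall n, bopM Z (U n) = bopM (U n) Z /\ bopM Z (V n) = bopM (V n) Z) ->
    forall g, bopM Z (rho g) = bopM (rho g) Z].
Proof.
exists (fun g => word_op (word g)); split.
- split=> // [g h|[s rs] /= x y].
    rewrite -[word (g * h)%g]/(foldr (@push X) (word h) (word g)).
    elim: (word g) => [|a s IH] /=; first by apply: bop_ext.
    by rewrite word_op_push IH bopMA.
  by elim: s {rs} => //= -[n []] s IH; rewrite /= ?VI ?UI.
- by move=> n; apply: bop_ext.
- move=> Z hZ [s rs] /=; elim: s {rs} => [|[n b] s IH] /=; first by apply: bop_ext.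
  have [hU hV] := hZ n; have hl : bopM Z (letter_op (n, b)) = bopM (letter_op (n, b)) Z by case: b.
  by rewrite bopMA hl -bopMA IH bopMA.
Qed.

End FreeGroupRep.

(* H + H as the kernel Hilbert space of H * bool, with the skew operators [0 a; -a* 0]. *)
Section Doubling.
Variables (R : realType) (S : mosys R) (HS : osys_ax S) (H : realHilbert R) (f : S -> BHsys H).
Hypothesis uf : ucp f.

Let X := (H * bool)%type.
Definition dbl_fun (s : S) (x y : X) : R := if x.2 == y.2 then inner H (bop (f s) y.1) x.1 else 0.

Lemma dbl_pos : pos_kernel dbl_fun.
Proof.
have [Fl Fp Fs] := ucp_form HS uf; split.
- by move=> x y a v w; rewrite /dbl_fun; case: ifP => _; rewrite ?mulr0 ?addr0//; exact: Fl.
- move=> P A xi hA; pose xib b i := if (xi i).2 == b then (xi i).1 else 0.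
  suff -> : \sum_i \sum_j dbl_fun (A i j) (xi i) (xi j) =
    \sum_b \sum_i \sum_j inner H (bop (f (A i j)) (xib b j)) (xib b i).
    by apply: sumr_ge0 => b _; exact: Fp.
  rewrite [RHS]exchange_big; apply: eq_bigr => i _; rewrite [RHS]exchange_big; apply: eq_bigr => j _.
  rewrite big_bool /= /dbl_fun /xib; case: (xi i) (xi j) => [x b] [y c] /=.
  by case: b c => [] [] /=; rewrite ?bop0r ?ip0l ?ip0r ?addr0 ?add0r.
- by move=> s [x b] [y c]; rewrite /dbl_fun /= eq_sym; case: ifP => // _; exact: Fs.
Qed.

(** [K a] is skew whatever [a] is, so a Cayley transform is available for every operator of the
    commutant. [D a] is the diagonal copy of [a], used for complexifying. *)
Lemma doubling : exists (H2 : realHilbert R) (v : bool -> H -> H2) (f2 : S -> BHsys H2) (K D : BH H -> BH H2),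
  [/\ [/\ ucp f2, forall b, linear (v b),
      forall b c x y, inner H2 (v b x) (v c y) = if b == c then inner H x y else 0,
      forall h, exists x y, h = v true x + v false y &
      forall s b x, bop (f2 s) (v b x) = v b (bop (f s) x)],
    [/\ forall a, adjoint (K a) = - K a, forall a x, K a (v false x) = v true (a x) &
      forall a x, K a (v true x) = - v false (adjoint a x)],
    forall a b x, D a (v b x) = v b (a x) &
    forall s a, bopM (f s) a = bopM a (f s) -> bopM (f s) (adjoint a) = bopM (adjoint a) (f s) ->
      bopM (f2 s) (K a) = bopM (K a) (f2 s)].
Proof.
have [H2 [w [f2 [uf2 wP f2E]]]] := kolmogorov HS dbl_pos.
have [wip wext _] := wP; have f1 := uf.2.
pose K0 := unit_kernel HS dbl_pos; have K0E x y : K0 x y = if x.2 == y.2 then inner H y.1 x.1 else 0.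
  by rewrite /K0 /= /dbl_fun f1.
pose pr b (s : seq (R * X)) : H := \sum_(p <- s) p.1 *: (if p.2.2 == b then p.2.1 else 0).
have prE b c s t (T : BH H) : inner H (T (pr b s)) (pr c t) = \sum_(p <- s) \sum_(r <- t)
    p.1 * r.1 * (if (p.2.2 == b) && (r.2.2 == c) then inner H (T p.2.1) r.2.1 else 0).
  rewrite /pr bop_sumr ip_suml; apply: eq_bigr => p _; rewrite ip_sumr; apply: eq_bigr => r _.
  rewrite bopZr ipZl ipZr mulrA; congr (_ * _).
  by do 2 case: eqP => _ /=; rewrite ?bop0r ?ip0l ?ip0r.
have kE s t : kform K0 s t = inner H (pr true s) (pr true t) + inner H (pr false s) (pr false t).
  have := prE true true s t (bop1 H); have := prE false false s t (bop1 H) => /= -> ->.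
  rewrite -[RHS]big_split; apply: eq_bigr => p _; rewrite -[RHS]big_split; apply: eq_bigr => r _.
  rewrite /= -mulrDr; congr (_ * _); rewrite /dbl_fun f1 /= (ipC r.2.1).
  by case: p.2.2 r.2.2 => [] []; rewrite ?addr0 ?add0r.
pose bK (a : BH H) (x y : X) : R := match x.2, y.2 with
  | false, true => inner H (a x.1) y.1 | true, false => - inner H (adjoint a x.1) y.1 | _, _ => 0 end.
have bKE a s t : kform (bK a) s t = inner H (a (pr false s)) (pr true t) - inner H (adjoint a (pr true s)) (pr false t).
  have -> : - inner H (adjoint a (pr true s)) (pr false t) = inner H ((- adjoint a) (pr true s)) (pr false t).
    by rewrite bopNE ipNl.
  rewrite !prE -big_split; apply: eq_bigr => p _; rewrite -big_split; apply: eq_bigr => r _.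
  rewrite /= -mulrDr; congr (_ * _); rewrite /bK.
  by case: p.2.2 r.2.2 => [] []; rewrite /= ?addr0 ?add0r ?bopNE ?ipNl.
have /choice[K hK] : forall a, exists T : BH H2, forall x y, inner H2 (T (w x)) (w y) = bK a x y.
  move=> a; have [M M0 hM] := bop_bounded a.
  apply: (krep_op wP M0) => s t; rewrite !kE bKE (ipC (adjoint a _)) -adjointP.
  set s1 := pr true s; set s2 := pr false s; set t1 := pr true t; set t2 := pr false t.
  have h x y : `|inner H (a x) y| <= M * (`|x| * `|y|).
    by rewrite (le_trans (ip_norm_le _ _))// mulrA ler_wpM2r.
  have := h s2 t1; have := h t2 s1; rewrite !ler_norml => /andP[_ h1] /andP[h2 _].
  rewrite -!inner_norm.
  have := mulr_ge0 M0 (sqr_ge0 (`|s2| - `|t1|)); have := mulr_ge0 M0 (sqr_ge0 (`|t2| - `|s1|)).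
  rewrite !sqrrB; lra.
have /choice[D hD] : forall a : BH H, exists T : BH H2, forall x y, inner H2 (T (w x)) (w y) =
    if x.2 == y.2 then inner H (a x.1) y.1 else 0.
  move=> a; have [M M0 hM] := bop_bounded a.
  apply: (krep_op wP M0 (b := fun x y : X => if x.2 == y.2 then inner H (a x.1) y.1 else 0)) => s t.
  have -> : kform (fun x y : X => if x.2 == y.2 then inner H (a x.1) y.1 else 0) s t =
      inner H (a (pr true s)) (pr true t) + inner H (a (pr false s)) (pr false t).
    rewrite !prE -[RHS]big_split; apply: eq_bigr => p _; rewrite -[RHS]big_split; apply: eq_bigr => r _.
    rewrite /= -mulrDr; congr (_ * _).
    by case: p.2.2 r.2.2 => [] []; rewrite /= ?addr0 ?add0r.
  rewrite !kE; set s1 := pr true s; set s2 := pr false s; set t1 := pr true t; set t2 := pr false t.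
  have h x y : `|inner H (a x) y| <= M * (`|x| * `|y|).
    by rewrite (le_trans (ip_norm_le _ _))// mulrA ler_wpM2r.
  have := h s1 t1; have := h s2 t2; rewrite !ler_norml => /andP[h1 _] /andP[h2 _].
  rewrite -!inner_norm.
  have := mulr_ge0 M0 (sqr_ge0 (`|s2| - `|t2|)); have := mulr_ge0 M0 (sqr_ge0 (`|s1| - `|t1|)).
  rewrite !sqrrB; lra.
exists H2, (fun b x => w (x, b)), f2, K, D.
have Kf a x : K a (w (x, false)) = w (a x, true).
  by apply: wext => -[y []]; rewrite hK wip -/K0 K0E /bK /= ?(ipC y).
have Kt a x : K a (w (x, true)) = - w (adjoint a x, false).
  by apply: wext => -[y []]; rewrite hK ipNl wip -/K0 K0E /bK /= ?oppr0 ?(ipC y).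
have f2w s x b : f2 s (w (x, b)) = w (bop (f s) x, b).
  by apply: wext => -[y c]; rewrite f2E wip -/K0 K0E /dbl_fun /= eq_sym; case: eqP => // _; rewrite ipC.
have Ks a : adjoint (K a) = - K a.
  apply: (krep_bop_ext wP) => -[x b] [y c]; rewrite -adjointPr bopNE ipNl ipC !hK /bK.
  case: b c => [] []; rewrite /= ?oppr0 ?opprK//; first by rewrite adjointP ipC.
  by congr (- _); rewrite ipC -adjointP.
have wlin b : linear (fun x => w (x, b)).
  move=> a x y; apply: wext => -[z c]; rewrite ipDl ipZl !wip -/K0 !K0E /=; case: eqP => _; last by rewrite mulr0 addr0.
  by rewrite ipDr ipZr.
have wwE x b y c : inner H2 (w (x, b)) (w (y, c)) = if b == c then inner H x y else 0.
  by rewrite wip -/K0 K0E /= ipC.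
have part b h : exists x, forall y, inner H2 h (w (y, b)) = inner H x y.
  have [a y z|y|x hx] := @riesz R H `|h| (fun y => inner H2 h (w (y, b))); last by exists x => y; rewrite hx ipC.
    by rewrite wlin ipDr ipZr.
  rewrite (le_trans (ip_norm_le _ _))// ler_wpM2l//.
  by rewrite norm_le_ip// wwE eqxx inner_norm.
split.
- split=> // h.
  have [[x hx] [y hy]] := (part true h, part false h); exists x, y.
  by apply: wext => -[z []]; rewrite ?hx ?hy ipDl !wwE /= ?addr0 ?add0r.
- by split.
- by move=> a b x; apply: wext => -[y c]; rewrite hD wwE.
- move=> s a ha ha'.
  have h x : f s (a x) = a (bop (f s) x) by have /(congr1 (fun T : BH H => T x)) := ha.
  have h' x : f s (adjoint a x) = adjoint a (bop (f s) x) by have /(congr1 (fun T : BH H => T x)) := ha'.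
  apply: (krep_bop_ext wP) => -[x b] y; congr (inner H2 _ _) => /=.
  by case: b; rewrite f2w ?Kf ?Kt ?bopNr f2w ?h ?h'.
Qed.

End Doubling.

(** * The DCEP from tensor products with the full group C*-algebra *)

Section FreeGroupDCEP.
Variables (R : realType) (S : mosys R) (oS : is_opsys (@idfun R) S).
Hypothesis el_max : forall C : mosys R, is_full_group_cstar (@idfun R) (free_group nat) C ->
  forall (I : mosys R) (j : S -> I), is_injenv (@idfun R) j ->
  forall n : nat, @el_cone R S I j C n = @max_cone R S C n.
Let HS := opsys_ax oS.

Lemma full_group_cstar_opsys (C : mosys R) (G : groupType) : is_full_group_cstar (@idfun R) G C ->
  is_opsys (@idfun R) C.
Proof. by move=> [H [f [u [fP _ _ _]]]]; exact: cstar_opsys fP. Qed.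

Variables (I : mosys R) (j : S -> I) (ij : is_injenv (@idfun R) j).
Variables (H : realHilbert R) (f : S -> BHsys H) (uf : uco_embedding f).

(** The Cayley transforms of the [K (a n)] are images of the free generators. The extension given by
    [commuting_extension] commutes with them, hence with the [K (a n)], and is compressed to one
    copy of [H]. *)
Lemma commuting_sequence (a : nat -> BH H) :
  (forall n, commutant (range f) (a n)) -> a 0%N = bop1 H ->
  exists g : I -> BHsys H, [/\ ucp g, forall s, g (j s) = f s &
    forall n x, bopM (g x) (a n) = bopM (a n) (g x)].
Proof.
move=> ac a0; have fs s : f (ostar s) = adjoint (f s) by have [[]] := uf.
have [oI _ uj _] := ij; have HI := opsys_ax oI.
have [H2 [v [f2 [K [_ [[uf2 vl vipbc _ f2v] [Ks Kf Kt] _ Kcomm]]]]]] := doubling HS (uco_ucp uf).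
have vip b x y : inner H2 (v b x) (v b y) = inner H x y by rewrite vipbc eqxx.
have f2K s n : bopM (f2 s) (K (a n)) = bopM (K (a n)) (f2 s).
  have h : bopM (f s) (a n) = bopM (a n) (f s) by rewrite ac//; exists s.
  apply: Kcomm => //; have := ac n (f (ostar s)) (ex_intro2 _ _ _ Logic.I erefl).
  by rewrite fs => /(congr1 (@adjoint _ _ H)); rewrite !adjointM adjointK.
have /choice[U hU] : forall n, exists U : BH H2, exists V : BH H2, [/\ forall x y, inner H2 (U x) (U y) = inner H2 x y,
      forall x y, inner H2 (V x) (V y) = inner H2 x y, bopM U V = bop1 H2 /\ bopM V U = bop1 H2,
      forall Z, bopM Z (K (a n)) = bopM (K (a n)) Z -> bopM Z U = bopM U Z /\ bopM Z V = bopM V Z &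
      forall Z, bopM Z U = bopM U Z -> bopM Z (K (a n)) = bopM (K (a n)) Z].
  by move=> n; have [U [V h]] := cayley (Ks (a n)); exists U, V.
have {hU}/choice[V hV] := hU.
have [||||rho [rhoP rhoU rhoZ]] := @free_group_rep R nat H2 U V.
1-4: by move=> n; have [? ? [? ?] _ _] := hV n.
have [C [u [pi [fullC [upi piu iso piZ]]]]] := full_group_cstar_exists rhoP.
have oC := full_group_cstar_opsys fullC; have HC := opsys_ax oC.
have comm s c : bopM (f2 s) (pi c) = bopM (pi c) (f2 s).
  by apply: piZ => g; apply: rhoZ => n; have [_ _ _ h _] := hV n; apply: h.
have [n x hx|g [ug gj gc]] := commuting_extension HS HI HC uj uf2 upi comm.
  rewrite -(el_max fullC ij) /el_cone /=.
  by apply: (pD_max HI HC); apply: eq_pD hx => i k; rewrite mxE.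
have gK n x : bopM (g x) (K (a n)) = bopM (K (a n)) (g x).
  have [_ _ _ _] := hV n; apply; rewrite -(rhoU n) -piu.
  by have [h1 h2] := iso (FreeGroup (isT : reduced [:: (n, false)])); exact: gc.
have gKv n x y : g x (K (a n) y) = K (a n) (bop (g x) y).
  by have /(congr1 (fun T : BH H2 => T y)) := gK n x.
have Kip n x y : inner H2 (K (a n) x) y = - inner H2 x (K (a n) y).
  by rewrite adjointP Ks bopNE ipNr.
pose F (x : I) (y z : H) := inner H2 (bop (g x) (v true z)) (v true y).
have [Fl Fp Fs] := ucp_form HI ug.
have FP : pos_kernel F by split=> [y z b s t|P A xi hA|c y z]; [exact: Fl|exact: Fp hA|exact: Fs].
have [|||g1 [ug1 g1E]] := form_ucp HI FP.
- by move=> c y b x x'; rewrite /F vl ipDr ipZr.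
- by move=> c x b y y'; rewrite /F vl bopDr bopZr ipDl ipZl.
- by move=> x y; rewrite /F ug.2 /= vip ipC.
exists g1; split=> // [s|n x].
  by apply: bop_ip_ext => y z; rewrite g1E /F gj f2v vip.
have A1 : adjoint (a 0%N) = bop1 H by rewrite a0 adjoint1.
(* Since [a 0] is the identity, [K (a 0)] swaps the two copies of [H] up to sign, so [g x] has equal
   diagonal corners. Commutation with [K (a n)] then becomes commutation of the corner with
   [a n]. *)
have Jf y : v true y = K (a 0%N) (v false y) by rewrite Kf a0.
have same y z : inner H2 (g x (v false y)) (v false z) = inner H2 (g x (v true y)) (v true z).
  by rewrite (Jf y) (Jf z) gKv Kip -(Jf z) Kt A1 ipNr opprK.
apply: bop_ip_ext => y z.
rewrite -[bop (bopM (g1 x) _) y]/(g1 x (a n y)) -[bop (bopM (a n) _) y]/(a n (bop (g1 x) y)).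
by rewrite [in RHS]adjointP !g1E /F -(Kf (a n) y) gKv Kip Kt ipNr opprK same.
Qed.

(** The free group handles only a sequence at a time; an ultralimit over finite lists of operators
    reaches the whole commutant. *)
Lemma el_max_DCEP_map : exists2 g : I -> BHsys H, ucp g &
  (forall x, g (j x) = f x) /\ (forall y, commutant (commutant (range f)) (g y)).
Proof.
have [oI _ uj _] := ij; have HI := opsys_ax oI; pose N := commutant (range f).
have N1 : N (bop1 H) by exact: commutant1.
(* The sequence starts with 1, as [commuting_sequence] requires, runs through the members of [s] in
   the commutant, and is 1 from then on. *)
pose a (s : seq (BH H)) n : BH H := nth (bop1 H) (bop1 H :: [seq T <- s | `[< N T >]]) n.
have aN s n : N (a s n).
  rewrite /a; case: (ltnP n (size (bop1 H :: [seq T <- s | `[< N T >]]))) => hn; last by rewrite nth_default.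
  have := mem_nth (bop1 H) hn; rewrite inE => /orP[/eqP ->//|].
  by rewrite mem_filter => /andP[/asboolP].
have /choice[gs hgs] : forall s, exists g : I -> BHsys H, [/\ ucp g, forall s, g (j s) = f s &
    forall n x, bopM (g x) (a s n) = bopM (a s n) (g x)].
  by move=> s; apply: commuting_sequence => // n; exact: aN.
have [|g [ug gE gE']] := ulim_ucp HI (gs := gs) (finite_sets_filter (BH H)); first by move=> s; case: (hgs s).
exists g => //; split=> [s|y T NT].
  apply: bop_ip_ext => x z.
  have h x' z' : inner H (bop (g (j s)) x') z' <= inner H (bop (f s) x') z'.
    by apply: gE'; exists [::] => t _ /=; have [_ -> _] := hgs t.
  by apply/eqP; rewrite eq_le h /=; have := h x (- z); rewrite !ipNr lerN2.
apply: bop_ip_ext => x z.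
rewrite -[bop (bopM (g y) T) x]/(g y (T x)) -[bop (bopM T (g y)) x]/(T (bop (g y) x)).
rewrite [RHS]adjointP; apply: gE; exists [:: T] => t tT /=.
have [n an] : exists n, a t n = T.
  have Tt : T \in [seq T <- t | `[< N T >]].
    by rewrite mem_filter (tT T) ?inE// andbT; apply/asboolP.
  by exists (index T [seq T <- t | `[< N T >]]).+1; rewrite /a /= nth_index.
rewrite -adjointP; have [_ _ /(_ n y)] := hgs t.
by rewrite an => /(congr1 (fun Z : BH H => Z x)) /= ->.
Qed.

End FreeGroupDCEP.

Lemma el_max_DCEP (R : realType) (S : mosys R) : is_opsys (@idfun R) S ->
  (forall C : mosys R, is_full_group_cstar (@idfun R) (free_group nat) C ->
  forall (I : mosys R) (j : S -> I), is_injenv (@idfun R) j ->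
  forall n : nat, @el_cone R S I j C n = @max_cone R S C n) -> DCEP (@idfun R) S.
Proof. by move=> oS hd I j ij H f uf; exact: el_max_DCEP_map. Qed.

(** * Real parts and positivity of complex numbers *)

Section ComplexNumbers.
Variable R : realType.
Implicit Types (z w : R[i]) (a : R).
Local Open Scope complex_scope.

Lemma RecD z w : complex.Re (z + w) = complex.Re z + complex.Re w.
Proof. by case: z w => [a b] [c d]. Qed.
Lemma RecN z : complex.Re (- z) = - complex.Re z.
Proof. by case: z. Qed.
Lemma RecZ a z : complex.Re (a%:C * z) = a * complex.Re z.
Proof. by case: z => [b c] /=; rewrite mul0r subr0. Qed.
Lemma RecJ z : complex.Re z^* = complex.Re z.
Proof. by case: z. Qed.
Lemma ImcE z : complex.Im z = - complex.Re ('i * z).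
Proof. by case: z => b c /=; rewrite mul0r mul1r sub0r opprK. Qed.
Lemma cge0P z : reflect (exists2 a, 0 <= a & z = a%:C) (0 <= z).
Proof.
rewrite lecE /=; apply: (iffP andP) => [[/eqP zi zr]|[a a0 ->]] //.
by exists (complex.Re z) => //; case: z zi {zr} => b c /= ->.
Qed.
Lemma cgt0P z : reflect (exists2 a, 0 < a & z = a%:C) (0 < z).
Proof.
rewrite ltcE /=; apply: (iffP andP) => [[/eqP zi zr]|[a a0 ->]] //.
by exists (complex.Re z) => //; case: z zi {zr} => b c /= ->.
Qed.
Lemma normc_real a : `|a%:C| = `|a|%:C.
Proof. by rewrite normc_def /= expr0n /= addr0 sqrtr_sqr. Qed.

End ComplexNumbers.

(** * The real Hilbert space underlying a complex one *)

Section RealHilbert.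
Variables (R : realType) (H : hilbertType (@conjc R)).
Local Open Scope complex_scope.

Definition realH : Type := H.
HB.instance Definition _ := GRing.Zmodule.copy realH (H : Type).

Definition realH_scale (a : R) (x : realH) : realH := a%:C *: (x : H).
Lemma realH_scaleA a b x : realH_scale a (realH_scale b x) = realH_scale (a * b) x.
Proof. by rewrite /realH_scale scalerA rmorphM. Qed.
Lemma realH_scale1 : left_id 1 realH_scale.
Proof. by move=> x; rewrite /realH_scale rmorph1 scale1r. Qed.
Lemma realH_scaleDr : right_distributive realH_scale +%R.
Proof. by move=> a x y; rewrite /realH_scale scalerDr. Qed.
Lemma realH_scaleDl x : {morph realH_scale^~ x : a b / a + b}.
Proof. by move=> a b; rewrite /realH_scale rmorphD scalerDl. Qed.
HB.instance Definition _ := GRing.Zmodule_isLmodule.Build R realH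
  realH_scaleA realH_scale1 realH_scaleDr realH_scaleDl.

Definition realH_norm (x : realH) : R := complex.Re `|x : H|.
Lemma realH_normE x : `|x : H| = (realH_norm x)%:C.
Proof. by rewrite /realH_norm; have /cge0P[a _ ->] := normr_ge0 (x : H). Qed.
Lemma realH_normD x y : realH_norm (x + y) <= realH_norm x + realH_norm y.
Proof. by have := ler_normD (x : H) y; rewrite !realH_normE -rmorphD lecR. Qed.
Lemma realH_normZ a x : realH_norm (a *: x) = `|a| * realH_norm x.
Proof.
by have := normrZ a%:C (x : H); rewrite !realH_normE normc_real -rmorphM => /complexI.
Qed.
Lemma realH_norm_eq0 x : realH_norm x = 0 -> x = 0.
Proof. by move=> h; apply: (@normr0_eq0 _ H); rewrite realH_normE h. Qed.
HB.instance Definition _ := Lmodule_isNormed.Build R realH realH_normD realH_normZ realH_norm_eq0.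

Lemma realH_complete (F : set_system realH) : ProperFilter F -> cauchy F -> cvg F.
Proof.
move=> FF Fc; have cF : cvg (F : set_system H).
  apply: cauchy_cvg; apply/cauchy_ballP => _ /cgt0P[e e0 ->].
  have /cauchy_ballP/(_ e e0)[[A B]/= [FA FB] AB] := Fc.
  exists (A, B) => // -[x y] xy; have := AB (x, y) xy.
  by rewrite -!ball_normE /= -[`|_ - _|]/(realH_norm (x - y)) -ltcR -realH_normE.
have [l Fl] := (cvg_ex _).1 cF; apply/cvg_ex; exists (l : realH).
apply/cvgrPdist_le => e e0; have /cvgrPdist_le/(_ e%:C) := Fl.
rewrite ltcR => /(_ e0); apply: filterS => x /=.
by rewrite -lecR -[X in _ -> X%:C <= _]/(realH_norm (l - x)) -realH_normE.
Qed.
HB.instance Definition _ := Uniform_isComplete.Build realH realH_complete.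

Definition realH_inner (x y : realH) : R := complex.Re (inner H x y).
Lemma realH_inner_bilinear : bilinear_for *%R (idfun \; *%R) realH_inner.
Proof.
split=> x a y z; rewrite /realH_inner.
  by rewrite linearDl RecD linearZl_LR /= RecZ.
rewrite linearDr RecD linearZr_LR; congr (_ + _).
by rewrite -[LHS]/(complex.Re (conjc a%:C * inner H x y)) [conjc _](_ : _ = a%:C) ?RecZ//= oppr0.
Qed.
Lemma realH_inner_herm x y : realH_inner x y = (-1) ^+ false * idfun (realH_inner y x).
Proof. by rewrite /realH_inner hermC !expr0 !mul1r /= RecJ. Qed.
Lemma realH_inner_norm x : `|x| ^+ 2 = realH_inner x x.
Proof. by rewrite -[`|x|]/(realH_norm x) /realH_inner -inner_norm realH_normE -rmorphXn. Qed.
Lemma realH_inner_dot x : x != 0 -> 0 < realH_inner x x.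
Proof. by move=> x0; rewrite -realH_inner_norm exprn_gt0// normr_gt0. Qed.
HB.instance Definition _ := bilinear_isBilinear.Build R realH realH R *%R (idfun \; *%R) realH_inner realH_inner_bilinear.
HB.instance Definition _ := isHermitianSesquilinear.Build R realH false idfun realH_inner realH_inner_herm.
HB.instance Definition _ := isDotProduct.Build R realH realH_inner realH_inner_dot.

Definition real_hilbert : realHilbert R := @Hilbert R idfun realH realH_inner realH_inner_norm.

End RealHilbert.

(** * The complex Hilbert space of an orthogonal complex structure *)

Section ComplexStructure.
Variables (R : realType) (K : realHilbert R) (J : BH K).
Hypotheses (Jskew : adjoint J = - J) (JJ : forall x, J (J x) = - x).
Local Open Scope complex_scope.

Let Jip x y : inner K (J x) y = - inner K x (J y).
Proof. by rewrite adjointP Jskew bopNE ipNr. Qed.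
Let Jid x : inner K (J x) x = 0.
Proof. by have := Jip x x; rewrite (ipC x); lra. Qed.

(* The parameters are kept in the type so that the instances below depend on them. *)
Definition cxH of adjoint J = - J & (forall x, J (J x) = - x) : Type := K.
Local Notation C := (cxH Jskew JJ).
HB.instance Definition _ := GRing.Zmodule.copy C (K : Type).

Definition cxH_scale (a : R[i]) (x : C) : C :=
  complex.Re a *: (x : K) + complex.Im a *: J (x : K).
Lemma cxH_scaleA a b x : cxH_scale a (cxH_scale b x) = cxH_scale (a * b) x.
Proof.
case: a b => [a1 a2] [b1 b2]; rewrite /cxH_scale /=.
rewrite bopDr !bopZr JJ !scalerDr !scalerN !scalerA !scalerDl !scaleNr.
by rewrite addrACA [X in _ + X]addrC addrACA; congr (_ + _); rewrite addrC.
Qed.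
Lemma cxH_scale1 : left_id 1 cxH_scale.
Proof. by move=> x; rewrite /cxH_scale /= scale1r scale0r addr0. Qed.
Lemma cxH_scaleDr : right_distributive cxH_scale +%R.
Proof. by move=> a x y; rewrite /cxH_scale bopDr !scalerDr addrACA. Qed.
Lemma cxH_scaleDl x : {morph cxH_scale^~ x : a b / a + b}.
Proof. by move=> [a1 a2] [b1 b2]; rewrite /cxH_scale /= !scalerDl addrACA. Qed.
HB.instance Definition _ := GRing.Zmodule_isLmodule.Build R[i] C
  cxH_scaleA cxH_scale1 cxH_scaleDr cxH_scaleDl.

Definition cxH_norm (x : C) : R[i] := `|x : K|%:C.
Lemma cxH_normD x y : cxH_norm (x + y) <= cxH_norm x + cxH_norm y.
Proof. by rewrite /cxH_norm -rmorphD lecR; exact: ler_normD. Qed.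
Lemma cxH_normZ a x : cxH_norm (a *: x) = `|a| * cxH_norm x.
Proof.
rewrite normc_def -[cxH_norm _]/(`|complex.Re a *: (x : K) + complex.Im a *: J x|%:C) /cxH_norm.
rewrite -rmorphM; congr (_%:C); apply/eqP; rewrite -(@eqrXn2 _ 2)// ?mulr_ge0 ?sqrtr_ge0//.
rewrite exprMn sqr_sqrtr ?addr_ge0 ?sqr_ge0// !inner_norm !ipDl !ipDr !ipZl !ipZr.
by rewrite (ipC x) Jid (Jip x) JJ ipNr; apply/eqP; ring.
Qed.
Lemma cxH_norm_eq0 x : cxH_norm x = 0 -> x = 0.
Proof. by move=> /(@complexI R)/(@normr0_eq0 _ K). Qed.
HB.instance Definition _ := Lmodule_isNormed.Build R[i] C cxH_normD cxH_normZ cxH_norm_eq0.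

Lemma cxH_complete (F : set_system C) : ProperFilter F -> cauchy F -> cvg F.
Proof.
move=> FF Fc; have cF : cvg (F : set_system K).
  apply: cauchy_cvg; apply/cauchy_ballP => e e0.
  have /cauchy_ballP/(_ e%:C)[|[A B]/= [FA FB] AB] := Fc; first by rewrite ltcR.
  exists (A, B) => // -[x y] xy; have := AB (x, y) xy.
  by rewrite -!ball_normE /= -[X in X < _ -> _]/(`|x - y : K|%:C) ltcR.
have [l Fl] := (cvg_ex _).1 cF; apply/cvg_ex; exists (l : C).
apply/cvgrPdist_le => _ /cgt0P[e e0 ->]; have /cvgrPdist_le/(_ e e0) := Fl.
by apply: filterS => x /=; rewrite -[X in _ -> X <= _]/(`|l - x : K|%:C) lecR.
Qed.
HB.instance Definition _ := Uniform_isComplete.Build C cxH_complete.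

(** The imaginary part is forced by linearity in the first argument, with [J] acting as i. *)
Definition cxH_inner (x y : C) : R[i] := inner K x y +i* - inner K (J x) y.
Lemma cxH_inner_bilinear : bilinear_for *%R (@conjc R \; *%R) cxH_inner.
Proof.
split=> x [a b] y z; rewrite /cxH_inner /=; simpc.
  rewrite -[(_ *: y + z)%R]/(a *: (y : K) + b *: J y + z).
  by rewrite !bopDr !bopZr JJ !ipDl !ipZl ipNl; congr Complex; ring.
rewrite -[(_ *: y + z)%R]/(a *: (y : K) + b *: J y + z).
by rewrite !ipDr !ipZr (Jip x (J y)) JJ ipNr (Jip x y); congr Complex; ring.
Qed.
Lemma cxH_inner_herm x y : cxH_inner x y = (-1) ^+ false * conjc (cxH_inner y x).
Proof. by rewrite expr0 mul1r /cxH_inner /= (ipC y) Jip !opprK (ipC (J y)). Qed.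
Lemma cxH_inner_norm x : `|x| ^+ 2 = cxH_inner x x.
Proof. by rewrite -[`|x|]/(`|x : K|%:C) -rmorphXn inner_norm /cxH_inner Jid oppr0. Qed.
Lemma cxH_inner_dot x : x != 0 -> 0 < cxH_inner x x.
Proof. by move=> x0; rewrite -cxH_inner_norm exprn_gt0// normr_gt0. Qed.
HB.instance Definition _ := bilinear_isBilinear.Build R[i] C C R[i] *%R (@conjc R \; *%R) cxH_inner cxH_inner_bilinear.
HB.instance Definition _ := isHermitianSesquilinear.Build R[i] C false (@conjc R) cxH_inner cxH_inner_herm.
HB.instance Definition _ := isDotProduct.Build R[i] C cxH_inner cxH_inner_dot.

Definition complex_hilbert : hilbertType (@conjc R) := @Hilbert R[i] (@conjc R) C cxH_inner cxH_inner_norm.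

End ComplexStructure.

Lemma Rec_sum (R : realType) I (r : seq I) P (F : I -> R[i]) :
  complex.Re (\sum_(i <- r | P i) F i) = \sum_(i <- r | P i) complex.Re (F i).
Proof. by apply: big_morph => // x y; exact: RecD. Qed.

(** * Complex operators as real operators commuting with i *)

Section ComplexOperators.
Variables (R : realType) (H : hilbertType (@conjc R)).
Local Open Scope complex_scope.
Local Notation HR := (real_hilbert H).
Let rip (x y : H) : R := complex.Re (inner H x y).

Lemma cip_re (x y u w : H) : rip x y = rip u w -> rip ('i *: x) y = rip ('i *: u) w ->
  inner H x y = inner H u w.
Proof.
rewrite /rip => h; rewrite !linearZl_LR /= => h'; apply/eqP; rewrite eq_complex h eqxx /=.
by rewrite !ImcE; apply/eqP; congr (- _).
Qed.

Lemma rip_i (x y : H) : rip ('i *: x) y = - rip x ('i *: y).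
Proof.
have E1 : inner H ('i *: x) y = 'i * inner H x y by exact: linearZl_LR.
have E2 : inner H x ('i *: y) = conjc 'i * inner H x y by exact: linearZr_LR.
by rewrite /rip E1 E2; case: (inner H x y) => a b /=; ring.
Qed.

Lemma realify_linear (T : BH H) : linear (bop T : HR -> HR).
Proof. by move=> a x y; exact: (bop_linear T a%:C). Qed.

Lemma realify_bounded (T : BH H) : exists M : R, forall x : HR, `|T x : HR| <= M * `|x|.
Proof.
have [M /cge0P[a a0 ->] h] := bop_bounded T; exists a => x.
by have := h x; rewrite !realH_normE -rmorphM lecR.
Qed.

Definition realify (T : BH H) : BH HR := mkbop (realify_linear T) (realify_bounded T).

Definition imop : BH HR := realify ('i *: bop1 H).

Lemma imopE x : imop x = 'i *: (x : H). Proof. by []. Qed.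

Lemma imopK x : imop (imop x) = - x.
Proof. by have := scalerA ('i : R[i]) 'i (x : H); rewrite -expr2 sqr_i scaleN1r; exact. Qed.

Lemma imop_skew : adjoint imop = - imop.
Proof.
apply: adjoint_uniq => x y; rewrite bopNE ipNr; exact: rip_i.
Qed.

Lemma realify_imop (T : BH H) : bopM (realify T) imop = bopM imop (realify T).
Proof. by apply: bop_ext => x; exact: (bopZr T 'i x). Qed.

Lemma complexify_exists (T : BH HR) : bopM T imop = bopM imop T ->
  exists S : BH H, forall x, S x = T x.
Proof.
move=> h; have hi (x : H) : T ('i *: x) = 'i *: (T x : H) by have /(congr1 (fun Z : BH HR => Z x)) := h.
have lT : linear (bop T : H -> H).
  move=> [a b] x y.
  have E (z : H) : (a +i* b) *: z = a%:C *: z + b%:C *: ('i *: z).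
    by rewrite scalerA -scalerDl; congr (_ *: _); simpc.
  have TD (u w : H) : T (u + w) = (T u : H) + (T w : H) by exact: (bopDr T u w).
  have TZ (c : R) (u : H) : T (c%:C *: u) = c%:C *: (T u : H) by exact: (bopZr T c u).
  by rewrite (E x) (E (T x)) TD TD TZ TZ hi.
have bT : exists M : R[i], forall x : H, `|T x : H| <= M * `|x|.
  have [M M0 hM] := bop_bounded T; exists M%:C => x.
  by rewrite !realH_normE -rmorphM lecR; exact: hM.
by exists (mkbop lT bT).
Qed.

(** The real adjoint of a complex operator commutes with i as well, hence is complex linear. *)
Lemma cadjoint_exists (T : BH H) : exists S : BH H, forall x y, inner H (T x) y = inner H x (S y).
Proof.
have [|S hS] := @complexify_exists (adjoint (realify T)).
  have := congr1 (@adjoint _ _ HR) (realify_imop T).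
  rewrite !adjointM imop_skew => h; apply: bop_ext => x.
  have /(congr1 (fun Z : BH HR => Z x)) := h.
  rewrite -[LHS]/(- (imop (adjoint (realify T) x))) -[RHS]/(adjoint (realify T) (- imop x)) bopNr.
  by move/oppr_inj.
have h (x y : H) : rip (T x) y = rip x (S y) by rewrite hS; exact: (adjointP (realify T) x y).
exists S => x y; apply: cip_re => //.
by have := h ('i *: x) y; rewrite bopZr.
Qed.

Lemma cadjointP (T : BH H) x y : inner H (T x) y = inner H x (adjoint T y).
Proof. by rewrite /adjoint; case: xgetP => [S _ ->//|] h; have [S hS] := cadjoint_exists T; case: (h S). Qed.

Lemma realify_adjoint (T : BH H) : realify (adjoint T) = adjoint (realify T).
Proof.
apply/esym/adjoint_uniq => x y; have := cadjointP T x y => /(congr1 (@complex.Re R)); exact.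
Qed.

Lemma realify_inj : injective realify.
Proof. by move=> S T h; apply: bop_ext => x; have /(congr1 (fun Z : BH HR => Z x)) := h. Qed.

Lemma cadjoint_re (S T : BH H) : (forall x y, rip (T x) y = rip x (S y)) -> adjoint T = S.
Proof.
move=> h; apply: realify_inj; rewrite realify_adjoint; apply: adjoint_uniq => x y; exact: h.
Qed.

(** The real form is the real part of the complex one; selfadjointness of the matrix makes the
    imaginary part vanish. *)
Lemma cBH_cone n (X : 'M[BHsys H]_n) : cone X <->
  @cone R (BHsys HR) n (\matrix_(i, j) realify (X i j)).
Proof.
rewrite cone_BH; split=> [[/matrixP Xs Xp]|[Xs Xp]]; split.
- by move=> i j; rewrite !mxE -realify_adjoint; congr realify; have := Xs i j; rewrite mxE.
- move=> xi; have := Xp xi; rewrite lecE => /andP[_] /=.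
  congr (_ <= _); rewrite Rec_sum; apply: eq_bigr => i _.
  by rewrite Rec_sum; apply: eq_bigr => j _; rewrite mxE.
- apply/matrixP => i j; apply: realify_inj; rewrite mxE realify_adjoint.
  by have := Xs i j; rewrite !mxE.
- have Xa i j : adjoint (X j i) = X i j.
    by apply: realify_inj; rewrite realify_adjoint; have := Xs i j; rewrite !mxE.
  move=> xi; set z := \sum_i _.
  have hc i j : conjc (inner H (X i j (xi j)) (xi i)) = inner H (X j i (xi i)) (xi j).
    by rewrite cadjointP Xa [RHS](hermC (inner H)) expr0 mul1r.
  have zc : conjc z = z.
    rewrite /z (raddf_sum (@conjc R)) exchange_big; apply: eq_bigr => i _; rewrite (raddf_sum (@conjc R)).
    by apply: eq_bigr => j _; exact: hc.
  rewrite lecE; apply/andP; split.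
    by move: zc; case: z => a b [/eqP]; rewrite /= -subr_eq0 -opprD oppr_eq0 -mulr2n mulrn_eq0.
  have := Xp xi; congr (_ <= _); rewrite Rec_sum; apply: eq_bigr => i _.
  by rewrite Rec_sum; apply: eq_bigr => j _; rewrite mxE.
Qed.

End ComplexOperators.

Lemma linear_fun_scale (K : numFieldType) (V W : lmodType K) (f : V -> W) a x :
  linear f -> f (a *: x) = a *: f x.
Proof.
move=> lf; have f0 : f 0 = 0 by have := lf (-1) 0 0; rewrite scaler0 addr0 scaleN1r addNr.
by rewrite -[a *: x]addr0 lf f0 addr0.
Qed.

(** * Restriction of scalars for operator systems *)

Section RestrictionOfScalars.
Variable R : realType.
Local Open Scope complex_scope.

Section RealSystem.
Variable V : mosys R[i].

Definition rscal : Type := V.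
HB.instance Definition _ := GRing.Zmodule.copy rscal (V : Type).
Definition rscal_scale (a : R) (x : rscal) : rscal := a%:C *: (x : V).
Lemma rscal_scaleA a b x : rscal_scale a (rscal_scale b x) = rscal_scale (a * b) x.
Proof. by rewrite /rscal_scale scalerA rmorphM. Qed.
Lemma rscal_scale1 : left_id 1 rscal_scale.
Proof. by move=> x; rewrite /rscal_scale rmorph1 scale1r. Qed.
Lemma rscal_scaleDr : right_distributive rscal_scale +%R.
Proof. by move=> a x y; rewrite /rscal_scale scalerDr. Qed.
Lemma rscal_scaleDl x : {morph rscal_scale^~ x : a b / a + b}.
Proof. by move=> a b; rewrite /rscal_scale rmorphD scalerDl. Qed.
HB.instance Definition _ := GRing.Zmodule_isLmodule.Build R rscal
  rscal_scaleA rscal_scale1 rscal_scaleDr rscal_scaleDl.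

Definition realsys : mosys R :=
  @MOSys R rscal (@ostar _ V) (ounit V) (fun n => @cone _ V n).

End RealSystem.

Lemma realsys_linear (V W : mosys R[i]) (f : V -> W) : linear f -> linear (f : realsys V -> realsys W).
Proof. by move=> lf a x y; exact: lf. Qed.

Lemma realsys_ucp (V W : mosys R[i]) (f : V -> W) : ucp f -> ucp (f : realsys V -> realsys W).
Proof. by move=> [[lf cf] f1]; split=> //; split=> //; exact: realsys_linear. Qed.

Lemma realsys_uco (V W : mosys R[i]) (f : V -> W) :
  uco_embedding f -> uco_embedding (f : realsys V -> realsys W).
Proof. by move=> [[lf jf sf cf] f1]; split=> //; split=> //; exact: realsys_linear. Qed.

Lemma realify_uco (H : hilbertType (@conjc R)) :
  uco_embedding (@realify R H : realsys (BHsys H) -> BHsys (real_hilbert H)).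
Proof.
split; last by apply: bop_ext.
split=> [a S T|S T|S|n X]; [exact: bop_ext|exact: realify_inj|exact: realify_adjoint|].
rewrite cBH_cone; suff -> : map_mx (@realify R H : realsys (BHsys H) -> BHsys (real_hilbert H)) X =
  \matrix_(i, j) realify (X i j) by [].
by apply/matrixP => i j; rewrite !mxE.
Qed.

Lemma realsys_opsys (V : mosys R[i]) : is_opsys (@conjc R) V -> is_opsys (@idfun R) (realsys V).
Proof.
move=> [H [f uf]]; exists (real_hilbert H), (@realify R H \o f).
exact: uco_comp (realsys_uco uf) (realify_uco H).
Qed.

Definition phase (V : lmodType R[i]) (a b : bool) (x : V) : V :=
  if a == b then x else if a then 'i *: x else - ('i *: x).

(* Conjugation of X by the row (1, i). *)
Lemma pcone_phase (V : mosys R[i]) (P : finType) (X : P -> P -> realsys V) : is_opsys (@conjc R) V ->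
  pcone X -> pcone (fun p q : P * bool => phase p.2 q.2 (X p.1 q.1) : realsys V).
Proof.
move=> [H [f uf]] hX; pose r : realsys V -> BHsys (real_hilbert H) := @realify R H \o f.
have ur : uco_embedding r by exact: uco_comp (realsys_uco uf) (realify_uco H).
apply/(co_pcone _ ur.1)/BHpcone; have /(co_pcone _ ur.1)/BHpcone[Xs Xp] := hX.
have [[lr _ _ _] _] := ur; set J := imop H.
have ri x : r ('i *: x) = bopM J (r x).
  by have [[lf _ _ _] _] := uf; apply: bop_ext => y; rewrite /r /= (linear_fun_scale _ _ lf).
have Jc x : bopM J (r x) = bopM (r x) J by rewrite /r /= realify_imop.
have Js : adjoint J = - J by exact: imop_skew.
have JcE x y : r x (J y) = J (bop (r x) y) by have /(congr1 (fun T : BH _ => bop T y)) := Jc x.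
have JJ0 y : J (J y) = - y by exact: imopK.
clearbody r J.
have rp a b x : r (phase a b x) = if a == b then r x else if a then bopM J (r x) else - bopM J (r x).
  by rewrite /phase; case: (a == b) => //; case: a; rewrite ?(linear_opp _ lr) ri.
split=> [[p a] [q b]|xi] /=.
  rewrite !rp eq_sym; have [_|] := eqVneq a b; first exact: Xs.
  have sJ x x' : adjoint (r x) = r x' -> adjoint (bopM J (r x)) = - bopM J (r x').
    move=> h; rewrite adjointM h Js; apply: bop_ext => y.
    by rewrite -[LHS]/(r x' (- J y)) bopNr JcE.
  have sN (T : BH (real_hilbert H)) : adjoint (- T) = - adjoint T.
    by rewrite -[in LHS]scaleN1r adjointZ scaleN1r.
  by case: a b => [] [] //= _; rewrite ?sN (sJ _ _ (Xs _ _)) ?opprK.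
have := Xp (fun p => xi (p, true) + J (xi (p, false))); congr (_ <= _).
rewrite [RHS]sum_prod; apply: eq_bigr => p _.
have E (F : P * bool -> R) : \sum_q F q = \sum_q \sum_b F (q, b) by rewrite sum_prod.
under [RHS]eq_bigr do rewrite E; rewrite [RHS]exchange_big; apply: eq_bigr => q _.
rewrite !big_bool /= !rp /=.
have Jip x y : inner (real_hilbert H) (J x) y = - inner (real_hilbert H) x (J y).
  by rewrite adjointP Js bopNE ipNr.
set x := r (X p q); set a := xi (q, true); set b := xi (q, false); set c := xi (p, true); set d := xi (p, false).
rewrite -[LHS]/(inner (real_hilbert H) (x (a + J b)) (c + J d)).
rewrite -[RHS]/(inner (real_hilbert H) (x a) c + inner (real_hilbert H) (J (x b)) c +
  (inner (real_hilbert H) (- J (x a)) d + inner (real_hilbert H) (x b) d)).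
have JJ y : J (J y) = - y by rewrite JJ0.
by rewrite bopDr !ipDl !ipDr ipNl !JcE (Jip (x b) (J d)) JJ ipNr (Jip (x a) d); ring.
Qed.

End RestrictionOfScalars.

(** * Matrix cones of the complexification *)

Section Complexification.
Variables (R : realType) (S : mosys R) (HS : osys_ax S).
Local Open Scope complex_scope.

(* The blocks of the real 2 x 2 matrix [x -y; y x] representing x + iy. *)
Definition cent (w : cplx S) (a b : bool) : S :=
  if a == b then w.1 else if a then - w.2 else w.2.

Lemma cent_star (w : complexification S) a b : cent (ostar w) a b = ostar (cent w b a).
Proof.
by rewrite /cent; case: a b => [] [] /=; rewrite ?(ax_starN HS) ?opprK.
Qed.

(** Selfadjointness of the block matrix contains the two symmetry conditions on the real and
    imaginary parts. *)
Lemma cx_cone n (z : 'M[complexification S]_n) : cone z <->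
  pcone (fun p q : 'I_n * bool => cent (z p.1 q.1) p.2 q.2).
Proof.
pose f (p : 'I_n * bool) : 'I_(n + n) := if p.2 then lshift n p.1 else rshift n p.1.
pose g (k : 'I_(n + n)) : 'I_n * bool := match fintype.split k with inl i => (i, true) | inr i => (i, false) end.
pose x := \matrix_(i, j) (z i j).1; pose y := \matrix_(i, j) (z i j).2.
have fE p q : block_mx x (- y) y x (f p) (f q) = cent (z p.1 q.1) p.2 q.2.
  case: p q => [i []] [j []]; rewrite /f /= ?block_mxEul ?block_mxEur ?block_mxEdl ?block_mxEdr !mxE//.
have gE k l : cent (z (g k).1 (g l).1) (g k).2 (g l).2 = block_mx x (- y) y x k l.
  rewrite -fE; congr (block_mx _ _ _ _ _ _).
    by rewrite /f /g; case: split_ordP => i ->.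
  by rewrite /f /g; case: split_ordP => i ->.
split=> [[_ _ h]|h].
  have h1 := pcone_sub HS f ((cone_pcone HS _).1 h).
  by apply: (eq_pcone _ h1) => p q; rewrite -fE.
have st p q := pcone_star HS p q h.
split; last by apply/(cone_pcone HS); apply: (eq_pcone _ (pcone_sub HS g h)) => k l; rewrite -gE.
  by apply/matrixP => i j; rewrite !mxE; exact: (st (i, true) (j, true)).
by apply/matrixP => i j; rewrite !mxE; exact: (st (i, true) (j, false)).
Qed.

Lemma cx_pcone (P : finType) (z : P -> P -> realsys (complexification S)) : pcone z <->
  pcone (fun p q : P * bool => cent (z p.1 q.1) p.2 q.2).
Proof.
rewrite [X in X <-> _](cx_cone (\matrix_(i, j) z (enum_val i) (enum_val j))).
split=> h.
  have := pcone_sub HS (fun p : P * bool => (enum_rank p.1, p.2)) h.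
  by apply: eq_pcone => p q; rewrite /= mxE !enum_rankK.
have := pcone_sub HS (fun p : 'I_#|P| * bool => (enum_val p.1, p.2)) h.
by apply: eq_pcone => p q; rewrite /= mxE.
Qed.

Lemma cx_star_ax (w : complexification S) : ostar (ostar w) = w.
Proof. by case: w => a b /=; rewrite (ax_starN HS) opprK !(ax_starK HS). Qed.

Definition cincl (x : S) : realsys (complexification S) := (x, 0).
Definition cre (z : realsys (complexification S)) : S := z.1.

Lemma cincl_uco : uco_embedding cincl.
Proof.
split=> //; split=> [a x y|x y []//|x|n x].
- by congr pair; rewrite /= ?scale0r ?scaler0 ?subr0 ?addr0.
- by congr pair; rewrite /= (ax_star0 HS) oppr0.
have -> : cone (map_mx cincl x) <-> pcone (fun p q : 'I_n * bool => cent (cincl (x p.1 q.1)) p.2 q.2).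
  rewrite [X in X <-> _](cx_cone (map_mx cincl x)).
  by split; apply: eq_pcone => p q; rewrite mxE.
split=> [/(cone_pcone HS) hx|/(pcone_sub HS (fun i : 'I_n => (i, true))) hx].
  have h1 := pcone_scale HS (fun p : 'I_n * bool => p.1) (fun p => (p.2 == true)%:R) hx.
  have h2 := pcone_scale HS (fun p : 'I_n * bool => p.1) (fun p => (p.2 == false)%:R) hx.
  apply: eq_pcone (pconeD HS h1 h2) => -[i a] [j b]; rewrite /cent /=.
  by case: a b => [] []; rewrite /= ?mulr0 ?mul0r ?mulr1 ?scale0r ?scale1r ?addr0 ?add0r ?oppr0.
by apply/(cone_pcone HS); apply: (eq_pcone _ hx) => i j; rewrite /cent eqxx.
Qed.

End Complexification.

(** * Complexified maps and representations *)

Section ComplexificationMaps.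
Variable R : realType.
Local Open Scope complex_scope.

Lemma cre_ucp (S : mosys R) : osys_ax S -> ucp (@cre R S).
Proof.
move=> HS; split=> //; split=> [a x y|n z].
  by rewrite /cre /= /cplx_scale /= scale0r subr0.
move=> /(cx_cone HS z)/(pcone_sub HS (fun i : 'I_n => (i, true))) hz.
by apply/(cone_pcone HS); apply: (eq_pcone _ hz) => i j; rewrite mxE /cent eqxx.
Qed.

Definition cxmap (S I : mosys R) (j : S -> I) (z : complexification S) : complexification I :=
  (j z.1, j z.2).

Lemma cxmap_uco (S I : mosys R) (j : S -> I) : osys_ax S -> osys_ax I ->
  uco_embedding j -> uco_embedding (cxmap j).
Proof.
move=> HS HI [[lj ij sj cj] j1]; split; last by rewrite /cxmap /= j1 (linear_zero lj).
split=> [a x y|[x x'] [y y'] [] /ij -> /ij ->//|x|n z].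
- by congr pair; rewrite /= (linear_add _ _ lj) ?(linear_add _ _ lj) ?(linear_opp _ lj) !(linear_scale _ _ lj).
- by congr pair; rewrite /= ?sj// (linear_opp _ lj) sj.
rewrite (cx_cone HS) (cx_cone HI).
have E p q : cent (map_mx (cxmap j) z p.1 q.1) p.2 q.2 = j (cent (z p.1 q.1) p.2 q.2) :> I.
  case: p q => [i a] [k b]; rewrite mxE /cent /=; case: (a == b) => //; case: a => //=.
  by rewrite (linear_opp _ lj).
have uj : co_embedding j by [].
split=> [/(co_pcone _ uj)|h]; first by apply: eq_pcone => p q; rewrite E.
by apply/(co_pcone _ uj); apply: (eq_pcone _ h) => p q; rewrite E.
Qed.

Lemma cx_op (K : realHilbert R) (J : BH K) (Js : adjoint J = - J) (JJ : forall x, J (J x) = - x) (T : BH K) :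
  (forall x, T (J x) = J (T x)) -> exists S : BH (complex_hilbert Js JJ), forall x, S x = T x.
Proof.
move=> TJ; pose Hc := complex_hilbert Js JJ.
have lT : linear (bop T : Hc -> Hc).
  move=> a x y; have sE (z : K) : a *: (z : Hc) = complex.Re a *: z + complex.Im a *: J z by [].
  transitivity (T (complex.Re a *: (x : K) + complex.Im a *: J x + y)); first by [].
  by rewrite !bopDr !bopZr TJ.
have bT : exists M : R[i], forall x : Hc, `|T x : Hc| <= M * `|x|.
  have [M M0 hM] := bop_bounded T; exists M%:C => x.
  by rewrite -[`|T x : Hc|]/(`|T x|%:C) -[`|x|]/(`|x : K|%:C) -rmorphM lecR.
by exists (mkbop lT bT).
Qed.

(** [Hc] is the doubled space with [J = - K2 1] as multiplication by i: [v true x + v false y]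
    stands for [x + i y], [F] is [f2] of the real part plus [J] times [f2] of the imaginary part,
    and [D a] is the complexification of [a]. *)
Lemma cx_embedding (S : mosys R) (H : realHilbert R) (f : S -> BHsys H) :
  osys_ax S -> uco_embedding f ->
  exists (Hc : hilbertType (@conjc R)) (F : complexification S -> BHsys Hc)
    (v : bool -> H -> Hc) (D : BH H -> BH Hc),
  [/\ uco_embedding F,
      [/\ forall b a x y, v b (a *: x + y) = a%:C *: v b x + v b y,
          forall b c x y, complex.Re (inner Hc (v b x) (v c y)) = if b == c then inner H x y else 0 &
          forall h, exists x y, h = v true x + v false y],
      forall s b x, bop (F (s, 0)) (v b x) = v b (bop (f s) x),
      forall a b x, D a (v b x) = v b (a x) &
      forall a z, (forall s, bopM (f s) a = bopM a (f s)) -> bopM (F z) (D a) = bopM (D a) (F z)].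
Proof.
move=> HS uf; have [[lf jf sf cf] f1] := uf.
have [K [v [f2 [K2 [D0 [[uf2 vl vip vsur f2v] [Ks Kf Kt] Dv Kc]]]]]] := doubling HS (uco_ucp uf).
pose J : BH K := - K2 (bop1 H).
have Js : adjoint J = - J by rewrite /J -[in LHS]scaleN1r adjointZ Ks scaleN1r.
have Jt x : J (v true x) = v false x by rewrite /J bopNE Kt adjoint1 opprK.
have Jf x : J (v false x) = - v true x by rewrite /J bopNE Kf.
clearbody J.
have ext (T U : BH K) : (forall b x, T (v b x) = U (v b x)) -> T = U.
  by move=> h; apply: bop_ext => w; have [x [y ->]] := vsur w; rewrite !bopDr !h.
have JJ x : J (J x) = - x.
  have -> : J (J x) = bopM J J x by [].
  suff -> : bopM J J = - bop1 K by [].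
  by apply: ext => -[] y; rewrite /= ?Jt ?Jf ?bopNr ?Jt ?Jf.
have diagJ (T : BH K) : (forall b x, exists y, T (v b x) = v b y /\ T (v (~~ b) x) = v (~~ b) y) -> forall x, T (J x) = J (T x).
  move=> h x; suff /(congr1 (fun Z : BH K => Z x)) : bopM T J = bopM J T by [].
  apply: ext => b y; rewrite /=; have [y' [h1 h2]] := h b y.
  by case: b h1 h2 => /= h1 h2; rewrite ?Jt ?Jf ?bopNr h1 h2 ?Jt ?Jf.
have f2J s x : f2 s (J x) = J (bop (f2 s) x).
  by apply: diagJ => b y; exists (bop (f s) y); rewrite !f2v.
have DJ a x : D0 a (J x) = J (D0 a x) by apply: diagJ => b y; exists (a y); rewrite !Dv.
pose Hc := complex_hilbert Js JJ.
have /choice[F FE] : forall z : complexification S, exists T : BH Hc, forall x, T x = (f2 z.1 + bopM J (f2 z.2) : BH K) x.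
  move=> z; apply: (cx_op Js JJ) => x.
  by rewrite !bopDE /= bopDr !f2J.
have /choice[D DE] : forall a, exists T : BH Hc, forall x, T x = D0 a x.
  by move=> a; apply: (cx_op Js JJ) => x; exact: DJ.
have Fv z x : F z (v true x) = v true (bop (f z.1) x) + v false (bop (f z.2) x) :> K.
  by rewrite FE bopDE /= !f2v Jt.
have Fv' z x : F z (v false x) = v false (bop (f z.1) x) - v true (bop (f z.2) x) :> K.
  by rewrite FE bopDE /= !f2v Jf.
have f2s s : adjoint (f2 s) = f2 (ostar s) by exact: esym (cp_star s HS (BH_ax K) uf2.1).
have lf2 := uf2.1.1.
have v0 b : v b 0 = 0 by have := vl b (-1) 0 0; rewrite scaler0 addr0 scaleN1r addNr.
have vD b x y : v b (x + y) = v b x + v b y by have := vl b 1 x y; rewrite !scale1r.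
have ipv x y x' y' : inner K (v true x + v false y) (v true x' + v false y') = inner H x x' + inner H y y'.
  by rewrite ipDl !ipDr !vip /= addr0 add0r.
have vN b x : v b (- x) = - v b x by have := vl b (-1) x 0; rewrite !scaleN1r v0 !addr0.
have Fstar z : F (ostar z) = adjoint (F z).
  apply/esym/cadjoint_re => x y; rewrite -[LHS]/(inner K (F z x) y) -[RHS]/(inner K x (F (ostar z) y)) !FE !bopDE.
  rewrite -[bop (bopM J _) x]/(J (bop (f2 z.2) x)) -[bop (bopM J _) y]/(J (bop (f2 (- ostar z.2)) y)).
  rewrite ipDl ipDr -f2s -adjointP; congr (_ + _).
  rewrite (linear_opp _ lf2) -f2s bopNE bopNr ipNr [in LHS](adjointP J) Js bopNE ipNr; congr (- _).
  by rewrite adjointP f2s f2J.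
have f2D s t w : f2 (s + t) w = bop (f2 s) w + bop (f2 t) w by rewrite (linear_add _ _ lf2).
have f2Z c s w : f2 (c *: s) w = c *: bop (f2 s) w by rewrite (linear_scale _ _ lf2).
have f2N s w : f2 (- s) w = - bop (f2 s) w by rewrite (linear_opp _ lf2).
have Flin : linear F.
  move=> a x y; apply: bop_ext => w.
  transitivity (complex.Re a *: (F x w : K) + complex.Im a *: J (F x w) + F y w); last by [].
  rewrite !FE !bopDE.
  rewrite -[bop (bopM J _) w in LHS]/(J (bop (f2 (complex.Re a *: x.2 + complex.Im a *: x.1 + y.2)) w)).
  rewrite -[bop (bopM J _) w in X in _ = X + _]/(J (bop (f2 x.2) w)) -[bop (bopM J _) w in RHS]/(J (bop (f2 y.2) w)).
  rewrite -[(a *: x + y).1]/(complex.Re a *: x.1 - complex.Im a *: x.2 + y.1).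
  rewrite !f2D f2N !f2Z !bopDr !bopZr JJ.
  by apply: ip_inj => u; rewrite !(ipDl, ipZl, ipNl); ring.
have Finj : injective F.
  move=> x y h; have h1 a : bop (f x.1) a = bop (f y.1) a /\ bop (f x.2) a = bop (f y.2) a.
    have := Fv x a; rewrite h Fv => h2; split; apply: ip_inj => u.
      have := congr1 (fun w => inner K w (v true u + v false 0)) h2.
      by rewrite !ipv !ip0r !addr0.
    have := congr1 (fun w => inner K w (v true 0 + v false u)) h2.
    by rewrite !ipv !ip0r !add0r.
  case: x y h1 {h} => [x1 x2] [y1 y2] h1; congr pair; apply: jf; apply: bop_ext => a; by case: (h1 a).
(* The real form of [F z] on the complexified space is the form of the block matrix that defines the
   cone of the complexification. *)
have hsum n (z : 'M[complexification S]_n) (x : 'I_n * bool -> H) :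
  \sum_i \sum_j inner K (F (z i j) (v true (x (j, true)) + v false (x (j, false))))
     (v true (x (i, true)) + v false (x (i, false))) =
  \sum_p \sum_q inner H (bop (f (cent (z p.1 q.1) p.2 q.2)) (x q)) (x p).
  rewrite [RHS]sum_prod; apply: eq_bigr => i _.
  have E (G : 'I_n * bool -> R) : \sum_q G q = \sum_q \sum_b G (q, b) by rewrite sum_prod.
  under [RHS]eq_bigr do rewrite E; rewrite [RHS]exchange_big; apply: eq_bigr => k _.
  rewrite !big_bool /cent; set a := x (k, true); set b := x (k, false); set w := z i k.
  have -> : F w (v true a + v false b) = v true (bop (f w.1) a - bop (f w.2) b) + v false (bop (f w.2) a + bop (f w.1) b) :> K.
    transitivity (F w (v true a) + F w (v false b) : K); first exact: (bopDr (F w)).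
    by rewrite Fv Fv' !vD vN [X in _ + X]addrC addrACA.
  rewrite ipv !ipDl ipNl.
  suff -> : bop (f (- w.2)) b = - bop (f w.2) b by rewrite /= ipNl; ring.
  by rewrite (linear_opp _ lf).
exists Hc, F, v, D; split.
- split; last first.
    by apply: bop_ext => x; rewrite FE (linear_zero lf2) uf2.2 bopDE /= bop0r addr0.
  split=> // n z; rewrite (cx_cone HS) cBH_cone; split=> [hz|/cone_BH[Xs Xp]].
    have /(co_pcone _ uf.1)/BHpcone[_ Xp] := hz; have st p q := pcone_star HS p q hz.
    apply/cone_BH; split=> [i k|xi].
      rewrite !mxE -realify_adjoint -Fstar; congr (realify (F _)).
      have := st (i, true) (k, true); have := st (i, false) (k, true); rewrite /cent /= (ax_starN HS).
      by move=> h1 h2; rewrite /= h1 h2 -surjective_pairing.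
    have /choice[x hx] : forall i, exists p : H * H, xi i = v true p.1 + v false p.2.
      by move=> i; have [a [b ->]] := vsur (xi i); exists (a, b).
    have := Xp (fun p => if p.2 then (x p.1).1 else (x p.1).2); rewrite -hsum; congr (_ <= _).
    by apply: eq_bigr => i _; apply: eq_bigr => k _; rewrite !mxE /= -!hx.
  have zs i k : ostar (z k i) = z i k.
    apply: Finj; rewrite Fstar; apply: realify_inj; rewrite realify_adjoint.
    by have := Xs i k; rewrite !mxE.
  apply/(co_pcone _ uf.1)/BHpcone; split=> [p q|x].
    by rewrite -[LHS]/(ostar (f _)) -sf -(cent_star HS) zs.
  rewrite -hsum; have := Xp (fun i => v true (x (i, true)) + v false (x (i, false))); congr (_ <= _).
  by apply: eq_bigr => i _; apply: eq_bigr => k _; rewrite !mxE.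
- split=> [b a x y|b c x y|//]; last exact: vip.
  rewrite vl; congr (_ + _).
  by rewrite -[RHS]/(a *: v b x + 0 *: J (v b x)) scale0r addr0.
- by move=> s b x; rewrite FE (linear_zero lf2) bopDE /= bop0r addr0 f2v.
- by move=> a b x; rewrite DE Dv.
- move=> a z ha.
  have h s : bopM (f2 s) (D0 a) = bopM (D0 a) (f2 s).
    apply: ext => b x; rewrite /= Dv !f2v Dv; congr v.
    by have /(congr1 (fun T : BH H => T x)) := ha s.
  have h' s w : f2 s (D0 a w) = D0 a (bop (f2 s) w) by have /(congr1 (fun T : BH K => T w)) := h s.
  apply: bop_ext => w; rewrite -[LHS]/(F z (D a w)) -[RHS]/(D a (F z w)) !DE !FE !bopDE bopDr.
  by rewrite -[bop (bopM J _) _ in LHS]/(J (bop (f2 z.2) (D0 a w))) -[bop (bopM J _) _ in RHS]/(J (bop (f2 z.2) w)) !h' DJ.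
Qed.

End ComplexificationMaps.

Lemma ucp_trans (K : numFieldType) (V W Z : mosys K) (f : V -> W) (g : W -> Z) :
  ucp f -> ucp g -> ucp (g \o f).
Proof.
move=> [[lf cf] f1] [[lg cg] g1]; split; last by rewrite /= f1.
split=> [a x y|n x /cf/cg]; first by rewrite /= lf lg.
by rewrite -map_mx_comp.
Qed.

(** * The complexification of an injective envelope *)

Section ComplexEnvelope.
Variable R : realType.
Local Open Scope complex_scope.

Lemma cx_opsys (S : mosys R) : is_opsys (@idfun R) S -> is_opsys (@conjc R) (complexification S).
Proof.
move=> oS; have [H [f uf]] := oS; have [Hc [F [v [D [uF _ _ _ _]]]]] := cx_embedding (opsys_ax oS) uf.
by exists Hc, F.
Qed.

Lemma complex_scaleE (V : lmodType R[i]) (a : R[i]) (x : V) :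
  a *: x = (complex.Re a)%:C *: x + (complex.Im a)%:C *: ('i *: x).
Proof. by case: a => a b; rewrite scalerA -scalerDl; congr (_ *: _); simpc. Qed.

(** Extend the real part of [f] by real injectivity and recover a complex map from its real part. *)
Lemma cx_injective (I : mosys R) : is_opsys (@idfun R) I -> is_injective (@idfun R) I ->
  is_injective (@conjc R) (complexification I).
Proof.
move=> oI iI E F j f oE oF uj uf; have HI := opsys_ax oI; have [[lj _ _ _] j1] := uj; have [[lf cf] f1] := uf.
have [g ug gj] := iI _ _ _ _ (realsys_opsys oE) (realsys_opsys oF) (realsys_uco uj)
  (ucp_comp (realsys_ucp uf) (cre_ucp HI)).
have HF := opsys_ax (realsys_opsys oF); have lg := ug.1.1.
have gZ a (x : F) : g (a%:C *: x) = a *: g x := linear_scale a (x : realsys F) lg.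
have gD (x y : F) : g (x + y) = g x + g y := linear_add (x : realsys F) y lg.
have gN (x : F) : g (- x) = - g x := linear_opp (x : realsys F) lg.
(* The complex linear map with real part [g]. Its block matrices are the images under [g] of those
   in [pcone_phase], which gives complete positivity. *)
pose G (x : F) : complexification I := (g x, - g ('i *: x)).
have Gj x : G (j x) = f x.
  rewrite /G -(linear_fun_scale _ _ lj) !gj /cre /= (linear_fun_scale _ _ lf).
  by case: (f x) => a b; rewrite /= scale0r sub0r scale1r opprK.
exists G => //; split; last by rewrite -j1 Gj.
split=> [a x y|n X hX].
  have ii : 'i *: ('i *: x) = - x by rewrite scalerA -expr2 sqr_i scaleN1r.
  have E1 : a *: x = (complex.Re a)%:C *: x + (complex.Im a)%:C *: ('i *: x) by exact: complex_scaleE.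
  have E2 : 'i *: (a *: x) = (complex.Re a)%:C *: ('i *: x) - (complex.Im a)%:C *: x.
    by rewrite scalerA mulrC -scalerA complex_scaleE ii scalerN.
  rewrite /G scalerDr E2 E1 !gD gN !gZ; congr pair => /=; first by rewrite scalerN opprK.
  by rewrite scalerN !opprD opprK.
apply/(cx_cone HI).
have h1 := (cone_pcone HF (X : 'M[realsys F]_n)).1 hX.
have := cp_pcone ug.1 (pcone_phase oF h1); apply: eq_pcone => -[p a] [q b].
by rewrite mxE /cent /phase /G; case: a b => [] [] /=; rewrite ?gN ?opprK.
Qed.

Variables (S I : mosys R) (j : S -> I).
Hypotheses (oS : is_opsys (@idfun R) S) (ij : is_injenv (@idfun R) j).

Lemma cx_rigid_re (f : complexification I -> complexification I) (x : I) :
  ucp f -> (forall z, f (cxmap j z) = cxmap j z) -> (f (x, 0)).1 = x.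
Proof.
move=> uf fj; have [oI _ uj rig] := ij; have HI := opsys_ax oI; have [[lj _ _ _] _] := uj.
pose u (x : I) : I := cre (f (cincl x)).
have uu : ucp u.
  exact: ucp_comp (uco_ucp (cincl_uco HI)) (ucp_comp (realsys_ucp uf) (cre_ucp HI)).
apply: (rig u) => // s; rewrite /u.
have -> : cincl (j s) = cxmap j (s, 0) by rewrite /cxmap /= (linear_zero lj).
by rewrite fj.
Qed.

(** Rigidity of [I] fixes the real part, so [f x = x + i h x] for [x] in [I]; applied to [f]
    composed with itself it gives that [h] composed with [h] is 0. The iterates are then
    [x + i n h x], and their uniform boundedness forces [h] to vanish. *)
Lemma cx_injenv : is_injenv (@conjc R) (cxmap j).
Proof.
have [oI iI uj _] := ij; have HI := opsys_ax oI; have HS := opsys_ax oS.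
split; [exact: cx_opsys|exact: cx_injective|exact: cxmap_uco|].
move=> f uf fj; have [[lf _] f1] := uf; pose h x := (f (x, 0)).2.
have fre x : f (x, 0) = (x, h x) by rewrite [LHS]surjective_pairing (cx_rigid_re _ uf fj).
have fD z w : f (z + w) = f z + f w by have := lf 1 z w; rewrite !scale1r.
have fE x y : f (x, y) = (x - h y, h x + y).
  have -> : (x, y) = (x, 0) + 'i *: ((y, 0) : complexification I).
    by congr pair; rewrite /= scale0r ?scaler0 ?subr0 ?scale1r ?addr0 ?add0r.
  rewrite fD (linear_fun_scale _ _ lf) !fre; congr pair => /=; first by rewrite scale0r sub0r scale1r.
  by rewrite scale0r add0r scale1r.
have hh x : h (h x) = 0.
  have := cx_rigid_re x (ucp_trans uf uf); rewrite /= fre fE /= => /(_ _)/eqP.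
  by rewrite -subr_eq0 addrAC subrr sub0r oppr_eq0 => h1; apply/eqP/h1 => z; rewrite /= !fj.
have hN n x : iter n f (x, 0) = (x, n%:R *: h x).
  have hZ c y : h (c *: y) = c *: h y.
    have -> : h (c *: y) = (f (c%:C *: ((y, 0) : complexification I))).2.
      by congr (f _).2; congr pair; rewrite /= ?scale0r ?scaler0 ?subr0 ?addr0.
    by rewrite (linear_fun_scale _ _ lf) fre /= scale0r addr0.
  elim: n => [|n IH] /=; first by rewrite scale0r.
  by rewrite IH fE hZ hh scaler0 subr0 -natr1 scalerDl scale1r addrC.
have iter_ucp n : ucp (iter n f).
  elim: n => [|n IH]; last exact: ucp_trans IH uf.
  by split=> //; split=> // k z; rewrite [map_mx _ z](_ : _ = z)//; apply/matrixP => a b; rewrite mxE.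
suff h0 x : h x = 0 by move=> [x y]; rewrite fE !h0 subr0 add0r.
have [K [r ur]] := oI; have [[lr jr _ _] r1] := ur; apply: jr; rewrite (linear_zero lr).
have [M M0 hM] := ax_bound HI x.
(* The bound [M] for [x] persists for its image under the [n]-th iterate. The entries used are [M]
   on the diagonal and [- n h x] in the corner, tested on [r (h x) b] and [b]. *)
have key n (b : K) : n%:R * (2 * `|bop (r (h x)) b| ^+ 2) <= M * (`|bop (r (h x)) b| ^+ 2 + `|b| ^+ 2).
  have h1 := cp_pcone (uco_ucp (cincl_uco HI)).1 hM.
  have /(cx_pcone HI)/(pcone_sub HI (fun a : bool => (a, a))) := cp_pcone (realsys_ucp (iter_ucp n)).1 h1.
  move=> /(co_pcone _ ur.1)/BHpcone[Xs Xp].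
  have := Xs false true; have := Xp (fun a => if a then bop (r (h x)) b else b).
  rewrite !big_bool /= /cincl !hN /cent /= => h2 h3; rewrite -h3 in h2; move: h2.
  have rnx y : bop (r (- (n%:R *: h x))) y = - (n%:R *: bop (r (h x)) y).
    by rewrite (linear_opp _ lr) (linear_scale _ _ lr).
  have r1M y : bop (r (M *: ounit I)) y = M *: y by rewrite (linear_scale _ _ lr) r1.
  set w := bop (r (h x)) b.
  suff : 0 <= inner K (M *: w) w + inner K (- (n%:R *: w)) w + (inner K (- (n%:R *: w)) w + inner K (M *: b) b) ->
      n%:R * (2 * `|w| ^+ 2) <= M * (`|w| ^+ 2 + `|b| ^+ 2).
    by rewrite (ipC (bop (adjoint _) _)) -adjointP !rnx !r1M; exact.
  by rewrite ipNl !ipZl -!inner_norm; lra.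
apply: bop_ext => b; apply/eqP; rewrite bop0E -normr_eq0 -sqrf_eq0; apply/eqP.
set w := _ ^+ 2; have [w0|w0] := leP w 0; first by apply/eqP; rewrite eq_le w0 sqr_ge0.
have c0 : 0 < 2 * w by rewrite mulr_gt0.
set C := M * (w + `|b| ^+ 2); have := truncnS_gt (C / (2 * w)).
by rewrite ltr_pdivrMr// ltNge key.
Qed.

End ComplexEnvelope.

Lemma uco_ucp_gen (K : numFieldType) (V W : mosys K) (f : V -> W) : uco_embedding f -> ucp f.
Proof. by move=> [[lf _ _ cf] f1]; split=> //; split=> // n x /cf. Qed.

(** * Equivalence of the real and complex DCEP *)

Section ComplexDCEP.
Variables (R : realType) (S : mosys R).
Hypothesis oS : is_opsys (@idfun R) S.
Local Open Scope complex_scope.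
Let HS := opsys_ax oS.

(** A real ucp map commuting with i extends complex linearly, and complete positivity is read off
    the 2 x 2 real picture. *)
Lemma commuting_cx_ucp (I : mosys R) (H : hilbertType (@conjc R)) (g : I -> BHsys (real_hilbert H)) :
  osys_ax I -> ucp g -> (forall y, bopM (g y) (imop H) = bopM (imop H) (g y)) ->
  exists2 G : complexification I -> BHsys H, ucp G &
    forall z x, bop (G z) x = bop (g z.1) x + 'i *: (bop (g z.2) x : H) :> H.
Proof.
move=> HI ug gJ; pose HR := real_hilbert H; pose J := imop H; have lg := ug.1.1.
have gJE y x : g y (J x) = J (bop (g y) x) by have /(congr1 (fun T : BH HR => T x)) := gJ y.
have /choice[G GE] : forall z : complexification I, exists T : BH H, forall x, T x = (g z.1 + bopM J (g z.2) : BH HR) x.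
  move=> z; apply: complexify_exists; apply: bop_ext => x.
  rewrite -[LHS]/(bop (g z.1) (J x) + J (bop (g z.2) (J x))).
  by rewrite -[RHS]/(J (bop (g z.1) x + J (bop (g z.2) x))) !gJE bopDr.
have rG z : realify (G z) = g z.1 + bopM J (g z.2) :> BH HR by apply: bop_ext => x; exact: GE.
have Jip x y : inner HR (J x) y = - inner HR x (J y) by rewrite adjointP (imop_skew H) bopNE ipNr.
have JJ x : J (J x) = - x by exact: imopK.
have gD s t w : g (s + t) w = bop (g s) w + bop (g t) w by rewrite (linear_add _ _ lg).
have gZ c s w : g (c *: s) w = c *: bop (g s) w by rewrite (linear_scale _ _ lg).
have gN s w : g (- s) w = - bop (g s) w by rewrite (linear_opp _ lg).
exists G; last by move=> z x; rewrite GE.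
split; last by apply: bop_ext => x; rewrite GE -[LHS]/(bop (g (ounit I)) x + J (bop (g 0) x)) ug.2 (linear_zero lg) bop0E bop0r addr0.
split=> [a z w|n z /(cx_cone HI) hz].
  apply: bop_ext => x.
  transitivity (a *: (bop (G z) x : H) + bop (G w) x); last by [].
  rewrite (complex_scaleE a (bop (G z) x : H)) !GE.
  rewrite -[LHS]/(bop (g (complex.Re a *: z.1 - complex.Im a *: z.2 + w.1)) x +
    J (bop (g (complex.Re a *: z.2 + complex.Im a *: z.1 + w.2)) x)).
  rewrite -[RHS]/(complex.Re a *: (bop (g z.1) x + J (bop (g z.2) x)) +
    complex.Im a *: J (bop (g z.1) x + J (bop (g z.2) x)) + (bop (g w.1) x + J (bop (g w.2) x)) : HR).
  rewrite !gD gN !gZ !bopDr !bopZr JJ.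
  by apply: (@ip_inj R HR) => u; rewrite !(ipDl, ipZl, ipNl); ring.
apply/cBH_cone/cone_BH; have /BHpcone[Xs Xp] := cp_pcone ug.1 hz.
have st p q := pcone_star HI p q hz; have gs s : adjoint (g s) = g (ostar s) := esym (cp_star s HI (BH_ax HR) ug.1).
split=> [i k|xi].
  have := st (i, true) (k, true); have := st (i, false) (k, true); rewrite /cent /= (ax_starN HI) => h2 h1.
  rewrite !mxE !rG adjointD adjointM (imop_skew H) !gs h1 -h2 (linear_opp _ lg); congr (_ + _).
  apply: bop_ext => x; rewrite -[LHS]/(bop (g (ostar (z k i).2)) (- J x)) -[RHS]/(J (- bop (g (ostar (z k i).2)) x)).
  by rewrite !bopNr gJE.
(* On pairs [(xi, - i xi)] the form of the real block matrix is twice the form of [G]. *)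
have := Xp (fun p => if p.2 then xi p.1 else - J (xi p.1)).
set T := \sum_i \sum_j inner _ _ _; suff -> : T = 2 * \sum_i \sum_j inner HR (bop (realify (G (z i j))) (xi j)) (xi i).
  rewrite pmulr_rge0//; congr (_ <= _); apply: eq_bigr => i _; apply: eq_bigr => k _; by rewrite !mxE.
rewrite /T sum_prod mulr_sumr; apply: eq_bigr => i _; rewrite mulr_sumr.
have E (F : 'I_n * bool -> R) : \sum_q F q = \sum_q \sum_b F (q, b) by rewrite sum_prod.
under [LHS]eq_bigr do rewrite E; rewrite [LHS]exchange_big; apply: eq_bigr => k _.
rewrite !big_bool /cent; set x := xi k; set y := xi i; set w := z i k.
transitivity (inner HR (bop (g w.1) x) y + inner HR (bop (g (- w.2)) (- J x)) y +
  (inner HR (bop (g w.2) x) (- J y) + inner HR (bop (g w.1) (- J x)) (- J y))); first by [].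
rewrite rG -[bop (_ + _) x]/(bop (g w.1) x + J (bop (g w.2) x)) gN !bopNr !gJE opprK.
rewrite !ipNr ipNl opprK (Jip (bop (g w.1) x)) JJ ipNr opprK ipDl (Jip (bop (g w.2) x)); ring.
Qed.

(** The restriction of [f] to [S] commutes with i, so i lies in its commutant and the real extension
    commutes with i. An arbitrary envelope [I'] is first mapped into the complexification of [I] by
    injectivity. *)
Lemma DCEP_cx : DCEP (@idfun R) S -> DCEP (@conjc R) (complexification S).
Proof.
move=> dS I' j' ij' H f uf; have [I [j ij]] := injenv_exists oS.
have [oI iI uj _] := ij; have HI := opsys_ax oI; have [oI' _ uj' _] := ij'; have [[lf _ _ _] _] := uf.
pose r (s : S) : BHsys (real_hilbert H) := realify (f (s, 0)).
have ur : uco_embedding r by exact: uco_comp (cincl_uco HS) (uco_comp (realsys_uco uf) (realify_uco H)).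
have [g ug [gj gc]] := dS I j ij (real_hilbert H) r ur.
have [|G uG GE] := commuting_cx_ucp HI ug.
  by move=> y; apply: gc => _ [s _ <-]; rewrite /r realify_imop.
have [q uq qj] := cx_injective oI iI (cx_opsys oS) oI' uj' (uco_ucp_gen (cxmap_uco HS HI uj)).
exists (G \o q); first exact: ucp_trans uq uG.
split=> [[x y]|y T hT] /=.
  rewrite qj; apply: bop_ext => v; rewrite GE /= !gj.
  have -> : (x, y) = 'i *: ((y, 0) : complexification S) + (x, 0).
    by congr pair; rewrite /= ?scale0r ?scaler0 ?subr0 ?sub0r ?oppr0 ?add0r ?scale1r ?addr0.
  by rewrite lf addrC.
have gT z : bopM (g z) (realify T) = bopM (realify T) (g z).
  apply: gc => _ [s _ <-]; rewrite /r; apply: bop_ext => v.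
  by have := hT (f (s, 0)) (ex_intro2 _ _ _ Logic.I erefl) => /(congr1 (fun Z : BH H => Z v)).
have gTE z v : g z (T v) = T (bop (g z) v) by have /(congr1 (fun Z : BH (real_hilbert H) => Z v)) := gT z.
apply: bop_ext => v; rewrite -[LHS]/(bop (G (q y)) (T v)) -[RHS]/(T (bop (G (q y)) v)) !GE !gTE.
by rewrite bopDr bopZr.
Qed.

(** Complexify [f], extend to the complexification of [I], and compress to the real copy of [H]. If
    [T] commutes with the range of [f], its complexification [D T] commutes with the range of [F],
    hence with the extension. *)
Lemma DCEP_of_cx : DCEP (@conjc R) (complexification S) -> DCEP (@idfun R) S.
Proof.
move=> dS I j ij H f uf; have [oI _ uj _] := ij; have HI := opsys_ax oI; have [[lj _ _ _] _] := uj.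
have [Hc [F [v [D [uF [vl vip vsur] Fv Dv FD]]]]] := cx_embedding HS uf.
have [G uG [Gj Gc]] := dS _ _ (cx_injenv oS ij) Hc F uF.
pose HR := real_hilbert Hc; pose g (x : I) : BHsys HR := realify (G (cincl x)).
have ug : ucp g.
  exact: ucp_comp (uco_ucp (cincl_uco HI)) (ucp_comp (realsys_ucp uG) (uco_ucp (realify_uco Hc))).
have vl' b a x y : v b (a *: x + y) = a *: (v b x : HR) + v b y by rewrite vl.
have vip' b c x y : inner HR (v b x) (v c y) = if b == c then inner H x y else 0 by exact: vip.
pose Fm (x : I) (a b : H) := inner HR (bop (g x) (v true b)) (v true a).
have [Fl Fp Fs] := ucp_form HI ug.
have FP : pos_kernel Fm by split=> [y z b s t|P A xi hA|c y z]; [exact: Fl|exact: Fp hA|exact: Fs].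
have [|||g1 [ug1 g1E]] := form_ucp HI FP.
- by move=> c y a x x'; rewrite /Fm vl' ipDr ipZr.
- by move=> c x a y y'; rewrite /Fm vl' bopDr bopZr ipDl ipZl.
- by move=> x y; rewrite /Fm ug.2 /= -[LHS]/(inner HR (v true y) (v true x)) vip' ipC.
exists g1 => //; split=> [s|x T hT].
  apply: bop_ip_ext => a b; rewrite g1E /Fm /g.
  have -> : cincl (j s) = cxmap j (s, 0) by rewrite /cxmap /= (linear_zero lj).
  by rewrite Gj -[bop (realify _) _]/(bop (F (s, 0)) (v true a)) Fv vip'.
have hG y : bopM (G y) (D T) = bopM (D T) (G y).
  by apply: Gc => _ [z _ <-]; rewrite FD// => s; rewrite hT//; exists s.
have hg w : g x (D T w) = D T (bop (g x) w : Hc) by have /(congr1 (fun Z : BH Hc => Z w)) := hG (cincl x).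
have DTip w b : inner HR (D T w) (v true b) = inner HR w (v true (adjoint T b)).
  have [p [q ->]] := vsur w.
  rewrite bopDr !Dv -[LHS]/(inner HR ((v true (T p) : HR) + v false (T q)) _) -[RHS]/(inner HR ((v true p : HR) + v false q) _).
  by rewrite !ipDl !vip' /= adjointP.
apply: bop_ip_ext => a b; rewrite -[bop (bopM _ T) a]/(bop (g1 x) (T a)) -[bop (bopM T _) a]/(T (bop (g1 x) a)).
by rewrite [RHS]adjointP !g1E /Fm -Dv hg DTip.
Qed.

End ComplexDCEP.

Theorem theorem11p5 (R : realType) (S : mosys R) (HS : is_opsys idfun S) :
  [<-> (* (a) *)
       DCEP idfun S;
       (* (b) *)
       DCEP (@conjc R) (complexification S);
       (* (c) *)
       forall T : mosys R, is_opsys idfun T ->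
       forall (I : mosys R) (j : S -> I), is_injenv idfun j ->
       forall n : nat, @el_cone R S I j T n = @c_cone R S T n;
       (* (d) *)
       forall C : mosys R, is_full_group_cstar idfun (free_group nat) C ->
       forall (I : mosys R) (j : S -> I), is_injenv idfun j ->
       forall n : nat, @el_cone R S I j C n = @max_cone R S C n;
       (* (e) *)
       forall A B : mosys R,
         is_unital_cstar idfun A -> is_unital_cstar idfun B ->
       forall j : S -> A, uco_embedding j ->
         uco_embedding
           (tens_map j (@id B) : max_tensor S B -> max_tensor A B)].
Proof.
tfae.
- exact: DCEP_cx.
(* (b) is first brought back to the real DCEP, from which (c) follows. *)
- move=> /(DCEP_of_cx HS) dS T oT I j ij n; apply/seteqP; split=> x.
    exact: (DCEP_el_sub_c dS HS oT ij).
  exact: (c_sub_el oT ij).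
- move=> elc C fullC I j ij n; have [H [f [_ [fP _ _ _]]]] := fullC.
  have cC : is_unital_cstar idfun C by exists H, f.
  by apply: (el_c_eq_max HS cC ij); apply: elc ij n; exact: cstar_opsys fP.
(* (d) yields the real DCEP, from which (e) follows. *)
- move=> /(el_max_DCEP HS) dS A B cA cB j uj; have [I [j0 ij0]] := injenv_exists HS.
  exact: (DCEP_exact HS ij0 dS cA cB uj).
- exact: exact_DCEP.
Qed.
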